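(* Let $N\geq 3$, $a>0$, $1<\gamma\leq \frac{N}{4}+\frac12$, $\mu>0$, $\mu+\lambda>0$, and let the external force $f\in [L^1_{\mathrm{loc}}(\mathbb{R}^N\times[0,\infty))]^N$ be given with $\mathrm{div}\, f=0$. Let the initial data $(\rho_0,v_0)$, with $0\leq\rho_0\in L^1_{\mathrm{loc}}(\mathbb{R}^N)$, $\rho_0v_0\in L^1_{\mathrm{loc}}(\mathbb{R}^N)$ and $\rho_0^\gamma+\rho_0|v_0|^2\in L^1(\mathbb{R}^N)$, satisfy $$\mathcal{E}(0)=\int_{\mathbb{R}^N}\left[\frac12\rho_0|v_0|^2+\frac{a\rho_0^\gamma}{\gamma-1}\right]dx<\infty,\qquad \int_{\mathbb{R}^N}\rho_0(x)|v_0(x)||x|\,dx<\infty,$$ $$\int_{\mathbb{R}^N}\rho_0(x)v_0(x)\cdot x\,dx>0.$$ Then there exists no finite energy global weak solution $(\rho,v)$ to the compressible Navier-Stokes system with initial data $(\rho_0,v_0)$ such that $$\rho|x|^2\in L^1_{\mathrm{loc}}(0,\infty;L^1(\mathbb{R}^N)),\qquad v\in L^1_{\mathrm{loc}}(0,\infty;L^{\frac{N}{N-1}}(\mathbb{R}^N)).$$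
   Context: The compressible (isentropic) Navier-Stokes system on $\mathbb{R}^N$ is $$\partial_t\rho+\mathrm{div}(\rho v)=0,\qquad \partial_t(\rho v)+\mathrm{div}(\rho v\otimes v)=-\nabla p+\mu\Delta v+(\mu+\lambda)\nabla\,\mathrm{div}\,v+f,\qquad p=a\rho^\gamma,$$ with $a>0$, $\gamma>1$, where $\rho$ (scalar, density), $v$ ($\mathbb{R}^N$-valued, velocity), $p$ (pressure) and $f$ (external force) are functions of $(x,t)\in\mathbb{R}^N\times(0,\infty)$. Here $\mathrm{div}$, $\nabla$, $\Delta$ act in $x$, and $\mathrm{div}\,f=0$ is understood in the sense of distributions. Convention: for a Banach space $X$ and $1\le q\le\infty$, $L^q_{\mathrm{loc}}(0,\infty;X)$ denotes the functions belonging to $L^q(0,T;X)$ for every $0<T<\infty$; likewise local integrability on $\mathbb{R}^N\times(0,\infty)$ means integrability on $K\times(0,T)$ for every compact $K\subset\mathbb{R}^N$ and every $0<T<\infty$. Definition (finite energy weak solution). Let $(\rho_0,v_0)$ satisfy $0\leq\rho_0\in L^1_{\mathrm{loc}}(\mathbb{R}^N)$, $\rho_0v_0\in L^1_{\mathrm{loc}}(\mathbb{R}^N)$, $\rho_0^\gamma+\rho_0|v_0|^2\in L^1(\mathbb{R}^N)$. A pair $(\rho,v)$ is a finite energy (global) weak solution with initial data $(\rho_0,v_0)$ if all of the following hold. (i) $0\leq\rho\in L^1_{\mathrm{loc}}(\mathbb{R}^N\times(0,\infty))$, $\rho v\in L^1_{\mathrm{loc}}(\mathbb{R}^N\times(0,\infty))$,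 $\rho^\gamma+\rho|v|^2\in L^\infty_{\mathrm{loc}}(0,\infty;L^1(\mathbb{R}^N))$, and $v\in L^2_{\mathrm{loc}}(0,\infty;\dot H^1(\mathbb{R}^N))$, where $\dot H^1$ is the homogeneous Sobolev space. (ii) For all $\psi\in C_0^\infty(\mathbb{R}^N)$ and $\xi\in C_0^1([0,\infty))$ (so $\xi(0)$ need not vanish), $$\xi(0)\int_{\mathbb{R}^N}\rho_0\psi\,dx+\int_0^\infty\!\!\int_{\mathbb{R}^N}\rho\,\psi(x)\,\xi'(t)\,dx\,dt+\int_0^\infty\!\!\int_{\mathbb{R}^N}\rho v\cdot\nabla\psi(x)\,\xi(t)\,dx\,dt=0.$$ (iii) For all $\phi\in[C_0^\infty(\mathbb{R}^N)]^N$ and $\xi\in C_0^1([0,\infty))$, $$\xi(0)\int_{\mathbb{R}^N}\rho_0v_0\cdot\phi\,dx+\int_0^\infty\!\!\int_{\mathbb{R}^N}\rho v\cdot\phi(x)\,\xi'(t)\,dx\,dt+\int_0^\infty\!\!\int_{\mathbb{R}^N}\rho\, v\otimes v:\nabla\phi(x)\,\xi(t)\,dx\,dt$$ $$=-\int_0^\infty\!\!\int_{\mathbb{R}^N}p\,\mathrm{div}\,\phi(x)\,\xi(t)\,dx\,dt-\mu\int_0^\infty\!\!\int_{\mathbb{R}^N}v\cdot\Delta\phi(x)\,\xi(t)\,dx\,dt$$ $$-(\mu+\lambda)\int_0^\infty\!\!\int_{\mathbb{R}^N}v\cdot\nabla\,\mathrm{div}\,\phi(x)\,\xi(t)\,dx\,dt-\int_0^\infty\!\!\int_{\mathbb{R}^N}f\cdot\phi(x)\,\xi(t)\,dx\,dt.$$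 (iv) $p=a\rho^\gamma$ almost everywhere in $\mathbb{R}^N\times(0,\infty)$. (v) The energy inequality holds: $$\frac{d}{dt}\mathcal{E}(t)+\int_{\mathbb{R}^N}\left(\mu|\nabla v|^2+(\mu+\lambda)|\mathrm{div}\,v|^2\right)dx\leq 0\quad\text{for almost every }t\geq0,$$ where $$\mathcal{E}(t):=\int_{\mathbb{R}^N}\left[\frac12\rho|v|^2+\frac{a\rho^\gamma}{\gamma-1}\right]dx,$$ and $\mathcal{E}(0)$ is this expression evaluated at the initial data $(\rho_0,v_0)$. *)

(* Defs.v *)
From HB Require Import structures.
From mathcomp Require Import all_boot all_order all_algebra.
From mathcomp Require Import all_classical all_reals all_analysis.

Set Implicit Arguments.
Unset Strict Implicit.
Unset Printing Implicit Defensive.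

Import Order.TTheory GRing.Theory Num.Theory.
Import numFieldNormedType.Exports.

Local Open Scope classical_set_scope.
Local Open Scope ring_scope.

(** Points of R^n are ['rV[R]_n], with the library's topology and the
    sigma-algebra generated by the coordinates, i.e. the Borel sets (the library
    does the same for [n.-tuple T]).  Since [lebesgue_measure] lives on
    [measurableTypeR R], a copy of [R], so does the measure [lebesgue_rV].  As in
    the library, functions are Borel measurable; every class of Lebesgue
    measurable functions modulo null sets has a Borel representative. *)

Definition measure_rV_display : measure_display -> measure_display.
Proof. exact. Qed.

Section measurable_rV.
Context {d} {T : sigmaRingType d} (n : nat).

Let coors : 'I_n -> 'rV[T]_n -> T := fun i x => x ord0 i.

Let rV_set0 : g_sigma_preimage coors set0.
Proof. exact: sigma_algebra0. Qed.

Let rV_setC A : g_sigma_preimage coors A -> g_sigma_preimage coors (~` A).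
Proof. exact: sigma_algebraC. Qed.

Let rV_bigcup (F : _^nat) : (forall i, g_sigma_preimage coors (F i)) ->
  g_sigma_preimage coors (\bigcup_i (F i)).
Proof. exact: sigma_algebra_bigcup. Qed.

HB.instance Definition _ := @isMeasurable.Build (measure_rV_display d)
  'rV[T]_n (g_sigma_preimage coors) rV_set0 rV_setC rV_bigcup.

End measurable_rV.

Lemma measurable_coord_rV d (T : sigmaRingType d) n (i : 'I_n) :
  measurable_fun [set: 'rV[T]_n] (fun x : 'rV[T]_n => x ord0 i).
Proof.
move=> _ Y mY; rewrite setTI; apply: sub_sigma_algebra => /=.
rewrite -bigcup_seq/=; exists i => /=; first by rewrite mem_index_enum.
by exists Y => //; rewrite setTI.
Qed.


Lemma measurable_fun_rVP d1 d2 (T1 : measurableType d1) (T2 : measurableType d2)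
    n (f : T1 -> 'rV[T2]_n) :
  (forall i, measurable_fun [set: T1] (fun x => f x ord0 i)) ->
  measurable_fun [set: T1] f.
Proof.
move=> mf _ A mA; rewrite setTI.
have : <<s \big[setU/set0]_(i < n) preimage_set_system [set: T1]
    (fun x => f x ord0 i) measurable >> (f @^-1` A).
  have := g_sigma_preimage_comp (fun (i : 'I_n) (x : 'rV[T2]_n) => x ord0 i) f.
  rewrite /g_sigma_preimage => ->.
  by exists A => //; rewrite setTI.
apply: smallest_sub; first exact: sigma_algebra_measurable.
rewrite -bigcup_seq => B [i _ [C mC <-]].
exact: mf.
Qed.

Definition cons_rV (T : Type) n (p : T * 'rV[T]_n) : 'rV[T]_n.+1 :=
  \row_i (if unlift ord0 i is Some j then p.2 ord0 j else p.1).

Lemma measurable_cons_rV d (T : measurableType d) n :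
  measurable_fun [set: T * 'rV[T]_n] (@cons_rV T n).
Proof.
apply: measurable_fun_rVP => i; case: (unliftP ord0 i) => [j|] ->.
  under eq_fun do rewrite mxE liftK.
  exact: (measurableT_comp (measurable_coord_rV j) measurable_snd).
under eq_fun do rewrite mxE unlift_none.
exact: measurable_fst.
Qed.


HB.instance Definition _ d (T : measurableType d) n :=
  isMeasurableFun.Build _ _ _ _ (@cons_rV T n) (@measurable_cons_rV d T n).

Lemma cons_rV_bij T n : bijective (@cons_rV T n).
Proof.
exists (fun x : 'rV[T]_n.+1 => (x ord0 ord0, \row_j x ord0 (lift ord0 j))) => [[a x]|x].
  rewrite /cons_rV mxE unlift_none; congr pair.
  by apply/rowP => j; rewrite !mxE liftK.
apply/rowP => i; rewrite mxE; case: unliftP => [j|] -> //=.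
by rewrite mxE.
Qed.

(* The library proves this, but inside a [Let]. *)
Lemma sigma_finite_prod d1 d2 (T1 : measurableType d1) (T2 : measurableType d2)
    (R : realType) (m1 : {sigma_finite_measure set T1 -> \bar R})
    (m2 : {sigma_finite_measure set T2 -> \bar R}) :
  sigma_finite setT (m1 \x m2)%E.
Proof.
have /sigma_finiteP[F [TF ndF Foo]] := sigma_finiteT m1.
have /sigma_finiteP[G [TG ndG Goo]] := sigma_finiteT m2.
exists (fun n => F n `*` G n).
  rewrite -setXTT TF TG predeqE => -[x y]; split.
    move=> [/= [n _ Fnx] [k _ Gky]]; exists (maxn n k) => //; split.
    - by move: x Fnx; exact/subsetPset/ndF/leq_maxl.
    - by move: y Gky; exact/subsetPset/ndG/leq_maxr.
  by move=> [n _ []/= ? ?]; split; exists n.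
move=> k; have [? ?] := Foo k; have [? ?] := Goo k.
split; first exact: measurableX.
by rewrite product_measure1E// lte_mul_pinfty// ge0_fin_numE.
Qed.

Section lebesgue_rV.
Context {R : realType}.
Local Notation T := (measurableTypeR R).
Local Open Scope ereal_scope.

Section lebesgue_cons.
Context {n : nat} (m : {sigma_finite_measure set 'rV[T]_n -> \bar R}).

Definition lebesgue_cons : set 'rV[T]_n.+1 -> \bar R :=
  pushforward (@lebesgue_measure R \x m) (@cons_rV T n).

Let lebesgue_cons0 : lebesgue_cons set0 = 0.
Proof. exact: measure0. Qed.

Let lebesgue_cons_ge0 A : 0 <= lebesgue_cons A.
Proof. exact: measure_ge0. Qed.

Let lebesgue_cons_sigma_additive : semi_sigma_additive lebesgue_cons.
Proof. exact: measure_semi_sigma_additive. Qed.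

HB.instance Definition _ := isMeasure.Build _ _ _ lebesgue_cons
  lebesgue_cons0 lebesgue_cons_ge0 lebesgue_cons_sigma_additive.

Let lebesgue_cons_sigma_finite : sigma_finite setT lebesgue_cons.
Proof.
have [F FT Foo] := sigma_finite_prod (@lebesgue_measure R) m.
have [g cg gc] := cons_rV_bij T n.
have mg : measurable_fun setT g.
  apply/measurable_fun_pairP; split.
    rewrite (_ : _ \o _ = fun x : 'rV[T]_n.+1 => x ord0 ord0).
      exact: measurable_coord_rV.
    apply/funext => x /=; rewrite -[in RHS](gc x) /cons_rV mxE.
    by rewrite unlift_none.
  apply: measurable_fun_rVP => i.
  rewrite (_ : (fun _ => _) = fun x : 'rV[T]_n.+1 => x ord0 (lift ord0 i)).
    exact: measurable_coord_rV.
  by apply/funext => x /=; rewrite -[in RHS](gc x) /cons_rV mxE liftK.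
exists (fun i => g @^-1` F i) => [|i].
  by rewrite -preimage_bigcup -FT preimage_setT.
have [mF Fi] := Foo i; split; first by rewrite -[X in measurable X]setTI; exact: mg.
rewrite /lebesgue_cons /pushforward -comp_preimage.
by rewrite (_ : _ \o _ = idfun) //; apply/funext => x /=.
Qed.

HB.instance Definition _ := Measure_isSigmaFinite.Build _ _ _ lebesgue_cons
  lebesgue_cons_sigma_finite.

End lebesgue_cons.

(** Iterated product measure; [lebesgue_rV_box] below characterizes it. *)
Fixpoint lebesgue_rV (n : nat) :
    {sigma_finite_measure set 'rV[T]_n -> \bar R} :=
  if n is k.+1 return {sigma_finite_measure set 'rV[T]_n -> \bar R}
  then lebesgue_cons (lebesgue_rV k) else @dirac _ 'rV[T]_0 (0%R : 'rV[R]_0) R.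

Lemma lebesgue_rV_box n (A : 'I_n -> set T) :
  (forall i, measurable (A i)) ->
  lebesgue_rV n [set x | forall i, A i (x ord0 i)] =
  \prod_(i < n) lebesgue_measure (A i).
Proof.
elim: n A => [|n IH] A mA.
  rewrite big_ord0 /= /dirac indicE mem_set //=.
  by case.
have mB : measurable [set x : 'rV[T]_n | forall i, A (lift ord0 i) (x ord0 i)].
  rewrite (_ : mkset _ = \bigcap_(i in [set: 'I_n])
     ((fun x : 'rV[T]_n => x ord0 i) @^-1` (A (lift ord0 i)))).
    apply: fin_bigcap_measurable => // i _.
    by rewrite -[X in measurable X]setTI; exact: measurable_coord_rV.
  by apply/seteqP; split => [x xA i _|x xA i]; exact: xA.
rewrite big_ord_recl -IH // -product_measure1E//.
rewrite /= /lebesgue_cons /pushforward; congr (_ _).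
apply/seteqP; split => -[a x] /= => [H|[H0 H] i].
  split; first by have := H ord0; rewrite mxE unlift_none.
  by move=> i; have := H (lift ord0 i); rewrite mxE liftK.
by rewrite mxE; case: (unliftP ord0 i) => [j|] -> //=.
Qed.

End lebesgue_rV.

Section calculus.
Context {R : realType}.

(** C^oo: all iterated directional derivatives exist and are continuous. *)
Fixpoint iter_derive (V : normedModType R) (s : seq V) (f : V -> R) : V -> R :=
  if s is w :: s' then 'D_w (iter_derive s' f) else f.

Definition smooth (V : normedModType R) (f : V -> R) : Prop :=
  forall s : seq V, continuous (iter_derive s f) /\
    forall w x, derivable (iter_derive s f) x w.

Definition support_closure (V : normedModType R) (f : V -> R) : set V :=
  closure [set x | f x != 0].

(** C_0^oo(U) *)
Definition test_function (V : normedModType R) (U : set V) (f : V -> R) : Prop :=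
  [/\ smooth f, compact (support_closure f) & support_closure f `<=` U].

(** C_0^1([0, oo)): only the values of [xi] on [0, oo) are ever used, and every
    C^1 function on [0, oo) is the restriction of a C^1 function on the line. *)
Definition time_test_function (xi : R -> R) : Prop :=
  [/\ forall t, derivable xi t 1, continuous (derive1 xi) &
      exists tau, forall t, tau <= t -> xi t = 0].

Definition dot n (x y : 'rV[R]_n) : R := \sum_(i < n) x ord0 i * y ord0 i.

(** Euclidean (Frobenius) norm; the library's norm on matrices is the sup norm. *)
Definition enorm m n (A : 'M[R]_(m, n)) : R :=
  Num.sqrt (\sum_(i < m) \sum_(j < n) A i j ^+ 2).

Variable N : nat.
Implicit Types (psi : 'rV[R]_N -> R) (phi : 'rV[R]_N -> 'rV[R]_N).

Definition coord phi (i : 'I_N) : 'rV[R]_N -> R := fun x => phi x ord0 i.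

Definition vector_test_function phi : Prop :=
  forall i, test_function setT (coord phi i).

Definition partial (i : 'I_N) psi : 'rV[R]_N -> R := 'D_(delta_mx ord0 i) psi.

Definition grad psi : 'rV[R]_N -> 'rV[R]_N := fun x => \row_i partial i psi x.

Definition laplacian psi : 'rV[R]_N -> R :=
  fun x => \sum_(i < N) partial i (partial i psi) x.

Definition vector_laplacian phi : 'rV[R]_N -> 'rV[R]_N :=
  fun x => \row_i laplacian (coord phi i) x.

Definition divergence phi : 'rV[R]_N -> R :=
  fun x => \sum_(i < N) partial i (coord phi i) x.

(** v (x) v : grad phi *)
Definition tensor_grad phi (x u : 'rV[R]_N) : R :=
  \sum_(i < N) \sum_(j < N) u ord0 i * u ord0 j * partial j (coord phi i) x.

End calculus.

Section function_spaces.
Context {R : realType} (N : nat).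
Local Notation T := (measurableTypeR R).
Local Notation muX := (@lebesgue_rV R N).
Local Notation muT := (@lebesgue_measure R).

Implicit Types (u : 'rV[R]_N -> R) (g : 'rV[R]_N * R -> R).

Definition space_time : set ('rV[T]_N * T) := setT `*` `]0%R, +oo[.

Definition L1 u : Prop := muX.-integrable setT (EFin \o u).

Definition L1loc_space u : Prop :=
  forall K : set 'rV[R]_N, compact K -> muX.-integrable K (EFin \o u).

Definition L1loc_space_time g : Prop :=
  forall (K : set 'rV[R]_N) (tau : R), compact K -> 0 < tau ->
    (muX \x muT)%E.-integrable (K `*` `]0, tau[) (EFin \o g).

(** L^q_loc(0, oo; L^p(R^N)) *)
Definition Lq_loc_Lp (q p : \bar R) g : Prop :=
  measurable_fun space_time g /\
  forall tau : R, 0 < tau ->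
    ('N[muT]_q[(fun t => 'N[muX]_p[(fun x => (g (x, t))%:E)]) \_ (`]0%R, tau[%classic)]
       < +oo)%E.

Definition Lq_loc_Lp_mx (q p : \bar R) m n
    (A : 'rV[R]_N * R -> 'M[R]_(m, n)) : Prop :=
  (forall i j, measurable_fun space_time (fun z => A z i j)) /\
  Lq_loc_Lp q p (fun z => enorm (A z)).

(** [Dw x i j] is the distributional derivative of [w_i] along [x_j]. *)
Definition weak_gradient (w : 'rV[R]_N -> 'rV[R]_N) (Dw : 'rV[R]_N -> 'M[R]_N)
    : Prop :=
  forall psi, test_function setT psi -> forall i j,
    \int[muX]_x (w x ord0 i * partial j psi x)
      = - \int[muX]_x (Dw x i j * psi x).

(** [w] is in the homogeneous Sobolev space
    { w in L^1_loc | grad w in L^2 }, and [Dw] is its gradient. *)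
Definition homogeneous_H1 (w : 'rV[R]_N -> 'rV[R]_N) (Dw : 'rV[R]_N -> 'M[R]_N)
    : Prop :=
  [/\ forall i, L1loc_space (fun x => w x ord0 i),
      forall i j, measurable_fun [set: 'rV[T]_N] (fun x => Dw x i j),
      L1 (fun x => enorm (Dw x) ^+ 2) &
      weak_gradient w Dw].

(** [v] is in L^2_loc(0, oo; H), with H the space above and [Dv] the gradient
    of [v] in the space variable. *)
Definition L2_loc_homogeneous_H1 (v : 'rV[R]_N * R -> 'rV[R]_N)
    (Dv : 'rV[R]_N * R -> 'M[R]_N) : Prop :=
  [/\ forall i, measurable_fun space_time (fun z => v z ord0 i),
      {ae muT, forall t : R, 0 < t ->
        homogeneous_H1 (fun x => v (x, t)) (fun x => Dv (x, t))} &
      Lq_loc_Lp_mx 2%:E 2%:E Dv].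

Definition divergence_free (f : 'rV[R]_N * R -> 'rV[R]_N) : Prop :=
  forall eta : 'rV[R]_N * R -> R, test_function [set z : 'rV[R]_N * R | 0 < z.2] eta ->
    \int[(muX \x muT)%E]_(z in space_time)
      (\sum_(i < N) f z ord0 i * 'D_(delta_mx ord0 i, 0) eta z) = 0.

End function_spaces.

Section compressible_Navier_Stokes.
Context {R : realType} (N : nat).
Local Notation T := (measurableTypeR R).
Local Notation muX := (@lebesgue_rV R N).
Local Notation muT := (@lebesgue_measure R).

Variables (a gamma mu lambda : R) (f : 'rV[R]_N * R -> 'rV[R]_N).
Variables (rho0 : 'rV[R]_N -> R) (v0 : 'rV[R]_N -> 'rV[R]_N).

Definition energy (r : 'rV[R]_N -> R) (w : 'rV[R]_N -> 'rV[R]_N) : \bar R :=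
  (\int[muX]_x (2^-1 * r x * enorm (w x) ^+ 2
                 + a * r x `^ gamma / (gamma - 1))%:E)%E.

Definition dissipation (Dw : 'rV[R]_N -> 'M[R]_N) : \bar R :=
  (\int[muX]_x (mu * enorm (Dw x) ^+ 2 + (mu + lambda) * (\tr (Dw x)) ^+ 2)%:E)%E.

Definition finite_energy_data : Prop :=
  [/\ {ae muX, forall x, 0 <= rho0 x}, L1loc_space rho0,
      forall i, L1loc_space (fun x => rho0 x * v0 x ord0 i) &
      L1 (fun x => rho0 x `^ gamma + rho0 x * enorm (v0 x) ^+ 2)].

Definition time_space_integral (g : 'rV[R]_N -> R -> R) : R :=
  \int[muT]_(t in `]0%R, +oo[) \int[muX]_x g x t.

Definition weak_continuity_equation (rho : 'rV[R]_N * R -> R)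
    (v : 'rV[R]_N * R -> 'rV[R]_N) : Prop :=
  forall (psi : 'rV[R]_N -> R) (xi : R -> R),
    test_function setT psi -> time_test_function xi ->
    xi 0 * \int[muX]_x (rho0 x * psi x)
    + time_space_integral (fun x t => rho (x, t) * psi x * derive1 xi t)
    + time_space_integral
        (fun x t => rho (x, t) * dot (v (x, t)) (grad psi x) * xi t)
    = 0.

Definition weak_momentum_equation (rho p : 'rV[R]_N * R -> R)
    (v : 'rV[R]_N * R -> 'rV[R]_N) : Prop :=
  forall (phi : 'rV[R]_N -> 'rV[R]_N) (xi : R -> R),
    vector_test_function phi -> time_test_function xi ->
    xi 0 * \int[muX]_x (rho0 x * dot (v0 x) (phi x))
    + time_space_integral
        (fun x t => rho (x, t) * dot (v (x, t)) (phi x) * derive1 xi t)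
    + time_space_integral
        (fun x t => rho (x, t) * tensor_grad phi x (v (x, t)) * xi t)
    = - time_space_integral (fun x t => p (x, t) * divergence phi x * xi t)
      - mu * time_space_integral
          (fun x t => dot (v (x, t)) (vector_laplacian phi x) * xi t)
      - (mu + lambda) * time_space_integral
          (fun x t => dot (v (x, t)) (grad (divergence phi) x) * xi t)
      - time_space_integral (fun x t => dot (f (x, t)) (phi x) * xi t).

(** E(t) is only determined for almost every t, so that dE/dt is taken on the
    nonincreasing representative [E] of the energy whose value at 0 is the energy
    of the data.  This amounts to
    E(t) + int_s^t dissipation <= E(s) for a.e. t, and s = 0 or a.e. s < t,
    whereas an inequality between a.e. derivatives alone would let E jump up on
    null sets of times and would not involve the initial energy. *)
Definition energy_inequality (rho : 'rV[R]_N * R -> R)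
    (v : 'rV[R]_N * R -> 'rV[R]_N) (Dv : 'rV[R]_N * R -> 'M[R]_N) : Prop :=
  exists E : R -> R,
  [/\ (E 0)%:E = energy rho0 v0,
      forall s t, 0 <= s -> s <= t -> E t <= E s,
      {ae muT, forall t : R, 0 < t ->
        energy (fun x => rho (x, t)) (fun x => v (x, t)) = (E t)%:E} &
      {ae muT, forall t : R, 0 < t ->
        derivable E t 1 /\
        ((derive1 E t)%:E + dissipation (fun x => Dv (x, t)) <= 0)%E}].

Record finite_energy_solution_with (rho p : 'rV[R]_N * R -> R)
    (v : 'rV[R]_N * R -> 'rV[R]_N) (Dv : 'rV[R]_N * R -> 'M[R]_N) : Prop := {
  density_ge0 : {ae (muX \x muT)%E, forall z, 0 < z.2 -> 0 <= rho z};
  density_L1loc : L1loc_space_time rho;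
  momentum_L1loc : forall i, L1loc_space_time (fun z => rho z * v z ord0 i);
  energy_Linfty :
    Lq_loc_Lp +oo%E 1%:E (fun z => rho z `^ gamma + rho z * enorm (v z) ^+ 2);
  velocity_H1 : L2_loc_homogeneous_H1 v Dv;
  continuity_eq : weak_continuity_equation rho v;
  momentum_eq : weak_momentum_equation rho p v;
  pressure_measurable : measurable_fun (@space_time R N) p;
  pressure_law :
    {ae (muX \x muT)%E, forall z, 0 < z.2 -> p z = a * rho z `^ gamma};
  energy_ineq : energy_inequality rho v Dv
}.

Definition finite_energy_weak_solution (rho : 'rV[R]_N * R -> R)
    (v : 'rV[R]_N * R -> 'rV[R]_N) : Prop :=
  exists p Dv, finite_energy_solution_with rho p v Dv.

End compressible_Navier_Stokes.

(* Main.v *)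
Require Import Defs.
From HB Require Import structures.
From mathcomp Require Import all_boot all_order all_algebra.
From mathcomp Require Import all_classical all_reals all_analysis.
From mathcomp Require Import measurable_realfun ring lra.

Set Implicit Arguments.
Unset Strict Implicit.
Unset Printing Implicit Defensive.

Import Order.TTheory GRing.Theory Num.Theory.
Import numFieldNormedType.Exports.

Local Open Scope classical_set_scope.
Local Open Scope ring_scope.


(** Suppose that a solution exists.  Let I = 1/2 int rho |x|^2, y = int rho v.x, and let
    the energy E = K + P be split into its kinetic part and its internal part
    P = a / (gamma - 1) int rho^gamma; put k = N (gamma - 1).  The continuity equation
    gives I' = y.  The momentum equation tested with the field x gives y' = 2 K + k P
    ([momentum_weighted]): the force does no work on gradient fields, and the viscous
    terms vanish in the limit thanks to the integrability of v.  The energy E is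
    nonincreasing.  Hence
      H = I - t y + t^2 E = 1/2 int rho |x - t v|^2 + t^2 P
    satisfies H' <= (2 - k) t P <= m H / t with m = max (0, 2 - k) < 2, so that H is
    O(t^m) ([virial_growth]).  The gas expands: its internal energy is O(t^(m-2)), and v is
    close to x / t in quadratic mean ([energy_decay]).

    The dissipation prevents this.  Let A = int rho h, where h is smooth and of the order
    of |x| ([linear_weight]).  Its derivative B = int rho v.grad h differs from A / t by
    O(t^(m/2-1)) ([flux_deviation]), so A / t is nondecreasing up to an error of this order.
    As the dissipation is integrable in time, there are arbitrarily late times at which
    grad v is small in L^2.  By a weak form of the Sobolev inequality ([weak_sobolev]),
    which rests on N >= 3 and on the decay of v at infinity, v is small at these times
    except on a set of small measure, and such a set carries little mass because
    int rho^gamma is bounded.  Thus B, and with it A / t, is small at some late times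
    ([small_moment]), and therefore A = O(t^(m/2)) at all times ([sublinear_growth]).

    The total mass is constant, and it is positive because the virial of the data is
    ([mass_positive]).  It stays at distance O(t^(m/2)) from the origin, which bounds
    int rho^gamma from below by a multiple of t^(- m k / 2) ([mass_upper_bound]).  Since
    m k / 2 < 2 - m, this contradicts the decay of P ([mass_decay]).

    All the identities hold in the sense of distributions in time ([weak_eq], [weak_le]);
    monotonicity is recovered at Lebesgue points ([weak_le_nonincreasing]). *)

(** * Smooth functions *)

Section smooth_closure.
Context {R : realType} (V : normedModType R).
Implicit Types (f g : V -> R) (C : (V -> R) -> Prop).

(** Smoothness is the largest class of continuous, directionally derivable
    functions that is stable under directional derivatives, so it can be proved
    by exhibiting such a class. *)
Lemma smooth_coind C :
  (forall f, C f -> continuous f /\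
     forall w, (forall x, derivable f x w) /\ C ('D_w f)) ->
  forall f, C f -> smooth f.
Proof.
move=> HC f Cf s; suff Cs : C (iter_derive s f).
  by split=> [|w x]; [exact: (HC _ Cs).1|exact: ((HC _ Cs).2 w).1].
by elim: s => //= w s IH; exact: ((HC _ IH).2 w).2.
Qed.

Lemma smooth_derive f w : smooth f -> smooth ('D_w f).
Proof.
move=> sf s; have E : iter_derive s ('D_w f) = iter_derive (rcons s w) f.
  by elim: s => [|a s IH]; [|rewrite rcons_cons /= IH].
by rewrite E; exact: sf.
Qed.

Lemma smooth_continuous f : smooth f -> continuous f.
Proof. by move=> /(_ [::]) []. Qed.

Lemma smooth_derivable f x w : smooth f -> derivable f x w.
Proof. by move=> /(_ [::]) [_]; exact. Qed.

(** The algebra generated by a class of functions; closing under products is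
    what makes the Leibniz rule stay inside the class. *)
Inductive gen_alg C : (V -> R) -> Prop :=
| gen_alg_in f : C f -> gen_alg C f
| gen_alg_add f g : gen_alg C f -> gen_alg C g -> gen_alg C (f + g)
| gen_alg_mul f g : gen_alg C f -> gen_alg C g -> gen_alg C (f * g).

Lemma smooth_gen_alg C :
  (forall f, C f -> continuous f /\
     forall w, (forall x, derivable f x w) /\ gen_alg C ('D_w f)) ->
  forall f, gen_alg C f -> smooth f.
Proof.
move=> HC; apply: smooth_coind => f; elim=> {f} [f /HC//|f g|f g].
  move=> fA [cf df] gA [cg dg]; split=> [x|w].
    by apply: cvgD; [exact: cf|exact: cg].
  have [df1 df2] := df w; have [dg1 dg2] := dg w.
  split=> [x|]; first exact: derivableD.
  rewrite (_ : 'D_w _ = 'D_w f + 'D_w g); first exact: gen_alg_add.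
  by apply/funext => x; rewrite deriveD.
move=> fA [cf df] gA [cg dg]; split=> [x|w].
  by apply: cvgM; [exact: cf|exact: cg].
have [df1 df2] := df w; have [dg1 dg2] := dg w.
split=> [x|]; first exact: derivableM.
rewrite (_ : 'D_w _ = f * 'D_w g + g * 'D_w f).
  by apply: gen_alg_add; exact: gen_alg_mul.
by apply/funext => x; rewrite deriveM.
Qed.

Lemma smooth_cst (c : R) : smooth (fun _ : V => c).
Proof.
apply: (@smooth_coind (fun f => exists c, f = cst c)); last by exists c.
move=> _ [{}c ->]; split=> [x|w]; first exact: cvg_cst.
split=> [x|]; first exact: derivable_cst.
by exists 0; apply/funext => x; rewrite derive_cst.
Qed.

Let smoothA f : gen_alg (@smooth R V) f -> smooth f.
Proof.
apply: smooth_gen_alg => {}f sf; split; first exact: smooth_continuous.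
move=> w; split=> [x|]; first exact: smooth_derivable.
by apply: gen_alg_in; exact: smooth_derive.
Qed.

Lemma smoothD f g : smooth f -> smooth g -> smooth (fun x => f x + g x).
Proof. by move=> sf sg; apply: smoothA; apply: gen_alg_add; exact: gen_alg_in. Qed.

Lemma smoothM f g : smooth f -> smooth g -> smooth (fun x => f x * g x).
Proof. by move=> sf sg; apply: smoothA; apply: gen_alg_mul; exact: gen_alg_in. Qed.

Lemma smoothZ (c : R) f : smooth f -> smooth (fun x => c * f x).
Proof. by move=> sf; apply: smoothM; [exact: smooth_cst|exact: sf]. Qed.

Lemma smoothB f g : smooth f -> smooth g -> smooth (fun x => f x - g x).
Proof.
move=> sf sg; rewrite (_ : (fun _ => _) = fun x => f x + (-1) * g x).
  by apply: smoothD; [exact: sf|exact: smoothZ].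
by apply/funext => x; rewrite mulN1r.
Qed.

Lemma smooth_sum (I : Type) (s : seq I) (F : I -> V -> R) :
  (forall i, smooth (F i)) -> smooth (fun x => \sum_(i <- s) F i x).
Proof.
move=> sF; elim: s => [|i s IH].
  by under eq_fun do rewrite big_nil; exact: smooth_cst.
by under eq_fun do rewrite big_cons; apply: smoothD.
Qed.

Lemma smooth_prod (I : Type) (s : seq I) (F : I -> V -> R) :
  (forall i, smooth (F i)) -> smooth (fun x => \prod_(i <- s) F i x).
Proof.
move=> sF; elim: s => [|i s IH].
  by under eq_fun do rewrite big_nil; exact: smooth_cst.
by under eq_fun do rewrite big_cons; apply: smoothM.
Qed.

(** Along the line [x + h w] the function [f] is a function of one variable. *)
Lemma is_derive_line f x w (h : R) : derivable f (h *: w + x) w ->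
  is_derive h 1 (fun h => f (h *: w + x)) ('D_w f (h *: w + x)).
Proof.
move=> df.
have E : (fun k : R => k^-1 *: (((fun h => f (h *: w + x)) \o shift h) (k *: 1) -
     f (h *: w + x))) = (fun k => k^-1 *: ((f \o shift (h *: w + x)) (k *: w) -
     f (h *: w + x))).
  apply/funext => k /=; congr (_ *: (f _ - _)).
  by rewrite /shift/= [k *: 1]mulr1 scalerDl addrA.
by apply: DeriveDef; [rewrite /derivable E|rewrite /derive E].
Qed.

End smooth_closure.

Section smooth_closure_more.
Context {R : realType} (V : normedModType R).
Implicit Types (f g : V -> R).

Lemma smooth_comp (F : R -> R) f : smooth F -> smooth f -> smooth (F \o f).
Proof.
move=> sF sf; pose C g := smooth g \/ exists F : R -> R, smooth F /\ g = F \o f.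
apply: (@smooth_gen_alg _ _ C); last by apply: gen_alg_in; right; exists F.
move=> g [sg|[{}F [{}sF ->]]].
  split; first exact: smooth_continuous.
  move=> w; split=> [x|]; first exact: smooth_derivable.
  by apply: gen_alg_in; left; exact: smooth_derive.
split=> [x|w].
  by apply: continuous_comp; [exact: (smooth_continuous sf)|exact: (smooth_continuous sF)].
have D x : is_derive x w (F \o f) (('D_1 F) (f x) * 'D_w f x).
  have /(@is_derive_line _ _ f x w 0) df : derivable f (0 *: w + x) w by exact: smooth_derivable.
  rewrite !scale0r !add0r in df.
  have dF : is_derive (f (0 *: w + x)) 1 F ('D_1 F (f x)).
    by rewrite scale0r add0r; apply: derivableP; exact: smooth_derivable.
  have [d1 d2] := @is_derive1_comp _ F (fun h : R => f (h *: w + x)) 0 _ _ dF df.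
  apply: DeriveDef; first exact/derivable1P.
  have E : (fun k : R => k^-1 *: (((fun h : R => (F \o f) (h *: w + x)) \o shift 0) (k *: 1) -
      (F \o f) (0 *: w + x))) = (fun k => k^-1 *: (((F \o f) \o shift x) (k *: w) - (F \o f) x)).
    by apply/funext => k /=; rewrite /shift/= [k *: 1]mulr1 addr0 scale0r add0r.
  by rewrite -d2 /derive -E.
split=> [x|]; first by case: (D x).
rewrite (_ : 'D_w _ = ('D_1 F \o f) * 'D_w f).
  apply: gen_alg_mul; apply: gen_alg_in; last by left; exact: smooth_derive.
  by right; exists ('D_1 F); split => //; exact: smooth_derive.
by apply/funext => x; rewrite derive_val.
Qed.

(** Additivity of directional derivatives in the direction, from the continuity
    of the derivatives. *)
Lemma smooth_deriveDl f x v w : smooth f -> 'D_(v + w) f x = 'D_v f x + 'D_w f x.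
Proof.
move=> sf.
have cw : continuous ('D_w f) by exact: smooth_continuous (smooth_derive _ sf).
suff H : (fun h : R => h^-1 *: ((f \o shift x) (h *: (v + w)) - f x)) h @[h --> 0^'] -->
    'D_v f x + 'D_w f x by exact/cvg_lim.
have E (h : R) : h^-1 *: ((f \o shift x) (h *: (v + w)) - f x) =
  h^-1 *: ((f \o shift x) (h *: v) - f x) +
  h^-1 * (f (h *: w + (h *: v + x)) - f (h *: v + x)).
  have -> : (f \o shift x) (h *: (v + w)) = f (h *: w + (h *: v + x)).
    by rewrite /= /shift/=; congr f; rewrite scalerDr [X in X + x]addrC -addrA.
  change (h^-1 * (f (h *: w + (h *: v + x)) - f x) = h^-1 * (f (h *: v + x) - f x) +
    h^-1 * (f (h *: w + (h *: v + x)) - f (h *: v + x))); ring.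
under eq_fun do rewrite E.
apply: cvgD; first exact: (@smooth_derivable _ _ f x v sf).
apply/cvgrPdist_lt => e e0.
have /cvgrPdist_lt/(_ e e0) := cw x.
move=> /nbhs_ballP[d /= d0 Hd].
have K0 : 0 < `|v| + `|w| + 1 by rewrite ltr_wpDl// addr_ge0.
near=> h.
have h0 : h != 0 by near: h; exact: nbhs_dnbhs_neq.
have hd : `|h| * (`|v| + `|w| + 1) < d.
  rewrite -ltr_pdivlMr//.
  near: h; apply: dnbhs0_lt; exact: divr_gt0.
have [th [th1 ->]] : exists th, `|th| <= `|h| /\
    h^-1 * (f (h *: w + (h *: v + x)) - f (h *: v + x)) =
    'D_w f (th *: w + (h *: v + x)).
  pose g k := f (k *: w + (h *: v + x)).
  have dg (k : R) : is_derive k 1 g ('D_w f (k *: w + (h *: v + x))).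
    by apply: is_derive_line; exact: smooth_derivable.
  have cg (a b : R) : {within `[a, b], continuous g}.
    apply: continuous_subspaceT => k; apply: differentiable_continuous.
    by apply/derivable1_diffP; case: (dg k).
  have [hlt|hlt] : h < 0 \/ 0 < h.
    by case: (ltgtP h 0) h0 => //; [left|right].
    have [c] := @MVT _ g _ _ _ hlt (fun k _ => dg k) (cg _ _).
    rewrite in_itv/= => /andP[c1 c2] Ec; exists c; split.
      by rewrite !ltr0_norm// lerN2 ltW.
    move: Ec; rewrite sub0r {1}/g scale0r add0r => Ec.
    rewrite -[in LHS]opprB /g -/(g h) Ec. 
    by rewrite -mulrN opprK mulrCA mulVf// mulr1.
  have [c] := @MVT _ g _ _ _ hlt (fun k _ => dg k) (cg _ _).
  rewrite in_itv/= => /andP[c1 c2] Ec; exists c; split.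
    by rewrite !gtr0_norm// ltW.
  move: Ec; rewrite subr0 {2}/g scale0r add0r => Ec.
  by rewrite -/(g h) Ec mulrCA mulVf// mulr1.
apply: Hd => /=; rewrite -ball_normE/=.
rewrite (_ : x - _ = - (th *: w + h *: v)); last first.
  by rewrite addrA opprD [RHS]opprD addrCA subrr addr0 opprD.
rewrite normrN.
rewrite (le_lt_trans _ hd)// (le_trans (ler_normD _ _))// !normrZ.
by have := ler_wpM2r (normr_ge0 w) th1; have := normr_ge0 h; lra.
Unshelve. all: by end_near. Qed.

End smooth_closure_more.

Lemma smooth_of_derive1 {R : realType} (f : R -> R) :
  (forall x, derivable f x 1) -> smooth ('D_1 f) -> smooth f.
Proof.
move=> df sf.
have dw w x : is_derive x w f (w * 'D_1 f x).
  have d1 : differentiable f x by exact/derivable1_diffP.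
  apply: DeriveDef; first exact: diff_derivable.
  rewrite !deriveE//. 
  by rewrite -[in LHS](mulr1 w) -[w * 1]/(w *: (1 : R)) linearZ.
apply: (@smooth_coind _ _ (fun g => g = f \/ smooth g)); last by left.
move=> g [->|sg]; split.
- move=> x; apply: differentiable_continuous; exact/derivable1_diffP.
- move=> w; split=> [x|]; first by case: (dw w x).
  right; rewrite (_ : 'D_w f = fun x => w * 'D_1 f x); first exact: smoothZ.
  by apply/funext => x; rewrite derive_val.
- exact: smooth_continuous.
- move=> w; split=> [x|]; first exact: smooth_derivable.
  by right; exact: smooth_derive.
Qed.

Lemma smooth_id {R : realType} : smooth (fun x : R => x).
Proof.
apply: smooth_of_derive1 => [x|]; first exact: derivable_id.
have -> : 'D_(1 : R) (fun x : R => x) = (fun=> 1) :> (R -> R).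
  by apply/funext => x; rewrite derive_id.
exact: smooth_cst.
Qed.
Section smooth_inv.
Context {R : realType} (V : normedModType R).

Lemma smoothV (g : V -> R) : (forall x, g x != 0) -> smooth g ->
  smooth (fun x => (g x)^-1).
Proof.
move=> g0 sg; pose C f := smooth f \/ f = (fun x => (g x)^-1).
apply: (@smooth_gen_alg _ _ C); last by apply: gen_alg_in; right.
move=> f [sf|->].
  split; first exact: smooth_continuous.
  move=> w; split=> [x|]; first exact: smooth_derivable.
  by apply: gen_alg_in; left; exact: smooth_derive.
have dg x w : derivable g x w by exact: smooth_derivable.
split=> [x|w]; first by apply: cvgV; [exact: g0|exact: (smooth_continuous sg)].
split=> [x|]; first by apply: derivableV; [exact: g0|exact: dg].
rewrite (_ : 'D_w _ = (fun x => (g x)^-1) * ((fun x => (g x)^-1) * (fun x => -1 * 'D_w g x))).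
  have Cg : C (fun x => (g x)^-1) by right.
  apply: gen_alg_mul; first exact: gen_alg_in.
  apply: gen_alg_mul; apply: gen_alg_in => //; left.
  by apply: smoothZ; exact: smooth_derive.
apply/funext => x; rewrite deriveV; [|exact: g0|exact: dg].
rewrite /GRing.mul/= -[LHS]/(- (g x) ^- 2 * 'D_w g x) -exprVn expr2.
by change (- ((g x)^-1 * (g x)^-1) * 'D_w g x = (g x)^-1 * ((g x)^-1 * (-1 * 'D_w g x))); ring.
Qed.

End smooth_inv.

Section bump.
Context {R : realType}.
Implicit Types (x t : R) (n : nat).

(** The flat functions [x^-n exp(-1/x)], extended by [0]: they are stable under
    differentiation up to linear combinations. *)
Definition flat n x : R := if 0 < x then x^-1 ^+ n * expR (- x^-1) else 0.

Let flat_formula_derive n x : 0 < x ->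
  is_derive x 1 (fun x => x^-1 ^+ n * expR (- x^-1) : R)
    (flat n.+2 x - n%:R * flat n.+1 x).
Proof.
move=> x0; have xn0 : x != 0 by rewrite gt_eqF.
have dV : is_derive x 1 (fun x : R => x^-1) (- x^-1 ^+ 2).
  have := @is_deriveV R id x 1 1 xn0 (is_derive_id _ _).
  by move=> [d1 d2]; apply: DeriveDef => //; rewrite d2 -exprVn [LHS]mulr1.
have dE : is_derive x 1 (fun x => expR (- x^-1) : R) (x^-1 ^+ 2 * expR (- x^-1)).
  have dN : is_derive x 1 (fun x : R => - x^-1) (x^-1 ^+ 2).
    by rewrite -[x^-1 ^+ 2]opprK; exact: is_deriveN.
  have dX : is_derive (- x^-1) 1 (@expR R) (expR (- x^-1)) by exact: is_derive_expR.
  have [d1 d2] := @is_derive1_comp _ (@expR R) (fun x => - x^-1) _ _ _ dX dN.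
  by apply: DeriveDef => //; rewrite mulrC.
have dX : is_derive x 1 (fun x : R => x^-1 ^+ n) (- (n%:R * x^-1 ^+ n.+1)).
  have [d1 d2] := @is_deriveX _ _ _ n x 1 _ dV.
  rewrite (_ : (fun x => _) = (fun x : R => x^-1) ^+ n); last first.
    by apply/funext => y; rewrite exprfctE.
  apply: DeriveDef => //; rewrite d2.
  rewrite -[LHS]/(_ * _); case: n {d1 d2} => [|m]; first by rewrite !mul0r oppr0.
  by rewrite [m.+1.-1]/= mulrN -mulrA -exprD addn2.
have [d1 d2] := is_deriveM dX dE.
apply: DeriveDef => //; rewrite d2 /flat x0.
rewrite -[LHS]/(x^-1 ^+ n * (x^-1 ^+ 2 * expR (- x^-1)) +
   expR (- x^-1) * - (n%:R * x^-1 ^+ n.+1)) !exprS; ring.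
Qed.

Let flat_le n x : `|flat n x| <= (n.+2)`!%:R * x ^+ 2.
Proof.
rewrite /flat; case: ifPn => x0; last by rewrite normr0 mulr_ge0// sqr_ge0.
have xn0 : x != 0 by rewrite gt_eqF.
have V0 : 0 < x^-1 by rewrite invr_gt0.
rewrite ger0_norm ?mulr_ge0 ?exprn_ge0 ?expR_ge0 ?(ltW V0)//.
have := expR_ge1Dxn n.+1 (ltW V0); set E := expR x^-1 => H.
have H2 : x^-1 ^+ n.+2 <= (n.+2)`!%:R * E.
  rewrite mulrC -ler_pdivrMr ?ltr0n ?fact_gt0//; apply: le_trans H.
  by rewrite lerDr.
rewrite expRN ler_pdivrMr ?expR_gt0// -/E.
rewrite (_ : x^-1 ^+ n = x ^+ 2 * x^-1 ^+ n.+2).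
  rewrite [leRHS](_ : _ = x ^+ 2 * ((n.+2)`!%:R * E)); last by rewrite mulrA [x ^+ 2 * _]mulrC.
  by apply: ler_wpM2l; rewrite ?sqr_ge0.
by rewrite -[n.+2]addn2 exprD mulrC -mulrA -exprMn mulVf// expr1n mulr1.
Qed.

Lemma flat_derive n x :
  is_derive x 1 (flat n) (flat n.+2 x - n%:R * flat n.+1 x).
Proof.
have [x0|x0|<-] := ltgtP 0 x.
- apply: (near_eq_is_derive (f := fun x => x^-1 ^+ n * expR (- x^-1) : R)) => //.
  + near=> y; rewrite /flat ifT//; near: y; exact: lt_nbhsr.
  + exact: flat_formula_derive.
- have z m : flat m x = 0 by rewrite /flat ifF ?(lt_gtF x0).
  rewrite !z mulr0 subr0.
  suff N : \near x, cst (0:R) x = flat n x by exact: (near_eq_is_derive N (is_derive_cst _ _ _)).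
  near=> y; rewrite /flat ifF//; apply/negbTE; rewrite -leNgt ltW//; near: y; exact: lt_nbhsl.
- have -> : flat n.+2 0 - n%:R * flat n.+1 0 = 0 by rewrite /flat ltxx mulr0 subr0.
  have H : (fun h : R => h^-1 *: ((flat n \o shift 0) (h *: 1) - flat n 0)) h @[h --> 0^'] --> (0 : R).
    apply/cvgrPdist_le => e e0; near=> h.
    have h0 : h != 0 by near: h; exact: nbhs_dnbhs_neq.
    rewrite sub0r normrN /= /shift addr0 [h *: 1]mulr1 {2}/flat ltxx subr0.
    rewrite normrM normfV ler_pdivrMl ?normr_gt0// (le_trans (flat_le _ _))//.
    rewrite (_ : h ^+ 2 = `|h| * `|h|); last by rewrite -normrM -expr2 ger0_norm ?sqr_ge0.
    rewrite mulrCA; apply: ler_wpM2l => //; rewrite mulrC.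
    rewrite -ler_pdivlMr ?ltr0n ?fact_gt0//.
    near: h; apply: dnbhs0_le; by rewrite divr_gt0// ltr0n fact_gt0.
  apply: DeriveDef; last exact/cvg_lim.
  by apply/cvg_ex; exists 0.
Unshelve. all: by end_near. Qed.

Lemma flat_smooth n : smooth (flat n).
Proof.
pose C f := (exists n, f = flat n) \/ exists c, f = (fun=> c : R).
have H f : gen_alg C f -> smooth f.
  apply: smooth_gen_alg => {}f [[m ->]|[c ->]]; last first.
    split=> [x|w]; first exact: cvg_cst.
    split=> [x|]; first exact: derivable_cst.
    by apply: gen_alg_in; right; exists 0; apply/funext => x; rewrite derive_cst.
  have d1 x : derivable (flat m) x 1 by case: (flat_derive m x).
  have dd x : differentiable (flat m) x by exact/derivable1_diffP.
  split=> [x|w]; first exact: differentiable_continuous.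
  split=> [x|]; first exact: diff_derivable.
  rewrite (_ : 'D_w _ = (fun=> w) * (flat m.+2 + (fun=> - m%:R) * flat m.+1)).
    apply: gen_alg_mul; first by apply: gen_alg_in; right; exists w.
    apply: gen_alg_add; first by apply: gen_alg_in; left; exists m.+2.
    apply: gen_alg_mul; first by apply: gen_alg_in; right; exists (- m%:R).
    by apply: gen_alg_in; left; exists m.+1.
  apply/funext => x; rewrite deriveE//.
  rewrite -[in LHS](mulr1 w) -[w * 1]/(w *: (1 : R)) linearZ -deriveE//.
  have [_ ->] := flat_derive m x.
  by change (w * (flat m.+2 x - m%:R * flat m.+1 x) =
             w * (flat m.+2 x + - m%:R * flat m.+1 x)); rewrite mulNr.
by apply: H; apply: gen_alg_in; left; exists n.
Qed.

Lemma smooth_affine (c d : R) : smooth (fun t : R => c * t + d).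
Proof. by apply: smoothD; [apply: smoothZ; exact: smooth_id|exact: smooth_cst]. Qed.

Lemma flat0_gt0 x : 0 < x -> 0 < flat 0 x.
Proof. by move=> x0; rewrite /flat x0 mul1r expR_gt0. Qed.

Lemma flat0_ge0 x : 0 <= flat 0 x.
Proof. by rewrite /flat; case: ifP => // _; rewrite mul1r expR_ge0. Qed.

Lemma flat0_le0 x : x <= 0 -> flat 0 x = 0.
Proof. by move=> x0; rewrite /flat ltNge x0. Qed.

(** A smooth transition from [0] on the left of [0] to [1] on the right of [1]. *)
Definition step x : R := flat 0 x / (flat 0 x + flat 0 (1 - x)).

Let step_den x : 0 < flat 0 x + flat 0 (1 - x).
Proof.
have [x0|x0] := ltP 0 x; first by rewrite ltr_pwDl ?flat0_gt0 ?flat0_ge0.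
by rewrite ltr_wpDl ?flat0_ge0// flat0_gt0// subr_gt0 (le_lt_trans x0).
Qed.

Lemma step_smooth : smooth step.
Proof.
apply: smoothM; first exact: flat_smooth.
apply: smoothV => [x|]; first by rewrite gt_eqF// step_den.
apply: smoothD; first exact: flat_smooth.
have -> : (fun x => flat 0 (1 - x)) = flat 0 \o (fun x => (-1) * x + 1).
  by apply/funext => x /=; rewrite mulN1r addrC.
by apply: smooth_comp; [exact: flat_smooth|exact: smooth_affine].
Qed.

Lemma step_le0 x : x <= 0 -> step x = 0.
Proof. by move=> x0; rewrite /step flat0_le0// mul0r. Qed.

Lemma step_ge1 x : 1 <= x -> step x = 1.
Proof.
move=> x1; rewrite /step [flat 0 (1 - x)]flat0_le0 ?subr_le0// addr0 divff//.
by rewrite gt_eqF// flat0_gt0// (lt_le_trans _ x1).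
Qed.

Lemma step_ge0 x : 0 <= step x.
Proof. by rewrite /step divr_ge0 ?flat0_ge0// ltW. Qed.

Lemma step_le1 x : step x <= 1.
Proof. by rewrite /step ler_pdivrMr// mul1r lerDl flat0_ge0. Qed.

(** A cutoff equal to [1] on [[a, b]] and to [0] outside [[a - d, b + d]]. *)
Definition plateau (a b d t : R) : R :=
  step (d^-1 * t + (1 - d^-1 * a)) * step ((- d^-1) * t + (1 + d^-1 * b)).

Lemma plateau_smooth a b d : smooth (plateau a b d).
Proof.
by apply: smoothM; apply: (smooth_comp step_smooth); exact: smooth_affine.
Qed.

Lemma plateau_ge0 a b d t : 0 <= plateau a b d t.
Proof. by rewrite mulr_ge0 ?step_ge0. Qed.

Lemma plateau_le1 a b d t : plateau a b d t <= 1.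
Proof. by rewrite -[1]mulr1 ler_pM ?step_ge0 ?step_le1. Qed.

Lemma plateau1 a b d t : 0 < d -> a <= t <= b -> plateau a b d t = 1.
Proof.
move=> d0 /andP[at_ tb]; rewrite /plateau !step_ge1 ?mulr1//.
  by rewrite mulNr; have := @ler_wpM2l _ d^-1 _ _ _ tb; rewrite invr_ge0 (ltW d0) => /(_ isT); lra.
by have := @ler_wpM2l _ d^-1 _ _ _ at_; rewrite invr_ge0 (ltW d0) => /(_ isT); lra.
Qed.

Lemma plateau0 a b d t : 0 < d -> ~~ (a - d < t < b + d) -> plateau a b d t = 0.
Proof.
move=> d0; have dV : d^-1 * d = 1 by rewrite mulVf// gt_eqF.
have di : 0 <= d^-1 by rewrite invr_ge0 ltW.
rewrite negb_and -!leNgt => /orP[H|H]; rewrite /plateau; have := ler_wpM2l di H => {}H.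
  by rewrite step_le0 ?mul0r//; move: H; rewrite mulrBr dV; lra.
by rewrite mulrC step_le0 ?mul0r//; move: H; rewrite mulrDr dV; lra.
Qed.

End bump.

Section coord.
Context {R : realType} {N : nat}.

Lemma coord_derive (i : 'I_N) (x w : 'rV[R]_N) :
  is_derive x w (fun x : 'rV[R]_N => x ord0 i) (w ord0 i).
Proof.
have H : (fun h : R => h^-1 *: (((fun x : 'rV[R]_N => x ord0 i) \o shift x) (h *: w) - x ord0 i)) h
     @[h --> 0^'] --> w ord0 i.
  apply: cvg_near_cst; near=> h.
  have h0 : h != 0 by near: h; exact: nbhs_dnbhs_neq.
  rewrite /= /shift !mxE addrK -[LHS]/(_ * _) mulrA mulVf// mul1r//.
apply: DeriveDef; last exact/cvg_lim.
by apply/cvg_ex; exists (w ord0 i).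
Unshelve. all: by end_near. Qed.

Lemma smooth_coord (i : 'I_N) : smooth (fun x : 'rV[R]_N => x ord0 i).
Proof.
apply: (@smooth_coind _ _ (fun f => f = (fun x : 'rV[R]_N => x ord0 i) \/ exists c, f = cst c)); last by left.
move=> _ [->|[c ->]].
  split=> [|w]; first by move=> x; exact: coord_continuous.
  split=> [x|]; first by case: (coord_derive i x w).
  by right; exists (w ord0 i); apply/funext => x; have [_ ->] := coord_derive i x w.
split=> [|w]; first exact: cst_continuous.
split=> [x|]; first exact: derivable_cst.
by right; exists 0; apply/funext => x; rewrite derive_cst.
Qed.

End coord.
Section affine.
Context {R : realType} (V : normedModType R).
Implicit Types (f g : V -> R).

Lemma derive_affine f (c : R) (b x w : V) : smooth f ->
  is_derive x w (fun x => f (c *: x + b)) (c * 'D_w f (c *: x + b)).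
Proof.
move=> sf.
have dF : is_derive (c * 0 : R) 1 (fun h : R => f (h *: w + (c *: x + b))) ('D_w f (c *: x + b)).
  have /is_derive_line := @smooth_derivable _ _ f ((c * 0) *: w + (c *: x + b)) w sf.
  by rewrite mulr0 scale0r add0r; exact.
have dL : is_derive (0 : R) 1 (fun h : R => c * h) c.
  have [d1 d2] := @is_deriveZ _ _ _ id c (0 : R) 1 1 (is_derive_id _ _).
  by apply: DeriveDef => //; rewrite d2 [LHS]mulr1.
have [d1 d2] := @is_derive1_comp _ (fun h : R => f (h *: w + (c *: x + b))) (fun h : R => c * h) 0 _ _ dF dL.
have E (h : R) : (fun h : R => f (h *: w + (c *: x + b))) (c * h) = f (c *: (h *: w + x) + b).
  by rewrite /= scalerDr scalerA addrA.
have E2 : ((fun h : R => f (h *: w + (c *: x + b))) \o (fun h : R => c * h)) =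
   (fun h : R => f (c *: (h *: w + x) + b)).
  by apply/funext => h /=; rewrite -E.
rewrite E2 in d1 d2.
apply: DeriveDef; first by apply/derivable1P.
rewrite mulrC -d2 /derive.
suff -> : (fun h : R => h^-1 *: (((fun x : V => f (c *: x + b)) \o shift x) (h *: w) - f (c *: x + b))) =
  (fun h : R => h^-1 *: (((fun h : R => f (c *: (h *: w + x) + b)) \o shift 0) (h *: 1) - f (c *: (0 *: w + x) + b))) by [].
by apply/funext => h /=; rewrite /shift/= [h *: 1]mulr1 addr0 scale0r add0r.
Qed.

Lemma smooth_comp_affine f (c : R) (b : V) : smooth f ->
  smooth (fun x => f (c *: x + b)).
Proof.
move=> sf.
apply: (@smooth_coind _ _ (fun g => exists f, smooth f /\ g = fun x => f (c *: x + b))); last by exists f.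
move=> _ {sf}[{}f [sf ->]]; split.
  move=> x; apply: (@continuous_comp _ _ _ (fun x => c *: x + b) f).
    by apply: cvgD; [apply: cvgZr; exact: cvg_id|exact: cvg_cst].
  exact: (smooth_continuous sf).
move=> w; split=> [x|]; first by case: (derive_affine c b x w sf).
exists (fun x => c * 'D_w f x); split.
  by apply: smoothZ; exact: smooth_derive.
by apply/funext => x; have [_ ->] := derive_affine c b x w sf.
Qed.

Lemma derive_eq_open (U : set V) f g w : open U -> (forall x, U x -> f x = g x) ->
  forall x, U x -> 'D_w f x = 'D_w g x.
Proof.
move=> oU fg x Ux; apply: near_eq_derive.
by near=> y; apply: fg; near: y; exact: open_nbhs_nbhs.
Unshelve. all: by end_near. Qed.

End affine.

(** * Test functions on [R^N] *)

Section test_functions.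
Context {R : realType} {N : nat}.
Implicit Types (psi : 'rV[R]_N -> R) (L r : R) (x : 'rV[R]_N).

Definition box L : set 'rV[R]_N := [set x | forall i, `|x ord0 i| <= L].

Lemma box_compact L : compact (box L).
Proof.
have -> : box L = [set v : 'rV[R]_N | forall i, `[- L, L]%classic (v ord0 i)].
  by apply/seteqP; split=> x /= H i; have := H i; rewrite /= in_itv/= ler_norml.
by apply: (@rV_compact R N (fun=> `[- L, L]%classic)) => i; exact: segment_compact.
Qed.

Lemma box_closed L : closed (box L).
Proof.
have -> : box L = \bigcap_(i in [set: 'I_N]) ((fun x : 'rV[R]_N => x ord0 i) @^-1` `[- L, L]%classic).
  apply/seteqP; split=> x H i; have := H i; rewrite /= in_itv/= -ler_norml//.
  by move=> /(_ I).
apply: closed_bigI => i _; apply: preimage_closed; last exact: itv_closed.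
by move=> x _; exact: coord_continuous.
Qed.

Lemma coord_le_norm x i : `|x ord0 i| <= `|x|.
Proof.
rewrite {2}/Num.norm/= mx_normrE.
by have /= := @le_bigmax _ _ _ 0 (fun ij : 'I_1 * 'I_N => `|x ij.1 ij.2|) (ord0, i); exact.
Qed.

Lemma norm_le_coord x L : 0 <= L -> (forall i, `|x ord0 i| <= L) -> `|x| <= L.
Proof.
move=> L0 H; rewrite {1}/Num.norm/= mx_normrE.
by apply/bigmax_leP; split=> // -[j i] _ /=; rewrite (ord1 j); exact: H.
Qed.

Lemma box_norm L x : `|x| <= L -> box L x.
Proof. by move=> H i; exact: le_trans (coord_le_norm _ _) H. Qed.

Lemma boxS L L' : L <= L' -> box L `<=` box L'.
Proof. by move=> LL x H i; exact: le_trans (H i) LL. Qed.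

Lemma test_functionP psi : test_function setT psi <->
  smooth psi /\ exists L, forall x, ~ box L x -> psi x = 0.
Proof.
split=> [[spsi cpt _]|[spsi [L HL]]].
  split=> //; have [M [_ HM]] := compact_bounded cpt.
  have {}HM : forall x, support_closure psi x -> `|x| <= M + 1.
    by apply: HM; rewrite ltrDl.
  exists (M + 1) => x nx; apply/eqP/negPn/negP => px; apply: nx.
  by apply: box_norm; apply: HM; apply: subset_closure.
have sub : support_closure psi `<=` box L.
  have /closure_id -> := @box_closed L; apply: closureS => x /= px.
  by apply: contrapT => /HL p0; rewrite p0 eqxx in px.
split=> //.
by apply: (subclosed_compact _ (@box_compact L) sub); exact: closed_closure.
Qed.

Lemma test_smooth psi : test_function setT psi -> smooth psi.
Proof. by case. Qed.

Lemma derive_box0 psi L w : (forall x, ~ box L x -> psi x = 0) ->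
  forall x, ~ box L x -> 'D_w psi x = 0.
Proof.
move=> H x nx; rewrite (@derive_eq_open _ _ (~` box L) psi (cst 0))//.
- by rewrite derive_cst.
- by apply: closed_openC; exact: box_closed.
Qed.

Lemma test_derive psi w : test_function setT psi -> test_function setT ('D_w psi).
Proof.
move=> /test_functionP[sp [L HL]]; apply/test_functionP; split; first exact: smooth_derive.
by exists L; exact: derive_box0.
Qed.

Lemma test_mull psi f : smooth f -> test_function setT psi ->
  test_function setT (fun x => f x * psi x).
Proof.
move=> sf /test_functionP[sp [L HL]]; apply/test_functionP; split; first exact: smoothM.
by exists L => x /HL ->; rewrite mulr0.
Qed.

Lemma continuous_box_bounded psi L : continuous psi ->
  exists2 C, 0 < C & forall x, box L x -> `|psi x| <= C.
Proof.
move=> cp; have : compact (psi @` box L).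
  by apply: continuous_compact; [exact: continuous_subspaceT|exact: box_compact].
move=> /compact_bounded[M [_ HM]]; exists (`|M| + 1); first by rewrite ltr_wpDl.
move=> x bx; apply: (HM (`|M| + 1)); last by exists x.
by rewrite (le_lt_trans (ler_norm M))// ltrDl.
Qed.

Lemma test_bounded psi : test_function setT psi ->
  exists2 C, 0 < C & forall x, `|psi x| <= C.
Proof.
move=> /test_functionP[/smooth_continuous/continuous_box_bounded H [L HL]].
have [C C0 HC] := H L; exists C => // x.
have [/HC//|/HL ->] := pselect (box L x); by rewrite normr0 ltW.
Qed.

(** [cutoff r] equals [1] on [box r] and vanishes outside [box (2 r)]; all the
    cutoffs are dilations of [cutoff 1]. *)
Definition cutoff r : 'rV[R]_N -> R :=
  fun x => \prod_(i < N) plateau (-1) 1 1 ((r^-1 *: x) ord0 i).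

Let cutoff1_smooth : smooth (fun x : 'rV[R]_N => \prod_(i < N) plateau (-1) 1 1 (x ord0 i) : R).
Proof.
apply: smooth_prod => i.
exact: (smooth_comp (plateau_smooth _ _ _) (smooth_coord i)).
Qed.

Lemma cutoff_smooth r : smooth (cutoff r).
Proof.
have := smooth_comp_affine r^-1 0 cutoff1_smooth.
by rewrite /cutoff; under eq_fun do under eq_bigr do rewrite addr0.
Qed.

Lemma cutoff_ge0 r x : 0 <= cutoff r x.
Proof. by apply: prodr_ge0 => i _; exact: plateau_ge0. Qed.

Lemma cutoff_le1 r x : cutoff r x <= 1.
Proof. by apply: prodr_ile1 => i _; rewrite plateau_ge0 plateau_le1. Qed.

Lemma cutoff1 r x : 0 < r -> box r x -> cutoff r x = 1.
Proof.
move=> r0 bx; rewrite /cutoff big1// => i _; rewrite plateau1// -ler_norml mxE.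
by rewrite normrM (ger0_norm (_ : 0 <= r^-1)) ?invr_ge0 ?(ltW r0)// mulrC ler_pdivrMr// mul1r.
Qed.

Lemma cutoff0 r x : 0 < r -> ~ box (2 * r) x -> cutoff r x = 0.
Proof.
move=> r0 /existsNP[i /negP]; rewrite -ltNge => nx.
rewrite /cutoff (bigD1 i)//= plateau0 ?mul0r//.
rewrite (_ : -1 - 1 = - 2); last by lra.
rewrite (_ : 1 + 1 = 2); last by lra.
rewrite -ltr_norml -leNgt mxE normrM (ger0_norm (_ : 0 <= r^-1)) ?invr_ge0 ?(ltW r0)//.
by rewrite mulrC ler_pdivlMr// (ltW nx).
Qed.

Lemma cutoff_test r : 0 < r -> test_function setT (cutoff r).
Proof.
move=> r0; apply/test_functionP; split; first exact: cutoff_smooth.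
by exists (2 * r) => x; exact: cutoff0.
Qed.

(** The derivatives of the cutoffs are uniformly of order [1 / r]. *)
Lemma cutoff_derive_bound w : exists2 C, 0 < C &
  forall r x, 0 < r -> `|'D_w (cutoff r) x| <= C / r.
Proof.
have [C C0 HC] := test_bounded (test_derive w (cutoff_test ltr01)).
exists C => // r x r0.
have E : cutoff r = fun x => cutoff 1 (r^-1 *: x + 0).
  by apply/funext => y; rewrite /cutoff addr0 invr1 scale1r.
have [_] := derive_affine r^-1 0 x w (cutoff_smooth 1).
rewrite -E => ->; rewrite normrM (ger0_norm (_ : 0 <= r^-1)) ?invr_ge0 ?(ltW r0)// mulrC.
by apply: ler_wpM2r; [rewrite invr_ge0 (ltW r0)|exact: HC].
Qed.

Lemma cutoff_derive0 r x w : 0 < r -> (forall i, `|x ord0 i| < r) ->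
  'D_w (cutoff r) x = 0.
Proof.
move=> r0 xr; rewrite (@near_eq_derive _ _ _ _ (cst (1 : R))) ?derive_cst//.
have H : \forall y \near x, forall i : 'I_N, `|(y : 'rV[R]_N) ord0 i| < r.
  have H (i : 'I_N) : \forall y \near nbhs x, `|(y : 'rV[R]_N) ord0 i| < r.
    have c : (fun y : 'rV[R]_N => `|y ord0 i|) y @[y --> x] --> `|x ord0 i|.
      exact: (cvg_norm (@coord_continuous R 1 N ord0 i x)).
    exact: (cvgr_lt _ c _ (xr i)).
  exact: filter_forall H.
by apply: filterS H => y Hy; apply: cutoff1 => // i; exact: ltW.
Qed.

End test_functions.
(** * Integration preliminaries *)

Section dominated.
Context d (T : measurableType d) (R : realType) (mu : {measure set T -> \bar R}).
Implicit Types (D : set T) (f g : T -> R).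

Lemma Rdominated_cvg D (f_ : nat -> T -> R) f g : measurable D ->
  (forall n, measurable_fun D (f_ n)) -> measurable_fun D f ->
  {ae mu, forall x, D x -> f_ ^~ x @ \oo --> f x} ->
  mu.-integrable D (EFin \o g) ->
  {ae mu, forall x, D x -> forall n, `|f_ n x| <= g x} ->
  [/\ forall n, mu.-integrable D (EFin \o f_ n), mu.-integrable D (EFin \o f) &
    \int[mu]_(x in D) f_ n x @[n --> \oo] --> \int[mu]_(x in D) f x].
Proof.
move=> mD mf_ mf cf ig fg.
have ifn n : mu.-integrable D (EFin \o f_ n).
  have /integrableP[_ goo] := ig.
  apply/integrableP; split; first exact/measurable_EFinP.
  apply: le_lt_trans goo; apply: ae_ge0_le_integral => //.
  - by apply/measurable_EFinP; exact: measurableT_comp.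
  - by apply: measurableT_comp => //; exact: (measurable_int mu ig).
  - by apply: filterS fg => x H Dx /=; rewrite lee_fin (le_trans (H Dx n))// ler_norm.
have [] := @dominated_convergence _ _ _ mu D mD (fun n => EFin \o f_ n) (EFin \o f) (EFin \o g).
- by move=> n; exact/measurable_EFinP.
- exact/measurable_EFinP.
- by apply: filterS cf => x H Dx; apply: cvg_EFin; [near=> n|exact: H].
- exact: ig.
- by apply: filterS fg => x H n Dx /=; rewrite lee_fin H.
move=> i_f _ cv; split=> //.
apply: (fine_cvg (f := fun n => \int[mu]_(x in D) (EFin \o f_ n) x)%E).
rewrite /Rintegral fineK//.
by apply: integrable_fin_num.
Unshelve. all: by end_near. Qed.

Lemma measurable_of_integrable D f : mu.-integrable D (EFin \o f) -> measurable_fun D f.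
Proof. by move=> i_f; apply/measurable_EFinP; exact: (measurable_int mu i_f). Qed.

Lemma ae_le_Rintegral D f g : measurable D -> mu.-integrable D (EFin \o f) ->
  mu.-integrable D (EFin \o g) ->
  {ae mu, forall x, D x -> f x <= g x} ->
  \int[mu]_(x in D) f x <= \int[mu]_(x in D) g x.
Proof.
move=> mD i_f ig fg; rewrite -subr_ge0 -RintegralB//.
have mfg : measurable_fun D (fun x => g x - f x).
  by apply: measurable_funB; apply/measurable_EFinP; [exact: (measurable_int mu ig)|exact: (measurable_int mu i_f)].
rewrite /Rintegral fine_ge0//.
rewrite (@ae_eq_integral _ _ _ mu D (fun x => `|g x - f x|%:E))//.
- by apply: integral_ge0 => x _; rewrite lee_fin.
- exact/measurable_EFinP.
- by apply/measurable_EFinP; exact: measurableT_comp.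
- by apply: filterS fg => x H Dx; rewrite ger0_norm// subr_ge0 H.
Qed.

Lemma ae_eq_Rintegral D f g : measurable D -> measurable_fun D f ->
  measurable_fun D g -> {ae mu, forall x, D x -> f x = g x} ->
  \int[mu]_(x in D) f x = \int[mu]_(x in D) g x.
Proof.
move=> mD mf mg fg; rewrite /Rintegral; congr fine.
apply: ae_eq_integral; [exact: mD|exact/measurable_EFinP|exact/measurable_EFinP|].
by apply: filterS fg => x H Dx /=; rewrite H.
Qed.

Lemma ae_integrable_dom D f g : measurable D -> measurable_fun D f ->
  mu.-integrable D (EFin \o g) ->
  {ae mu, forall x, D x -> `|f x| <= g x} -> mu.-integrable D (EFin \o f).
Proof.
move=> mD mf ig fg.
by have [/(_ 0)] := @Rdominated_cvg D (fun=> f) f g mD (fun=> mf) mf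
  (filterS (fun x H Dx => cvg_cst _) fg) ig (filterS (fun x H Dx n => H Dx) fg).
Qed.

Lemma ae_norm_Rintegral_le D f g : measurable D -> measurable_fun D f ->
  mu.-integrable D (EFin \o g) ->
  {ae mu, forall x, D x -> `|f x| <= g x} ->
  `|\int[mu]_(x in D) f x| <= \int[mu]_(x in D) g x.
Proof.
move=> mD mf ig fg; have i_f := ae_integrable_dom mD mf ig fg.
apply: (le_trans (le_normr_Rintegral mD i_f)).
by apply: ae_le_Rintegral => //; exact: integrable_norm.
Qed.

Lemma integrableM_bounded D f g (C : R) : measurable D -> mu.-integrable D (EFin \o f) ->
  measurable_fun D g -> (forall x, D x -> `|g x| <= C) ->
  mu.-integrable D (EFin \o (fun x => f x * g x)).
Proof.
move=> mD i_f mg gC.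
apply: (@ae_integrable_dom D _ (fun x => `|f x| * C)) => //.
- by apply: measurable_funM => //; apply/measurable_EFinP; exact: (measurable_int mu i_f).
- have := integrableZr mD C (integrable_norm i_f); apply: eq_integrable => //.
- by apply/aeW => x Dx; rewrite normrM ler_wpM2l// gC.
Qed.

Lemma Rintegral_abs_eq0 D f : measurable D -> mu.-integrable D (EFin \o f) ->
  {ae mu, forall x, D x -> 0 <= f x} -> \int[mu]_(x in D) f x = 0 ->
  {ae mu, forall x, D x -> f x = 0}.
Proof.
move=> mD i_f f0 H.
have mf := measurable_int mu i_f.
suff : ae_eq mu D (EFin \o f) (cst 0%E).
  by apply: filterS => x /= Hx Dx; have [] := Hx Dx.
apply/(ae_eq_integral_abs mu mD mf).
rewrite -(@ae_eq_integral _ _ _ mu D _ (EFin \o f))//.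
- rewrite -[LHS]fineK ?integrable_fin_num//; congr EFin; exact: H.
- exact: measurableT_comp.
- by apply: filterS f0 => x Hx Dx /=; rewrite ger0_norm// Hx.
Qed.

(** Splitting at level [lam] bounds a function by a bounded one and a power of
    it; this does duty for the Hoelder inequality. *)
Lemma powR_split (g lam s : R) : 1 < g -> 0 < lam -> 0 <= s ->
  s <= lam + lam `^ (1 - g) * s `^ g.
Proof.
move=> g1 l0 s0; have [sl|ls] := leP s lam.
  by rewrite (le_trans sl)// lerDl mulr_ge0 ?powR_ge0.
have s1 : 0 < s by exact: lt_trans ls.
rewrite (@le_trans _ _ (lam `^ (1 - g) * s `^ g))//; last by rewrite lerDr ltW.
have E : s = s `^ (1 - g) * s `^ g.
  by rewrite -powRD ?subrK ?powRr1// ?gt_eqF ?implybT.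
rewrite {1}E ler_wpM2r ?powR_ge0//.
rewrite -[1 - g]opprB !powRN lef_pV2 ?posrE ?powR_gt0//.
by rewrite ge0_ler_powR ?subr_ge0 ?nnegrE ?ltW.
Qed.

End dominated.
(** * Lebesgue measure on [R^N] *)

Section rV_measure.
Context {R : realType} {N : nat}.
Local Notation T := (measurableTypeR R).
Local Notation mu := (@lebesgue_rV R N).
Implicit Types (L : R) (f : 'rV[R]_N -> R).

(** Continuous functions are limits of functions that are constant on the cells
    of finer and finer grids. *)
Lemma continuous_measurable_rV f : continuous f ->
  measurable_fun [set: 'rV[T]_N] (f : 'rV[T]_N -> R).
Proof.
move=> cf.
pose grid (n : nat) (z : 'rV[int]_N) : 'rV[R]_N := \row_i ((z ord0 i)%:~R / n.+1%:R).
pose cell (n : nat) (x : 'rV[R]_N) : 'rV[int]_N := \row_i Num.floor (x ord0 i * n.+1%:R).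
have mcell n z : measurable [set x : 'rV[T]_N | cell n x = z].
  rewrite (_ : mkset _ = \bigcap_(i in [set: 'I_N])
     ((fun x : 'rV[T]_N => x ord0 i) @^-1` `[(z ord0 i)%:~R / n.+1%:R, (z ord0 i + 1)%:~R / n.+1%:R[%classic)).
    apply: fin_bigcap_measurable => // i _; rewrite -[X in measurable X]setTI.
    by apply: measurable_coord_rV => //; exact: measurable_itv.
  have E (x : R) (k : int) : (Num.floor (x * n.+1%:R) == k) = (k%:~R / n.+1%:R <= x < (k + 1)%:~R / n.+1%:R).
    by rewrite ler_pdivrMr// ltr_pdivlMr// floor_eq.
  apply/seteqP; split=> x /= H.
    by move=> i _; rewrite /= in_itv/= -E -H mxE.
  apply/rowP => i; rewrite mxE; apply/eqP; rewrite E.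
  by have := H i I; rewrite /= in_itv.
apply: (@measurable_fun_cvg _ _ _ _ (fun n x => f (grid n (cell n x)))) => [n|x _].
  move=> _ Y mY; rewrite setTI.
  rewrite (_ : _ @^-1` _ = \bigcup_z ([set x : 'rV[T]_N | cell n x = z] `&` [set _ | Y (f (grid n z))])).
    apply: countable_bigcupT_measurable => [|z]; first exact: countableP.
    have [H|H] := pselect (Y (f (grid n z))).
      rewrite (_ : _ `&` _ = [set x : 'rV[T]_N | cell n x = z]); first exact: mcell.
      by apply/seteqP; split=> [x []|x].
    rewrite (_ : _ `&` _ = set0); first exact: measurable0.
    by apply/seteqP; split=> [x []|x].
  apply/seteqP; split=> [x /= H|x [z _ [/= <-]]//].
  by exists (cell n x).
have : grid n (cell n x) @[n --> \oo] --> x.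
  apply/cvgrPdist_le => e e0; near=> n.
  apply: norm_le_coord; first exact: ltW.
  move=> i; rewrite !mxE.
  have n0 : 0 < n.+1%:R :> R by rewrite ltr0n.
  have /andP[] := floor_itv (x ord0 i * n.+1%:R).
  set k := Num.floor _ => k1 k2.
  rewrite ger0_norm; last by rewrite subr_ge0 ler_pdivrMr.
  apply: (@le_trans _ _ (n.+1%:R^-1)).
    by rewrite lerBlDl -[X in _ + X]mul1r -mulrDl ler_pdivlMr// ltW// -[1]/(1%:~R) -intrD.
  by apply: ltW; near: n; exact: (near_infty_natSinv_lt (PosNum e0)).
by move=> /(cvg_comp _ _); apply; exact: cf.
Unshelve. all: by end_near. Qed.

Lemma measurable_box L : measurable (box L : set 'rV[T]_N).
Proof.
rewrite (_ : box L = \bigcap_(i in [set: 'I_N]) ((fun x : 'rV[T]_N => x ord0 i) @^-1` `[- L, L]%classic)).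
  apply: fin_bigcap_measurable => // i _; rewrite -[X in measurable X]setTI.
  by apply: measurable_coord_rV => //; exact: measurable_itv.
by apply/seteqP; split=> x H i; have := H i; rewrite /= in_itv/= -ler_norml// => /(_ I).
Qed.

Lemma box_volume L : 0 <= L -> mu (box L) = ((2 * L) ^+ N)%:E.
Proof.
move=> L0; have := @lebesgue_rV_box R N (fun=> `[- L, L]%classic).
have -> : box L = [set x : 'rV[T]_N | forall i, `[- L, L]%classic (x ord0 i)].
  by apply/seteqP; split=> x /= H i; have := H i; rewrite /= in_itv/= -ler_norml.
move=> H; etransitivity; first by apply: H => i; exact: measurable_itv.
rewrite (eq_bigr (fun=> (2 * L)%:E)); last first.
  move=> i _; rewrite lebesgue_measure_itv/= lte_fin.
  case: ifPn; first by rewrite -EFinD opprK -mulr2n mulr_natl.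
  rewrite -leNgt => L1; congr EFin; lra.
by rewrite prodEFin prodr_const card_ord.
Qed.

Lemma box_volume_lty L : (mu (box L) < +oo)%E.
Proof.
apply: (@le_lt_trans _ _ (mu (box `|L|))).
  by apply: le_measure; rewrite ?inE; [exact: measurable_box|exact: measurable_box|apply: boxS; exact: ler_norm].
by rewrite box_volume// ltry.
Qed.

End rV_measure.

Section affine_change.
Context {R : realType}.
Local Notation T := (measurableTypeR R).
Local Open Scope ereal_scope.

Lemma measurable_affine (c b : R) : measurable_fun [set: T] ((fun s : R => c * s + b)%R : T -> T).
Proof. by apply: measurable_funD => //; exact: measurable_funM. Qed.

Lemma lebesgue_measure_affine (c b : R) (A : set T) : c != 0%R -> measurable A ->
  lebesgue_measure A =
  `|c|%:E * pushforward (@lebesgue_measure R) ((fun s : R => c * s + b)%R : T -> T) A.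
Proof.
move=> c0 mA; have mphi := measurable_affine c b.
have n0 : (0 <= `|c|)%R by [].
pose m1 := [the {measure set T -> \bar R} of pushforward (@lebesgue_measure R) ((fun s : R => c * s + b)%R : T -> T)].
pose m := [the {measure set T -> \bar R} of mscale (NngNum n0) (m1 mphi)].
rewrite (@lebesgue_measure_unique _ m)// => {A mA} _ [[x y] _ <-].
rewrite /m /= /mscale /= /pushforward.
have [cn|cp] : (c < 0)%R \/ (0 < c)%R by case: (ltgtP c 0%R) c0 => //; [left|right].
  have -> : ((fun s : R => c * s + b)%R @^-1` `]x, y]%classic) = `[((y - b) / c)%R, ((x - b) / c)%R[%classic.
    apply/seteqP; split=> s; rewrite /= !in_itv/= ler_ndivrMr// ltr_ndivlMr// mulrC ltrBlDr lerBrDr andbC//.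
  rewrite !lebesgue_measure_itv/= !lte_fin ltr_nM2r ?invr_lt0// ltrD2r ltr0_norm//.
  case: ifPn => _; last by rewrite mule0.
  rewrite -EFinM; congr EFin; rewrite -mulrBl mulrCA mulNr divff ?lt_eqF//; ring.
have -> : ((fun s : R => c * s + b)%R @^-1` `]x, y]%classic) = `]((x - b) / c)%R, ((y - b) / c)%R]%classic.
  by apply/seteqP; split=> s; rewrite /= !in_itv/= ler_pdivlMr// ltr_pdivrMr// mulrC ltrBlDr lerBrDr.
rewrite !lebesgue_measure_itv/= !lte_fin ltr_pM2r ?invr_gt0// ltrD2r gtr0_norm//.
case: ifPn => _; last by rewrite mule0.
by rewrite -EFinM; congr EFin; rewrite -mulrBl mulrCA divff ?gt_eqF//; ring.
Qed.

Lemma ge0_integral_affine (c b : R) (g : R -> \bar R) : c != 0%R ->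
  measurable_fun [set: T] g -> (forall x, 0 <= g x) ->
  \int[@lebesgue_measure R]_s g (c * s + b)%R = `|c|^-1%:E * \int[@lebesgue_measure R]_s g s.
Proof.
move=> c0 mg g0; have mphi := measurable_affine c b.
have n0 : (0 <= `|c|)%R by [].
pose m1 := [the {measure set T -> \bar R} of pushforward (@lebesgue_measure R) ((fun s : R => c * s + b)%R : T -> T)].
pose m := [the {measure set T -> \bar R} of mscale (NngNum n0) (m1 mphi)].
rewrite [in RHS](@eq_measure_integral _ _ _ setT m); last first.
  by move=> A mA _; exact: lebesgue_measure_affine.
rewrite ge0_integral_mscale//= muleA -EFinM mulVf ?normr_eq0// mul1e.
by rewrite /m1 ge0_integral_pushforward.
Qed.

(** Affine changes of variables in [R^N]: one coordinate at a time. *)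
Lemma ge0_integral_affine_rV N (c : R) (b : 'rV[R]_N) (g : 'rV[R]_N -> \bar R) : c != 0%R ->
  measurable_fun [set: 'rV[T]_N] g -> (forall x, 0 <= g x) ->
  \int[lebesgue_rV N]_s g (c *: s + b)%R = ((`|c| ^+ N)^-1)%:E * \int[lebesgue_rV N]_s g s.
Proof.
move=> c0; elim: N b g => [|n IH] b g mg g0.
  rewrite expr0 invr1 mul1e; apply: eq_integral => x _; congr g.
  by apply/rowP => -[].
have split_int (h : 'rV[R]_n.+1 -> \bar R) : measurable_fun [set: 'rV[T]_n.+1] h ->
    (forall x, 0 <= h x) -> \int[lebesgue_rV n.+1]_s h s =
    \int[lebesgue_measure]_a \int[lebesgue_rV n]_x h (cons_rV (a, x)).
  move=> mh h0; rewrite /= /lebesgue_cons.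
  rewrite (@ge0_integral_pushforward _ _ _ _ _ _ (@measurable_cons_rV _ T n))//= preimage_setT.
  by rewrite fubini_tonelli1//; apply: measurableT_comp.
have maff : measurable_fun [set: 'rV[T]_n.+1] (fun s : 'rV[T]_n.+1 => (c *: s + b)%R : 'rV[T]_n.+1).
  apply: measurable_fun_rVP => i; under eq_fun do rewrite !mxE.
  exact: (measurableT_comp (measurable_affine c (b ord0 i)) (measurable_coord_rV i)).
rewrite !split_int//; last exact: measurableT_comp.
pose t : 'rV[R]_n := (\row_j b ord0 (lift ord0 j))%R.
have E a x : (c *: cons_rV (a, x) + b = cons_rV (c * a + b ord0 ord0, c *: x + t) :> 'rV[R]_n.+1)%R.
  by apply/rowP => i; rewrite !mxE; case: unliftP => [j|] ->; rewrite ?mxE.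
have mG : measurable_fun [set: T * 'rV[T]_n] (fun p => g (cons_rV p)).
  by apply: measurableT_comp => //; exact: measurable_cons_rV.
under eq_integral => a _.
  under eq_integral do rewrite E.
  rewrite (IH t (fun x => g (cons_rV ((c * a + b ord0 ord0)%R, x))))//; last first.
    by apply: (measurableT_comp mG); exact: measurable_pair1.
  over.
pose F a := \int[lebesgue_rV n]_x g (cons_rV (a, x)).
have mF : measurable_fun [set: T] F by exact: (measurable_fun_fubini_tonelli_F _ mG).
have F0 a : 0 <= F a by exact: integral_ge0.
rewrite ge0_integralZl//; last 2 first.
  - by apply: (measurableT_comp mF); exact: measurable_affine.
  - by move=> a _; exact: F0.
rewrite (@ge0_integral_affine c _ F)// muleA -EFinM; congr (_%:E * _).
by rewrite exprS invfM mulrC.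
Qed.

End affine_change.
(** * Approximation of measurable sets by smooth functions *)

Section approximation.
Context d (X : measurableType d) (R : realType) (mu : {measure set X -> \bar R}).
Variables (Q : set X) (W : X -> R) (S : (X -> R) -> Prop).
Hypothesis mQ : measurable Q.
Hypothesis iW : mu.-integrable Q (EFin \o W).
Hypothesis W0 : forall x, 0 <= W x.
Hypothesis S_measurable : forall psi, S psi -> measurable_fun setT psi.
Hypothesis S_01 : forall psi x, S psi -> 0 <= psi x <= 1.
Hypothesis S_compl : forall psi, S psi -> S (fun x => 1 - psi x).
Hypothesis S_mul : forall psi phi, S psi -> S phi -> S (fun x => psi x * phi x).
Hypothesis S_1 : S (fun=> 1).

(** The indicator of [A] is a limit of elements of [S] in L^1(Q, W mu). *)
Definition approximable (A : set X) : Prop := measurable A /\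
  forall e, 0 < e -> exists2 psi, S psi &
    \int[mu]_(x in Q) (W x * `|psi x - \1_A x|) <= e.

Let indic01 (A : set X) x : 0 <= (\1_A x : R) <= 1.
Proof. by rewrite indicE ler0n lern1 leq_b1. Qed.

Let dist_integrable (f g : X -> R) : measurable_fun setT f -> measurable_fun setT g ->
  (forall x, 0 <= f x <= 1) -> (forall x, 0 <= g x <= 1) ->
  mu.-integrable Q (EFin \o (fun x => W x * `|f x - g x|)).
Proof.
move=> mf mg f1 g1; apply: (@integrableM_bounded _ _ _ _ _ _ _ 1) => //.
  apply: measurableT_comp => //; apply: measurable_funB; exact: measurable_funTS.
move=> x _; rewrite normr_id ler_norml; have := f1 x; have := g1 x; lra.
Qed.

Let approx_compl A : approximable A -> approximable (~` A).
Proof.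
move=> [mA HA]; split; first exact: measurableC.
move=> e /HA[psi Sp H]; exists (fun x => 1 - psi x); first exact: S_compl.
rewrite (@eq_Rintegral _ _ _ mu Q (fun x => W x * `|psi x - \1_A x|))// => x _.
congr (_ * _); rewrite -[RHS]normrN; congr `|_|.
rewrite !indicE in_setC; case: (x \in A); rewrite /=; lra.
Qed.

Let approx_union A B : approximable A -> approximable B -> approximable (A `|` B).
Proof.
move=> [mA HA] [mB HB]; split; first exact: measurableU.
move=> e e0; have e2 : 0 < e / 2 by rewrite divr_gt0.
have [psi Sp Hp] := HA _ e2; have [phi Sq Hq] := HB _ e2.
have mp := S_measurable Sp; have mq := S_measurable Sq.
exists (fun x => 1 - (1 - psi x) * (1 - phi x)).
  by apply: S_compl; apply: S_mul; exact: S_compl.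
have Su : S (fun x => 1 - (1 - psi x) * (1 - phi x)).
  by apply: S_compl; apply: S_mul; exact: S_compl.
have i1 := dist_integrable mp (measurable_indic mA) (fun x => S_01 x Sp) (indic01 A).
have i2 := dist_integrable mq (measurable_indic mB) (fun x => S_01 x Sq) (indic01 B).
have i3 := dist_integrable (S_measurable Su) (measurable_indic (measurableU _ _ mA mB)) (fun x => S_01 x Su) (indic01 (A `|` B)).
rewrite (splitr e); apply: le_trans (lerD Hp Hq).
rewrite -RintegralD//; apply: le_Rintegral => //.
  by have := integrableD mQ i1 i2; apply: eq_integrable.
move=> x _; rewrite -mulrDr ler_wpM2l//.
have := S_01 x Sp; have := S_01 x Sq.
have -> : \1_(A `|` B) x = 1 - (1 - \1_A x) * (1 - \1_B x) :> R.
  rewrite !indicE in_setU; case: (x \in A); case: (x \in B); rewrite /=; lra.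
have [a01 b01] : ((\1_A x == 0 :> R) || (\1_A x == 1 :> R)) /\ ((\1_B x == 0 :> R) || (\1_B x == 1 :> R)).
  by rewrite !indicE; split; case: (_ \in _); rewrite eqxx ?orbT.
set a := \1_A x in a01 *; set b := \1_B x in b01 *; set p := psi x; set q := phi x.
move=> /andP[q0 q1] /andP[p0 p1].
case/orP: a01 => /eqP ->; case/orP: b01 => /eqP ->.
- rewrite !subr0 !ger0_norm//; nra.
- rewrite (_ : 1 - (1 - p) * (1 - q) - (1 - (1 - 0) * (1 - 1)) = - ((1 - p) * (1 - q))); last by ring.
  rewrite normrN subr0 (ger0_norm p0) [`|q - 1|]ler0_norm ?ger0_norm; nra.
- rewrite (_ : 1 - (1 - p) * (1 - q) - (1 - (1 - 1) * (1 - 0)) = - ((1 - p) * (1 - q))); last by ring.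
  rewrite normrN subr0 (ger0_norm q0) [`|p - 1|]ler0_norm ?ger0_norm; nra.
- rewrite (_ : 1 - (1 - p) * (1 - q) - (1 - (1 - 1) * (1 - 1)) = - ((1 - p) * (1 - q))); last by ring.
  rewrite normrN ![`|_ - 1|]ler0_norm ?ger0_norm; nra.
Qed.

Let approx0 : approximable set0.
Proof.
split=> // e e0; exists (fun x => 1 - 1); first exact: (S_compl S_1).
rewrite (@eq_Rintegral _ _ _ mu Q (cst 0)).
  by rewrite Rintegral_cst// mul0r ltW.
by move=> x _; rewrite indic0 subrr subrr normr0 mulr0.
Qed.

(** Finite unions are handled by the products of the approximants, countable ones
    by dominated convergence. *)
Lemma approximable_sigma (G : set (set X)) :
  G `<=` approximable -> <<s G >> `<=` approximable.
Proof.
move=> GA; apply: smallest_sub => //; split.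
- exact: approx0.
- by move=> A; rewrite setTD; exact: approx_compl.
move=> F HF.
pose B n := \big[setU/set0]_(i < n) F i.
have HB n : approximable (B n).
  elim: n => [|n IH]; first by rewrite /B big_ord0; exact: approx0.
  by rewrite /B big_ord_recr; apply: approx_union.
have mU : measurable (\bigcup_n F n) by apply: bigcupT_measurable => n; case: (HF n).
split=> // e e0; have e2 : 0 < e / 2 by rewrite divr_gt0.
have mB n : measurable (B n) by case: (HB n).
have cv : \int[mu]_(x in Q) (W x * `|\1_(B n) x - \1_(\bigcup_n F n) x|) @[n --> \oo] --> (0 : R).
  have [] := @Rdominated_cvg _ _ _ mu Q (fun n x => W x * `|\1_(B n) x - \1_(\bigcup_n F n) x|) (cst 0) W mQ.
  - move=> n; apply: (@measurable_of_integrable _ _ _ mu).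
    by apply: dist_integrable => //; exact: measurable_indic.
  - exact: measurable_cst.
  - apply/aeW => x _; apply: cvg_near_cst.
    have [[m _ Fm]|nF] := pselect ((\bigcup_n F n) x).
      near=> n; rewrite !indicE !mem_set ?subrr ?normr0 ?mulr0//; first by exists m.
      rewrite /B -bigcup_mkord; exists m => //=.
      by near: n; exact: nbhs_infty_gt.
    near=> n; rewrite !indicE !memNset ?subrr ?normr0 ?mulr0// /B -bigcup_mkord.
    by move=> [m _ Fm]; apply: nF; exists m.
  - exact: iW.
  - apply/aeW => x _ n; rewrite normrM normr_id (ger0_norm (W0 x)) ler_piMr//.
    rewrite ler_norml; have := indic01 (B n) x; have := indic01 (\bigcup_n F n) x; lra.
  - by move=> _ _; rewrite Rintegral_cst// mul0r.
have [n _ Hn] : \forall n \near \oo, \int[mu]_(x in Q) (W x * `|\1_(B n) x - \1_(\bigcup_n F n) x|) < e / 2.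
  by apply: (cvgr_lt _ cv).
have {}Hn := Hn n (leqnn n).
have [_ /(_ _ e2)[psi Sp Hp]] := HB n; exists psi => //.
rewrite (splitr e); apply: le_trans (lerD Hp (ltW Hn)).
have i1 := dist_integrable (S_measurable Sp) (measurable_indic (mB n)) (fun x => S_01 x Sp) (indic01 (B n)).
have i2 := dist_integrable (measurable_indic (mB n)) (measurable_indic mU) (indic01 (B n)) (indic01 _).
have i3 := dist_integrable (S_measurable Sp) (measurable_indic mU) (fun x => S_01 x Sp) (indic01 _).
rewrite -RintegralD//; apply: le_Rintegral => //.
  by have := integrableD mQ i1 i2; apply: eq_integrable.
move=> x _; rewrite -mulrDr ler_wpM2l//.
by rewrite -[psi x - _](subrKA (\1_(B n) x)) ler_normD.
Unshelve. all: by end_near. Qed.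

End approximation.

Section interval_approximation.
Context {R : realType}.

(** These tend to the indicator of [`]a, b]] at every point. *)
Definition itv_bump (a b : R) (n : nat) (x : R) : R :=
  step (n%:R * x + - (n%:R * a)) * step (- n%:R * x + (1 + n%:R * b)).

Lemma itv_bump_smooth a b n : smooth (itv_bump a b n).
Proof.
by apply: smoothM; apply: (smooth_comp step_smooth); exact: smooth_affine.
Qed.

Lemma itv_bump01 a b n x : 0 <= itv_bump a b n x <= 1.
Proof. by rewrite mulr_ge0 ?step_ge0//= -[1]mulr1 ler_pM ?step_ge0 ?step_le1. Qed.

Lemma itv_bump_cvg a b x : itv_bump a b n x @[n --> \oo] --> (\1_(`]a, b]%classic) x : R).
Proof.
apply: cvg_near_cst; rewrite indicE.
have [ax|xa] := ltP a x; last first.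
  near=> n; rewrite memNset /=; last by rewrite in_itv/= ltNge xa.
  rewrite /itv_bump step_le0 ?mul0r// -mulrBr mulr_ge0_le0 ?subr_le0//.
have [xb|bx] := leP x b.
  near=> n; rewrite mem_set /=; last by rewrite in_itv/= ax.
  rewrite /itv_bump !step_ge1 ?mulr1//.
    by rewrite mulNr; have := @ler_wpM2l R n%:R (ler0n _ _) _ _ xb; lra.
  rewrite -mulrBr -ler_pdivrMr ?subr_gt0// mul1r.
  by near: n; exact: nbhs_infty_ger.
near=> n; rewrite memNset /=; last by rewrite in_itv/= leNgt bx andbF.
rewrite /itv_bump [X in _ * X]step_le0 ?mulr0//.
suff : 1 <= n%:R * (x - b) by lra.
rewrite -ler_pdivrMr ?subr_gt0// mul1r.
by near: n; exact: nbhs_infty_ger.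
Unshelve. all: by end_near. Qed.

End interval_approximation.

Section test_density.
Context {R : realType} {N : nat}.
Local Notation T := (measurableTypeR R).
Local Notation mu := (@lebesgue_rV R N).

(** The sets whose indicator is a limit of smooth functions in the weighted L^1 form
    a sigma-algebra, which contains the preimages of half-open intervals under the
    coordinates; a cutoff makes the approximants compactly supported. *)
Lemma test_density (W : 'rV[R]_N -> R) (L : R) (A : set 'rV[T]_N) (e : R) :
  0 < L -> (forall x, 0 <= W x) -> mu.-integrable (box (2 * L)) (EFin \o W) ->
  measurable A -> A `<=` box L -> 0 < e ->
  exists psi, [/\ test_function setT psi, forall x, 0 <= psi x <= 1,
    forall x, ~ box (2 * L) x -> psi x = 0 &
    \int[mu]_(x in box (2 * L)) (W x * `|psi x - \1_A x|) <= e].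
Proof.
move=> L0 W0 iW mA AL e0.
pose S (f : 'rV[R]_N -> R) := smooth f /\ forall x, 0 <= f x <= 1.
have mS f : S f -> measurable_fun [set: 'rV[T]_N] f.
  by move=> [sf _]; exact: continuous_measurable_rV (smooth_continuous sf).
have mQ := @measurable_box R N (2 * L).
pose appr := @approximable _ _ _ mu (box (2 * L)) W S.
have sg (G : set (set 'rV[T]_N)) : G `<=` appr -> <<s G >> `<=` appr.
  apply: approximable_sigma => //.
  - by move=> f x [].
  - move=> f [sf f1]; split; first by apply: smoothB; [exact: smooth_cst|exact: sf].
    by move=> x; have := f1 x; lra.
  - move=> f g [sf f1] [sg g1]; split; first exact: smoothM.
    by move=> x; have := f1 x; have := g1 x; nra.
  - by split; [exact: smooth_cst|move=> x; rewrite ler01 lexx].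
have coorA (i : 'I_N) (Y : set T) : measurable Y -> appr ((fun x : 'rV[T]_N => x ord0 i) @^-1` Y).
  have pre (H : set T) : measurable H -> measurable ((fun x : 'rV[T]_N => x ord0 i) @^-1` H).
    by move=> mH; rewrite -[X in measurable X]setTI; exact: measurable_coord_rV.
  move=> mY.
  have : <<s [set ((fun x : 'rV[T]_N => x ord0 i) @^-1` Z) | Z in @ocitv R] >>
      ((fun x : 'rV[T]_N => x ord0 i) @^-1` Y).
    have := mY; rewrite /measurable /=.
    move: Y {mY}; apply: smallest_sub.
      split.
      - by rewrite preimage_set0; exact: sigma_algebra0.
      - by move=> Z HZ; rewrite setTD preimage_setC -setTD; exact: sigma_algebraCD.
      - by move=> F HF; rewrite preimage_bigcup; exact: sigma_algebra_bigcup.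
    by move=> Z oZ; apply: sub_sigma_algebra; exists Z.
  apply: sg => _ [_ [[a b] _ <-] <-] /=.
  split; first by apply: pre; exact: measurable_itv.
  move=> {}e {}e0.
  have cv : \int[mu]_(x in box (2 * L)) (W x * `|itv_bump a b n (x ord0 i) - \1_((fun x : 'rV[T]_N => x ord0 i) @^-1` `]a, b]%classic) x|) @[n --> \oo] --> (0 : R).
    have mb n : measurable_fun [set: 'rV[T]_N] (fun x : 'rV[R]_N => itv_bump a b n (x ord0 i)).
      apply: continuous_measurable_rV; apply: smooth_continuous.
      exact: (smooth_comp (itv_bump_smooth a b n) (smooth_coord i)).
    have mi : measurable_fun [set: 'rV[T]_N] (\1_((fun x : 'rV[T]_N => x ord0 i) @^-1` `]a, b]%classic) : 'rV[T]_N -> R).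
      by apply: measurable_indic; apply: pre; exact: measurable_itv.
    have [] := @Rdominated_cvg _ _ _ mu (box (2 * L)) (fun n x => W x * `|itv_bump a b n (x ord0 i) - \1_((fun x : 'rV[T]_N => x ord0 i) @^-1` `]a, b]%classic) x|) (cst 0) W mQ.
    - move=> n; apply: measurable_funM; first exact: (measurable_of_integrable iW).
      by apply: measurableT_comp => //; apply: measurable_funB; exact: measurable_funTS.
    - exact: measurable_cst.
    - apply/aeW => x _.
      rewrite -[X in _ --> X](mulr0 (W x)); apply: cvgMr; rewrite -[X in _ --> X](@normr0 _ R).
      apply: cvg_norm; rewrite -[X in _ --> X](subrr (\1_((fun x : 'rV[T]_N => x ord0 i) @^-1` `]a, b]%classic) x : R)).
      by apply: cvgB; [exact: itv_bump_cvg|exact: cvg_cst].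
    - exact: iW.
    - apply/aeW => x _ n; rewrite normrM normr_id (ger0_norm (W0 x)) ler_piMr//.
      have := itv_bump01 a b n (x ord0 i); rewrite indicE ler_norml.
      by case: (_ \in _); rewrite /=; lra.
    - by move=> _ _; rewrite Rintegral_cst// mul0r.
  have [n _ Hn] := cvgr_le _ cv _ e0.
  exists (fun x : 'rV[R]_N => itv_bump a b n (x ord0 i)); last exact: Hn (leqnn n).
  split=> [|x]; last exact: itv_bump01.
  exact: (smooth_comp (itv_bump_smooth a b n) (smooth_coord i)).
have : <<s \big[setU/set0]_(i < N) preimage_set_system [set: 'rV[T]_N]
    (fun x => x ord0 i) measurable >> `<=` appr.
  apply: sg; rewrite -bigcup_seq => _ [i _ [Y mY <-]].
  by rewrite setTI; exact: coorA.
move=> /(_ A mA)[_ /(_ _ e0)[psi [sp p1] Hp]].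
exists (fun x => psi x * cutoff L x); split.
- by under eq_fun do rewrite mulrC; apply/test_functionP; split; [apply: smoothM; [exact: cutoff_smooth|exact: sp]|exists (2 * L) => x /(cutoff0 L0) ->; rewrite mul0r].
- by move=> x; have := p1 x; have := cutoff_ge0 L x; have := cutoff_le1 L x; nra.
- by move=> x /(cutoff0 L0) ->; rewrite mulr0.
have mp : measurable_fun [set: 'rV[T]_N] psi by exact: mS.
have mc : measurable_fun [set: 'rV[T]_N] (cutoff L : 'rV[R]_N -> R).
  by apply: continuous_measurable_rV; apply: smooth_continuous; exact: cutoff_smooth.
have iB (f : 'rV[R]_N -> R) : measurable_fun [set: 'rV[T]_N] f -> (forall x, 0 <= f x <= 1) ->
    mu.-integrable (box (2 * L)) (EFin \o (fun x => W x * `|f x - \1_A x|)).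
  move=> mf f1; apply: (@integrableM_bounded _ _ _ _ _ _ _ 1) => //.
    apply: measurableT_comp => //; apply: measurable_funB; apply: measurable_funTS => //.
  move=> x _; rewrite normr_id indicE ler_norml; have := f1 x.
  by case: (_ \in _); rewrite /=; lra.
apply: le_trans Hp; apply: le_Rintegral => //.
- apply: iB; first exact: measurable_funM.
  by move=> x; have := p1 x; have := cutoff_ge0 L x; have := cutoff_le1 L x; nra.
- exact: iB.
- move=> x _; rewrite ler_wpM2l// indicE.
  have [/set_mem/AL/(cutoff1 L0) ->|_] := boolP (x \in A); first by rewrite mulr1.
  rewrite !subr0 normrM ler_piMr// ger0_norm ?cutoff_le1 ?cutoff_ge0//.
Qed.

End test_density.
(** * Averages of test functions *)

Section directional.
Context {R : realType} {N : nat}.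
Implicit Types (psi : 'rV[R]_N -> R) (x y v w : 'rV[R]_N).

Lemma smooth_deriveZ (V : normedModType R) (f : V -> R) (x w : V) (c : R) :
  smooth f -> 'D_(c *: w) f x = c * 'D_w f x.
Proof.
move=> sf.
have dF : is_derive (c * 0 : R) 1 (fun h : R => f (h *: w + x)) ('D_w f x).
  have /is_derive_line := @smooth_derivable _ _ f ((c * 0) *: w + x) w sf.
  by rewrite mulr0 scale0r add0r; exact.
have dL : is_derive (0 : R) 1 (fun h : R => c * h) c.
  have [d1 d2] := @is_deriveZ _ _ _ id c (0 : R) 1 1 (is_derive_id _ _).
  by apply: DeriveDef => //; rewrite d2 [LHS]mulr1.
have [_ ] := @is_derive1_comp _ (fun h : R => f (h *: w + x)) (fun h : R => c * h) 0 _ _ dF dL.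
rewrite [RHS]mulrC => <-; rewrite /derive.
suff -> : (fun h : R => h^-1 *: ((f \o shift x) (h *: (c *: w)) - f x)) =
  (fun h : R => h^-1 *: ((((fun h : R => f (h *: w + x)) \o (fun h : R => c * h)) \o shift 0) (h *: 1) -
     ((fun h : R => f (h *: w + x)) \o (fun h : R => c * h)) 0)) by [].
by apply/funext => h /=; rewrite /shift/= [h *: 1]mulr1 addr0 mulr0 scale0r add0r scalerA mulrC.
Qed.

Lemma row_sum_coord v : v = \sum_(i < N) v ord0 i *: delta_mx ord0 i.
Proof. by rewrite [LHS]row_sum_delta. Qed.

Lemma smooth_derive_sum psi x v : smooth psi ->
  'D_v psi x = \sum_(i < N) v ord0 i * partial i psi x.
Proof.
move=> sp; rewrite {1}(row_sum_coord v).
have H (I : Type) (s : seq I) (F : I -> 'rV[R]_N) :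
    'D_(\sum_(i <- s) F i) psi x = \sum_(i <- s) 'D_(F i) psi x.
  elim: s => [|i s IH]; first by rewrite !big_nil derive0.
  by rewrite !big_cons smooth_deriveDl// IH.
by rewrite H; apply: eq_bigr => i _; rewrite smooth_deriveZ.
Qed.

Lemma smooth_MVT (V : normedModType R) (f : V -> R) (x w : V) : smooth f ->
  exists2 th : R, 0 <= th <= 1 & f (w + x) - f x = 'D_w f (th *: w + x).
Proof.
move=> sf; pose g k := f (k *: w + x).
have dg (k : R) : is_derive k 1 g ('D_w f (k *: w + x)).
  by apply: is_derive_line; exact: smooth_derivable.
have cg : {within `[0, 1], continuous g}.
  apply: continuous_subspaceT => k; apply: differentiable_continuous.
  by apply/derivable1_diffP; case: (dg k).
have [c] := @MVT _ g _ _ _ ltr01 (fun k _ => dg k) cg.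
rewrite in_itv/= => /andP[c1 c2]; rewrite subr0 mulr1 /g scale1r scale0r add0r => E.
by exists c => //; rewrite !ltW.
Qed.

Lemma test_lipschitz psi : test_function setT psi ->
  exists2 K, 0 < K & forall x y, `|psi x - psi y| <= K * `|x - y|.
Proof.
move=> tp; have sp := test_smooth tp.
have H (i : 'I_N) : exists C, 0 < C /\ forall x, `|partial i psi x| <= C.
  by have [C C0 HC] := test_bounded (test_derive (delta_mx ord0 i) tp); exists C.
have /choice[C HC] := H.
have S0 : 0 <= \sum_(i < N) C i by apply: sumr_ge0 => i _; rewrite ltW// (HC i).1.
exists (\sum_(i < N) C i + 1) => [|x y]; first by rewrite ltr_wpDl.
have [th _] := smooth_MVT y (x - y) sp; rewrite subrK => ->.
rewrite smooth_derive_sum//; apply: le_trans (ler_norm_sum _ _ _) _.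
rewrite mulrDl mul1r; apply: (@le_trans _ _ (\sum_(i < N) C i * `|x - y|)); last first.
  by rewrite mulr_suml lerDl.
apply: ler_sum => i _; rewrite normrM mulrC; apply: ler_pM => //; first exact: (HC i).2.
exact: coord_le_norm.
Qed.

End directional.

Lemma lipschitz_continuous {R : realType} (V : normedModType R) (f : V -> R) (K : R) :
  0 < K -> (forall x y, `|f x - f y| <= K * `|x - y|) -> continuous f.
Proof.
move=> K0 HK x; apply/cvgrPdist_le => e e0; near=> y.
apply: le_trans (HK _ _) _; rewrite mulrC -ler_pdivlMr//.
by near: y; apply: cvgr_dist_le; [exact: cvg_id|exact: divr_gt0].
Unshelve. all: by end_near. Qed.

Section averaging.
Context {R : realType} {N : nat}.
Local Notation T := (measurableTypeR R).
Local Notation mu := (@lebesgue_rV R N).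
Context d (Om : measurableType d) (P : {sigma_finite_measure set Om -> \bar R}).
Variables (D : set Om) (c : Om -> R) (z : Om -> 'rV[R]_N) (r : R).
Hypothesis mD : measurable D.
Hypothesis PD : P D = 1%E.
Hypothesis mc : measurable_fun D c.
Hypothesis mz : forall i, measurable_fun setT (fun om => z om ord0 i).
Hypothesis c1 : forall om, D om -> `|c om| <= 1.
Hypothesis zr : forall om, D om -> `|z om| <= r.
Implicit Types (psi : 'rV[R]_N -> R) (x : 'rV[R]_N).

(** Translates of [psi] by the random vector [z], averaged with weight [c] over the
    probability space [D].  Both the means over cubes and the fluxes below have
    this form. *)
Definition average psi x : R := \int[P]_(om in D) (c om * psi (x - z om)).

Let msub : measurable_fun [set: 'rV[T]_N * Om] (fun p => p.1 - z p.2 : 'rV[T]_N).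
Proof.
apply: measurable_fun_rVP => i; under eq_fun do rewrite !mxE.
apply: measurable_funB; first exact: (measurableT_comp (measurable_coord_rV i) measurable_fst).
exact: (measurableT_comp (mz i) measurable_snd).
Qed.

Let msub1 x : measurable_fun setT (fun om => x - z om : 'rV[T]_N).
Proof.
apply: measurable_fun_rVP => i; under eq_fun do rewrite !mxE.
by apply: measurable_funB => //; exact: mz.
Qed.

Lemma Rintegral_prob_cst (C : R) : \int[P]_(om in D) C = C.
Proof.
rewrite Rintegral_cst// (_ : fine _ = 1) ?mulr1//.
by rewrite -[RHS]/(fine 1%E); congr fine; exact: PD.
Qed.

Let integrable_prob_cst (C : R) : P.-integrable D (EFin \o (cst C)).
Proof.
apply: measurable_bounded_integrable => //.
  by apply: (@le_lt_trans _ _ 1%E); [rewrite -PD|rewrite ltry].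
by exists `|C|; split=> // x Cx om _ /=; exact: ltW.
Qed.

Let avg_bound (F : Om -> R) (C : R) : measurable_fun D F ->
  (forall om, D om -> `|F om| <= C) ->
  P.-integrable D (EFin \o F) /\ `|\int[P]_(om in D) F om| <= C.
Proof.
move=> mF FC; have FC' : {ae P, forall om, D om -> `|F om| <= cst C om} by exact/aeW.
split; first exact: (ae_integrable_dom mD mF (integrable_prob_cst C) FC').
by rewrite -[leRHS]Rintegral_prob_cst; exact: (ae_norm_Rintegral_le mD mF (integrable_prob_cst C) FC').
Qed.

Let measurable_shift psi x : test_function setT psi ->
  measurable_fun D (fun om => c om * psi (x - z om)).
Proof.
move=> tp; apply: measurable_funM => //; apply: measurable_funTS.
apply: (measurableT_comp _ (msub1 x)).
by apply: continuous_measurable_rV; apply: smooth_continuous; case: tp.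
Qed.

Lemma integrable_shift psi x : test_function setT psi ->
  P.-integrable D (EFin \o (fun om => c om * psi (x - z om))).
Proof.
move=> tp; have [C C0 HC] := test_bounded tp.
apply: (avg_bound (measurable_shift x tp) _).1 => om Dom.
rewrite normrM; apply: (@le_trans _ _ (1 * C)); last by rewrite mul1r.
by apply: ler_pM => //; exact: c1.
Qed.

Let averageB psi phi x y : test_function setT psi -> test_function setT phi ->
  average psi x - average phi y =
  \int[P]_(om in D) (c om * (psi (x - z om) - phi (y - z om))).
Proof.
move=> tp tq; rewrite /average -RintegralB//; [|exact: integrable_shift..].
by apply: eq_Rintegral => om _; rewrite mulrBr.
Qed.

Let measurable_shiftB psi phi x y : test_function setT psi -> test_function setT phi ->
  measurable_fun D (fun om => c om * (psi (x - z om) - phi (y - z om))).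
Proof.
move=> tp tq; under eq_fun do rewrite mulrBr.
by apply: measurable_funB; exact: measurable_shift.
Qed.

Let average_lip psi : test_function setT psi ->
  exists2 K, 0 < K & forall x y, `|average psi x - average psi y| <= K * `|x - y|.
Proof.
move=> tp; have [K K0 HK] := test_lipschitz tp; exists K => // x y.
rewrite averageB//; apply: (avg_bound (measurable_shiftB x y tp tp) _).2 => om Dom.
rewrite normrM -[leRHS]mul1r; apply: ler_pM => //; first exact: c1.
by apply: le_trans (HK _ _) _; rewrite opprB addrA subrK.
Qed.

Let average_derive psi x w : test_function setT psi ->
  is_derive x w (average psi) (average ('D_w psi) x).
Proof.
move=> tp; have sp := test_smooth tp.
have tw := test_derive w tp; have [K K0 HK] := test_lipschitz tw.
have H : (fun h : R => h^-1 *: ((average psi \o shift x) (h *: w) - average psi x)) h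
    @[h --> 0^'] --> average ('D_w psi) x.
  apply/cvgrPdist_le => e e0.
  have K1 : 0 < K * `|w| + 1 by rewrite ltr_wpDl// mulr_ge0// ltW.
  near=> h.
  have h0 : h != 0 by near: h; exact: nbhs_dnbhs_neq.
  have hd : `|h| * (K * `|w| + 1) <= e.
    by rewrite -ler_pdivlMr//; near: h; apply: dnbhs0_le; exact: divr_gt0.
  rewrite /= /shift averageB// distrC.
  have mB := measurable_shiftB (h *: w + x) x tp tp.
  have mw := measurable_shift x tw.
  pose G om := h^-1 * (c om * (psi (h *: w + x - z om) - psi (x - z om))) - c om * 'D_w psi (x - z om).
  have GC om : D om -> `|G om| <= e.
    move=> Dom; rewrite /G.
    have -> : h *: w + x - z om = h *: w + (x - z om) by rewrite addrA.
    have [th /andP[th0 th1]] := smooth_MVT (x - z om) (h *: w) sp.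
    rewrite smooth_deriveZ// => ->.
    rewrite mulrCA mulKf// -mulrBr normrM; apply: le_trans hd.
    apply: (@le_trans _ _ (1 * (K * (`|h| * `|w|)))).
      apply: ler_pM => //; first exact: c1.
      apply: (le_trans (HK _ _)); apply: ler_wpM2l; first exact: ltW.
      by rewrite addrK !normrZ (ger0_norm th0); apply: ler_piMl.
    by rewrite mul1r mulrCA mulrDr mulr1 lerDl.
  have mG : measurable_fun D G by apply: measurable_funB => //; exact: measurable_funM.
  have iB : P.-integrable D (EFin \o (fun om => c om * (psi (h *: w + x - z om) - psi (x - z om)))).
    have := integrableB mD (integrable_shift (h *: w + x) tp) (integrable_shift x tp).
    by apply: eq_integrable => // om _ /=; rewrite mulrBr EFinB.
  have -> : h^-1 *: \int[P]_(om in D) (c om * (psi (h *: w + x - z om) - psi (x - z om))) -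
       average ('D_w psi) x = \int[P]_(om in D) G om.
    rewrite -[_ *: _]/(_ * _) -RintegralZl// /average -RintegralB//.
    - by have := integrableZl mD h^-1 iB; apply: eq_integrable.
    - exact: (integrable_shift x tw).
  exact: (avg_bound mG GC).2.
apply: DeriveDef; last exact/cvg_lim.
by apply/cvg_ex; exists (average ('D_w psi) x).
Unshelve. all: by end_near. Qed.

Lemma average_partial psi x w : test_function setT psi ->
  'D_w (average psi) x = average ('D_w psi) x.
Proof. by move=> tp; have [_ ->] := average_derive x w tp. Qed.

Lemma average_box0 psi L : (forall x, ~ box L x -> psi x = 0) ->
  forall x, ~ box (L + r) x -> average psi x = 0.
Proof.
move=> HL x nx; rewrite /average (@eq_Rintegral _ _ _ P D (cst 0)).
  by rewrite Rintegral_cst// mul0r.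
move=> om /set_mem Dom; rewrite HL ?mulr0// => bx; apply: nx => i.
have -> : x ord0 i = (x - z om) ord0 i + z om ord0 i by rewrite !mxE subrK.
apply: le_trans (ler_normD _ _) _; apply: lerD; first exact: bx.
by apply: le_trans (coord_le_norm _ _) _; exact: zr.
Qed.

(** Derivatives of averages are averages of derivatives. *)
Lemma average_test psi : test_function setT psi -> test_function setT (average psi).
Proof.
move=> tp; apply/test_functionP; split; last first.
  by have /test_functionP[_ [L HL]] := tp; exists (L + r); exact: average_box0.
apply: (@smooth_coind _ _ (fun f => exists psi, test_function setT psi /\ f = average psi)); last by exists psi.
move=> _ {tp}[{}psi [tp ->]]; split.
  by have [K K0 HK] := average_lip tp; exact: lipschitz_continuous HK.
move=> w; split=> [x|]; first by case: (average_derive x w tp).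
exists ('D_w psi); split; first exact: test_derive.
by apply/funext => x; rewrite average_partial.
Qed.

Local Open Scope ereal_scope.

Lemma measurable_average (G : 'rV[R]_N -> \bar R) : measurable_fun [set: 'rV[T]_N] G ->
  (forall x, 0 <= G x) ->
  measurable_fun [set: 'rV[T]_N] (fun x => \int[P]_(om in D) G (x - z om)%R).
Proof.
move=> mG G0.
pose F (p : 'rV[T]_N * Om) := G (p.1 - z p.2)%R * (\1_D p.2)%:E.
have mF : measurable_fun setT F.
  apply: emeasurable_funM; first exact: measurableT_comp.
  apply/measurable_EFinP; apply: measurableT_comp; last exact: measurable_snd.
  exact: measurable_indic.
have F0 p : 0 <= F p by rewrite mule_ge0// lee_fin.
rewrite (_ : (fun x => _) = fubini_F P F); first exact: measurable_fun_fubini_tonelli_F.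
apply/funext => x; rewrite integral_mkcond /fubini_F; apply: eq_integral => om _.
by rewrite /F/= patchE indicE; case: (om \in D); rewrite ?mule1 ?mule0.
Qed.

(** Tonelli and translation invariance. *)
Lemma integral_average (G : 'rV[R]_N -> \bar R) : measurable_fun [set: 'rV[T]_N] G ->
  (forall x, 0 <= G x) ->
  \int[mu]_x \int[P]_(om in D) G (x - z om)%R = \int[mu]_x G x.
Proof.
move=> mG G0.
pose F (p : 'rV[T]_N * Om) := G (p.1 - z p.2)%R * (\1_D p.2)%:E.
have mF : measurable_fun setT F.
  apply: emeasurable_funM; first exact: measurableT_comp.
  apply/measurable_EFinP; apply: measurableT_comp; last exact: measurable_snd.
  exact: measurable_indic.
have F0 p : 0 <= F p by rewrite mule_ge0// lee_fin.
transitivity (\int[mu]_x \int[P]_om F (x, om)).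
  apply: eq_integral => x _; rewrite integral_mkcond; apply: eq_integral => om _.
  by rewrite /F/= patchE indicE; case: (om \in D); rewrite ?mule1 ?mule0.
rewrite -[LHS](@fubini_tonelli1 _ _ _ _ _ mu P F mF F0) (@fubini_tonelli2 _ _ _ _ _ mu P F mF F0).
transitivity (\int[P]_om ((\int[mu]_x G x) * (\1_D om)%:E)).
  apply: eq_integral => om _; rewrite /fubini_G /F /=.
  rewrite ge0_integralZr//; last first.
    apply: (measurableT_comp mG); apply: measurable_fun_rVP => i.
    by under eq_fun do rewrite !mxE; apply: measurable_funB => //; exact: measurable_coord_rV.
  congr (_ * _); have := @ge0_integral_affine_rV R N 1%R (- z om)%R G.
  rewrite oner_neq0 normr1 expr1n invr1 mul1e => <- //.
  by apply: eq_integral => x _; rewrite scale1r.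
rewrite ge0_integralZl//; last 2 first.
- by apply/measurable_EFinP; exact: measurable_indic.
- exact: integral_ge0.
have E : \int[P]_x (\1_D x)%:E = 1 by rewrite integral_indic// setIT; exact: PD.
by rewrite E mule1.
Qed.

Let mshift_fun psi x : test_function setT psi ->
  measurable_fun D (fun om => psi (x - z om)%R).
Proof.
move=> tp; apply: measurable_funTS; apply: (measurableT_comp _ (msub1 x)).
by apply: continuous_measurable_rV; apply: smooth_continuous; case: tp.
Qed.

Let integrable_abs psi x : test_function setT psi ->
  P.-integrable D (EFin \o (fun om => `|psi (x - z om)%R|%R)).
Proof.
move=> tp; have [C C0 HC] := test_bounded tp.
apply: (avg_bound (C := C) _ _).1; first exact: measurableT_comp (mshift_fun x tp).
by move=> om _; rewrite normr_id.
Qed.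

Let integrable_sqr psi x : test_function setT psi ->
  P.-integrable D (EFin \o (fun om => psi (x - z om)%R ^+ 2)%R).
Proof.
move=> tp; have [C C0 HC] := test_bounded tp.
apply: (avg_bound (C := (C ^+ 2)%R) _ _).1; first exact: measurable_funX (mshift_fun x tp).
by move=> om _; rewrite normrX; apply: lerXn2r; rewrite ?nnegrE//; exact: ltW.
Qed.

Lemma average_norm_le psi x : test_function setT psi ->
  `|(average psi x)%:E| <= \int[P]_(om in D) `|psi (x - z om)%R|%:E.
Proof.
move=> tp; have ia := integrable_abs x tp.
rewrite -[leRHS]fineK ?(integrable_fin_num mD ia)//= lee_fin.
apply: (ae_norm_Rintegral_le mD (measurable_shift x tp) ia).
by apply/aeW => om Dom; rewrite normrM; apply: ler_piMl => //; exact: c1.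
Qed.

(** Jensen: the weighted variance is nonnegative. *)
Lemma average_sqr_le psi x : test_function setT psi ->
  ((average psi x) ^+ 2)%:E <= \int[P]_(om in D) (psi (x - z om)%R ^+ 2)%:E.
Proof.
move=> tp; have iq := integrable_sqr x tp.
rewrite -[leRHS]fineK ?(integrable_fin_num mD iq)//= lee_fin.
set m := average psi x; rewrite -subr_ge0.
have H : (0 <= \int[P]_(om in D) (psi (x - z om) ^+ 2 + m ^+ 2 - 2 * m * (c om * psi (x - z om))))%R.
  apply: Rintegral_ge0 => om Dom; have := c1 Dom; set a := c om; set b := psi _.
  move=> a1; have a2 : (a ^+ 2 <= 1)%R.
    by rewrite -[leRHS](expr1n _ 2) -real_normK ?num_real// lerXn2r ?nnegrE.
  have : (0 <= (m - a * b) ^+ 2)%R by exact: sqr_ge0.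
  have : (0 <= (1 - a ^+ 2) * b ^+ 2)%R by rewrite mulr_ge0 ?sqr_ge0 ?subr_ge0.
  nra.
move: H; rewrite RintegralB//; last 2 first.
- by have := integrableD mD iq (integrable_prob_cst (m ^+ 2)%R); apply: eq_integrable.
- by have := integrableZl mD (2 * m)%R (integrable_shift x tp); apply: eq_integrable.
rewrite RintegralD//; last exact: integrable_prob_cst.
rewrite RintegralZl//; last exact: integrable_shift.
rewrite Rintegral_prob_cst -/(average psi x) -/m; rewrite /Rintegral; lra.
Qed.

Lemma average_L1 psi : test_function setT psi ->
  \int[mu]_x `|(average psi x)%:E| <= \int[mu]_x `|psi x|%:E.
Proof.
move=> tp.
have mp : measurable_fun [set: 'rV[T]_N] psi.
  by apply: continuous_measurable_rV; apply: smooth_continuous; case: tp.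
have ma : measurable_fun [set: 'rV[T]_N] (average psi).
  by apply: continuous_measurable_rV; apply: smooth_continuous; case: (average_test tp).
have mG : measurable_fun [set: 'rV[T]_N] (fun x => `|psi x|%:E).
  by apply/measurable_EFinP; exact: measurableT_comp.
rewrite -(integral_average mG)//; apply: ge0_le_integral => //.
- by apply/measurable_EFinP; exact: measurableT_comp.
- exact: (measurable_average mG).
- by move=> x _; exact: average_norm_le.
Qed.

Lemma average_L2 psi : test_function setT psi ->
  \int[mu]_x ((average psi x) ^+ 2)%:E <= \int[mu]_x (psi x ^+ 2)%:E.
Proof.
move=> tp.
have mp : measurable_fun [set: 'rV[T]_N] psi.
  by apply: continuous_measurable_rV; apply: smooth_continuous; case: tp.
have ma : measurable_fun [set: 'rV[T]_N] (average psi).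
  by apply: continuous_measurable_rV; apply: smooth_continuous; case: (average_test tp).
have mG : measurable_fun [set: 'rV[T]_N] (fun x => (psi x ^+ 2)%:E).
  by apply/measurable_EFinP; exact: measurable_funX.
have G0 x : 0 <= (psi x ^+ 2)%:E by rewrite lee_fin sqr_ge0.
rewrite -(integral_average mG)//; apply: ge0_le_integral => //.
- by move=> x _; rewrite lee_fin sqr_ge0.
- by apply/measurable_EFinP; exact: measurable_funX.
- exact: (measurable_average mG G0).
- by move=> x _; exact: average_sqr_le.
Qed.

End averaging.
(** * A weak Sobolev inequality *)

Section finite_sums.
Context d (X : measurableType d) (R : realType) (mu : {measure set X -> \bar R}).

Lemma Rintegral_sum (D : set X) (I : Type) (s : seq I) (F : I -> X -> R) :
  measurable D -> (forall i, mu.-integrable D (EFin \o F i)) ->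
  mu.-integrable D (EFin \o (fun x => \sum_(i <- s) F i x)) /\
  \int[mu]_(x in D) (\sum_(i <- s) F i x) = \sum_(i <- s) \int[mu]_(x in D) F i x.
Proof.
move=> mD iF; elim: s => [|i s [IH1 IH2]].
  split.
    rewrite (_ : EFin \o _ = cst 0%E); first exact: integrable0.
    by apply/funext => x; rewrite /= big_nil.
  rewrite big_nil; under eq_Rintegral do rewrite big_nil.
  by rewrite Rintegral_cst// mul0r.
have E : EFin \o (fun x => \sum_(j <- i :: s) F j x) =
    (EFin \o F i) \+ (EFin \o (fun x => \sum_(j <- s) F j x)).
  by apply/funext => x; rewrite /= big_cons.
split; first by rewrite E; exact: integrableD.
by rewrite big_cons -IH2 -RintegralD//; apply: eq_Rintegral => x _; rewrite big_cons.
Qed.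

End finite_sums.

Section cauchy_schwarz.
Context d (X : measurableType d) (R : realType) (mu : {measure set X -> \bar R}).

Lemma Rintegral_CS (f g : X -> R) (a b : R) : 0 < a -> 0 < b ->
  measurable_fun setT f -> measurable_fun setT g ->
  (\int[mu]_x (f x ^+ 2)%:E <= (a ^+ 2)%:E)%E ->
  (\int[mu]_x (g x ^+ 2)%:E <= (b ^+ 2)%:E)%E ->
  mu.-integrable setT (EFin \o (fun x => f x * g x)) /\
  `|\int[mu]_x (f x * g x)| <= a * b.
Proof.
move=> a0 b0 mf mg fa gb.
have sqr_int (h : X -> R) (e : R) : measurable_fun setT h ->
    (\int[mu]_x (h x ^+ 2)%:E <= (e ^+ 2)%:E)%E ->
    mu.-integrable setT (EFin \o (fun x => h x ^+ 2)) /\ \int[mu]_x (h x ^+ 2) <= e ^+ 2.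
  move=> mh he; have ih : mu.-integrable setT (EFin \o (fun x => h x ^+ 2)).
    apply/integrableP; split; first by apply/measurable_EFinP; exact: measurable_funX.
    under eq_integral do rewrite /= ger0_norm ?sqr_ge0//.
    exact: le_lt_trans he (ltry _).
  by split=> //; rewrite -lee_fin /Rintegral fineK// integrable_fin_num.
have [i_f fa'] := sqr_int f a mf fa; have [ig gb'] := sqr_int g b mg gb.
have k0 : 0 < b / (2 * a) by rewrite divr_gt0// mulr_gt0.
have l0 : 0 < a / (2 * b) by rewrite divr_gt0// mulr_gt0.
pose H x := b / (2 * a) * f x ^+ 2 + a / (2 * b) * g x ^+ 2.
have i1 : mu.-integrable setT (EFin \o (fun x => b / (2 * a) * f x ^+ 2)).
  by have := integrableZl measurableT (b / (2 * a)) i_f; apply: eq_integrable.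
have i2 : mu.-integrable setT (EFin \o (fun x => a / (2 * b) * g x ^+ 2)).
  by have := integrableZl measurableT (a / (2 * b)) ig; apply: eq_integrable.
have iH : mu.-integrable setT (EFin \o H).
  by have := integrableD measurableT i1 i2; apply: eq_integrable.
have dom : {ae mu, forall x, setT x -> `|f x * g x| <= H x}.
  apply/aeW => x _; rewrite normrM /H -[f x ^+ 2]real_normK ?num_real//.
  rewrite -[g x ^+ 2]real_normK ?num_real//.
  set u := `|f x|; set v := `|g x|.
  have H0 : 0 <= (b * u - a * v) ^+ 2 / (2 * a * b).
    by rewrite divr_ge0 ?sqr_ge0// ltW// !mulr_gt0.
  rewrite -subr_ge0 (_ : _ - _ = (b * u - a * v) ^+ 2 / (2 * a * b))//.
  by field; rewrite !gt_eqF.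
have mfg : measurable_fun setT (fun x => f x * g x) by exact: measurable_funM.
split; first exact: (ae_integrable_dom measurableT mfg iH dom).
apply: le_trans (ae_norm_Rintegral_le measurableT mfg iH dom) _.
rewrite /H RintegralD// !RintegralZl//.
apply: (@le_trans _ _ (b / (2 * a) * a ^+ 2 + a / (2 * b) * b ^+ 2)).
  by rewrite lerD// ler_wpM2l// ltW.
rewrite le_eqVlt; apply/orP; left; apply/eqP; field; rewrite !gt_eqF//.
Qed.

End cauchy_schwarz.

Section test_integrals.
Context {R : realType} {N : nat}.
Local Notation T := (measurableTypeR R).
Local Notation mu := (@lebesgue_rV R N).
Implicit Types (psi w : 'rV[R]_N -> R).

Lemma test_measurable psi : test_function setT psi -> measurable_fun [set: 'rV[T]_N] psi.
Proof. by case=> sp _ _; apply: continuous_measurable_rV; exact: smooth_continuous. Qed.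

Lemma integrable_vanish (L : R) (f : 'rV[R]_N -> R) : (forall x, ~ box L x -> f x = 0) ->
  mu.-integrable (box L) (EFin \o f) -> mu.-integrable setT (EFin \o f).
Proof.
move=> f0; rewrite (integrable_mkcond _ (@measurable_box R N L)).
apply: eq_integrable => // x _; rewrite patchE; case: ifPn => //.
by rewrite notin_setE => /f0 /= ->.
Qed.

Lemma test_mul_integrable w psi : (forall L, mu.-integrable (box L) (EFin \o w)) ->
  test_function setT psi -> mu.-integrable setT (EFin \o (fun x => w x * psi x)).
Proof.
move=> iw tp; have [C C0 HC] := test_bounded tp.
have /test_functionP[_ [L HL]] := tp.
apply: (@integrable_vanish L); first by move=> x /HL ->; rewrite mulr0.
apply: (integrableM_bounded (C := C) (@measurable_box R N L) (iw L)) => //.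
by apply: measurable_funTS; exact: test_measurable.
Qed.

Lemma test_integrable psi : test_function setT psi -> mu.-integrable setT (EFin \o psi).
Proof.
move=> tp; have := @test_mul_integrable (fun=> 1) psi; rewrite /=.
under [in X in _ -> _ -> X]eq_fun do rewrite mul1r.
apply=> // L; apply: measurable_bounded_integrable => //; first exact: measurable_box.
- exact: box_volume_lty.
- by exists 1; split=> // x x1 y _; rewrite /= normr1 ltW.
Qed.

End test_integrals.

Section space_line.
Context {R : realType} (N : nat).
Local Notation T := (measurableTypeR R).

Definition space_line : set ('rV[T]_N * T)%type -> \bar R :=
  (@lebesgue_rV R N \x @lebesgue_measure R)%E.

Let space_line0 : space_line set0 = 0%E.
Proof. exact: measure0. Qed.

Let space_line_ge0 A : (0 <= space_line A)%E.
Proof. exact: measure_ge0. Qed.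

Let space_line_sigma_additive : semi_sigma_additive space_line.
Proof. exact: measure_semi_sigma_additive. Qed.

HB.instance Definition _ := isMeasure.Build _ _ _ space_line
  space_line0 space_line_ge0 space_line_sigma_additive.

HB.instance Definition _ := Measure_isSigmaFinite.Build _ _ _ space_line
  (@sigma_finite_prod _ _ _ _ R (@lebesgue_rV R N) (@lebesgue_measure R)).

End space_line.

Section cube_average.
Context {R : realType} {N : nat}.
Local Notation T := (measurableTypeR R).
Local Notation mu := (@lebesgue_rV R N).
Local Notation leb := (@lebesgue_measure R).
Implicit Types (psi : 'rV[R]_N -> R) (x : 'rV[R]_N) (r : R).

Local Notation P := (@space_line R N).

Definition cube_itv : set ('rV[T]_N * T) := box 2^-1 `*` `[0, 1]%classic.

Let measurable_cube : measurable cube_itv.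
Proof. by apply: measurableX; [exact: measurable_box|exact: measurable_itv]. Qed.

Let P1 : P cube_itv = 1%E.
Proof.
rewrite /cube_itv /space_line product_measure1E//; [|exact: measurable_box].
transitivity ((1 : \bar R) * 1)%E; last by rewrite mule1.
congr (_ * _)%E; last first.
  by have := @lebesgue_measure_itv R `[0, 1]; rewrite /= lte_fin ltr01 sube0; exact.
by have := @box_volume R N 2^-1; rewrite invr_ge0 ler0n divff// expr1n; exact.
Qed.

(** [cube_mean r psi x] is the mean of [psi] over the cube of centre [x] and
    side [r].  It is taken over [cube_itv], so that [cube_flux], in which the second
    variable runs along segments, is an average over the same space. *)
Definition cube_mean r psi : 'rV[R]_N -> R :=
  average P cube_itv (fun=> 1) (fun om => r *: om.1) psi.

Definition cube_flux r (j : 'I_N) psi : 'rV[R]_N -> R :=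
  average P cube_itv (fun om => om.1 ord0 j) (fun om => (r * om.2) *: om.1) psi.

Let cube_norm (om : 'rV[T]_N * T) : cube_itv om -> `|om.1| <= 1 /\ 0 <= om.2 <= 1.
Proof.
case: om => s t [/= bs]; rewrite in_itv/= => t01; split=> //.
apply: norm_le_coord => // i; apply: (le_trans (bs i)).
by rewrite invf_le1 ?ler1n.
Qed.

Let mz1 r i : measurable_fun setT (fun om : 'rV[T]_N * T => (r *: om.1) ord0 i).
Proof.
under eq_fun do rewrite mxE; apply: measurable_funM => //.
exact: (measurableT_comp (measurable_coord_rV i) measurable_fst).
Qed.

Let mz2 r i : measurable_fun setT (fun om : 'rV[T]_N * T => ((r * om.2) *: om.1) ord0 i).
Proof.
under eq_fun do rewrite mxE; apply: measurable_funM.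
  by apply: measurable_funM => //; exact: measurable_snd.
exact: (measurableT_comp (measurable_coord_rV i) measurable_fst).
Qed.

Let mc2 j : measurable_fun cube_itv (fun om : 'rV[T]_N * T => om.1 ord0 j).
Proof.
apply: measurable_funTS.
exact: (measurableT_comp (measurable_coord_rV j) measurable_fst).
Qed.

Let zr1 r (om : 'rV[T]_N * T) : 0 < r -> cube_itv om -> `|r *: om.1| <= r.
Proof.
move=> r0 /cube_norm[s1 _]; rewrite normrZ (gtr0_norm r0) -[leRHS]mulr1.
by rewrite ler_wpM2l// ltW.
Qed.

Let zr2 r (om : 'rV[T]_N * T) : 0 < r -> cube_itv om -> `|(r * om.2) *: om.1| <= r.
Proof.
move=> r0 /cube_norm[s1 /andP[t0 t1]]; rewrite normrZ normrM (gtr0_norm r0) (ger0_norm t0).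
by rewrite -mulrA -[leRHS]mulr1 ler_wpM2l ?(ltW r0)// mulr_ile1.
Qed.

Let c1 (om : 'rV[T]_N * T) : cube_itv om -> `|1 : R| <= 1.
Proof. by rewrite normr1. Qed.

Let c2 j (om : 'rV[T]_N * T) : cube_itv om -> `|om.1 ord0 j| <= 1.
Proof. by move=> /cube_norm[s1 _]; exact: le_trans (coord_le_norm _ _) s1. Qed.

Let mc1 : measurable_fun cube_itv (fun=> 1 : R).
Proof. exact: measurable_cst. Qed.

Lemma cube_mean_test r psi : 0 < r -> test_function setT psi ->
  test_function setT (cube_mean r psi).
Proof. by move=> r0; exact: (average_test measurable_cube P1 mc1 (mz1 r) c1 (fun om => @zr1 r om r0)). Qed.

Lemma cube_flux_test r j psi : 0 < r -> test_function setT psi ->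
  test_function setT (cube_flux r j psi).
Proof. by move=> r0; exact: (average_test measurable_cube P1 (mc2 j) (mz2 r) (c2 j) (fun om => @zr2 r om r0)). Qed.

Lemma cube_mean_L1 r psi : 0 < r -> test_function setT psi ->
  (\int[mu]_x `|cube_mean r psi x|%:E <= \int[mu]_x `|psi x|%:E)%E.
Proof. by move=> r0; exact: (average_L1 measurable_cube P1 mc1 (mz1 r) c1 (fun om => @zr1 r om r0)). Qed.

Lemma cube_flux_L2 r j psi : 0 < r -> test_function setT psi ->
  (\int[mu]_x ((cube_flux r j psi x) ^+ 2)%:E <= \int[mu]_x (psi x ^+ 2)%:E)%E.
Proof. by move=> r0; exact: (average_L2 measurable_cube P1 (mc2 j) (mz2 r) (c2 j) (fun om => @zr2 r om r0)). Qed.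

(** The cube of side [r] has volume [r ^ N]. *)
Lemma cube_mean_sup r psi x : 0 < r -> test_function setT psi ->
  (`|cube_mean r psi x|%:E <= ((r ^+ N)^-1)%:E * \int[mu]_x `|psi x|%:E)%E.
Proof.
move=> r0 tp.
apply: (le_trans (average_norm_le measurable_cube P1 mc1 (mz1 r) c1 x tp)).
pose h (s : 'rV[R]_N) := (`|psi ((- r) *: s + x)|%:E)%E.
have mh : measurable_fun [set: 'rV[T]_N] h.
  apply/measurable_EFinP; apply: measurableT_comp => //.
  apply: (measurableT_comp (test_measurable tp)).
  apply: measurable_fun_rVP => i; under eq_fun do rewrite !mxE.
  exact: (measurableT_comp (measurable_affine (- r) (x ord0 i)) (measurable_coord_rV i)).
pose F (om : 'rV[T]_N * T) := (h om.1 * (\1_(`[0, 1]%classic) om.2)%:E)%E.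
have mF : measurable_fun setT F.
  apply: emeasurable_funM; first exact: (measurableT_comp mh measurable_fst).
  apply/measurable_EFinP; apply: (measurableT_comp _ measurable_snd).
  by apply: measurable_indic; exact: measurable_itv.
have F0 om : (0 <= F om)%E by rewrite mule_ge0// lee_fin.
have -> : (((r ^+ N)^-1)%:E * \int[mu]_x `|psi x|%:E = \int[P]_om F om)%E.
  rewrite (@fubini_tonelli1 _ _ _ _ _ mu leb F mF F0).
  transitivity (\int[mu]_s h s)%E.
    have := @ge0_integral_affine_rV R N (- r) x (fun y => `|psi y|%:E)%E.
    rewrite normrN (gtr0_norm r0) oppr_eq0 gt_eqF// => -> //.
    by apply/measurable_EFinP; apply: measurableT_comp => //; exact: test_measurable.
  apply: eq_integral => s _; rewrite /fubini_F /F /= ge0_integralZl//; last first.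
    by rewrite /h lee_fin.
    by apply/measurable_EFinP; exact: measurable_indic.
  rewrite integral_indic// setIT.
  have := @lebesgue_measure_itv R `[0, 1]; rewrite /= lte_fin ltr01 sube0 => ->.
  by rewrite mule1.
rewrite integral_mkcond; apply: ge0_le_integral => //.
- by move=> om _; rewrite patchE; case: ifP.
- have mh' : measurable_fun cube_itv (fun om : 'rV[T]_N * T => `|psi (x - r *: om.1)|%:E).
    apply: (@eq_measurable_fun _ _ _ _ cube_itv (fun om : 'rV[T]_N * T => h om.1)).
      by move=> om _; rewrite /h scaleNr addrC.
    by apply: measurable_funTS; exact: (measurableT_comp mh measurable_fst).
  exact: (measurable_restrictT _ measurable_cube).1 mh'.
- move=> om _; rewrite patchE; case: ifPn => [/set_mem[_ t01]|_]; last exact: F0.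
  by rewrite /F indicE mem_set// mule1 /h scaleNr addrC.
Qed.

(** [psi] differs from its means by the divergence of [r cube_flux]: the
    difference [psi x - psi (x - r s)] is the integral of a derivative of [psi]
    along the segment between both points. *)
Lemma cube_mean_flux r psi x : 0 < r -> test_function setT psi ->
  psi x - cube_mean r psi x = r * \sum_(j < N) partial j (cube_flux r j psi) x.
Proof.
move=> r0 tp; have sp := test_smooth tp.
pose gj (j : 'I_N) (om : 'rV[R]_N * R) : R :=
  om.1 ord0 j * partial j psi (x - (r * om.2) *: om.1).
pose g (om : 'rV[R]_N * R) : R := r * \sum_(j < N) gj j om.
pose f (om : 'rV[R]_N * R) : R := psi x - 1 * psi (x - r *: om.1).
have i_f0 : P.-integrable cube_itv (EFin \o (fun om : 'rV[R]_N * R => 1 * psi (x - r *: om.1))).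
  exact: (integrable_shift measurable_cube P1 mc1 (mz1 r) c1 x tp).
have icst : P.-integrable cube_itv (EFin \o (cst (psi x))).
  apply: measurable_bounded_integrable => //; first by apply: le_lt_trans (ltry 1); rewrite le_eqVlt; apply/orP; left; apply/eqP; exact: P1.
  by exists `|psi x|; split; rewrite ?num_real// => M /ltW xM om _.
have i_f : P.-integrable cube_itv (EFin \o f).
  by have := integrableB measurable_cube icst i_f0; apply: eq_integrable.
have igj j : P.-integrable cube_itv (EFin \o gj j).
  exact: (integrable_shift measurable_cube P1 (mc2 j) (mz2 r) (c2 j) x (test_derive _ tp)).
have iS := (Rintegral_sum (index_enum 'I_N) measurable_cube igj).1.
have ig : P.-integrable cube_itv (EFin \o g).
  by have := integrableZl measurable_cube r iS; apply: eq_integrable.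
have -> : r * \sum_(j < N) partial j (cube_flux r j psi) x = \int[P]_(om in cube_itv) g om.
  rewrite /g RintegralZl//; congr (_ * _).
  transitivity (\sum_(j < N) \int[P]_(om in cube_itv) gj j om).
    apply: eq_bigr => j _.
    by have := average_partial measurable_cube P1 (mc2 j) (mz2 r) (c2 j) x (delta_mx ord0 j) tp; rewrite /partial /cube_flux => ->.
  by rewrite (Rintegral_sum (index_enum 'I_N) measurable_cube igj).2.
have -> : psi x - cube_mean r psi x = \int[P]_(om in cube_itv) f om.
  by rewrite /f RintegralB// (Rintegral_prob_cst measurable_cube P1).
rewrite /Rintegral; congr fine; rewrite integral_mkcond [RHS]integral_mkcond.
have iD (h : 'rV[R]_N * R -> R) : P.-integrable cube_itv (EFin \o h) ->
    P.-integrable setT ((EFin \o h) \_ cube_itv).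
  by move=> ih; rewrite -integrable_mkcond.
transitivity (\int[mu]_s \int[leb]_t ((EFin \o f) \_ cube_itv) (s, t))%E.
  by rewrite (@integral12_prod_meas1 _ _ _ _ _ mu leb _ (iD _ i_f)).
transitivity (\int[mu]_s \int[leb]_t ((EFin \o g) \_ cube_itv) (s, t))%E; last first.
  by rewrite (@integral12_prod_meas1 _ _ _ _ _ mu leb _ (iD _ ig)).
apply: eq_integral => s _.
have [sb|nsb] := pselect (box 2^-1 s); last first.
  have out (h : 'rV[R]_N * R -> R) t : ((EFin \o h) \_ cube_itv) (s, t) = 0%E.
    by rewrite patchE memNset// => -[/= /nsb].
  by under eq_integral do rewrite out; under [in RHS]eq_integral do rewrite out.
have inn (h : 'rV[R]_N * R -> R) : (\int[leb]_t ((EFin \o h) \_ cube_itv) (s, t) =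
    \int[leb]_(t in `[0%R, 1%R]) (h (s, t))%:E)%E.
  rewrite [RHS]integral_mkcond; apply: eq_integral => t _; rewrite !patchE.
  have [tI|tI] := pselect (`[0, 1]%classic t); first by rewrite !mem_set.
  by rewrite !memNset// => -[].
rewrite !inn; pose w : 'rV[R]_N := - (r *: s).
transitivity (psi x - psi (w + x))%:E.
  under eq_integral do rewrite /f /= mul1r (addrC x) -/w.
  rewrite integral_cst//= -[RHS]mule1; congr (_ * _)%E.
  by have := @lebesgue_measure_itv R `[0, 1]; rewrite /= lte_fin ltr01 sube0.
transitivity (\int[leb]_(t in `[0%R, 1%R]) (- 'D_w psi (t *: w + x))%:E)%E; last first.
  apply: eq_integral => t _; rewrite /g /gj /= smooth_derive_sum// mulr_sumr -sumrN.
  congr EFin; apply: eq_bigr => j _; rewrite !mxE mulNr opprK mulrA.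
  by congr (_ * partial j psi _); rewrite /w scalerN scalerA addrC (mulrC t).
have dF (t : R) : is_derive t 1 (fun t => - psi (t *: w + x)) (- 'D_w psi (t *: w + x)).
  by apply: is_deriveN; apply: is_derive_line; exact: smooth_derivable.
have cF : continuous (fun t : R => - psi (t *: w + x)).
  by move=> t; apply: differentiable_continuous; apply/derivable1_diffP; case: (dF t).
have cD : continuous (fun t : R => - 'D_w psi (t *: w + x)).
  move=> t; apply: differentiable_continuous; apply/derivable1_diffP.
  have dG : is_derive t 1 (fun t => - 'D_w psi (t *: w + x)) (- 'D_w ('D_w psi) (t *: w + x)).
    apply: is_deriveN; apply: is_derive_line; apply: smooth_derivable.
    exact: smooth_derive.
  by case: dG.
rewrite (@continuous_FTC2 _ _ (fun t : R => - psi (t *: w + x))) //.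
- by rewrite scale0r scale1r add0r -EFinB; congr EFin; rewrite opprK addrC.
- exact: continuous_subspaceT cD.
- split.
  + by move=> t _; case: (dF t).
  + exact: cvg_at_right_filter (cF _).
  + exact: cvg_at_left_filter (cF _).
- by move=> t _; rewrite derive1E; case: (dF t).
Qed.

End cube_average.
Section dual_sobolev.
Context {R : realType} {N : nat}.
Local Notation T := (measurableTypeR R).
Local Notation mu := (@lebesgue_rV R N).
Implicit Types psi : 'rV[R]_N -> R.
Variables (w : 'rV[R]_N -> R) (dw : 'I_N -> 'rV[R]_N -> R) (delta p : R).
Hypothesis N3 : (3 <= N)%N.
Hypothesis delta0 : 0 < delta.
Hypothesis p1 : 1 < p.
Hypothesis iw : forall L, mu.-integrable (box L) (EFin \o w).
Hypothesis mdw : forall j, measurable_fun [set: 'rV[T]_N] (dw j).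
Hypothesis dw2 : forall j, (\int[mu]_x (dw j x ^+ 2)%:E <= (delta ^+ 2)%:E)%E.
Hypothesis wdw : forall psi, test_function setT psi -> forall j,
  \int[mu]_x (w x * partial j psi x) = - \int[mu]_x (dw j x * psi x).
Hypothesis wp : mu.-integrable setT (EFin \o (fun x => `|w x| `^ p)).

Let iwM psi : test_function setT psi ->
  mu.-integrable setT (EFin \o (fun x => w x * psi x)).
Proof. exact: test_mul_integrable. Qed.

(** Replacing [psi] by its means at scale [r] costs [r] times the gradient of
    [w] tested against a flux no larger than [psi]. *)
Lemma pairing_cube_mean psi r b : test_function setT psi -> 0 < r -> 0 < b ->
  (\int[mu]_x (psi x ^+ 2)%:E <= (b ^+ 2)%:E)%E ->
  `|\int[mu]_x (w x * psi x) - \int[mu]_x (w x * cube_mean r psi x)|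
    <= r * (N%:R * (delta * b)).
Proof.
move=> tp r0 b0 pb.
have tm := cube_mean_test r0 tp.
rewrite -RintegralB//; [|exact: iwM..].
have ij j : mu.-integrable setT (EFin \o (fun x => w x * partial j (cube_flux r j psi) x)).
  by apply: iwM; apply: test_derive; exact: cube_flux_test.
have -> : \int[mu]_x (w x * psi x - w x * cube_mean r psi x) =
    r * \sum_(j < N) \int[mu]_x (w x * partial j (cube_flux r j psi) x).
  rewrite -(Rintegral_sum (index_enum 'I_N) measurableT ij).2.
  rewrite -RintegralZl//; last exact: (Rintegral_sum (index_enum 'I_N) measurableT ij).1.
  apply: eq_Rintegral => x _; rewrite -mulrBr cube_mean_flux//.
  by rewrite mulrCA mulr_sumr.
rewrite normrM (gtr0_norm r0) ler_wpM2l ?(ltW r0)//.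
apply: (le_trans (ler_norm_sum _ _ _)).
apply: (@le_trans _ _ (\sum_(j < N) delta * b)); last first.
  by rewrite sumr_const card_ord mulr_natl.
apply: ler_sum => j _; rewrite wdw ?normrN; last exact: cube_flux_test.
have tf := @cube_flux_test R N r j psi r0 tp.
apply: (Rintegral_CS delta0 b0 (@mdw j) (test_measurable tf) (dw2 j) _).2.
exact: le_trans (cube_flux_L2 j r0 tp) pb.
Qed.

(** Means of means, at the scales 1, 2, 4, ... *)
Fixpoint dyadic_mean psi (n : nat) : 'rV[R]_N -> R :=
  if n is k.+1 then cube_mean (2 ^+ k) (dyadic_mean psi k) else psi.

Let pow0 k : 0 < 2 ^+ k :> R. Proof. exact: exprn_gt0. Qed.

Lemma dyadic_mean_test psi n : test_function setT psi ->
  test_function setT (dyadic_mean psi n).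
Proof. by move=> tp; elim: n => //= n IH; exact: cube_mean_test. Qed.

Lemma dyadic_mean_L1 psi n : test_function setT psi ->
  (\int[mu]_x `|dyadic_mean psi n x|%:E <= \int[mu]_x `|psi x|%:E)%E.
Proof.
move=> tp; elim: n => //= n IH; apply: le_trans IH.
by apply: cube_mean_L1 => //; exact: dyadic_mean_test.
Qed.

(** 9 / 64 is the square of 3 / 8, a rational number between 2 ^ (- 3 / 2) and 1 / 2. *)
Let pow_bound k : ((2 ^+ k) ^+ N)^-1 <= (9 / 64) ^+ k :> R.
Proof.
apply: (@le_trans _ _ (8^-1 ^+ k)); last first.
  by apply: lerXn2r; rewrite ?nnegrE//; lra.
rewrite -exprVn -exprVn -exprM mulnC exprM.
have -> : 8^-1 = (2^-1 : R) ^+ 3 by rewrite exprVn; congr (_^-1); rewrite -natrX.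
apply: lerXn2r; rewrite ?nnegrE ?exprn_ge0//.
by apply: ler_wiXn2l => //; lra.
Qed.

Lemma dyadic_mean_sup psi n x a1 : test_function setT psi ->
  (\int[mu]_x `|psi x|%:E <= a1%:E)%E ->
  `|dyadic_mean psi n.+1 x| <= (9 / 64) ^+ n * a1.
Proof.
move=> tp pa; have tq := dyadic_mean_test n tp.
have a0 : 0 <= a1 by rewrite -lee_fin; apply: le_trans pa; apply: integral_ge0 => y _; rewrite lee_fin.
rewrite -lee_fin; apply: (le_trans (cube_mean_sup x (pow0 n) tq)).
apply: (@le_trans _ _ ((((2 ^+ n) ^+ N)^-1)%:E * a1%:E)%E).
  rewrite lee_wpmul2l ?lee_fin ?invr_ge0 ?exprn_ge0//.
  exact: le_trans (dyadic_mean_L1 n tp) pa.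
by rewrite -EFinM lee_fin ler_wpM2r.
Qed.

Lemma dyadic_mean_L2 psi n a1 : test_function setT psi ->
  (\int[mu]_x `|psi x|%:E <= a1%:E)%E ->
  (\int[mu]_x (dyadic_mean psi n.+1 x ^+ 2)%:E <= (((3 / 8) ^+ n * a1) ^+ 2)%:E)%E.
Proof.
move=> tp pa; have tq := dyadic_mean_test n.+1 tp.
have a0 : 0 <= a1 by rewrite -lee_fin; apply: le_trans pa; apply: integral_ge0 => y _; rewrite lee_fin.
have q0 : 0 <= (9 / 64) ^+ n * a1 by rewrite mulr_ge0 ?exprn_ge0.
have mq := test_measurable tq.
apply: (@le_trans _ _ (\int[mu]_x (((9 / 64) ^+ n * a1)%:E * `|dyadic_mean psi n.+1 x|%:E))%E).
  apply: ge0_le_integral => //.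
  - by move=> x _; rewrite lee_fin sqr_ge0.
  - by apply/measurable_EFinP; exact: measurable_funX.
  - under eq_fun do rewrite -EFinM.
    apply/measurable_EFinP; apply: measurable_funM => //.
    exact: measurableT_comp mq.
  - move=> x _; rewrite -EFinM lee_fin -[X in X <= _]ger0_norm ?sqr_ge0// normrX expr2.
    by rewrite ler_wpM2r//; exact: dyadic_mean_sup.
rewrite ge0_integralZl//; last first.
  by apply/measurable_EFinP; exact: measurableT_comp mq.
apply: (@le_trans _ _ (((9 / 64) ^+ n * a1)%:E * a1%:E)%E).
  by rewrite lee_wpmul2l ?lee_fin//; exact: le_trans (dyadic_mean_L1 n.+1 tp) pa.
have E : (9 / 64 : R) ^+ n = ((3 / 8) ^+ n) ^+ 2.
  by rewrite -exprM mulnC exprM; congr (_ ^+ _); field.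
rewrite -EFinM lee_fin E.
by rewrite [leRHS]exprMn -mulrA -expr2.
Qed.

(** Telescoping over the scales: the step at scale [2 ^ k] costs a multiple of
    [2 ^ k * (3 / 8) ^ k], the general term of a convergent geometric series. *)
Lemma pairing_dyadic_mean psi a1 b n : test_function setT psi -> 0 < a1 -> 0 < b ->
  (\int[mu]_x `|psi x|%:E <= a1%:E)%E ->
  (\int[mu]_x (psi x ^+ 2)%:E <= (b ^+ 2)%:E)%E ->
  `|\int[mu]_x (w x * psi x)| <= N%:R * (delta * (b + 8 * a1)) +
     `|\int[mu]_x (w x * dyadic_mean psi n.+1 x)|.
Proof.
move=> tp a0 b0 pa pb.
suff H : `|\int[mu]_x (w x * psi x)| <=
    N%:R * (delta * (b + 8 * a1 * (1 - (3 / 4) ^+ n))) +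
     `|\int[mu]_x (w x * dyadic_mean psi n.+1 x)|.
  apply: (le_trans H); rewrite lerD2r ler_wpM2l// ler_wpM2l ?(ltW delta0)// lerD2l.
  rewrite ler_piMr ?mulr_ge0 ?(ltW a0)// gerBl exprn_ge0//.
elim: n => [|n IH].
  have := pairing_cube_mean tp ltr01 b0 pb.
  rewrite /= expr0 subrr mulr0 addr0 mul1r => H.
  by rewrite -lerBlDr; apply: le_trans H; exact: lerB_dist.
have c0 : 0 < (3 / 8) ^+ n * a1 by rewrite mulr_gt0 ?exprn_gt0.
have := pairing_cube_mean (dyadic_mean_test n.+1 tp) (pow0 n.+1) c0 (dyadic_mean_L2 n tp pa).
set u := \int[mu]_x (w x * dyadic_mean psi n.+1 x).
rewrite -/(dyadic_mean psi n.+2); set v := \int[mu]_x _ => uv.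
have uv' : `|u| <= 2 ^+ n.+1 * (N%:R * (delta * ((3 / 8) ^+ n * a1))) + `|v|.
  by rewrite -lerBlDr; apply: le_trans uv; exact: lerB_dist.
apply: (le_trans IH); apply: (le_trans (lerD (lexx _) uv')).
rewrite addrA lerD2r le_eqVlt; apply/orP; left; apply/eqP.
have -> : (3 / 8 : R) ^+ n = (3 / 4) ^+ n * (2 ^+ n)^-1.
  by rewrite -exprVn -exprMn; congr (_ ^+ _); field.
by rewrite !exprS; field; rewrite gt_eqF.
Qed.

(** A Sobolev inequality in dual form.  The dyadic means of [psi] tend to zero in
    L^2 faster than their scale grows, as 2^(N/2) > 2, and the integrability of a
    power of [w] excludes a constant at infinity. *)
Lemma dual_sobolev psi a1 b : test_function setT psi -> 0 < a1 -> 0 < b ->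
  (\int[mu]_x `|psi x|%:E <= a1%:E)%E ->
  (\int[mu]_x (psi x ^+ 2)%:E <= (b ^+ 2)%:E)%E ->
  `|\int[mu]_x (w x * psi x)| <= N%:R * (delta * (b + 8 * a1)).
Proof.
move=> tp a0 b0 pa pb; apply/ler_addgt0Pr => e e0.
(* With this level the bounded part of [w] contributes at most [e / 2]. *)
pose lam := e / (2 * a1).
have l0 : 0 < lam by rewrite divr_gt0// mulr_gt0.
pose W := \int[mu]_x (`|w x| `^ p).
have W0 : 0 <= W by apply: Rintegral_ge0 => x _; exact: powR_ge0.
pose K := a1 * lam `^ (1 - p) * W.
have K0 : 0 <= K by rewrite !mulr_ge0 ?powR_ge0// ltW.
have [n Kn] : exists n, (9 / 64) ^+ n * K <= e / 2.
  have q1 : `|9 / 64 : R| < 1 by rewrite ger0_norm; lra.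
  have cK : (9 / 64) ^+ n * K @[n --> \oo] --> 0.
    by rewrite -[X in _ --> X](mul0r K); apply: cvgM; [exact: cvg_expr|exact: cvg_cst].
  have e20 : 0 < e / 2 by rewrite divr_gt0.
  have /cvgrPdist_le/(_ _ e20)[n _ Hn] := cK.
  exists n; have := Hn n (leqnn _); rewrite sub0r normrN; apply: le_trans; exact: ler_norm.
apply: (le_trans (pairing_dyadic_mean n tp a0 b0 pa pb)); rewrite lerD2l.
have tq := dyadic_mean_test n.+1 tp; set q := dyadic_mean psi n.+1 in tq *.
have iq : mu.-integrable setT (EFin \o (fun x => `|q x|)).
  have := integrable_abse (test_integrable tq); apply: eq_integrable => //.
pose G x := lam * `|q x| + (9 / 64) ^+ n * a1 * lam `^ (1 - p) * `|w x| `^ p.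
have i1 : mu.-integrable setT (EFin \o (fun x => lam * `|q x|)).
  by have := integrableZl measurableT lam iq; apply: eq_integrable.
have i2 : mu.-integrable setT (EFin \o (fun x => (9 / 64) ^+ n * a1 * lam `^ (1 - p) * `|w x| `^ p)).
  by have := integrableZl measurableT ((9 / 64) ^+ n * a1 * lam `^ (1 - p)) wp; apply: eq_integrable.
have iG : mu.-integrable setT (EFin \o G).
  by have := integrableD measurableT i1 i2; apply: eq_integrable.
have mwq : measurable_fun [set: 'rV[T]_N] (fun x : 'rV[R]_N => w x * q x).
  by have := measurable_int mu (iwM tq); move/measurable_EFinP.
have wqG : {ae mu, forall x, setT x -> `|w x * q x| <= G x}.
  apply/aeW => x _; rewrite normrM /G.
  apply: (@le_trans _ _ ((lam + lam `^ (1 - p) * `|w x| `^ p) * `|q x|)).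
    by rewrite ler_wpM2r//; exact: powR_split.
  have c0 : 0 <= lam `^ (1 - p) * `|w x| `^ p by rewrite mulr_ge0 ?powR_ge0.
  rewrite mulrDl lerD2l -[leRHS]mulrA [leRHS]mulrC ler_wpM2l//.
  exact: (dyadic_mean_sup n x tp pa).
have H := ae_norm_Rintegral_le measurableT mwq iG wqG.
apply: le_trans H _.
rewrite /G RintegralD// !RintegralZl//.
rewrite (_ : e = e / 2 + e / 2); last by field.
apply: lerD.
  apply: (@le_trans _ _ (lam * a1)); last first.
    by rewrite /lam le_eqVlt; apply/orP; left; apply/eqP; field; rewrite gt_eqF.
  rewrite ler_wpM2l ?(ltW l0)// -lee_fin /Rintegral fineK; last exact: integrable_fin_num.
  exact: le_trans (dyadic_mean_L1 n.+1 tp) pa.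
by apply: le_trans Kn; rewrite /K -/W !mulrA.
Qed.

End dual_sobolev.

Section weak_sobolev.
Context {R : realType} {N : nat}.
Local Notation T := (measurableTypeR R).
Local Notation mu := (@lebesgue_rV R N).
Implicit Types w : 'rV[R]_N -> R.

(** What is used of a function with square integrable gradient: [delta] bounds
    the L^2 norm of its derivatives. *)
Definition weakly_differentiable w (dw : 'I_N -> 'rV[R]_N -> R) (delta : R) :=
  [/\ forall L, mu.-integrable (box L) (EFin \o w),
      forall j, measurable_fun [set: 'rV[T]_N] (dw j),
      forall j, (\int[mu]_x (dw j x ^+ 2)%:E <= (delta ^+ 2)%:E)%E &
      forall psi, test_function setT psi -> forall j,
        \int[mu]_x (w x * partial j psi x) = - \int[mu]_x (dw j x * psi x)].

(** On [A] the function [sg * w] is at least [e].  Testing [dual_sobolev] with smooth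
    approximations of the indicator of [A] bounds [e * mu A] by a multiple of
    [delta * (sqrt (mu A) + mu A)], whose second term can be absorbed. *)
Lemma weak_sobolev_bounded w dw delta p sg A L e : (3 <= N)%N -> 0 < delta -> 1 < p ->
  weakly_differentiable w dw delta ->
  mu.-integrable setT (EFin \o (fun x => `|w x| `^ p)) ->
  0 < L -> measurable (A : set 'rV[T]_N) -> A `<=` box L -> 0 < e ->
  64 * (N%:R * delta) <= e -> `|sg| <= 1 -> (forall x, A x -> e <= sg * w x) ->
  (mu A <= (8 * (N%:R * delta / e) ^+ 2)%:E)%E.
Proof.
move=> N3 d0 p1 [iw mdw dw2 wdw] wp L0 mA AL e0 de sg1 Ae.
have L20 : 0 < 2 * L by rewrite mulr_gt0.
have mQ := @measurable_box R N (2 * L).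
have AQ : A `<=` box (2 * L).
  by move=> x /AL; apply: boxS; rewrite ler_peMl ?(ltW L0)// ler1n.
have muQ : (mu (box (2 * L)) < +oo)%E by exact: box_volume_lty.
have muA : (mu A < +oo)%E by apply: le_lt_trans muQ; apply: le_measure; rewrite ?inE.
pose m := fine (mu A); have Em : mu A = m%:E by rewrite fineK// ge0_fin_numE.
rewrite Em lee_fin; have m0 : 0 <= m by exact: fine_ge0.
have [m1|] := ltP 0 m; last by move=> H; rewrite (le_trans H)// mulr_ge0 ?sqr_ge0.
(* The tolerance is small compared with [m], so that the integral of [psi] is at most
   [2 * m], and with [e * m], so that it can be absorbed. *)
pose eta := Num.min m (e * m / 8).
have eta0 : 0 < eta by rewrite lt_min m1 divr_gt0 ?mulr_gt0.
pose W x := 1 + `|w x|.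
have W0 x : 0 <= W x by rewrite addr_ge0.
have i1 : mu.-integrable (box (2 * L)) (EFin \o (cst (1 : R))).
  by apply: measurable_bounded_integrable => //; exists 1; split=> // M /ltW ? x _; rewrite /= normr1.
have iW : mu.-integrable (box (2 * L)) (EFin \o W).
  by have := integrableD mQ i1 (integrable_norm (iw (2 * L))); apply: eq_integrable.
have [psi [tp p01 pout pd]] := test_density L0 W0 iW mA AL eta0.
have mp := test_measurable tp.
have m1A : measurable_fun [set: 'rV[T]_N] (\1_A : _ -> R) by exact: measurable_indic.
have pb x : `|psi x| <= 1 by have /andP[? ?] := p01 x; rewrite ger0_norm.
have Ab x : `|\1_A x : R| <= 1 by rewrite indicE; case: (_ \in _); rewrite ?normr1 ?normr0.
have mW : measurable_fun (box (2 * L)) W.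
  by have := measurable_int mu iW; move/measurable_EFinP.
have iWd : mu.-integrable (box (2 * L)) (EFin \o (fun x => W x * `|psi x - \1_A x|)).
  apply: (integrableM_bounded (C := 2) mQ iW).
    apply: measurable_funTS; apply: measurableT_comp => //; exact: measurable_funB.
  move=> x _; rewrite normr_id; apply: (le_trans (ler_normB _ _)).
  by rewrite (_ : 2 = 1 + 1)// lerD.
have i_loc (f g : 'rV[R]_N -> R) (C : R) : mu.-integrable (box (2 * L)) (EFin \o f) ->
    measurable_fun [set: 'rV[T]_N] g -> (forall x, `|g x| <= C) ->
    mu.-integrable (box (2 * L)) (EFin \o (fun x => f x * g x)).
  move=> i_f mg gC; apply: (integrableM_bounded (C := C) mQ i_f) => //.
  exact: measurable_funTS.
have ext (f : 'rV[R]_N -> R) : (forall x, ~ box (2 * L) x -> f x = 0) ->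
    \int[mu]_x f x = \int[mu]_(x in box (2 * L)) f x.
  move=> f0; rewrite /Rintegral [in RHS]integral_mkcond; congr fine.
  apply: eq_integral => x _; rewrite patchE; case: ifPn => //.
  by rewrite notin_setE => /f0 ->.
have cmp (f : 'rV[R]_N -> R) : mu.-integrable (box (2 * L)) (EFin \o f) -> (forall x, `|f x| <= W x) ->
    `|\int[mu]_(x in box (2 * L)) (f x * psi x) - \int[mu]_(x in box (2 * L)) (f x * \1_A x)| <= eta.
  move=> i_f fW; apply: le_trans pd.
  rewrite -RintegralB//; [|exact: (i_loc _ _ 1)..].
  have mfp : measurable_fun (box (2 * L)) f.
    by have := measurable_int mu i_f; move/measurable_EFinP.
  apply: ae_norm_Rintegral_le => //.
    by apply: measurable_funB; apply: measurable_funM => //; exact: measurable_funTS.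
  by apply/aeW => x _; rewrite -mulrBr normrM ler_wpM2r.
have I1A : \int[mu]_(x in box (2 * L)) (1 * \1_A x) = m.
  under eq_Rintegral do rewrite mul1r.
  by rewrite /Rintegral integral_indic// setIC; congr (fine (mu _)); exact/setIidr.
have psi0 : \int[mu]_x psi x <= 2 * m.
  rewrite ext//; have := cmp (cst 1) i1 _.
  rewrite /= I1A => /(_ (fun x => _)) H.
  have {}H : `|\int[mu]_(x in box (2 * L)) (1 * psi x) - m| <= eta.
    by apply: H => x; rewrite normr1 lerDl.
  have E : \int[mu]_(x in box (2 * L)) (1 * psi x) = \int[mu]_(x in box (2 * L)) psi x.
    by apply: eq_Rintegral => x _; rewrite mul1r.
  have := le_trans (ler_norm _) H; rewrite E lerBlDr => /le_trans; apply.
  by rewrite (_ : 2 * m = m + m) ?lerD2r ?ge_min ?lexx//; ring.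
have ip := test_integrable tp.
have psiE : (\int[mu]_x (psi x)%:E <= (2 * m)%:E)%E.
  have := psi0; rewrite -lee_fin /Rintegral fineK//; exact: integrable_fin_num.
have psi1 : (\int[mu]_x `|psi x|%:E <= (2 * m)%:E)%E.
  under eq_integral => x _ do rewrite ger0_norm ?(andP (p01 x)).1//.
  exact: psiE.
have psi2 : (\int[mu]_x (psi x ^+ 2)%:E <= ((Num.sqrt (2 * m)) ^+ 2)%:E)%E.
  rewrite sqr_sqrtr ?mulr_ge0//; apply: le_trans psiE.
  apply: ge0_le_integral => //.
  - by move=> x _; rewrite lee_fin sqr_ge0.
  - by apply/measurable_EFinP; exact: measurable_funX.
  - exact/measurable_EFinP.
  - by move=> x _; rewrite lee_fin expr2; have /andP[? ?] := p01 x; rewrite ler_piMl.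
have m20 : 0 < 2 * m by rewrite mulr_gt0.
have sq0 : 0 < Num.sqrt (2 * m) by rewrite sqrtr_gt0.
have key := dual_sobolev N3 d0 p1 iw mdw dw2 wdw wp tp m20 sq0 psi1 psi2.
have low : e * m <= `|\int[mu]_x (w x * psi x)| + eta.
  have cw := cmp w (iw (2 * L)).
  have {}cw : `|\int[mu]_(x in box (2 * L)) (w x * psi x) -
      \int[mu]_(x in box (2 * L)) (w x * \1_A x)| <= eta.
    by apply: cw => x; rewrite lerDr.
  rewrite ext; last by move=> x /pout ->; rewrite mulr0.
  apply: (@le_trans _ _ (`|\int[mu]_(x in box (2 * L)) (w x * \1_A x)|)); last first.
    by rewrite -lerBlDl; apply: le_trans cw; rewrite distrC; exact: lerB_dist.
  have iwA := i_loc w _ 1 (iw _) m1A Ab.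
  apply: (@le_trans _ _ (sg * \int[mu]_(x in box (2 * L)) (w x * \1_A x))); last first.
    by apply: (le_trans (ler_norm _)); rewrite normrM ler_piMl.
  rewrite -I1A -!RintegralZl//; last exact: (i_loc (cst 1) _ 1).
  apply: ae_le_Rintegral => //.
  - by have := integrableZl mQ e (i_loc (cst 1) _ 1 i1 m1A Ab); apply: eq_integrable.
  - by have := integrableZl mQ sg iwA; apply: eq_integrable.
  - apply/aeW => x _; rewrite mul1r mulrA indicE.
    by case: (boolP (x \in A)) => [/set_mem /Ae|_]; rewrite ?mulr1// !mulr0.
set D := N%:R * delta in de *.
have D0 : 0 < D by rewrite mulr_gt0// ltr0n (leq_trans _ N3).
have key' : e * m <= D * Num.sqrt (2 * m) + D * 16 * m + e * m / 8.
  apply: (le_trans low); apply: lerD; last by rewrite ge_min lexx orbT.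
  by apply: (le_trans key); rewrite /D le_eqVlt; apply/orP; left; apply/eqP; ring.
have em : D * 16 * m <= e * m / 4.
  rewrite (_ : D * 16 * m = (64 * D) * m / 4); last by field.
  by rewrite ler_wpM2r// ler_wpM2r.
have half : e * m / 2 <= D * Num.sqrt (2 * m).
  have : 0 <= e * m by rewrite mulr_ge0// ltW.
  move: key' em; move: (D * Num.sqrt _) (D * 16 * m) (e * m); clear => X Y Z; lra.
have sq : (e * m / 2) ^+ 2 <= D ^+ 2 * (2 * m).
  rewrite -[2 * m in leRHS]sqr_sqrtr ?(ltW m20)// -exprMn.
  apply: lerXn2r half; rewrite nnegrE.
    by rewrite ltW// divr_gt0// mulr_gt0.
  by rewrite ltW// mulr_gt0.
rewrite expr_div_n mulrA ler_pdivlMr ?exprn_gt0//.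
rewrite -(ler_pM2l m1).
rewrite (_ : m * (m * e ^+ 2) = 4 * (e * m / 2) ^+ 2); last by field.
rewrite (_ : m * (8 * D ^+ 2) = 4 * (D ^+ 2 * (2 * m))); last by ring.
by rewrite ler_pM2l.
Qed.

(** Both signs of [w] are covered by the previous bound, and the large sets by the
    bounded ones. *)
Lemma weak_sobolev w dw delta p e : (3 <= N)%N -> 0 < delta -> 1 < p ->
  weakly_differentiable w dw delta ->
  measurable_fun [set: 'rV[T]_N] w ->
  mu.-integrable setT (EFin \o (fun x => `|w x| `^ p)) ->
  0 < e -> 64 * (N%:R * delta) <= e ->
  (mu [set x | (e <= `|w x|)%R] <= (16 * (N%:R * delta / e) ^+ 2)%:E)%E.
Proof.
move=> N3 d0 p1 dw1 mw wp e0 de.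
pose A (sg : R) (n : nat) : set 'rV[T]_N := [set x | e <= sg * w x] `&` box n.+1%:R.
have mA sg n : measurable (A sg n).
  apply: measurableI; last exact: measurable_box.
  have mf : measurable_fun [set: 'rV[T]_N] (fun x => sg * w x) by exact: measurable_funM.
  have := mf measurableT `[e, +oo[%classic (measurable_itv _).
  by rewrite setTI; congr measurable; apply/seteqP; split=> x /=; rewrite in_itv/= andbT.
have bA sg n : `|sg| <= 1 -> (mu (A sg n) <= (8 * (N%:R * delta / e) ^+ 2)%:E)%E.
  move=> sg1; apply: (@weak_sobolev_bounded w dw delta p sg (A sg n) n.+1%:R e) => //.
  - by move=> x [].
  - by move=> x [].
pose B n := A 1 n `|` A (-1) n.
have mB n : measurable (B n) by exact: measurableU.
have bB n : (mu (B n) <= (16 * (N%:R * delta / e) ^+ 2)%:E)%E.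
  apply: (le_trans (measureU2 _ _ _)) => //.
  rewrite (_ : 16 * _ = 8 * (N%:R * delta / e) ^+ 2 + 8 * (N%:R * delta / e) ^+ 2); last by ring.
  by rewrite EFinD; apply: leeD; apply: bA; rewrite ?normrN normr1.
have ndB : nondecreasing_seq B.
  apply/nondecreasing_seqP => n; apply/subsetPset => x.
  have H sg : A sg n x -> A sg n.+1 x.
    by move=> [? bx]; split=> //; apply: boxS bx; rewrite ler_nat.
  by case=> /H; [left|right].
have UB : \bigcup_n B n = [set x | e <= `|w x|].
  apply/seteqP; split=> [x [n _]|x /= ex].
    case=> -[/= H _]; apply: (le_trans H); last by rewrite mulN1r -normrN ler_norm.
    by rewrite mul1r ler_norm.
  have [n xn] : exists n, box n.+1%:R x.
    exists (Num.truncn `|x|) => i; apply: (le_trans (coord_le_norm _ _)).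
    exact/ltW/truncnS_gt.
  exists n => //; case: (leP 0 (w x)) ex => w0; rewrite ?(ger0_norm w0) ?(ltr0_norm w0) => ex.
    by left; split=> //; rewrite /= mul1r.
  by right; split=> //; rewrite /= mulN1r.
rewrite -UB; have := nondecreasing_cvg_mu mB
  (bigcup_measurable (fun n _ => mB n)) ndB => /(_ R mu) cB; rewrite -(cvg_lim _ cB)//; apply: lime_le; first by apply/cvg_ex; eexists; exact: cB.
by apply: nearW => n; exact: bB.
Qed.

End weak_sobolev.
(** * Weak differential inequalities on a half line *)

Section support.
Context d (X : measurableType d) (R : realType) (mu : {measure set X -> \bar R}).

Lemma Rintegral_supp (D E : set X) (f : X -> R) : E `<=` D ->
  (forall x, D x -> ~ E x -> f x = 0) ->
  \int[mu]_(x in D) f x = \int[mu]_(x in E) f x.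
Proof.
move=> ED f0; rewrite /Rintegral; congr fine.
rewrite integral_mkcond [RHS]integral_mkcond; apply: eq_integral => x _.
rewrite !patchE; have [Ex|nEx] := pselect (E x).
  by rewrite !mem_set//; exact: ED.
rewrite (memNset nEx); case: ifPn => // /set_mem Dx.
by rewrite f0.
Qed.

Lemma integrable_supp (D E : set X) (f : X -> R) : measurable D -> measurable E ->
  E `<=` D -> (forall x, D x -> ~ E x -> f x = 0) ->
  mu.-integrable E (EFin \o f) -> mu.-integrable D (EFin \o f).
Proof.
move=> mD mE ED f0; rewrite (integrable_mkcond _ mE) (integrable_mkcond _ mD).
apply: eq_integrable => // x _.
rewrite !patchE; have [Ex|nEx] := pselect (E x).
  by rewrite !mem_set//; exact: ED.
rewrite (memNset nEx); case: ifPn => // /set_mem Dx.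
by rewrite /= f0.
Qed.

End support.

Section time.
Context {R : realType}.
Local Notation T := (measurableTypeR R).
Local Notation leb := (@lebesgue_measure R).
Implicit Types (F G f xi : R -> R).

Lemma measurable_interval (i : interval R) : measurable ([set` i] : set T).
Proof. exact: measurable_itv. Qed.

(** The space C^1_c(]t0, oo[). *)
Definition C1c (t0 : R) xi : Prop :=
  [/\ forall t, derivable xi t 1, continuous (derive1 xi) &
      exists a b, t0 < a /\ forall t, ~~ (a <= t <= b) -> xi t = 0].

(** The space L^1_loc(]t0, oo[). *)
Definition Lloc (t0 : R) F : Prop :=
  forall a b, t0 < a -> leb.-integrable `[a, b] (EFin \o F).

Lemma continuous_integrable_itv f (a b : R) : continuous f ->
  leb.-integrable `[a, b] (EFin \o f).
Proof.
move=> cf; apply: (@continuous_compact_integrable R f); first exact: segment_compact.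
exact: continuous_subspaceT.
Qed.

Lemma C1c_deriv0 t0 xi : C1c t0 xi ->
  exists a b, [/\ t0 < a, forall t, ~~ (a <= t <= b) -> xi t = 0 &
    forall t, ~~ (a <= t <= b) -> derive1 xi t = 0].
Proof.
move=> [_ _ [a [b [Ta xi0]]]]; exists a, b; split=> // t tab.
have near0 : \forall s \near t, xi s = 0.
  move: tab; rewrite negb_and -!ltNge => /orP[ta|bt].
    near=> s; apply: xi0; rewrite negb_and -ltNge; apply/orP; left.
    by near: s; exact: lt_nbhsl.
  near=> s; apply: xi0; rewrite negb_and -!ltNge; apply/orP; right.
  by near: s; exact: lt_nbhsr.
rewrite derive1E (@near_eq_derive _ _ _ _ (cst 0))//.
  by rewrite derive_cst.
Unshelve. all: by end_near. Qed.

Lemma C1c_continuous t0 xi : C1c t0 xi -> continuous xi.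
Proof.
case=> dxi _ _ t; apply: differentiable_continuous; exact/derivable1_diffP.
Qed.

Lemma C1c_time_test t0 xi : C1c t0 xi -> time_test_function xi.
Proof.
case=> d1 c1 [a [b [_ xi0]]]; split=> //; exists (b + 1) => t bt.
by apply: xi0; rewrite negb_and -!ltNge (lt_le_trans _ bt) ?ltrDl ?orbT.
Qed.

Lemma C1cW t0 t1 xi : t1 <= t0 -> C1c t0 xi -> C1c t1 xi.
Proof.
by move=> t10 [d1 c1 [a [b [Ta H]]]]; split=> //; exists a, b; split=> //; exact: le_lt_trans Ta.
Qed.

Lemma LlocW t0 t1 F : t1 <= t0 -> Lloc t1 F -> Lloc t0 F.
Proof. by move=> t10 LF a b Ta; apply: LF; exact: le_lt_trans Ta. Qed.

Lemma LlocD t0 F G : Lloc t0 F -> Lloc t0 G -> Lloc t0 (fun t => F t + G t).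
Proof.
by move=> LF LG a b Ta; have := integrableD (measurable_interval _) (LF a b Ta) (LG a b Ta); apply: eq_integrable => //; exact: measurable_interval.
Qed.

Lemma Lloc_cont t0 F f : (forall t, t0 < t -> {for t, continuous f}) -> Lloc t0 F ->
  Lloc t0 (fun t => f t * F t).
Proof.
move=> cf LF a b Ta.
have cfab : {within `[a, b]%classic, continuous f}.
  apply: continuous_in_subspaceT => t /set_mem /=; rewrite in_itv/= => /andP[at_ _].
  by apply: cf; exact: lt_le_trans at_.
have [C HC] : exists C, forall t, a <= t <= b -> `|f t| <= C.
  have := continuous_compact cfab (@segment_compact R a b).
  move=> /compact_bounded[M [_ HM]]; exists (M + 1) => t tab.
  by apply: (HM (M + 1)); [rewrite ltrDl|exists t => //=; rewrite in_itv].
have -> : EFin \o (fun t => f t * F t) = EFin \o (fun t => F t * f t).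
  by apply/funext => t /=; rewrite mulrC.
apply: (integrableM_bounded (C := C) (measurable_interval _) (LF a b Ta)).
  exact: subspace_continuous_measurable_fun.
by move=> t; rewrite /= in_itv/=; exact: HC.
Qed.

Lemma Lloc_mulC1c t0 F xi : Lloc t0 F -> continuous xi ->
  (exists a b, t0 < a /\ forall t, ~~ (a <= t <= b) -> xi t = 0) ->
  forall D : set T, measurable D -> leb.-integrable D (EFin \o (fun t => F t * xi t)).
Proof.
move=> LF cxi [a [b [Ta xi0]]] D mD.
have LX : Lloc t0 (fun t => xi t * F t) by apply: Lloc_cont => // t _; exact: cxi.
have iT : leb.-integrable setT (EFin \o (fun t => F t * xi t)).
  apply: (@integrable_supp _ T R leb setT `[a, b]%classic) => //.
    by move=> t _ /negP; rewrite /= in_itv/= => /xi0 ->; rewrite mulr0.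
  by have := LX a b Ta; apply: eq_integrable => // t _ /=; rewrite mulrC.
exact: (@integrableS _ _ _ _ setT).
Qed.

Lemma C1c_integrable t0 F xi : Lloc t0 F -> C1c t0 xi ->
  leb.-integrable setT (EFin \o (fun t => F t * xi t)) /\
  leb.-integrable setT (EFin \o (fun t => F t * derive1 xi t)).
Proof.
move=> LF cxi; have [a [b [Ta H1 H2]]] := C1c_deriv0 cxi; split.
  by apply: (Lloc_mulC1c LF) => //; [exact: C1c_continuous cxi|exists a, b].
by apply: (Lloc_mulC1c LF) => //; [by case: cxi|exists a, b].
Qed.

Lemma C1c_integral_derive t0 xi : C1c t0 xi -> \int[leb]_t derive1 xi t = 0.
Proof.
move=> cxi; have [a [b [Ta H1 H2]]] := C1c_deriv0 cxi.
have [d1 c1 _] := cxi.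
pose a' := a - 1; pose b' := Num.max a b + 1.
have ab' : a' < b' by rewrite /a' /b' ltrBlDr -addrA ltr_pwDr// le_max lexx.
have aa : a' < a by rewrite /a' ltrBlDr ltrDl.
have bb : b < b' by rewrite /b' ltr_pwDr// le_max lexx orbT.
rewrite (@Rintegral_supp _ T R leb setT `[a', b']%classic)//; last first.
  move=> t _ /negP; rewrite /= in_itv/= negb_and -!ltNge => /orP[ta|bt]; apply: H2.
    by rewrite negb_and -ltNge (lt_trans ta).
  by rewrite negb_and -!ltNge (lt_trans _ bt) ?orbT.
have cx := C1c_continuous cxi.
have dF : derivable_oo_LRcontinuous xi a' b'.
  by split; [move=> t _; exact: d1|exact: cvg_at_right_filter (cx _)|exact: cvg_at_left_filter (cx _)].
have x1 : xi a' = 0 by apply: H1; rewrite negb_and -!ltNge aa.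
have x2 : xi b' = 0 by apply: H1; rewrite negb_and -!ltNge bb orbT.
rewrite /Rintegral (continuous_FTC2 ab' (continuous_subspaceT c1) dF (fun _ _ => erefl)).
by rewrite x1 x2 -EFinB subrr.
Qed.

(** A C^1 function on ]t0, oo[ and its derivative; nothing is asked elsewhere, as the
    weights will be powers of [t]. *)
Definition weight (t0 : R) f (df : R -> R) : Prop :=
  forall t, t0 < t -> is_derive t 1 f (df t) /\ {for t, continuous df}.

Lemma weight_continuous t0 f df t : weight t0 f df -> t0 < t -> {for t, continuous f}.
Proof.
move=> wf /wf[[df1 _] _]; apply: differentiable_continuous; exact/derivable1_diffP.
Qed.

Lemma C1c_mul t0 f df xi : weight t0 f df -> C1c t0 xi ->
  C1c t0 (fun t => f t * xi t) /\
  forall t, derive1 (fun t => f t * xi t) t = f t * derive1 xi t + df t * xi t.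
Proof.
move=> wf cxi; have [a [b [Ta H1 H2]]] := C1c_deriv0 cxi; have [d1 c1 _] := cxi.
pose h (t : R) := f t * derive1 xi t + df t * xi t.
have left0 (g : R -> R) t : (forall s, s < a -> g s = 0) -> t < a -> \forall s \near t, g s = 0.
  by move=> g0 ta; near=> s; apply: g0; near: s; exact: lt_nbhsl.
have x0 s : s < a -> xi s = 0 by move=> sa; apply: H1; rewrite negb_and -ltNge sa.
have dx0 s : s < a -> derive1 xi s = 0 by move=> sa; apply: H2; rewrite negb_and -ltNge sa.
have key (t : R) : is_derive t 1 (fun t : R => f t * xi t) (h t).
  have [ta|at_] := ltP t a; last first.
    have [df1 _] := wf t (lt_le_trans Ta at_).
    have dx1 : is_derive t 1 xi (derive1 xi t) by rewrite derive1E; exact: derivableP.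
    apply: is_derive_eq; rewrite /h [X in _ + X]mulrC; congr (_ + _).
  apply: (@near_eq_is_derive _ _ _ (cst 0)) => //.
    have fx0 s : s < a -> f s * xi s = 0 by move=> sa; rewrite x0// mulr0.
    by have := left0 (fun t => f t * xi t) t fx0 ta; apply: filterS => s ->.
  rewrite /h x0// dx0// !mulr0 addr0; exact: is_derive_cst.
have E t : derive1 (fun t => f t * xi t) t = h t by rewrite derive1E; case: (key t).
split; last exact: E.
split.
- by move=> t; case: (key t).
- rewrite (_ : derive1 _ = h); last exact/funext.
  move=> t; have [ta|at_] := ltP t a; last first.
    have tt := lt_le_trans Ta at_; have [_ cdf] := wf t tt.
    apply: cvgD; apply: cvgM => //; [exact: (weight_continuous wf)|exact: c1|].
    exact: (C1c_continuous cxi).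
  have h0 s : s < a -> h s = 0 by move=> sa; rewrite /h x0// dx0// !mulr0 addr0.
  rewrite /continuous_at h0//; apply: cvg_near_cst; exact: left0.
- exists a, b; split=> // t tab; by rewrite H1// mulr0.
Unshelve. all: by end_near. Qed.

(** F' <= G beyond [t0], in the sense of distributions. *)
Definition weak_le (t0 : R) F G : Prop :=
  [/\ Lloc t0 F, Lloc t0 G & forall xi, C1c t0 xi -> (forall t, 0 <= xi t) ->
    - (\int[leb]_t (G t * xi t)) <= \int[leb]_t (F t * derive1 xi t)].

Lemma weak_leD t0 F1 G1 F2 G2 : weak_le t0 F1 G1 -> weak_le t0 F2 G2 ->
  weak_le t0 (fun t => F1 t + F2 t) (fun t => G1 t + G2 t).
Proof.
move=> [LF1 LG1 H1] [LF2 LG2 H2]; split; [exact: LlocD|exact: LlocD|].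
move=> xi cxi xi0.
under eq_Rintegral do rewrite mulrDl; under [leRHS]eq_Rintegral do rewrite mulrDl.
have [? ?] := C1c_integrable LF1 cxi; have [? ?] := C1c_integrable LF2 cxi.
have [? ?] := C1c_integrable LG1 cxi; have [? ?] := C1c_integrable LG2 cxi.
by rewrite !RintegralD// opprD lerD// ?H1 ?H2.
Qed.

Lemma weak_leW t0 t1 F G : t1 <= t0 -> weak_le t1 F G -> weak_le t0 F G.
Proof.
move=> t10 [LF LG H]; split; [exact: LlocW LF|exact: LlocW LG|].
by move=> xi cxi; apply: H; exact: C1cW cxi.
Qed.

Lemma weak_le_ge t0 F G G' : weak_le t0 F G -> Lloc t0 G' ->
  {ae leb, forall t : T, t0 < t -> G t <= G' t} -> weak_le t0 F G'.
Proof.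
move=> [LF LG H] LG' GG; split=> // xi cxi xi0; apply: le_trans (H xi cxi xi0).
rewrite lerN2; have [i1 _] := C1c_integrable LG cxi; have [i2 _] := C1c_integrable LG' cxi.
apply: ae_le_Rintegral => //.
apply: filterS GG => t GGt _; have [tt|tt] := ltP t0 t.
  by rewrite ler_wpM2r// GGt.
have [_ _ [a [b [Ta x0]]]] := cxi.
by rewrite x0 ?mulr0// negb_and -ltNge (le_lt_trans tt Ta).
Qed.

(** Product rule: if [xi] is a test function, so is [f * xi]. *)
Lemma weak_leM t0 f df F G : weight t0 f df -> (forall t, t0 < t -> 0 <= f t) ->
  weak_le t0 F G -> weak_le t0 (fun t => f t * F t) (fun t => f t * G t + df t * F t).
Proof.
move=> wf f0 [LF LG H].
have cf t : t0 < t -> {for t, continuous f} by exact: weight_continuous wf.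
have cdf t : t0 < t -> {for t, continuous df} by case/wf.
have LfF := Lloc_cont cf LF; have LfG := Lloc_cont cf LG; have LdF := Lloc_cont cdf LF.
split=> //; first exact: LlocD.
move=> xi cxi xi0; have [cfx E] := C1c_mul wf cxi.
have fx0 t : 0 <= f t * xi t.
  have [tt|tt] := ltP t0 t; first by rewrite mulr_ge0// f0.
  have [_ _ [a [b [Ta x0]]]] := cxi.
  by rewrite x0 ?mulr0// negb_and -ltNge (le_lt_trans tt Ta).
have := H _ cfx fx0.
under eq_Rintegral do rewrite mulrCA mulrA.
under [leRHS]eq_Rintegral do rewrite E mulrDr mulrCA mulrA (mulrCA (F _)) (mulrA (df _)).
under [X in _ -> - X <= _]eq_Rintegral do rewrite mulrDl.
have [i1 _] := C1c_integrable LfG cxi; have [i2 _] := C1c_integrable LdF cxi.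
have [_ i3] := C1c_integrable LfF cxi.
by rewrite !RintegralD// opprD lerBlDr.
Qed.

End time.
Section lebesgue_points.
Context {R : realType}.
Local Notation T := (measurableTypeR R).
Local Notation leb := (@lebesgue_measure R).
Implicit Types (F G f xi : R -> R).

(** A Lebesgue point of [F], up to the normalization of the means. *)
Definition mean_point F (t : R) : Prop := forall e, 0 < e ->
  exists2 h0, 0 < h0 & forall h, 0 < h < h0 ->
    \int[leb]_(s in `]t - h, t + h[) `|F s - F t| <= e * h.

Lemma Lloc_mean_point t0 F : Lloc t0 F ->
  {ae leb, forall t : T, t0 < t -> mean_point F t}.
Proof.
move=> LF.
pose A n : set T := `[t0 + n.+1%:R^-1, n%:R]%classic.
pose Fn n := F \_ (A n).
have an n : t0 < t0 + n.+1%:R^-1 by rewrite ltrDl invr_gt0 ltr0n.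
have mA n : measurable (A n) by exact: measurable_interval.
have iFn n : leb.-integrable setT (EFin \o Fn n).
  have := LF _ n%:R (an n); rewrite (integrable_mkcond _ (mA n)).
  by rewrite /Fn -restrict_EFin.
have : {ae leb, forall t : T, forall n, lebesgue_pt (Fn n) t}.
  apply: ae_foralln => n; apply: lebesgue_differentiation.
  exact: (open_integrable_locally openT (iFn n)).
apply: filterS => t Ht t0t e e0.
have [n tn] : exists n, t0 + n.+1%:R^-1 < t /\ t < n%:R.
  exists (Num.truncn (Num.max (t - t0)^-1 t)).+1.
  have H := truncnS_gt (Num.max (t - t0)^-1 t).
  have d0 : 0 < t - t0 by rewrite subr_gt0.
  split; last by apply: le_lt_trans H; rewrite le_max lexx orbT.
  rewrite -ltrBrDl -[ltRHS]invrK ltf_pV2 ?posrE ?ltr0n ?invr_gt0//.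
  apply: (@lt_trans _ _ (Num.truncn (Num.max (t - t0)^-1 t)).+1%:R); last by rewrite ltr_nat.
  by apply: le_lt_trans H; rewrite le_max lexx.
have := Ht n; rewrite /lebesgue_pt.
have e20 : (0 < (e / 2)%:E)%E by rewrite lte_fin divr_gt0.
move=> /fine_cvgP[fin cv].
have e20' : 0 < e / 2 by rewrite divr_gt0.
have /cvgrPdist_lt/(_ _ e20') cv' := cv.
have [h1 /= h10 Hh] : exists2 h1, 0 < h1 & forall h, 0 < h < h1 ->
    davg (Fn n) t h \is a fin_num /\ `|0 - fine (davg (Fn n) t h)| < e / 2.
  have : nbhs (0 : R) [set h | 0 < h ->
      davg (Fn n) t h \is a fin_num /\ `|0 - fine (davg (Fn n) t h)| < e / 2].
    exact: (filterI fin cv').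
  move=> /nbhs_ballP[h1 /= h10 Hh]; exists h1 => // h /andP[h0 hh].
  by apply: Hh => //; rewrite /ball/= sub0r normrN gtr0_norm.
pose h2 := Num.min (t - (t0 + n.+1%:R^-1)) (n%:R - t).
have h20 : 0 < h2 by rewrite lt_min !subr_gt0; case: tn => -> ->.
exists (Num.min h1 h2); first by rewrite lt_min h10.
move=> h /andP[h0]; rewrite lt_min => /andP[hh1 hh2].
have sub s : t - h < s < t + h -> A n s.
  move: hh2; rewrite /h2 lt_min /A /= in_itv/=.
  move: (t0 + _) (n%:R : R) => x y /andP[h3 h4] /andP[h5 h6].
  by apply/andP; split; [move: h3 h5|move: h4 h6]; clear; lra.
have At : A n t by apply: sub; rewrite ltrBlDr !ltrDl h0.
have Ft : Fn n t = F t by rewrite /Fn patchE mem_set.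
have [fin1 lt1] := Hh h (introT andP (conj h0 hh1)).
have E : davg (Fn n) t h = ((h *+ 2)^-1%:E * \int[leb]_(s in `](t - h)%R, (t + h)%R[) `|(F s - F t)%R%:E|)%E.
  rewrite /davg /iavg lebesgue_measure_ball ?(ltW h0)// inver mulrn_eq0 /= gt_eqF//.
  rewrite ball_itv; congr (_ * _)%E; apply: eq_integral => s.
  rewrite inE /= in_itv/= => /sub As.
  by rewrite /= Ft /Fn patchE mem_set.
have I0 : (0 <= \int[leb]_(s in `](t - h)%R, (t + h)%R[) `|(F s - F t)%R%:E|)%E by exact: integral_ge0.
rewrite /Rintegral.
under eq_integral do rewrite -abse_EFin.
move: I0 E fin1 lt1; case: (\int[leb]_(s in _) _)%E => [r| |] //= r0 ->.
  move=> _; rewrite sub0r normrN => /(le_lt_trans (ler_norm _)).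
  rewrite -EFinM -[fine _]/((h *+ 2)^-1 * r) mulrC ltr_pdivrMr ?mulrn_wgt0// => /ltW H.
  by apply: (le_trans H); rewrite -(mulr_natl h) mulrA divfK.
by rewrite mulry gtr0_sg ?mul1e// invr_gt0 mulrn_wgt0.
Qed.

(** A smooth bump of height one and width of order [h] around [t]. *)
Definition bump (t h : R) : R -> R := plateau (t - h / 2) (t + h / 2) (h / 2).

Lemma bump_continuous t h : continuous (bump t h).
Proof. exact: smooth_continuous (plateau_smooth _ _ _). Qed.

Lemma bump_ge0 t h s : 0 <= bump t h s.
Proof. exact: plateau_ge0. Qed.

Lemma bump0 t h s : 0 < h -> ~~ (t - h < s < t + h) -> bump t h s = 0.
Proof.
move=> h0; have E1 : t - h = t - h / 2 - h / 2 by field.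
have E2 : t + h = t + h / 2 + h / 2 by field.
by rewrite E1 E2 => H; apply: plateau0 => //; rewrite divr_gt0.
Qed.

Lemma bump_integrable t h (D : set T) : 0 < h -> measurable D ->
  leb.-integrable D (EFin \o bump t h).
Proof.
move=> h0 mD; apply: (@integrableS _ _ _ _ setT) => //.
apply: (@integrable_supp _ T R leb setT `[t - h, t + h]%classic) => //.
  move=> s _ /negP; rewrite /= in_itv/= => H; apply: bump0 => //.
  by apply: contra H => /andP[? ?]; rewrite !ltW.
exact: continuous_integrable_itv _ _ (@bump_continuous _ _).
Qed.

Lemma bump_integral_ge t h : 0 < h -> h <= \int[leb]_s bump t h s.
Proof.
move=> h0.
have mI : measurable (`[t - h / 2, t + h / 2]%classic : set T) by exact: measurable_interval.
have hE : h = \int[leb]_(s in `[t - h / 2, t + h / 2]) (1 : R).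
  rewrite Rintegral_cst// mul1r -[LHS]/(fine h%:E); congr fine.
  have := lebesgue_measure_itv `[t - h / 2, t + h / 2]; rewrite /= lte_fin ifT; last lra.
  by rewrite -EFinB => E; apply: esym; rewrite [LHS]E; congr EFin; field.
rewrite [leLHS]hE.
apply: (@le_trans _ _ (\int[leb]_(s in `[t - h / 2, t + h / 2]) bump t h s)).
  apply: le_Rintegral => //.
  - exact: continuous_integrable_itv _ _ (fun=> cvg_cst _).
  - exact: bump_integrable.
  - move=> s; rewrite /= in_itv/= => H.
    by rewrite /bump plateau1// divr_gt0.
rewrite /Rintegral fine_le//.
- by apply: integrable_fin_num => //; exact: bump_integrable.
- by apply: integrable_fin_num => //; exact: bump_integrable.
- apply: ge0_subset_integral => //.
    by have := measurable_int leb (bump_integrable t h0 (@measurableT _ T)).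
  by move=> s _; rewrite lee_fin plateau_ge0.
Qed.

(** At a Lebesgue point the value is nearly the mean against the bump. *)
Lemma bump_test F t h e : 0 < h ->
  leb.-integrable `]t - h, t + h[ (EFin \o F) ->
  \int[leb]_(s in `]t - h, t + h[) `|F s - F t| <= e * h ->
  leb.-integrable setT (EFin \o (fun s => F s * bump t h s)) /\
  `|\int[leb]_s (F s * bump t h s) - F t * \int[leb]_s bump t h s|
     <= e * \int[leb]_s bump t h s.
Proof.
move=> h0 iF Fe.
have mI : measurable (`]t - h, t + h[%classic : set T) by exact: measurable_interval.
have b1 s : `|bump t h s| <= 1.
  by rewrite ger0_norm ?plateau_ge0 ?plateau_le1.
have mb : measurable_fun (`]t - h, t + h[%classic : set T) (bump t h).
  exact: (measurable_of_integrable (bump_integrable t h0 mI)).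
have iFb : leb.-integrable (`]t - h, t + h[%classic : set T) (EFin \o (fun s => F s * bump t h s)).
  by apply: (integrableM_bounded (C := 1) mI iF mb).
have out (g : R -> R) s : [set: T] s -> ~ `]t - h, t + h[%classic s -> g s * bump t h s = 0.
  by move=> _ /negP; rewrite /= in_itv/= => /(bump0 h0) ->; rewrite mulr0.
split; first exact: (@integrable_supp _ T R leb setT _ _ measurableT mI _ (out F)).
have i1 : leb.-integrable (`]t - h, t + h[%classic : set T) (EFin \o (fun s => F t * bump t h s)).
  have := integrableZl mI (F t) (bump_integrable t h0 mI); exact: eq_integrable.
have -> : F t * \int[leb]_s bump t h s = \int[leb]_(s in `]t - h, t + h[) (F t * bump t h s).
  rewrite -RintegralZl//; last exact: bump_integrable.
  by apply: Rintegral_supp => // s; exact: (out (fun=> F t)).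
rewrite (@Rintegral_supp _ T R leb setT _ _ _ (out F))// -RintegralB//.
have eh : 0 <= e.
  rewrite -(pmulr_lge0 _ h0); apply: le_trans Fe.
  by apply: Rintegral_ge0.
apply: (@le_trans _ _ (e * h)); last by rewrite ler_wpM2l// bump_integral_ge.
apply: le_trans Fe.
have icst : leb.-integrable (`]t - h, t + h[%classic : set T) (EFin \o (cst (F t))).
  apply: measurable_bounded_integrable => //.
    have E := lebesgue_measure_itv `]t - h, t + h[; apply: le_lt_trans (_ : _ <= (h *+ 2)%:E)%E (ltry _).
    rewrite [leLHS]E /= lte_fin; case: ifP => _; last by rewrite lee_fin mulrn_wge0 ?ltW.
    by rewrite -EFinB lee_fin; lra.
  by exists `|F t|; split; rewrite ?num_real// => M /ltW ? ? _.
have iD : leb.-integrable (`]t - h, t + h[%classic : set T) (EFin \o (fun s => F s - F t)).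
  by have := integrableB mI iF icst; exact: eq_integrable.
apply: ae_norm_Rintegral_le => //.
- by apply: (measurable_of_integrable (mu := leb)); have := integrableB mI iFb i1; exact: eq_integrable.
- exact: (integrable_norm iD).
- by apply/aeW => s _; rewrite -mulrBl normrM ler_piMr.
Qed.

End lebesgue_points.
#[local] Opaque bump.

Section monotone_points.
Context {R : realType}.
Local Notation T := (measurableTypeR R).
Local Notation leb := (@lebesgue_measure R).
Implicit Types (F G f xi phi : R -> R).

Definition primitive phi (t : R) : R := \int[leb]_(s in `]-oo, t]) phi s.

Lemma primitive_C1 phi : continuous phi -> leb.-integrable setT (EFin \o phi) ->
  (forall t, derivable (primitive phi) t 1) /\ derive1 (primitive phi) = phi.
Proof.
move=> cphi iphi.
have H (t : R) : derivable (primitive phi) t 1 /\ derive1 (primitive phi) t = phi t.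
  apply: (@continuous_FTC1 R phi -oo%O t (t + 1)).
  - by rewrite ltrDl.
  - by apply: (@integrableS _ _ _ leb setT) => //; exact: measurable_interval.
  - exact: ltNyr.
  - exact: cphi.
by split=> [t|]; [case: (H t)|apply/funext => t; case: (H t)].
Qed.

Lemma bump_primitive (c h t : R) : 0 < h ->
  [/\ t <= c - h -> primitive (bump c h) t = 0,
      c + h <= t -> primitive (bump c h) t = \int[leb]_s bump c h s &
      0 <= primitive (bump c h) t <= \int[leb]_s bump c h s].
Proof.
move=> h0; have mI : measurable (`]-oo, t]%classic : set T) by exact: measurable_interval.
split.
- move=> tc; rewrite /primitive (@eq_Rintegral _ _ _ leb _ (cst 0)).
    by rewrite Rintegral_cst ?mul0r//; exact: mI.
  move=> s; rewrite inE /= in_itv/= => st; apply: bump0 => //.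
  by rewrite negb_and -leNgt (le_trans st tc).
- move=> tc; rewrite /primitive; apply: esym; apply: Rintegral_supp => // s _ /negP.
  rewrite /= in_itv/= -ltNge => ts; apply: bump0 => //.
  by rewrite negb_and -!leNgt (le_trans tc (ltW ts)) orbT.
- have iI := bump_integrable c h0 mI; have iT := bump_integrable c h0 (@measurableT _ T).
  rewrite Rintegral_ge0/=; last by move=> s _; exact: bump_ge0.
  apply: fine_le; [exact: integrable_fin_num iI|exact: integrable_fin_num iT|].
  apply: ge0_subset_integral => //; first by have := measurable_int leb iT.
  by move=> s _; rewrite lee_fin bump_ge0.
Qed.

(** The primitive of a difference of bumps around [t1 < t2], weighted so as to have
    integral zero, rises and then falls: it is a nonnegative test function. *)
Lemma bump_pair (t0 t1 t2 h a b : R) : 0 < h -> t0 < t1 - h -> t1 + h < t2 - h ->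
  a = \int[leb]_s bump t1 h s -> b = \int[leb]_s bump t2 h s -> 0 <= a -> 0 <= b ->
  exists xi, [/\ C1c t0 xi, forall t, 0 <= xi t &
    derive1 xi = (fun s => b * bump t1 h s - a * bump t2 h s)].
Proof.
move=> h0 t1h ltt aE bE a0 b0.
have lth : t1 - h <= t2 - h by apply: le_trans (ltW ltt); rewrite lerD2l ge0_cp// ltW.
have lth' : t1 + h <= t2 + h by apply: (le_trans (ltW ltt)); rewrite lerD2l ge0_cp// ltW.
set phi := (fun s => b * bump t1 h s - a * bump t2 h s).
have ia c (D : set T) (mD : measurable D) : leb.-integrable D (EFin \o bump c h) by exact: bump_integrable.
have i1 c k (D : set T) (mD : measurable D) : leb.-integrable D (EFin \o (fun s => k * bump c h s)).
  by have := integrableZl mD k (ia c D mD); apply: eq_integrable.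
have iphi : leb.-integrable setT (EFin \o phi).
  have := integrableB measurableT (i1 t1 b _ measurableT) (i1 t2 a _ measurableT).
  by apply: eq_integrable.
have cphi : continuous phi.
  move=> s; apply: cvgB; apply: cvgM; try exact: cvg_cst; exact: bump_continuous.
have [dp Ep] := primitive_C1 cphi iphi.
have primE t : primitive phi t = b * primitive (bump t1 h) t - a * primitive (bump t2 h) t.
  have mI : measurable (`]-oo, t]%classic : set T) by exact: measurable_interval.
  rewrite /primitive /phi RintegralB; [|exact: mI|exact: i1|exact: i1].
  rewrite RintegralZl; [|exact: mI|exact: ia].
  by rewrite RintegralZl; [|exact: mI|exact: ia].
exists (primitive phi); split; last exact: Ep.
- split; [exact: dp|by rewrite Ep|].
  exists (t1 - h), (t2 + h); split=> // t; rewrite negb_and -!ltNge primE.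
  have [l1 r1 _] := bump_primitive t1 t h0; have [l2 r2 _] := bump_primitive t2 t h0.
  move=> /orP[/ltW lt|/ltW gt].
    by rewrite (l1 lt) (l2 (le_trans lt lth)) !mulr0 subrr.
  by rewrite (r2 gt) (r1 (le_trans lth' gt)) -aE -bE mulrC subrr.
- move=> t; rewrite primE.
  have [_ r1 /andP[p1 _]] := bump_primitive t1 t h0.
  have [l2 _ /andP[_ p2]] := bump_primitive t2 t h0.
  have [lt|gt] := leP t (t2 - h).
    rewrite (l2 lt) mulr0 subr0; exact: mulr_ge0 b0 p1.
  rewrite (r1 (ltW (lt_trans ltt gt))) subr_ge0 -aE [leRHS]mulrC bE.
  exact: ler_wpM2l a0 _ _ p2.
Qed.

Lemma compare_means (F1 F2 A B a b e : R) : 0 < a -> 0 < b ->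
  `|A - F1 * a| <= e / 2 * a -> `|B - F2 * b| <= e / 2 * b -> 0 <= b * A - a * B ->
  F2 <= F1 + e.
Proof.
move=> a0 b0 HA HB K0.
have HA' : A <= (F1 + e / 2) * a by rewrite mulrDl -lerBlDl; exact: le_trans (ler_norm _) HA.
have HB' : (F2 - e / 2) * b <= B.
  by rewrite mulrBl lerBlDl -lerBlDr; move: HB; rewrite distrC; exact: le_trans (ler_norm _).
have : 0 <= b * ((F1 + e / 2) * a) - a * ((F2 - e / 2) * b).
  by apply: (le_trans K0); apply: lerB; rewrite ler_wpM2l// ltW.
rewrite (_ : _ - _ = (F1 + e - F2) * (a * b)); last by field.
by rewrite pmulr_lge0 ?mulr_gt0// subr_ge0.
Qed.

(** Testing with a primitive of a difference of bumps compares the two means. *)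
Lemma weak_le_mean_point t0 F (t1 t2 : R) : weak_le t0 F (fun=> 0) ->
  t0 < t1 -> t1 < t2 -> mean_point F t1 -> mean_point F t2 -> F t2 <= F t1.
Proof.
move=> [LF _ H] t01 t12 m1 m2; apply/ler_addgt0Pr => e e0.
have e20 : 0 < e / 2 by rewrite divr_gt0.
have [h1 h10 H1] := m1 _ e20; have [h2 h20 H2] := m2 _ e20.
have [h [h0 hh1 hh2 ht0 ht12]] : exists h, [/\ 0 < h, h < h1, h < h2, h < t1 - t0 & h < (t2 - t1) / 2].
  pose m := Num.min (Num.min h1 h2) (Num.min (t1 - t0) ((t2 - t1) / 2)).
  have m0 : 0 < m by rewrite !lt_min h10 h20 !subr_gt0 t01 divr_gt0// subr_gt0.
  exists (m / 2); have : m / 2 < m by rewrite ltr_pdivrMr// ltr_pMr// ltr1n.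
  by rewrite {2}/m !lt_min => /andP[/andP[-> ->] /andP[-> ->]]; rewrite divr_gt0.
have [ltt t1h t2h] : [/\ t1 + h < t2 - h, t0 < t1 - h & t0 < t2 - h].
  by move: t12 ht0 ht12; clear => ? ? ?; split; lra.
have iF (t : R) : t0 < t - h -> leb.-integrable `]t - h, t + h[ (EFin \o F).
  move=> Ta; have := LF _ (t + h) Ta; apply: integrableS; [exact: measurable_interval|exact: measurable_interval|].
  by apply: subset_itv; rewrite bnd_simp.
have [iFa Fa] := bump_test h0 (iF t1 t1h) (H1 h (introT andP (conj h0 hh1))).
have [iFb Fb] := bump_test h0 (iF t2 t2h) (H2 h (introT andP (conj h0 hh2))).
have ag := bump_integral_ge t1 h0; have bg := bump_integral_ge t2 h0.
have [a aE] : exists a, a = \int[leb]_s bump t1 h s by eexists; reflexivity.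
have [b bE] : exists b, b = \int[leb]_s bump t2 h s by eexists; reflexivity.
rewrite -aE in Fa ag; rewrite -bE in Fb bg.
have a0 : 0 < a by exact: lt_le_trans ag.
have b0 : 0 < b by exact: lt_le_trans bg.
have [xi [cx x0 Ex]] := bump_pair h0 t1h ltt aE bE (ltW a0) (ltW b0).
have := H _ cx x0; rewrite Ex.
under eq_Rintegral do rewrite mul0r.
rewrite Rintegral_cst// mul0r oppr0.
have j1 : leb.-integrable setT (EFin \o (fun s => b * (F s * bump t1 h s))).
  by have := integrableZl measurableT b iFa; apply: eq_integrable.
have j2 : leb.-integrable setT (EFin \o (fun s => a * (F s * bump t2 h s))).
  by have := integrableZl measurableT a iFb; apply: eq_integrable.
under eq_Rintegral do rewrite mulrBr (mulrCA _ b) (mulrCA _ a).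
rewrite RintegralB; [|exact: measurableT|exact: j1|exact: j2].
rewrite RintegralZl; [|exact: measurableT|exact: iFa].
rewrite RintegralZl; [|exact: measurableT|exact: iFb].
exact: compare_means.
Qed.

(** The comparison holds between any two Lebesgue points. *)
Lemma weak_le_nonincreasing t0 F : weak_le t0 F (fun=> 0) ->
  exists2 P : R -> Prop, {ae leb, forall t : T, t0 < t -> P t} &
    forall t1 t2, t0 < t1 -> t1 < t2 -> P t1 -> P t2 -> F t2 <= F t1.
Proof.
move=> H; exists (mean_point F); first by case: H => /Lloc_mean_point.
by move=> t1 t2 t01 t12; exact: weak_le_mean_point H t01 t12.
Qed.

End monotone_points.
(** * Monotone energies *)

Section monotone_energy.
Context {R : realType}.
Local Notation T := (measurableTypeR R).
Local Notation leb := (@lebesgue_measure R).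
Implicit Types (F G f xi phi : R -> R).

Lemma lebesgue_itv_oo (a b : R) : a <= b -> leb `]a, b[%classic = (b - a)%:E.
Proof.
move=> ab; have := lebesgue_measure_itv `]a, b[; rewrite /= lte_fin => E.
rewrite [LHS]E; move: ab; rewrite le_eqVlt => /predU1P[->|->]; last by [].
by rewrite ltxx subrr.
Qed.

Lemma lebesgue_itv_oo_lty (a b : R) : (leb `]a, b[%classic < +oo)%E.
Proof.
have [ab|/ltW ba] := leP a b; first by rewrite (lebesgue_itv_oo ab) ltry.
by rewrite set_itv_ge ?measure0// bnd_simp -leNgt.
Qed.

Lemma bounded_integrable_oo f (a b C : R) :
  measurable_fun (`]a, b[%classic : set T) f -> (forall t, `|f t| <= C) ->
  leb.-integrable (`]a, b[%classic : set T) (EFin \o f).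
Proof.
move=> mf fC; have mI : measurable (`]a, b[%classic : set T) by exact: measurable_interval.
apply: measurable_bounded_integrable => //; first exact: lebesgue_itv_oo_lty.
by exists C; split; rewrite ?num_real// => M CM t _; exact: le_trans (fC t) (ltW CM).
Qed.

Lemma ae_exists_itv (P : R -> Prop) (s t : R) : s < t -> {ae leb, forall u : T, P u} ->
  exists u, s < u < t /\ P u.
Proof.
move=> st [B [mB B0 BP]]; apply: contrapT => H.
have : (leb `]s, t[%classic <= leb B)%E.
  apply: le_measure; rewrite ?inE; [exact: measurable_interval|exact: mB|].
  move=> u; rewrite /= in_itv/= => stu; apply: BP => /= Pu; apply: H.
  by exists u.
rewrite [leLHS](lebesgue_itv_oo (ltW st)) [leRHS]B0 lee_fin subr_le0.
by rewrite leNgt st.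
Qed.

Lemma ae_exists_gt (P : R -> Prop) (s : R) : {ae leb, forall u : T, P u} ->
  exists u, s < u /\ P u.
Proof.
move=> H; have s1 : s < s + 1 by rewrite ltrDl.
by have [u [/andP[su _] Pu]] := ae_exists_itv s1 H; exists u.
Qed.

Local Notation step_size n := (n.+1%:R^-1 : R).

Lemma difference_quotient_cvg f t : derivable f t 1 ->
  (f (t + step_size n) - f t) / step_size n @[n --> \oo] --> derive1 f t.
Proof.
move=> df; apply/cvgrPdist_lt => e e0.
have : (fun h : R => h^-1 *: ((f \o shift t) (h *: 1) - f t)) h @[h --> 0^'] --> derive1 f t.
  by rewrite derive1E; exact: df.
move=> /cvgrPdist_lt/(_ _ e0); rewrite near_withinE => /nbhs_ballP[d /= d0 Hd].
have [n _ Hn] : \forall n \near \oo, step_size n < d.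
  near=> n; rewrite -[ltRHS]invrK ltf_pV2 ?posrE ?invr_gt0//.
  apply: (@lt_trans _ _ n%:R); last by rewrite ltr_nat.
  by near: n; exact: nbhs_infty_gtr.
exists n => // k /Hn hk; have := Hd (step_size k); rewrite /ball/= sub0r normrN.
rewrite gtr0_norm ?invr_gt0// => /(_ hk); rewrite invr_eq0 pnatr_eq0 => /(_ isT).
by rewrite /shift/= [_ *: 1]mulr1 [_ + t]addrC -[_ *: _]/(_ * _) mulrC.
Unshelve. all: by end_near. Qed.

Section nonincreasing.
Variables (F : R -> R) (C : R).
Hypothesis F_ni : forall s t, s <= t -> F t <= F s.
Hypothesis F0 : forall t, 0 <= F t.
Hypothesis FC : forall t, F t <= C.

Let mF (D : set T) : measurable D -> measurable_fun D F.
Proof. by move=> mD; apply: nonincreasing_measurable => // s t; exact: F_ni. Qed.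

Let mFs (D : set T) (h : R) : measurable D -> measurable_fun D (fun t => F (t + h)).
Proof. by move=> mD; apply: nonincreasing_measurable => // s t st; apply: F_ni; rewrite lerD2r. Qed.

Let FnC t : `|F t| <= C.
Proof. by rewrite ger0_norm. Qed.

Let C0 : 0 <= C. Proof. exact: le_trans (F0 0) (FC 0). Qed.

Let iF (a b : R) : leb.-integrable (`]a, b[%classic : set T) (EFin \o F).
Proof. by apply: (bounded_integrable_oo (C := C)) => //; apply: mF; exact: measurable_interval. Qed.

Let iFs (a b h : R) : leb.-integrable (`]a, b[%classic : set T) (EFin \o (fun t => F (t + h))).
Proof. by apply: (bounded_integrable_oo (C := C)) => //; apply: mFs; exact: measurable_interval. Qed.

Lemma integral_shift (a b h : R) :
  \int[leb]_(t in `]a, b[) F (t + h) = \int[leb]_(t in `]a + h, b + h[) F t.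
Proof.
rewrite /Rintegral integral_mkcond [in RHS]integral_mkcond; congr fine.
pose g : R -> \bar R := (EFin \o F) \_ `]a + h, b + h[.
have mg : measurable_fun [set: T] g.
  have mFI : measurable_fun (`]a + h, b + h[%classic : set T) (EFin \o F).
    by apply/measurable_EFinP; apply: mF; exact: measurable_interval.
  exact: (measurable_restrictT _ (measurable_interval _)).1 mFI.
have g0 t : (0 <= g t)%E by rewrite /g patchE; case: ifP => // _; rewrite lee_fin.
have := @ge0_integral_affine R 1 h g (oner_neq0 _) mg g0.
rewrite normr1 invr1 mul1e => <-; apply: eq_integral => t _.
by rewrite /g !patchE mul1r !mem_setE !in_itv/= !ltrD2r.
Qed.

(** All but two end intervals of length [h] cancel. *)
Lemma integral_decrease (a b h : R) : a <= b -> 0 < h ->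
  \int[leb]_(t in `]a, b[) (F t - F (t + h)) <= h * C.
Proof.
move=> ab h0.
have mI u v : measurable (`]u, v[%classic : set T) by exact: measurable_interval.
rewrite RintegralB; [|exact: mI|exact: iF|exact: iFs].
rewrite integral_shift.
have sub u v v' : v <= v' ->
    \int[leb]_(t in `]u, v[) F t <= \int[leb]_(t in `]u, v'[) F t.
  move=> vv; rewrite /Rintegral; apply: fine_le; [exact: integrable_fin_num (iF _ _)|exact: integrable_fin_num (iF _ _)|].
  apply: ge0_subset_integral => //.
  - by apply/measurable_EFinP; exact: mF.
  - by move=> t _; rewrite lee_fin.
  - by apply: subset_itv; rewrite bnd_simp.
have split := @Rintegral_itvB R F (BRight a) (BLeft (b + h)) (a + h) (iF a (b + h)).
rewrite !bnd_simp in split.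
have {}split : \int[leb]_(t in `]a, b + h[) F t = \int[leb]_(t in `]a, a + h[) F t +
    \int[leb]_(t in `]a + h, b + h[) F t.
  have [ba|ba] := eqVneq a b.
    by rewrite ba (set_itv_ge (b1 := BRight (b + h))) ?bnd_simp ?ltxx// Rintegral_set0 addr0.
  have a_b : a < b by rewrite lt_neqAle ba.
  rewrite -split ?lerDl ?(ltW h0) ?ltrD2r// -Rintegral_itv_bndo_bndc; last exact: iF.
  by rewrite [RHS]addrC subrK.
apply: (@le_trans _ _ (\int[leb]_(t in `]a, a + h[) F t)).
  rewrite lerBlDr -split; apply: sub => //.
  by rewrite lerDl ltW.
apply: (@le_trans _ _ (\int[leb]_(t in `]a, a + h[) C)).
  apply: le_Rintegral => //; apply: (bounded_integrable_oo (C := C)) => //.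
  by move=> t; rewrite ger0_norm.
rewrite Rintegral_cst//.
by have := @lebesgue_itv_oo a (a + h); rewrite lerDl (ltW h0) => /(_ isT) E; rewrite [X in fine X]E /= addrC addKr mulrC.
Qed.

(** The derivative of a bounded monotone function is small somewhere: truncating
    the difference quotients at [delta / 2] makes dominated convergence apply. *)
Lemma derive_not_bounded_away (delta s : R) : 0 < delta ->
  {ae leb, forall t : T, s < t -> derivable F t 1 /\ derive1 F t <= - delta} -> False.
Proof.
move=> d0 H.
have d20 : 0 < delta / 2 by rewrite divr_gt0.
(* On a window of length [w] a decrease at rate [delta / 2] would exceed [C]. *)
pose w := C / (delta / 2) + 1.
have w0 : 0 < w by rewrite ltr_wpDl// divr_ge0// ltW.
pose I : set T := `]s, s + w[%classic.
have mI : measurable I by exact: measurable_interval.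
have sw : s <= s + w by rewrite lerDl ltW.
have muI : fine (leb I) = w by rewrite /I [X in fine X](lebesgue_itv_oo sw) /= addrC addKr.
pose q n (t : R) := (F t - F (t + step_size n)) / step_size n.
have h0 n : 0 < step_size n by rewrite invr_gt0.
have q0 n t : 0 <= q n t.
  by rewrite divr_ge0 ?(ltW (h0 n))// subr_ge0; apply: F_ni; rewrite lerDl ltW.
have mq n : measurable_fun I (q n).
  by apply: measurable_funM => //; apply: measurable_funB; [exact: mF|exact: mFs].
have iq n : leb.-integrable I (EFin \o q n).
  have iB := integrableB mI (iF _ _) (iFs s (s + w) (step_size n)).
  have := integrableZr mI (step_size n)^-1 iB; apply: eq_integrable => //.
pose g n t := Num.min (q n t) (delta / 2).
have mg n : measurable_fun I (g n).
  by apply: measurable_minr => //; exact: mq.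
have [] := @Rdominated_cvg _ T R leb I g (cst (delta / 2)) (cst (delta / 2)) mI mg.
- exact: measurable_cst.
- apply: filterS H => t Ht It; have st : s < t by move: It; rewrite /I /= in_itv/= => /andP[].
  have [dF dF1] := Ht st.
  apply: cvg_near_cst.
  have qc : q n t @[n --> \oo] --> - derive1 F t.
    rewrite (_ : (fun n => q n t) = (fun n => - ((F (t + step_size n) - F t) / step_size n))).
      by apply: cvgN; exact: difference_quotient_cvg.
    by apply/funext => n; rewrite /q -mulNr opprB.
  have lt2 : delta / 2 < - derive1 F t.
    rewrite ltrNr; apply: (le_lt_trans dF1); rewrite ltrN2 ltr_pdivrMr// ltr_pMr// ltr1n//.
  have : \forall n \near \oo, delta / 2 < q n t by exact: (cvgr_gt _ qc _ lt2).
  apply: filterS => n /ltW qn.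
  by rewrite /g; apply/min_idPr.
- apply: (bounded_integrable_oo (C := delta / 2)); first exact: measurable_cst.
  by move=> t; rewrite ger0_norm ?(ltW d20).
- apply/aeW => t _ n; rewrite ger0_norm; first by rewrite ge_min lexx orbT.
  by rewrite le_min q0 (ltW d20).
- move=> ig _; rewrite Rintegral_cst// -/I muI => cg.
  have gC n : \int[leb]_(t in I) g n t <= C.
    apply: (@le_trans _ _ (\int[leb]_(t in I) q n t)).
      by apply: le_Rintegral => // t _; rewrite ge_min lexx.
    have iB := integrableB mI (iF _ _) (iFs s (s + w) (step_size n)).
    have iB' : leb.-integrable I (EFin \o (fun t => F t - F (t + step_size n))).
      by apply: eq_integrable iB.
    rewrite /q RintegralZr; [|exact: mI|exact: iB'].
    rewrite ler_pdivrMr// mulrC.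
    exact: integral_decrease.
  have : lim (\int[leb]_(t in I) g n t @[n --> \oo]) <= C.
    by apply: limr_le; [exact: cvgP cg|exact: nearW].
  rewrite (cvg_lim _ cg)//.
  rewrite leNgt => /negP; apply.
  rewrite /w mulrDr mulr1 mulrCA divff ?gt_eqF// mulr1 ltrDl.
  exact: d20.
Qed.

(** Moving the difference quotient from the test function to [F] makes the sign
    of its increments appear. *)
Lemma nonincreasing_weak_le t0 : weak_le t0 F (fun=> 0).
Proof.
have L0 : Lloc t0 F.
  move=> a b _; have := iF (a - 1) (b + 1).
  apply: integrableS; [exact: measurable_interval|exact: measurable_interval|].
  by apply: subset_itv; rewrite bnd_simp ?ltrBlDr ltrDl.
split=> //; first by move=> a b _; exact: continuous_integrable_itv _ _ (fun=> cvg_cst _).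
move=> xi cxi xi0; under eq_Rintegral do rewrite mul0r.
rewrite Rintegral_cst// mul0r oppr0.
have [a [b [ta x0 dx0]]] := C1c_deriv0 cxi; have [dx cdx _] := cxi.
have cx := C1c_continuous cxi.
have h0 n : 0 < step_size n by rewrite invr_gt0.
have h1 n : step_size n <= 1 by rewrite invf_le1 ?ler1n// ltr0n.
have [K K0 HK] : exists2 K, 0 <= K & forall t, `|derive1 xi t| <= K.
  have := continuous_compact (continuous_subspaceT cdx) (@segment_compact R a b).
  move=> /compact_bounded[M [_ HM]]; exists (`|M| + 1); first by rewrite addr_ge0.
  move=> t; have [tab|tab] := boolP (a <= t <= b); last by rewrite dx0// normr0 addr_ge0.
  apply: (HM (`|M| + 1)); first by rewrite ltr_pwDr// ler_norm.
  by exists t => //=; rewrite in_itv.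
have mx : measurable_fun [set: T] xi by exact: continuous_measurable_fun.
have mxs h : measurable_fun [set: T] (fun t => xi (t + h)).
  by apply: continuous_measurable_fun => t; apply: continuous_comp; [apply: cvgD; [exact: cvg_id|exact: cvg_cst]|exact: cx].
have mdx : measurable_fun [set: T] (derive1 xi) by exact: continuous_measurable_fun.
pose q n (t : R) := F t * ((xi (t + step_size n) - xi t) / step_size n).
pose I : set T := `]a - 2, b + 2[%classic.
have mI : measurable I by exact: measurable_interval.
have supp t : ~ I t -> forall h, 0 <= h <= 1 -> xi (t + h) = 0.
  rewrite /I /= in_itv/= => /negP H h /andP[hh0 hh1]; apply: x0.
  move: H; rewrite !negb_and -!leNgt -!ltNge => /orP[H|H]; apply/orP; [left|right].
    by apply: (le_lt_trans (lerD H hh1)); lra.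
  by apply: (@lt_le_trans _ _ (b + 2)); [rewrite ltrDl|rewrite (le_trans H)// lerDl].
have supp' t : ~ I t -> xi t = 0.
  by move=> nI; have := supp t nI 0; rewrite lexx ler01 addr0 => /(_ isT).
have I1 : leb.-integrable I (EFin \o (fun=> C * K)).
  by apply: (bounded_integrable_oo (C := C * K)) => // t; rewrite ger0_norm ?mulr_ge0.
have [] := @Rdominated_cvg _ T R leb I q (fun t => F t * derive1 xi t) (fun=> C * K) mI.
- move=> n; apply: measurable_funM; first exact: mF.
  by apply: measurable_funM => //; apply: measurable_funB; exact: measurable_funTS.
- by apply: measurable_funM; [exact: mF|exact: measurable_funTS].
- apply/aeW => t _; apply: cvgM; first exact: cvg_cst.
  by apply: difference_quotient_cvg; exact: dx.
- exact: I1.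
- apply/aeW => t _ n; rewrite normrM; apply: ler_pM => //.
  have [c _] : exists2 c, c \in `[t, t + step_size n] & xi (t + step_size n) - xi t = derive1 xi c * (t + step_size n - t).
    apply: MVT_segment; first by rewrite lerDl ltW.
      by move=> u _; rewrite derive1E; exact: derivableP.
    exact: continuous_subspaceT.
  by rewrite addrAC subrr add0r => ->; rewrite mulfK ?gt_eqF.
- move=> iq idx cq.
  have q_ge0 n : 0 <= \int[leb]_(t in I) q n t.
    have bnd (u : R -> R) : measurable_fun [set: T] u -> (exists K', forall t, `|u t| <= K') ->
        leb.-integrable I (EFin \o (fun t => F t * u t)).
      move=> mu [K' uK]; apply: (integrableM_bounded (C := K') mI (iF _ _)) => //.
      exact: measurable_funTS.
    have [K' HK'] : exists K', forall t, `|xi t| <= K'.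
      have := continuous_compact (continuous_subspaceT cx) (@segment_compact R a b).
      move=> /compact_bounded[M [_ HM]]; exists (`|M| + 1) => t.
      have [tab|tab] := boolP (a <= t <= b); last by rewrite x0// normr0 addr_ge0.
      apply: (HM (`|M| + 1)); first by rewrite ltr_pwDr// ler_norm.
      by exists t => //=; rewrite in_itv.
    have b1 := bnd _ (mxs (step_size n)) (ex_intro _ K' (fun t => HK' (t + step_size n))).
    have b2 := bnd _ mx (ex_intro _ K' HK').
    have -> : \int[leb]_(t in I) q n t =
        (\int[leb]_(t in I) (F t * xi (t + step_size n)) - \int[leb]_(t in I) (F t * xi t)) / step_size n.
      rewrite -RintegralB; [|exact: mI|exact: b1|exact: b2].
      have b3 : leb.-integrable I (EFin \o (fun t => F t * xi (t + step_size n) - F t * xi t)).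
        by have := integrableB mI b1 b2; apply: eq_integrable.
      rewrite -RintegralZr; [|exact: mI|exact: b3].
      by apply: eq_Rintegral => t _; rewrite /q mulrA mulrBr.
    rewrite divr_ge0 ?(ltW (h0 n))// subr_ge0.
    have out (u : R -> R) : (forall t, ~ I t -> u t = 0) ->
        leb.-integrable I (EFin \o (fun t => F t * u t)) ->
        \int[leb]_(t in I) (F t * u t) = \int[leb]_t (F t * u t) /\
        leb.-integrable setT (EFin \o (fun t => F t * u t)).
      move=> u0 iu; split.
        by apply: esym; apply: Rintegral_supp => // t _ /u0 ->; rewrite mulr0.
      by apply: (@integrable_supp _ T R leb setT I) => // t _ /u0 ->; rewrite mulr0.
    have [-> b1'] := out _ (fun t nI => supp t nI _ (introT andP (conj (ltW (h0 n)) (h1 n)))) b1.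
    have [-> b2'] := out _ supp' b2.
    have mG : measurable_fun [set: T] (fun t : R => (F (t - step_size n) * xi t)%:E).
      by apply/measurable_EFinP; apply: measurable_funM => //; exact: mFs.
    have G0 (t : R) : (0 <= (F (t - step_size n) * xi t)%:E)%E by rewrite lee_fin mulr_ge0.
    have := @ge0_integral_affine R 1 (step_size n) _ (oner_neq0 _) mG G0.
    under eq_integral do rewrite mul1r addrK.
    rewrite normr1 invr1 mul1e /Rintegral => E.
    apply: fine_le; [exact: integrable_fin_num b2'|exact: integrable_fin_num b1'|].
    rewrite [leRHS]E; apply: ge0_le_integral => //.
    + by move=> t _; rewrite lee_fin mulr_ge0.
    + exact: (measurable_int leb b2').
    + by move=> t _; rewrite lee_fin ler_wpM2r// F_ni// gerBl ltW.
  have : 0 <= lim (\int[leb]_(t in I) q n t @[n --> \oo]).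
    by apply: limr_ge; [exact: cvgP cq|exact: nearW].
  rewrite (cvg_lim _ cq)//.
  move=> H; rewrite (@Rintegral_supp _ T R leb setT I)// => t _ nI.
  rewrite dx0 ?mulr0//; apply/negP => /andP[at_ tb]; apply: nI.
  by rewrite /I /= in_itv/=; apply/andP; split; lra.
Qed.

End nonincreasing.
(** By [bump_test] the function vanishes at its Lebesgue points. *)
Lemma bump_orthogonal t0 F : Lloc t0 F ->
  (forall t h, 0 < h -> t0 < t - h -> \int[leb]_s (F s * bump t h s) = 0) ->
  {ae leb, forall t : T, t0 < t -> F t = 0}.
Proof.
move=> LF H; apply: filterS (Lloc_mean_point LF) => t Ht t0t.
apply/eqP; rewrite -normr_le0; apply/ler_addgt0Pr => e e0; rewrite add0r.
have [h1 h10 Hh] := Ht t0t e e0.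
have [h [h0 hh1 ht]] : exists h, [/\ 0 < h, h < h1 & h < t - t0].
  have m0 : 0 < Num.min h1 (t - t0) by rewrite lt_min h10 subr_gt0.
  exists (Num.min h1 (t - t0) / 2); have : Num.min h1 (t - t0) / 2 < Num.min h1 (t - t0).
    by rewrite ltr_pdivrMr// ltr_pMr// ltr1n.
  by rewrite lt_min => /andP[-> ->]; rewrite divr_gt0.
have th : t0 < t - h by rewrite ltrBrDr -ltrBrDl.
have iF : leb.-integrable `]t - h, t + h[ (EFin \o F).
  have := LF _ (t + h) th; apply: integrableS; [exact: measurable_interval|exact: measurable_interval|].
  by apply: subset_itv; rewrite bnd_simp.
have [_] := bump_test h0 iF (Hh h (introT andP (conj h0 hh1))).
rewrite H// sub0r normrN normrM => K.
have a0 : 0 < \int[leb]_s bump t h s := lt_le_trans h0 (bump_integral_ge t h0).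
by move: K; rewrite (gtr0_norm a0) ler_pM2r.
Qed.

End monotone_energy.
(** * Functions of space and time *)

Section slices.
Context {R : realType} {N : nat}.
Local Notation T := (measurableTypeR R).
Local Notation muX := (@lebesgue_rV R N).
Local Notation muT := (@lebesgue_measure R).
Local Notation mu2 := (muX \x muT)%E.
Implicit Types (g G : 'rV[R]_N * R -> R) (eta : R -> R).

Definition slab (tau : R) : set ('rV[T]_N * T) := setT `*` `]0, tau[%classic.

Lemma measurable_slab tau : measurable (slab tau).
Proof. by apply: measurableX => //; exact: measurable_interval. Qed.

Lemma measurable_space_time : measurable (@space_time R N).
Proof. by apply: measurableX => //; exact: measurable_interval. Qed.

Lemma slab_space_time tau : slab tau `<=` @space_time R N.
Proof. by move=> z [_ /=]; rewrite in_itv/= => /andP[z0 _]; split=> //=; rewrite in_itv/= z0. Qed.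

(** Fubini for null sets. *)
Lemma ae_slice (P : 'rV[R]_N * R -> Prop) :
  {ae mu2, forall z : 'rV[T]_N * T, 0 < z.2 -> P z} ->
  {ae muT, forall t : T, 0 < t -> {ae muX, forall x : 'rV[T]_N, P (x, t)}}.
Proof.
move=> [B [mB B0 BP]].
pose h (t : T) := (\int[muX]_x (\1_B (x, t))%:E)%E.
have m1 : measurable_fun setT (EFin \o \1_B : 'rV[T]_N * T -> \bar R).
  by apply/measurable_EFinP; exact: measurable_indic.
have p1 (z : 'rV[T]_N * T) : (0 <= (EFin \o \1_B) z :> \bar R)%E by rewrite /= lee_fin indicE.
have mh : measurable_fun [set: T] h.
  exact: (@measurable_fun_fubini_tonelli_G _ _ _ _ _ muX _ m1 p1).
have h0 t : (0 <= h t)%E by apply: integral_ge0 => x _; exact: (p1 (x, t)).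
have ih : (\int[muT]_t `|h t| = 0)%E.
  under eq_integral do rewrite gee0_abs//.
  have := @fubini_tonelli2 _ _ _ _ _ muX muT _ m1 p1; rewrite /= => <-.
  by rewrite integral_indic// setIT; exact: B0.
have := (ae_eq_integral_abs muT measurableT mh).1 ih.
apply: filterS => t /(_ I) /= ht t0.
exists [set x | B (x, t)]; split.
- by have := @measurable_ysection _ _ _ _ B t mB; congr measurable; apply/seteqP; split=> x; rewrite /ysection /= ?inE.
- have mBt : measurable ([set x | B (x, t)] : set 'rV[T]_N).
    by have := @measurable_ysection _ _ _ _ B t mB; congr measurable; apply/seteqP; split=> x; rewrite /ysection /= ?inE.
  rewrite -[RHS]ht /h -(setIT [set x | B (x, t)]) -integral_indic//.
- by move=> x nP; apply: BP => /= H; apply: nP; exact: H.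
Qed.

(** Local integrability in time of the L^1 norm over the whole space. *)
Definition locally_finite g : Prop := measurable_fun (@space_time R N) g /\
  forall tau, mu2.-integrable (slab tau) (EFin \o g).

Definition slice g (t : R) : R := \int[muX]_x g (x, t).

Lemma measurable_section g t : measurable_fun (@space_time R N) g -> 0 < t ->
  measurable_fun [set: 'rV[T]_N] (fun x => g (x, t)).
Proof.
move=> mg t0.
have mp : measurable_fun [set: 'rV[T]_N] (fun x : 'rV[T]_N => (x, t) : 'rV[T]_N * T).
  exact: measurable_fun_pair.
apply: (@measurable_comp _ _ _ _ _ _ (@space_time R N) g _ (fun x : 'rV[T]_N => (x, t))) => //.
- exact: measurable_space_time.
- by move=> _ [x _ <-]; split=> //=; rewrite in_itv/= t0.
Qed.

Lemma locally_finite_slice g : locally_finite g ->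
  {ae muT, forall t : T, 0 < t -> muX.-integrable setT (EFin \o (fun x => g (x, t)))}.
Proof.
move=> [mg ig].
have : {ae muT, forall t : T, forall n : nat, muX.-integrable setT
    (fun x => ((EFin \o g) \_ (slab n%:R)) (x, t))}.
  apply: ae_foralln => n.
  apply: (@ae_integrable2 _ _ _ _ _ muX muT ((EFin \o g) \_ (slab n%:R))).
  by rewrite -integrable_mkcond//; exact: measurable_slab.
apply: filterS => t Ht t0; have := Ht (Num.truncn t).+1.
apply: eq_integrable => // x _; rewrite patchE mem_set//; split=> //=.
by rewrite in_itv/= t0 truncnS_gt.
Qed.

Lemma slice_integrable g tau : locally_finite g ->
  muT.-integrable `]0, tau[ (EFin \o slice g) /\
  \int[muT]_(t in `]0, tau[) slice g t = \int[mu2]_(z in slab tau) g z.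
Proof.
move=> lg; have [mg ig] := lg.
pose f := (EFin \o g) \_ (slab tau).
have i_f : mu2.-integrable setT f.
  by rewrite -integrable_mkcond; [exact: ig|exact: measurable_slab].
have mI : measurable (`]0, tau[%classic : set T) by exact: measurable_interval.
pose G t := (\int[muX]_x f (x, t))%E.
have mf : measurable_fun setT f by exact: (measurable_int mu2 i_f).
have iG : muT.-integrable setT G.
  apply/integrableP; split; first exact: (@measurable_fubini_G _ _ _ _ _ muX muT f i_f).
  apply: le_lt_trans ((integrable21ltyP muX muT mf).1 i_f).
  have mabs : measurable_fun setT (abse \o f) by exact: measurableT_comp.
  apply: ge0_le_integral => //.
  - by apply: measurableT_comp => //; exact: (@measurable_fubini_G _ _ _ _ _ muX muT f i_f).
  - exact: (@measurable_fun_fubini_tonelli_G _ _ _ _ _ muX (abse \o f) mabs (fun z => abse_ge0 (f z))).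
  - move=> t _; apply: le_abse_integral => //.
    exact: (measurableT_comp mf (measurable_pair2 t)).
have GE t : `]0, tau[%classic t -> G t = (\int[muX]_x (g (x, t))%:E)%E.
  by move=> It; apply: eq_integral => x _; rewrite /f patchE mem_set.
have sE t : `]0, tau[%classic t -> slice g t = fine (G t) by move=> /GE ->.
have iGI : muT.-integrable (`]0, tau[%classic : set T) G.
  exact: (@integrableS _ _ _ _ setT).
have ms : measurable_fun (`]0, tau[%classic : set T) (slice g).
  apply: (@eq_measurable_fun _ _ _ _ _ (fine \o G)).
    by move=> t /set_mem It; rewrite /= sE.
  by apply: measurableT_comp => //; exact: (measurable_int muT iGI).
have is_ : muT.-integrable (`]0, tau[%classic : set T) (EFin \o slice g).
  apply: (@le_integrable _ _ _ _ _ mI _ G) => //; first exact/measurable_EFinP.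
  move=> t It; rewrite /= sE//; case: (G t) => [r| |] //=.
  - by rewrite normr0 leey.
  - by rewrite normr0 leey.
split=> //.
rewrite /Rintegral; congr fine.
transitivity (\int[muT]_(t in `]0%R, tau[) G t)%E.
  apply: ae_eq_integral => //; [exact/measurable_EFinP|exact: measurable_int iGI|].
  apply: filterS (locally_finite_slice lg) => t Ht It.
  have t0 : 0 < t by move: It; rewrite /= in_itv/= => /andP[].
  by rewrite GE// /= /slice /Rintegral fineK// integrable_fin_num// Ht.
rewrite [RHS]integral_mkcond -/f [LHS]integral_mkcond.
rewrite -(@integral21_prod_meas1 _ _ _ _ _ muX muT f i_f).
apply: eq_integral => t _; rewrite patchE; case: ifPn => // nIt.
rewrite /fubini_G; apply: esym; rewrite -[RHS](@integral0 _ _ _ muX setT); apply: eq_integral => x _.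
rewrite /f patchE memNset// => -[_ /= It].
by move: nIt; rewrite notin_setE; apply.
Qed.

Lemma Lloc_slice g : locally_finite g -> Lloc 0 (slice g).
Proof.
move=> lg a b a0; have [+ _] := slice_integrable (b + 1) lg.
apply: integrableS; [exact: measurable_interval|exact: measurable_interval|].
by apply: subset_itv; rewrite bnd_simp// ltrDl.
Qed.

Lemma locally_finite_dom g G : measurable_fun (@space_time R N) g -> locally_finite G ->
  {ae mu2, forall z : 'rV[T]_N * T, 0 < z.2 -> `|g z| <= G z} -> locally_finite g.
Proof.
move=> mg [mG iG] gG; split=> // tau.
apply: (@ae_integrable_dom _ _ _ mu2 (slab tau) g G); [exact: measurable_slab| |exact: iG|].
  by apply: measurable_funS mg; [exact: measurable_space_time|exact: slab_space_time].
by apply: filterS gG => z Hz [_ /=]; rewrite in_itv/= => /andP[z0 _]; exact: Hz.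
Qed.

Lemma locally_finiteD g G : locally_finite g -> locally_finite G ->
  locally_finite (fun z => g z + G z).
Proof.
move=> [mg ig] [mG iG]; split; first exact: measurable_funD.
move=> tau; have := integrableD (measurable_slab tau) (ig tau) (iG tau).
by apply: eq_integrable => //; exact: measurable_slab.
Qed.

Lemma locally_finiteZ g (k : R) : locally_finite g -> locally_finite (fun z => k * g z).
Proof.
move=> [mg ig]; split; first exact: measurable_funM.
move=> tau; have := integrableZl (measurable_slab tau) k (ig tau).
by apply: eq_integrable => //; exact: measurable_slab.
Qed.

(** The space C_c(]0, oo[). *)
Definition Cc eta : Prop := continuous eta /\
  exists a b, 0 < a /\ forall t, ~~ (a <= t <= b) -> eta t = 0.

Lemma C1c_Cc xi : C1c 0 xi -> Cc xi /\ Cc (derive1 xi).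
Proof.
move=> cx; have [a [b [a0 H1 H2]]] := C1c_deriv0 cx; have [_ c1 _] := cx.
by split; split; [exact: C1c_continuous cx|exists a, b|exact: c1|exists a, b].
Qed.

Lemma Cc_bounded eta : Cc eta -> exists2 C, 0 < C & forall t, `|eta t| <= C.
Proof.
move=> [ceta [a [b [_ e0]]]].
have := continuous_compact (continuous_subspaceT ceta) (@segment_compact R a b).
move=> /compact_bounded[M [_ HM]]; exists (`|M| + 1); first by rewrite ltr_wpDl.
move=> t; have [tab|tab] := boolP (a <= t <= b); last by rewrite e0// normr0 addr_ge0.
apply: (HM (`|M| + 1)); first by rewrite ltr_pwDr// ler_norm.
by exists t => //=; rewrite in_itv.
Qed.

Lemma locally_finite_bounded_time g eta (C : R) : locally_finite g -> continuous eta ->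
  (forall t, `|eta t| <= C) -> locally_finite (fun z => g z * eta z.2).
Proof.
move=> lg ce HC; have [mg _] := lg.
have me : measurable_fun [set: 'rV[T]_N * T] (fun z : 'rV[T]_N * T => eta z.2).
  by apply: (measurableT_comp _ measurable_snd); exact: continuous_measurable_fun.
have ln : locally_finite (fun z => `|g z|).
  split; first exact: measurableT_comp.
  by move=> tau; have := integrable_norm (lg.2 tau).
apply: (locally_finite_dom _ (locally_finiteZ C ln)).
  by apply: measurable_funM => //; exact: measurable_funTS.
by apply/aeW => z _; rewrite normrM mulrC ler_wpM2r.
Qed.

Lemma locally_finite_time g eta : locally_finite g -> Cc eta ->
  locally_finite (fun z => g z * eta z.2).
Proof.
move=> lg ce; have [C C0 HC] := Cc_bounded ce.
by apply: (locally_finite_bounded_time lg _ HC); case: ce.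
Qed.

Lemma pairing_slab g eta a b : locally_finite g -> Cc eta -> 0 < a ->
  (forall t, ~~ (a <= t <= b) -> eta t = 0) ->
  time_space_integral (fun x t => g (x, t) * eta t) = \int[muT]_t (slice g t * eta t) /\
  \int[muT]_t (slice g t * eta t) = \int[mu2]_(z in slab (b + 1)) (g z * eta z.2).
Proof.
move=> lg ce a0 e0; have lge := locally_finite_time lg ce.
have [i1 E1] := slice_integrable (b + 1) lge.
have sub : (`]0, b + 1[%classic : set R) `<=` `]0, +oo[%classic by apply: subset_itv.
have out t : ~ `]0, b + 1[%classic t -> eta t = 0.
  rewrite /= in_itv/= => /negP H; apply: e0; apply: contra H => /andP[at_ tb].
  by rewrite (lt_le_trans a0 at_) (le_lt_trans tb)// ltrDl.
have A1 : time_space_integral (fun x t => g (x, t) * eta t) =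
    \int[muT]_(t in `]0, b + 1[) slice (fun z => g z * eta z.2) t.
  rewrite /time_space_integral; apply: Rintegral_supp => // t _ /out t0.
  by under eq_Rintegral do rewrite t0 mulr0; rewrite Rintegral_cst// mul0r.
have A2 : \int[muT]_t (slice g t * eta t) = \int[muT]_(t in `]0, b + 1[) (slice g t * eta t).
  by apply: Rintegral_supp => // t _ /out ->; rewrite mulr0.
suff A3 : \int[muT]_(t in `]0, b + 1[) slice (fun z => g z * eta z.2) t =
    \int[muT]_(t in `]0, b + 1[) (slice g t * eta t).
  by rewrite A1 A2 A3; split=> //; rewrite -A3 E1.
have mI : measurable (`]0, b + 1[%classic : set T) by exact: measurable_interval.
have [i2 _] := slice_integrable (b + 1) lg.
apply: ae_eq_Rintegral => //.
- exact: (measurable_of_integrable i1).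
- apply: measurable_funM; first exact: (measurable_of_integrable i2).
  by apply: measurable_funTS; apply: continuous_measurable_fun; case: ce.
- apply: filterS (locally_finite_slice lg) => t Ht.
  rewrite /= in_itv/= => /andP[t0 _].
  by rewrite /slice /= RintegralZr//; exact: Ht.
Qed.

Lemma pairing g eta : locally_finite g -> Cc eta ->
  time_space_integral (fun x t => g (x, t) * eta t) = \int[muT]_t (slice g t * eta t).
Proof.
move=> lg ce; have [_ [a [b [a0 e0]]]] := ce.
by have [] := pairing_slab lg ce a0 e0.
Qed.

(** Dominated convergence for space integrals tested in time. *)
Lemma pairing_cvg (g_ : nat -> 'rV[R]_N * R -> R) g G eta :
  (forall n, measurable_fun (@space_time R N) (g_ n)) ->
  measurable_fun (@space_time R N) g -> locally_finite G -> Cc eta ->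
  {ae mu2, forall z : 'rV[T]_N * T, 0 < z.2 -> forall n, `|g_ n z| <= G z} ->
  (forall z, g_ n z @[n --> \oo] --> g z) ->
  [/\ forall n, locally_finite (g_ n), locally_finite g &
   \int[muT]_t (slice (g_ n) t * eta t) @[n --> \oo] --> \int[muT]_t (slice g t * eta t)].
Proof.
move=> mg_ mg lG ce gG gc; have [_ [a [b [a0 e0]]]] := ce.
have lg_ n : locally_finite (g_ n).
  by apply: locally_finite_dom (mg_ n) lG _; apply: filterS gG => z Hz z0; exact: Hz.
have lg : locally_finite g.
  apply: locally_finite_dom mg lG _; apply: filterS gG => z Hz z0.
  have nc : `|g_ n z| @[n --> \oo] --> `|g z| by apply: cvg_norm; exact: gc.
  rewrite -(cvg_lim _ nc)//; apply: limr_le; first exact: cvgP nc.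
  by apply: nearW => n; exact: Hz.
split=> //.
have [C C0 HC] := Cc_bounded ce.
have E h : locally_finite h -> \int[muT]_t (slice h t * eta t) = \int[mu2]_(z in slab (b + 1)) (h z * eta z.2).
  by move=> lh; have [] := pairing_slab lh ce a0 e0.
rewrite E//; under eq_fun do rewrite E//.
have mS := measurable_slab (b + 1).
have sub := @slab_space_time (b + 1).
have me : measurable_fun (slab (b + 1)) (fun z : 'rV[T]_N * T => eta z.2).
  apply: measurable_funTS.
  by apply: (measurableT_comp _ measurable_snd); apply: continuous_measurable_fun; case: ce.
have [] := @Rdominated_cvg _ _ _ mu2 (slab (b + 1)) (fun n z => g_ n z * eta z.2) (fun z => g z * eta z.2) (fun z => C * G z) mS.
- by move=> n; apply: measurable_funM => //; apply: measurable_funS (mg_ n) => //; exact: measurable_space_time.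
- by apply: measurable_funM => //; apply: measurable_funS mg => //; exact: measurable_space_time.
- by apply/aeW => z _; apply: cvgM; [exact: gc|exact: cvg_cst].
- exact: (locally_finiteZ C lG).2.
- apply: filterS gG => z Hz [_ /=]; rewrite in_itv/= => /andP[z0 _] n.
  by rewrite normrM mulrC ler_pM// Hz.
- by move=> _ _.
Qed.

End slices.
Section local_finiteness.
Context {R : realType} {N : nat}.
Local Notation T := (measurableTypeR R).
Local Notation muX := (@lebesgue_rV R N).
Local Notation muT := (@lebesgue_measure R).
Local Notation mu2 := (muX \x muT)%E.
Implicit Types (g G : 'rV[R]_N * R -> R).

Lemma locally_finite_sum (g : 'I_N -> 'rV[R]_N * R -> R) : (forall i, locally_finite (g i)) ->
  locally_finite (fun z => \sum_(i < N) g i z).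
Proof.
move=> lg; have H (s : seq 'I_N) : locally_finite (fun z => \sum_(i <- s) g i z).
  elim: s => [|i s IH].
    under eq_fun do rewrite big_nil; split=> [|tau]; first exact: measurable_cst.
    exact: integrable0.
  under eq_fun do rewrite big_cons; exact: locally_finiteD.
exact: H.
Qed.


Lemma slabW (s t : R) : s <= t -> @slab R N s `<=` slab t.
Proof.
move=> st z [_ /=]; rewrite in_itv/= => /andP[z0 zs]; split=> //=.
by rewrite in_itv/= z0 (lt_le_trans zs st).
Qed.

Lemma locally_finite_iterated g : measurable_fun (@space_time R N) g ->
  (forall tau : R, 0 < tau ->
    (\int[muT]_(t in `]0%R, tau[) \int[muX]_x `|(g (x, t))%:E| < +oo)%E) ->
  locally_finite g.
Proof.
move=> mg ig; split=> // tau0.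
suff H tau : 0 < tau -> mu2.-integrable (slab tau) (EFin \o g).
  have t1 : 0 < `|tau0| + 1 by rewrite ltr_wpDl.
  apply: integrableS (H _ t1); [exact: measurable_slab|exact: measurable_slab|].
  by apply: slabW; rewrite (le_trans (ler_norm _))// lerDl.
move=> t0; have mS := @measurable_slab R N tau.
have mgs : measurable_fun (slab tau) (EFin \o g).
  by apply/measurable_EFinP; apply: measurable_funS mg; [exact: measurable_space_time|exact: slab_space_time].
rewrite (integrable_mkcond _ mS).
have mf : measurable_fun setT ((EFin \o g) \_ (slab tau)) by exact: (measurable_restrictT _ mS).1 mgs.
apply/(integrable21ltyP muX muT mf); apply: le_lt_trans (ig tau t0).
rewrite [leRHS]integral_mkcond le_eqVlt; apply/orP; left; apply/eqP.
apply: eq_integral => t _; rewrite patchE; case: ifPn => [/set_mem It|nIt].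
  by apply: eq_integral => x _; rewrite patchE mem_set.
rewrite -[RHS](@integral0 _ _ _ muX setT); apply: eq_integral => x _.
rewrite patchE memNset ?abse0// => -[_ /= It].
by move: nIt; rewrite notin_setE; apply.
Qed.

Lemma measurable_slice_abs g (tau : R) : measurable_fun (@space_time R N) g ->
  measurable_fun (`]0, tau[%classic : set T) (fun t => \int[muX]_x `|(g (x, t))%:E|)%E.
Proof.
move=> mg; have mI : measurable (`]0, tau[%classic : set T) by exact: measurable_interval.
have mS := @measurable_slab R N tau.
have mgs : measurable_fun (slab tau) (EFin \o g).
  by apply/measurable_EFinP; apply: measurable_funS mg; [exact: measurable_space_time|exact: slab_space_time].
have mf : measurable_fun setT ((EFin \o g) \_ (slab tau)) by exact: (measurable_restrictT _ mS).1 mgs.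
have mabs : measurable_fun setT (abse \o ((EFin \o g) \_ (slab tau))) by exact: measurableT_comp.
have := @measurable_fun_fubini_tonelli_G _ _ _ _ _ muX _ mabs (fun z => abse_ge0 _).
move=> /(@measurable_funTS _ _ _ _ `]0, tau[%classic); apply: eq_measurable_fun => t /set_mem It.
by apply: eq_integral => x _; rewrite /= patchE mem_set.
Qed.

Lemma locally_finite_slices g (b : R -> \bar R) : measurable_fun (@space_time R N) g ->
  (forall t, 0 <= b t)%E ->
  (forall tau, measurable_fun (`]0, tau[%classic : set T) b) ->
  (forall tau : R, (0 < tau)%R -> \int[muT]_(t in `]0%R, tau[) b t < +oo)%E ->
  {ae muT, forall t : T, 0 < t -> (\int[muX]_x `|(g (x, t))%:E| <= b t)%E} ->
  locally_finite g.
Proof.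
move=> mg b0 mb bi gb; apply: locally_finite_iterated => // tau t0.
have mI : measurable (`]0, tau[%classic : set T) by exact: measurable_interval.
apply: le_lt_trans (bi tau t0); apply: ae_ge0_le_integral => //.
- by move=> t _; exact: integral_ge0.
- exact: measurable_slice_abs.
- by apply: filterS gb => t Ht /=; rewrite in_itv/= => /andP[tt _]; exact: Ht.
Qed.

Lemma locally_finite_bounded_slices g (C : R) : 0 <= C -> measurable_fun (@space_time R N) g ->
  {ae muT, forall t : T, 0 < t -> (\int[muX]_x `|(g (x, t))%:E| <= C%:E)%E} ->
  locally_finite g.
Proof.
move=> C0 mg gC; apply: (locally_finite_slices (b := fun=> C%:E) mg) => //.
move=> tau t0; rewrite integral_cst; last exact: measurable_interval.
by rewrite [X in (_ * X)%E](lebesgue_itv_oo (ltW t0)) -EFinM ltry.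
Qed.

Lemma Lq_loc_L1_locally_finite g : Lq_loc_Lp 1%:E 1%:E g -> locally_finite g.
Proof.
move=> [mg Lg]; apply: locally_finite_iterated => // tau t0.
have := Lg tau t0; rewrite Lnorm1; apply: le_lt_trans.
rewrite [leLHS]integral_mkcond le_eqVlt; apply/orP; left; apply/eqP.
apply: eq_integral => t _; rewrite !patchE; case: ifP => _; last by rewrite abse0.
by rewrite Lnorm1 gee0_abs//; exact: integral_ge0.
Qed.

Lemma measurable_loc g : (forall K tau, compact K -> 0 < tau ->
    measurable_fun (K `*` `]0, tau[ : set ('rV[T]_N * T)) g) ->
  measurable_fun (@space_time R N) g.
Proof.
move=> H.
have -> : @space_time R N = \bigcup_n ((box n.+1%:R : set 'rV[T]_N) `*` (`]0, n.+1%:R[%classic : set T)).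
  apply/seteqP; split=> [[x t] [_ /=]|[x t] [n _ [_ /=]]].
    rewrite in_itv/= andbT => t0.
    exists (Num.truncn (Num.max `|x| t)) => //.
    have := truncnS_gt (Num.max `|x| t); rewrite gt_max => /andP[xn tn]; split=> /=.
      by move=> i; apply: (le_trans (coord_le_norm _ _)); exact: ltW.
    by rewrite in_itv/= t0.
  by rewrite in_itv/= => /andP[t0 _]; split=> //=; rewrite in_itv/= t0.
apply/measurable_fun_bigcup.
  by move=> n; apply: measurableX; [exact: measurable_box|exact: measurable_interval].
by move=> n; apply: H; [exact: box_compact|rewrite ltr0n].
Qed.

End local_finiteness.

Section euclidean.
Context {R : realType} {N : nat}.
Implicit Types (x y : 'rV[R]_N).

Lemma enorm_sq x : enorm x ^+ 2 = \sum_(i < N) x ord0 i ^+ 2.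
Proof.
rewrite /enorm big_ord1 sqr_sqrtr//.
by apply: sumr_ge0 => i _; exact: sqr_ge0.
Qed.

Lemma coord_le_enorm x (i : 'I_N) : `|x ord0 i| ^+ 2 <= enorm x ^+ 2.
Proof.
rewrite enorm_sq (bigD1 i)//= real_normK ?num_real// lerDl.
by apply: sumr_ge0 => j _; exact: sqr_ge0.
Qed.

Lemma enorm_ge0 m n (A : 'M[R]_(m, n)) : 0 <= enorm A.
Proof. exact: sqrtr_ge0. Qed.

Lemma norm_le_enorm x : `|x| ^+ 2 <= enorm x ^+ 2.
Proof.
have e0 := enorm_ge0 x.
apply: lerXn2r; rewrite ?nnegrE//; apply: norm_le_coord => // i.
have := coord_le_enorm x i; rewrite ler_sqr ?nnegrE//.
Qed.

End euclidean.
(** * Consequences of the energy and virial bounds *)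

Section truncated_tests.
Context {R : realType} {N : nat}.
Implicit Types (x : 'rV[R]_N) (psi : 'rV[R]_N -> R).

Lemma partialM psi phi x i : smooth psi -> smooth phi ->
  partial i (fun y => psi y * phi y) x = psi x * partial i phi x + phi x * partial i psi x.
Proof.
move=> sp sq; rewrite /partial.
by have -> := deriveM (@smooth_derivable _ _ _ x (delta_mx ord0 i) sp) (@smooth_derivable _ _ _ x (delta_mx ord0 i) sq).
Qed.

(** Test functions agreeing with [psi] on larger and larger boxes. *)
Definition trunc psi (n : nat) : 'rV[R]_N -> R := fun x => cutoff n.+1%:R x * psi x.

Lemma trunc_test psi n : smooth psi -> test_function setT (trunc psi n).
Proof.
move=> sp; rewrite /trunc (_ : (fun _ => _) = (fun x => psi x * cutoff n.+1%:R x)).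
  by apply: test_mull => //; apply: cutoff_test; rewrite ltr0n.
by apply/funext => x; rewrite mulrC.
Qed.

Lemma near_box x : \forall n \near \oo, forall i, `|x ord0 i| < n.+1%:R.
Proof.
near=> n => i; apply: (le_lt_trans (coord_le_norm x i)).
apply: (@lt_trans _ _ n%:R); last by rewrite ltr_nat.
by near: n; exact: nbhs_infty_gtr.
Unshelve. all: by end_near. Qed.

Lemma trunc_cvg psi x : trunc psi n x @[n --> \oo] --> psi x.
Proof.
apply: cvg_near_cst; apply: filterS (near_box x) => n xn.
by rewrite /trunc cutoff1 ?mul1r ?ltr0n// => i; exact/ltW/xn.
Qed.

Lemma trunc_partial_cvg psi x i : smooth psi ->
  partial i (trunc psi n) x @[n --> \oo] --> partial i psi x.
Proof.
move=> sp; apply: cvg_near_cst; apply: filterS (near_box x) => n xn.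
rewrite /trunc partialM//; last exact: cutoff_smooth.
rewrite cutoff1 ?mul1r ?ltr0n//; last by move=> j; exact/ltW/xn.
by rewrite /partial cutoff_derive0 ?mulr0 ?addr0// ltr0n.
Qed.

Lemma trunc_le psi n x : `|trunc psi n x| <= `|psi x|.
Proof.
by rewrite /trunc normrM ler_piMl// ger0_norm ?cutoff_ge0 ?cutoff_le1.
Qed.

Lemma box_enorm x L : 0 <= L -> box L x -> enorm x <= N%:R * L.
Proof.
move=> L0 bx; rewrite -ler_sqr ?nnegrE ?enorm_ge0 ?mulr_ge0//.
rewrite enorm_sq; apply: (@le_trans _ _ (\sum_(i < N) L ^+ 2)).
  apply: ler_sum => i _; rewrite -real_normK ?num_real//.
  by apply: lerXn2r; rewrite ?nnegrE//; exact: bx.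
rewrite sumr_const card_ord -(mulr_natl (L ^+ 2)) exprMn; apply: ler_wpM2r; first exact: sqr_ge0.
by rewrite -natrX ler_nat; case: (N) => // k; rewrite -{1}[k.+1]expn1 leq_pexp2l.
Qed.

(** Quadratic growth of [psi] is compensated by the decay of the gradient of the
    cutoff. *)
Lemma trunc_partial_le psi C : smooth psi -> 0 <= C ->
  (forall x, `|psi x| <= C * (1 + enorm x ^+ 2)) ->
  (forall i x, `|partial i psi x| <= C * (1 + enorm x)) ->
  exists2 C', 0 <= C' & forall n i x, `|partial i (trunc psi n) x| <= C' * (1 + enorm x).
Proof.
move=> sp C0 H0 H1.
have /choice[K HK] : forall i : 'I_N, exists K, 0 < K /\ forall r x, 0 < r ->
    `|'D_(delta_mx ord0 i) (cutoff r) x| <= K / r.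
  by move=> i; have [K K0 HK] := @cutoff_derive_bound R N (delta_mx ord0 i); exists K.
pose K1 := \sum_(i < N) K i.
have KK i : K i <= K1.
  rewrite /K1 (bigD1 i)//= lerDl; apply: sumr_ge0 => j _; exact: ltW (HK j).1.
have K10 : 0 <= K1 by apply: sumr_ge0 => j _; exact: ltW (HK j).1.
pose C' := C + K1 * (C * (1 + 2 * N%:R)).
have C'0 : 0 <= C' by rewrite addr_ge0// mulr_ge0// mulr_ge0// addr_ge0// mulr_ge0.
exists C' => // n i x; set r : R := n.+1%:R.
have r0 : 0 < r by rewrite ltr0n.
have r1 : 1 <= r by rewrite ler1n.
have e0 := enorm_ge0 x; have e1 : 0 <= 1 + enorm x by rewrite addr_ge0.
have [bx|nbx] := pselect (box (2 * r) x); last first.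
  rewrite /partial (@derive_box0 _ _ _ (2 * r)) ?normr0 ?mulr_ge0//.
  by move=> y ny; rewrite /trunc cutoff0 ?mul0r.
rewrite /trunc partialM//; last exact: cutoff_smooth.
apply: (le_trans (ler_normD _ _)); rewrite /C' mulrDl; apply: lerD.
  rewrite normrM; apply: le_trans (H1 i x).
  by rewrite ler_piMl// ger0_norm ?cutoff_ge0 ?cutoff_le1.
rewrite normrM.
apply: (@le_trans _ _ (C * (1 + enorm x ^+ 2) * (K1 / r))).
  apply: ler_pM => //.
  by apply: (le_trans ((HK i).2 r x r0)); rewrite ler_wpM2r ?invr_ge0 ?(ltW r0).
have xr : enorm x <= N%:R * (2 * r) by apply: box_enorm => //; rewrite mulr_ge0// ltW.
have q : (1 + enorm x ^+ 2) / r <= (1 + 2 * N%:R) * (1 + enorm x).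
  rewrite ler_pdivrMr//.
  apply: (@le_trans _ _ (r + enorm x * (N%:R * (2 * r)))).
    by rewrite lerD// expr2 ler_wpM2l.
  rewrite -subr_ge0 (_ : _ - _ = r * (enorm x + 2 * N%:R)); last by ring.
  by rewrite mulr_ge0 ?(ltW r0)// addr_ge0// mulr_ge0.
rewrite (_ : _ * (K1 / r) = K1 * C * ((1 + enorm x ^+ 2) / r)); last by ring.
rewrite -!mulrA mulrA [leRHS]mulrA ler_wpM2l ?mulr_ge0//.
Qed.

End truncated_tests.

Lemma mul_le_sum_sqr (R : realFieldType) (s t : R) : s * (1 + t) <= 1 + t ^+ 2 + s ^+ 2.
Proof. by have := sqr_ge0 (s - 1); have := sqr_ge0 (s - t); have := sqr_ge0 t; nra. Qed.

Section ae_integral.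
Context d (X : measurableType d) (R : realType) (mu : {measure set X -> \bar R}).
Local Open Scope ereal_scope.

Lemma ae_imp (P Q : X -> Prop) : (forall x, P x -> Q x) ->
  {ae mu, forall x, P x} -> {ae mu, forall x, Q x}.
Proof. by move=> PQ; apply: filterS. Qed.

Lemma ae_imp2 (P Q S : X -> Prop) : (forall x, P x -> Q x -> S x) ->
  {ae mu, forall x, P x} -> {ae mu, forall x, Q x} -> {ae mu, forall x, S x}.
Proof. by move=> PQ; apply: filterS2. Qed.

Lemma ae_and (P Q : X -> Prop) : {ae mu, forall x, P x} -> {ae mu, forall x, Q x} ->
  {ae mu, forall x, P x /\ Q x}.
Proof. exact: ae_imp2. Qed.

Lemma ae_Rintegral_ge0 (g : X -> R) : mu.-integrable setT (EFin \o g) ->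
  {ae mu, forall x, (0 <= g x)%R} -> (0 <= \int[mu]_x g x)%R.
Proof.
move=> ig g0; rewrite (_ : 0%R = \int[mu]_x (0 : R))%R; last by rewrite Rintegral_cst// mul0r.
apply: ae_le_Rintegral => //; first exact: integrable0.
by apply: filterS g0.
Qed.

Lemma ae_eq_abse (g : X -> \bar R) : measurable_fun setT g -> {ae mu, forall x, 0 <= g x} ->
  \int[mu]_x `|g x| = \int[mu]_x g x.
Proof.
move=> mg g0; apply: ae_eq_integral => //; first exact: measurableT_comp.
by apply: ae_imp g0 => x gx _; rewrite gee0_abs.
Qed.

End ae_integral.

Section solution.
Context {R : realType} {N : nat}.
Local Notation T := (measurableTypeR R).
Local Notation muX := (@lebesgue_rV R N).
Local Notation muT := (@lebesgue_measure R).
Local Notation mu2 := (muX \x muT)%E.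
Variables (a gamma mu lambda : R) (f : 'rV[R]_N * R -> 'rV[R]_N).
Variables (rho0 : 'rV[R]_N -> R) (v0 : 'rV[R]_N -> 'rV[R]_N).
Variables (rho p : 'rV[R]_N * R -> R) (v : 'rV[R]_N * R -> 'rV[R]_N).
Variable Dv : 'rV[R]_N * R -> 'M[R]_N.
Hypothesis a_gt0 : 0 < a.
Hypothesis gamma_gt1 : 1 < gamma.
Hypothesis sol : finite_energy_solution_with a gamma mu lambda f rho0 v0 rho p v Dv.
Hypothesis second_moment : Lq_loc_Lp 1%:E 1%:E (fun z => rho z * enorm z.1 ^+ 2).

Lemma rho_measurable : measurable_fun (@space_time R N) rho.
Proof.
apply: measurable_loc => K tau cK t0.
exact: (measurable_of_integrable (density_L1loc sol cK t0)).
Qed.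

Lemma v_measurable i : measurable_fun (@space_time R N) (fun z => v z ord0 i).
Proof. by have [H _ _] := velocity_H1 sol; exact: H. Qed.

Lemma enorm_v_measurable : measurable_fun (@space_time R N) (fun z => enorm (v z) ^+ 2).
Proof.
under eq_fun do rewrite enorm_sq.
apply: (@measurable_sum _ _ _ _ 'I_N (index_enum _) (fun i z => v z ord0 i ^+ 2)) => i.
by apply: measurable_funX; exact: v_measurable.
Qed.

Lemma coord_measurable (psi : 'rV[R]_N -> R) : measurable_fun [set: 'rV[T]_N] psi ->
  measurable_fun (@space_time R N) (fun z => psi z.1).
Proof.
by move=> mp; apply: measurable_funTS; exact: (measurableT_comp mp measurable_fst).
Qed.

Lemma rho_ge0_slices : {ae muT, forall t : T, 0 < t ->
  {ae muX, forall x : 'rV[T]_N, 0 <= rho (x, t)}}.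
Proof. exact: ae_slice (density_ge0 sol). Qed.

Definition energy_density (z : 'rV[R]_N * R) : R :=
  2^-1 * rho z * enorm (v z) ^+ 2 + a * rho z `^ gamma / (gamma - 1).
Local Notation e := energy_density.

Let rho_pow_measurable : measurable_fun (@space_time R N) (fun z => rho z `^ gamma).
Proof. exact: (measurableT_comp (measurable_powR gamma) rho_measurable). Qed.

Let e_measurable : measurable_fun (@space_time R N) e.
Proof.
apply: measurable_funD.
  apply: measurable_funM; last exact: enorm_v_measurable.
  by apply: measurable_funM => //; exact: rho_measurable.
apply: measurable_funM; last exact: measurable_cst.
by apply: measurable_funM; [exact: measurable_cst|exact: rho_pow_measurable].
Qed.

Let e_ge0 z : 0 <= rho z -> 0 <= e z.
Proof.
move=> r0; apply: addr_ge0.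
  by apply: mulr_ge0; [apply: mulr_ge0; rewrite ?invr_ge0|exact: sqr_ge0].
by rewrite divr_ge0 ?subr_ge0 ?(ltW gamma_gt1)// mulr_ge0 ?powR_ge0 ?(ltW a_gt0).
Qed.

(** The energy is nonnegative at almost all times, hence everywhere by monotonicity. *)
Lemma energy_facts : exists E : R -> R,
  [/\ forall s t, 0 <= s -> s <= t -> E t <= E s, forall t, 0 <= t -> 0 <= E t,
   {ae muT, forall t : T, 0 < t -> (\int[muX]_x (e (x, t))%:E)%E = (E t)%:E} &
   {ae muT, forall t : T, 0 < t -> derivable E t 1 /\
     ((derive1 E t)%:E + dissipation mu lambda (fun x => Dv (x, t)) <= 0)%E}].
Proof.
have [E [_ E1 E2 E3]] := energy_ineq sol; exists E; split=> //.
move=> t t0.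
have H : {ae muT, forall s : T, 0 < s -> 0 <= E s}.
  apply: ae_imp2 E2 rho_ge0_slices => s Hs Hr s0.
  rewrite -lee_fin -Hs// /energy -ae_eq_abse.
  - exact: integral_ge0.
  - by apply/measurable_EFinP; exact: measurable_section e_measurable s0.
  - by apply: ae_imp (Hr s0) => x rx; rewrite lee_fin; exact: (e_ge0 rx).
have [s [ts Es]] := ae_exists_gt t H.
exact: le_trans (Es (le_lt_trans t0 ts)) (E1 t s t0 (ltW ts)).
Qed.



Lemma locally_finite_energy : locally_finite e.
Proof.
have [E [Em E0 Ee _]] := energy_facts.
apply: (locally_finite_bounded_slices (E0 0 (lexx 0)) e_measurable).
apply: ae_imp2 Ee rho_ge0_slices => t Et rt t0.
have mes : measurable_fun [set: 'rV[T]_N] (fun x => (e (x, t))%:E).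
  by apply/measurable_EFinP; exact: measurable_section e_measurable t0.
have et0 : {ae muX, forall x : 'rV[T]_N, (0 <= (e (x, t))%:E)%E}.
  by apply: ae_imp (rt t0) => x rx; rewrite lee_fin; exact: e_ge0.
have E1 := @ae_eq_abse _ _ _ muX _ mes et0; rewrite [leLHS]E1 /= Et// lee_fin; apply: Em => //.
exact: ltW.
Qed.

Lemma locally_finite_kinetic : locally_finite (fun z => rho z * enorm (v z) ^+ 2).
Proof.
apply: (locally_finite_dom _ (locally_finiteZ 2 locally_finite_energy)).
  by apply: measurable_funM; [exact: rho_measurable|exact: enorm_v_measurable].
apply: ae_imp (density_ge0 sol) => z r0 z0; have {}r0 := r0 z0.
rewrite ger0_norm; last by rewrite mulr_ge0 ?sqr_ge0.
rewrite (_ : 2 * e z = rho z * enorm (v z) ^+ 2 + 2 * (a * rho z `^ gamma / (gamma - 1))); last first.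
  by rewrite /energy_density mulrDr !mulrA mulfV ?mul1r.
by rewrite lerDl mulr_ge0// divr_ge0 ?subr_ge0 ?(ltW gamma_gt1)// mulr_ge0 ?powR_ge0 ?(ltW a_gt0).
Qed.

Lemma locally_finite_power : locally_finite (fun z => rho z `^ gamma).
Proof.
have g0 : 0 < gamma - 1 by rewrite subr_gt0.
apply: (locally_finite_dom _ (locally_finiteZ ((gamma - 1) / a) locally_finite_energy)) => //.
apply: ae_imp (density_ge0 sol) => z r0 z0; have {}r0 := r0 z0.
rewrite ger0_norm ?powR_ge0// /energy_density mulrDr.
rewrite (_ : (gamma - 1) / a * (a * rho z `^ gamma / (gamma - 1)) = rho z `^ gamma); last first.
  by field; rewrite !gt_eqF.
rewrite lerDr mulr_ge0// ?divr_ge0 ?(ltW g0) ?(ltW a_gt0)//.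
by rewrite mulr_ge0 ?sqr_ge0// mulr_ge0 ?invr_ge0.
Qed.

Lemma locally_finite_pressure : locally_finite p.
Proof.
apply: (locally_finite_dom (pressure_measurable sol) (locally_finiteZ a locally_finite_power)).
apply: ae_imp (pressure_law sol) => z pz z0.
by rewrite pz// ger0_norm// mulr_ge0 ?powR_ge0 ?(ltW a_gt0).
Qed.

Lemma pressure_slice : {ae muT, forall t : T, 0 < t ->
  slice p t = a * slice (fun z => rho z `^ gamma) t}.
Proof.
apply: ae_imp2 (ae_slice (pressure_law sol)) (locally_finite_slice locally_finite_power).
move=> t Ht it t0; rewrite /slice -RintegralZl//; last exact: it.
apply: ae_eq_Rintegral => //.
- exact: measurable_section (pressure_measurable sol) t0.
- by apply: measurable_funM => //; exact: measurable_section rho_pow_measurable t0.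
- by apply: ae_imp (Ht t0) => x Hx _; exact: Hx.
Qed.

Lemma energy_slice (E : R -> R) :
  {ae muT, forall t : T, 0 < t -> (\int[muX]_x (e (x, t))%:E)%E = (E t)%:E} ->
  {ae muT, forall t : T, 0 < t ->
    E t = 2^-1 * slice (fun z => rho z * enorm (v z) ^+ 2) t
          + a / (gamma - 1) * slice (fun z => rho z `^ gamma) t}.
Proof.
move=> Ee.
have H := locally_finite_slice locally_finite_kinetic.
apply: ae_imp2 (ae_and Ee H) (locally_finite_slice locally_finite_power).
move=> t [Et ik] ip t0; have := Et t0; have {}ik := ik t0; have {}ip := ip t0.
move=> /(congr1 fine) /= <-; rewrite /slice -!RintegralZl//.
have i1 := integrableZl measurableT 2^-1 ik; have i2 := integrableZl measurableT (a / (gamma - 1)) ip.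
rewrite -RintegralD//.
by rewrite /Rintegral; congr fine; apply: eq_integral => x _; congr EFin; congr (_ + _); rewrite ?mulrA// mulrAC.
Qed.

Lemma locally_finite_moment : locally_finite (fun z => rho z * enorm z.1 ^+ 2).
Proof. exact: Lq_loc_L1_locally_finite. Qed.

(** The mass outside the unit box is bounded by the second moment. *)
Lemma locally_finite_rho : locally_finite rho.
Proof.
have mr := rho_measurable.
pose B : set ('rV[T]_N * T) := box 1 `*` setT.
have mB : measurable B by apply: measurableX => //; exact: measurable_box.
pose r1 z := rho z * \1_B z.
have lr1 : locally_finite r1.
  split; first by apply: measurable_funM => //; exact: measurable_indic.
  move=> tau; have [t0|t0] := ltP 0 tau; last first.
    rewrite (_ : slab tau = set0); first exact: integrable_set0.
    by apply/seteqP; split=> // -[x t] [_ /=]; rewrite in_itv/= => /andP[? ?]; move: t0; rewrite leNgt (lt_trans _ (_ : t < tau)).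
  have mK : measurable ((box 1 : set 'rV[T]_N) `*` (`]0, tau[%classic : set T)).
    by apply: measurableX; [exact: measurable_box|exact: measurable_interval].
  apply: (@integrable_supp _ _ _ mu2 (slab tau) ((box 1 : set 'rV[T]_N) `*` (`]0, tau[%classic : set T))) => //.
  - exact: measurable_slab.
  - by move=> z [_ ?]; split.
  - move=> z [_ zt] nz; rewrite /r1 indicE memNset ?mulr0// => -[bz _].
    by apply: nz; split.
  - have := density_L1loc sol (@box_compact R N 1) t0; apply: eq_integrable => // z /set_mem[bz _].
    by rewrite /= /r1 indicE mem_set ?mulr1//; split.
apply: (locally_finite_dom mr (locally_finiteD lr1 locally_finite_moment)).
apply: ae_imp (density_ge0 sol) => z r0 z0; have {}r0 := r0 z0.
rewrite ger0_norm// /r1 indicE.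
have [bz|nbz] := boolP (z \in B).
  by rewrite mulr1 lerDl mulr_ge0// sqr_ge0.
rewrite mulr0 add0r -[leLHS]mulr1 ler_wpM2l//.
have /existsNP[i /negP] : ~ box 1 z.1.
  by move=> bz; move: nbz; rewrite notin_setE; apply; split.
rewrite -ltNge => zi; apply: le_trans (coord_le_enorm z.1 i).
by rewrite expr2 -[leLHS]mulr1 ler_pM// ltW.
Qed.

(** It dominates all the mass and momentum terms below. *)
Definition majorant z := rho z + rho z * enorm z.1 ^+ 2 + rho z * enorm (v z) ^+ 2.

Lemma locally_finite_majorant : locally_finite majorant.
Proof.
apply: locally_finiteD; last exact: locally_finite_kinetic.
exact: locally_finiteD locally_finite_rho locally_finite_moment.
Qed.

Lemma density_le_majorant z c C : 0 <= rho z -> 0 <= C -> `|c| <= C * (1 + enorm z.1 ^+ 2) ->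
  `|rho z * c| <= C * majorant z.
Proof.
move=> r0 C0 Hc; rewrite normrM (ger0_norm r0).
apply: (@le_trans _ _ (rho z * (C * (1 + enorm z.1 ^+ 2)))); first by rewrite ler_wpM2l.
rewrite /majorant (_ : rho z * _ = C * (rho z + rho z * enorm z.1 ^+ 2)); last by ring.
by rewrite ler_wpM2l// lerDl mulr_ge0 ?sqr_ge0.
Qed.

Lemma momentum_le_majorant z (w : 'rV[R]_N) C : 0 <= rho z -> 0 <= C ->
  (forall j, `|w ord0 j| <= C * (1 + enorm z.1)) ->
  `|rho z * dot (v z) w| <= N%:R * C * majorant z.
Proof.
move=> r0 C0 Hw; rewrite normrM (ger0_norm r0).
have H j : `|v z ord0 j * w ord0 j| <= C * (1 + enorm z.1 ^+ 2 + enorm (v z) ^+ 2).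
  have vj : `|v z ord0 j| <= enorm (v z).
    by rewrite -ler_sqr ?nnegrE ?enorm_ge0//; exact: coord_le_enorm.
  rewrite normrM; apply: (@le_trans _ _ (enorm (v z) * (C * (1 + enorm z.1)))).
    exact: ler_pM.
  rewrite mulrCA ler_wpM2l//.
  exact: mul_le_sum_sqr.
apply: (@le_trans _ _ (rho z * (N%:R * (C * (1 + enorm z.1 ^+ 2 + enorm (v z) ^+ 2))))).
  rewrite ler_wpM2l//; apply: (le_trans (ler_norm_sum _ _ _)).
  by apply: (le_trans (ler_sum _ (fun j _ => H j))); rewrite sumr_const card_ord mulr_natl.
by rewrite /majorant le_eqVlt; apply/orP; left; apply/eqP; ring.
Qed.

End solution.
(** * Weak evolution equations for space integrals *)

Section weak_equations.
Context {R : realType}.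
Local Notation T := (measurableTypeR R).
Local Notation leb := (@lebesgue_measure R).
Implicit Types (F G : R -> R).

(** F' = G in the sense of distributions. *)
Definition weak_eq F G : Prop :=
  [/\ Lloc 0 F, Lloc 0 G & forall xi, C1c 0 xi ->
    \int[leb]_t (F t * derive1 xi t) = - \int[leb]_t (G t * xi t)].

Lemma LlocZ t0 F (k : R) : Lloc t0 F -> Lloc t0 (fun t => k * F t).
Proof. by move=> LF; apply: Lloc_cont LF => t _; exact: cvg_cst. Qed.

Lemma weak_eq_le F G (k : R) : weak_eq F G -> weak_le 0 (fun t => k * F t) (fun t => k * G t).
Proof.
move=> [LF LG H]; split; [exact: LlocZ|exact: LlocZ|move=> xi cxi _].
have [i1 _] := C1c_integrable LG cxi; have [_ i2] := C1c_integrable LF cxi.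
under eq_Rintegral do rewrite -mulrA; under [leRHS]eq_Rintegral do rewrite -mulrA.
by rewrite !RintegralZl// H// mulrN.
Qed.

(** Both the function and its opposite are nonincreasing at Lebesgue points. *)
Lemma weak_eq_constant F : weak_eq F (fun=> 0) ->
  exists c, {ae leb, forall t : T, 0 < t -> F t = c}.
Proof.
move=> FF.
have L (k : R) : weak_le 0 (fun t => k * F t) (fun=> 0).
  by have := weak_eq_le k FF; congr weak_le; apply/funext => t; rewrite mulr0.
have [P1 aeP1 H1] := weak_le_nonincreasing (L 1).
have [P2 aeP2 H2] := weak_le_nonincreasing (L (-1)).
have [s [s0 [P1s P2s]]] : exists s, 0 < s /\ (P1 s /\ P2 s).
  have aeP : {ae leb, forall t : T, 0 < t -> P1 t /\ P2 t}.
    by apply: filterS2 aeP1 aeP2 => t h1 h2 t0; split; [exact: h1|exact: h2].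
  by have [s [s0 Hs]] := ae_exists_gt 0 aeP; exists s; split=> //; exact: Hs.
exists (F s).
apply: filterS2 aeP1 aeP2 => t h1 h2 t0; have {}h1 := h1 t0; have {}h2 := h2 t0.
have [ts|st|->] := ltgtP t s; last by [].
  by have := H1 t s t0 ts h1 P1s; have := H2 t s t0 ts h2 P2s; lra.
by have := H1 s t s0 st P1s h1; have := H2 s t s0 st P2s h2; lra.
Qed.

End weak_equations.

Lemma cvg_opp_unique (R : realType) (u w : nat -> R) (A B : R) :
  u n @[n --> \oo] --> A -> w n @[n --> \oo] --> B -> (forall n, u n = - w n) -> A = - B.
Proof.
move=> uA wB uw; have nB : - w n @[n --> \oo] --> - B by exact: cvgN.
have uwE : u = (fun n => - w n) by apply/funext.
by rewrite -(cvg_lim _ uA)// -(cvg_lim _ nB)// uwE.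
Qed.

Section continuity.
Context {R : realType} {N : nat}.
Local Notation T := (measurableTypeR R).
Local Notation muX := (@lebesgue_rV R N).
Local Notation muT := (@lebesgue_measure R).
Local Notation mu2 := (muX \x muT)%E.
Variables (a gamma mu lambda : R) (f : 'rV[R]_N * R -> 'rV[R]_N).
Variables (rho0 : 'rV[R]_N -> R) (v0 : 'rV[R]_N -> 'rV[R]_N).
Variables (rho p : 'rV[R]_N * R -> R) (v : 'rV[R]_N * R -> 'rV[R]_N).
Variable Dv : 'rV[R]_N * R -> 'M[R]_N.
Hypothesis a_gt0 : 0 < a.
Hypothesis gamma_gt1 : 1 < gamma.
Hypothesis sol : finite_energy_solution_with a gamma mu lambda f rho0 v0 rho p v Dv.
Hypothesis second_moment : Lq_loc_Lp 1%:E 1%:E (fun z => rho z * enorm z.1 ^+ 2).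

Let lW := locally_finite_majorant a_gt0 gamma_gt1 sol second_moment.

Lemma dot_measurable (phi : 'rV[R]_N -> 'rV[R]_N) :
  (forall j, measurable_fun [set: 'rV[T]_N] (fun x : 'rV[R]_N => phi x ord0 j)) ->
  measurable_fun (@space_time R N) (fun z => dot (v z) (phi z.1)).
Proof.
move=> mphi.
apply: (@measurable_sum _ _ _ _ 'I_N (index_enum _) (fun i (z : 'rV[R]_N * R) => v z ord0 i * phi z.1 ord0 i)) => i.
by apply: measurable_funM; [exact: (v_measurable sol)|exact: (coord_measurable (mphi i))].
Qed.

Lemma density_locally_finite (psi : 'rV[R]_N -> R) (C : R) : measurable_fun [set: 'rV[T]_N] psi -> 0 <= C ->
  (forall x, `|psi x| <= C * (1 + enorm x ^+ 2)) ->
  locally_finite (fun z => rho z * psi z.1).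
Proof.
move=> mp C0 HC; apply: (locally_finite_dom _ (locally_finiteZ C lW)).
  by apply: measurable_funM; [exact: (rho_measurable sol)|exact: coord_measurable].
by apply: ae_imp (density_ge0 sol) => z r0 z0; apply: density_le_majorant => //; exact: r0.
Qed.

Lemma momentum_locally_finite (phi : 'rV[R]_N -> 'rV[R]_N) C : 0 <= C ->
  (forall j, measurable_fun [set: 'rV[T]_N] (fun x : 'rV[R]_N => phi x ord0 j)) ->
  (forall x j, `|phi x ord0 j| <= C * (1 + enorm x)) ->
  locally_finite (fun z => rho z * dot (v z) (phi z.1)).
Proof.
move=> C0 mp HC; apply: (locally_finite_dom _ (locally_finiteZ (N%:R * C) lW)).
  by apply: measurable_funM; [exact: (rho_measurable sol)|exact: dot_measurable].
by apply: ae_imp (density_ge0 sol) => z r0 z0; apply: momentum_le_majorant => //; exact: r0.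
Qed.

Lemma smooth_measurable (psi : 'rV[R]_N -> R) : smooth psi -> measurable_fun [set: 'rV[T]_N] psi.
Proof. by move=> sp; apply: continuous_measurable_rV; exact: smooth_continuous. Qed.

Lemma grad_coord_measurable (psi : 'rV[R]_N -> R) j : smooth psi ->
  measurable_fun [set: 'rV[T]_N] (fun x : 'rV[R]_N => grad psi x ord0 j).
Proof.
move=> sp; under eq_fun do rewrite mxE.
by apply: smooth_measurable; exact: smooth_derive.
Qed.

(** Truncations of [psi] are admissible in the continuity equation, and by
    [trunc_partial_le] all the terms are dominated by [majorant]. *)
Lemma continuity_weighted psi C : smooth psi -> 0 <= C ->
  (forall x, `|psi x| <= C * (1 + enorm x ^+ 2)) ->
  (forall i x, `|partial i psi x| <= C * (1 + enorm x)) ->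
  weak_eq (slice (fun z => rho z * psi z.1)) (slice (fun z => rho z * dot (v z) (grad psi z.1))).
Proof.
move=> sp C0 H0 H1.
have [C' C'0 HC'] := trunc_partial_le sp C0 H0 H1.
have mt n : measurable_fun [set: 'rV[T]_N] (trunc psi n).
  by apply: test_measurable; exact: trunc_test.
have st n : smooth (trunc psi n) by exact: test_smooth (trunc_test n sp).
have l1 : locally_finite (fun z => rho z * psi z.1).
  by apply: density_locally_finite C0 H0; exact: smooth_measurable.
have l2 : locally_finite (fun z => rho z * dot (v z) (grad psi z.1)).
  apply: (momentum_locally_finite C0); first by move=> j; exact: grad_coord_measurable.
  by move=> x j; rewrite mxE.
split; [exact: Lloc_slice|exact: Lloc_slice|move=> xi cxi].
have [c1 c2] := C1c_Cc cxi.
have x0 : xi 0 = 0.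
  by have [_ _ [t1 [t2 [t10 H]]]] := cxi; apply: H; rewrite negb_and -ltNge t10.
pose g1 n (z : 'rV[R]_N * R) := rho z * trunc psi n z.1.
pose g2 n (z : 'rV[R]_N * R) := rho z * dot (v z) (grad (trunc psi n) z.1).
have [] := @pairing_cvg R N g1 (fun z => rho z * psi z.1) (fun z => C * majorant rho v z) (derive1 xi).
- by move=> n; apply: measurable_funM; [exact: (rho_measurable sol)|exact: coord_measurable].
- by case: l1.
- exact: locally_finiteZ.
- exact: c2.
- apply: ae_imp (density_ge0 sol) => z r0 z0 n; apply: density_le_majorant => //; first exact: r0.
  by apply: le_trans (trunc_le _ _ _) (H0 _).
- by move=> z; apply: cvgM; [exact: cvg_cst|exact: trunc_cvg].
move=> lg1 _ cv1.
have [] := @pairing_cvg R N g2 (fun z => rho z * dot (v z) (grad psi z.1)) (fun z => N%:R * C' * majorant rho v z) xi.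
- move=> n; apply: measurable_funM; first exact: (rho_measurable sol).
  by apply: dot_measurable => j; exact: grad_coord_measurable.
- by case: l2.
- exact: locally_finiteZ.
- exact: c1.
- apply: ae_imp (density_ge0 sol) => z r0 z0 n; apply: momentum_le_majorant => //; first exact: r0.
  by move=> j; rewrite mxE.
- move=> z; apply: cvgM; first exact: cvg_cst.
  rewrite /dot; apply: cvg_big => [|i _]; first exact: add_continuous.
  by apply: cvgM; [exact: cvg_cst|under eq_fun do rewrite mxE; rewrite mxE; exact: trunc_partial_cvg].
move=> lg2 _ cv2.
have E n : \int[muT]_t (slice (g1 n) t * derive1 xi t) + \int[muT]_t (slice (g2 n) t * xi t) = 0.
  rewrite -(pairing (lg1 n) c2) -(pairing (lg2 n) c1).
  have := continuity_eq sol (trunc_test n sp) (C1c_time_test cxi).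
  by rewrite x0 mul0r add0r.
exact: cvg_opp_unique cv1 cv2 (fun n => etrans (esym (addrK _ _)) (etrans (congr1 (fun y => y - _) (E n)) (sub0r _))).
Qed.

End continuity.
(** * The momentum equation tested with the radial field *)

Lemma box_indic_integrable (R : realType) (N : nat) (L : R) :
  (@lebesgue_rV R N).-integrable setT (EFin \o (\1_(box L) : 'rV[R]_N -> R)).
Proof.
have mB := @measurable_box R N L.
apply/integrableP; split.
  by apply/measurable_EFinP; exact: measurable_indic.
under eq_integral do rewrite /= ger0_norm ?indic_ge0//.
by rewrite integral_indic// setIT; exact: box_volume_lty.
Qed.

Lemma measurable_open_box (R : realType) (N : nat) (r : R) :
  measurable ([set y : 'rV[R]_N | forall j, `|y ord0 j| < r] : set 'rV[measurableTypeR R]_N).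
Proof.
rewrite (_ : mkset _ = \bigcap_(j in [set: 'I_N])
    ((fun x : 'rV[measurableTypeR R]_N => x ord0 j) @^-1` `]- r, r[%classic)).
  apply: fin_bigcap_measurable => // j _.
  by rewrite -[X in measurable X]setTI; exact: (measurable_coord_rV j measurableT (measurable_interval _)).
apply/seteqP; split=> [x xU j _|x xU j] /=; first by rewrite in_itv/= -ltr_norml; exact: xU.
by have := xU j I; rewrite /= in_itv/= -ltr_norml.
Qed.

Section viscous.
Context {R : realType} {N : nat}.
Local Notation T := (measurableTypeR R).
Local Notation muX := (@lebesgue_rV R N).
Local Notation muT := (@lebesgue_measure R).
Variable v : 'rV[R]_N * R -> 'rV[R]_N.
Local Notation p := (N%:R / (N%:R - 1) : R).
Hypothesis N3 : (3 <= N)%N.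
Hypothesis hv : Lq_loc_Lp_mx 1%:E p%:E v.

Local Notation u z := (enorm (v z)).
Local Notation V t := ('N[muX]_p%:E[(fun x => (u (x, t))%:E)])%E.

Lemma exponent_gt1 : 1 < p.
Proof.
have N1 : 1 < N%:R :> R by rewrite ltr1n (leq_trans _ N3).
by rewrite ltr_pdivlMr ?subr_gt0// mul1r ltrBlDr ltrDl ltr01.
Qed.

Let p0 : 0 < p. Proof. exact: lt_trans exponent_gt1. Qed.

Let mv i : measurable_fun (@space_time R N) (fun z => v z ord0 i).
Proof. by case: hv. Qed.

Let mu_ : measurable_fun (@space_time R N) (fun z => u z).
Proof. by case: hv => _ []. Qed.

Let mup : measurable_fun (@space_time R N) (fun z => u z `^ p).
Proof. exact: (measurableT_comp (measurable_powR p) mu_). Qed.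

Let VE t : V t = ((\int[muX]_x `|(u (x, t) `^ p)%:E|) `^ p^-1)%E.
Proof.
rewrite unlock /Lnorm; congr (_ `^ _)%E; apply: eq_integral => x _.
by rewrite /= ger0_norm ?sqrtr_ge0// ger0_norm ?powR_ge0.
Qed.

Let V0 t : (0 <= V t)%E. Proof. exact: Lnorm_ge0. Qed.

Let mV tau : measurable_fun (`]0, tau[%classic : set T) (fun t => V t).
Proof.
rewrite (_ : (fun t => V t) = (fun t => ((\int[muX]_x `|(u (x, t) `^ p)%:E|) `^ p^-1)%E)); last by apply/funext => t; exact: VE.
apply: (measurableT_comp (measurable_poweR p^-1)).
exact: measurable_slice_abs mup.
Qed.

Let iV tau : 0 < tau -> muT.-integrable (`]0, tau[%classic : set T) (fun t => V t).
Proof.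
move=> t0; apply/integrableP; split; first exact: mV.
have [_ [_ H]] := hv; have := H tau t0; rewrite Lnorm1; apply: le_lt_trans.
rewrite [leLHS]integral_mkcond le_eqVlt; apply/orP; left; apply/eqP.
by apply: eq_integral => t _; rewrite !patchE; case: ifP => _ //; rewrite abse0.
Qed.

(** The L^(N/(N-1)) norm of the velocity at time [t]; it is finite for almost every
    positive [t]. *)
Definition velocity_norm (t : R) : R := fine (V t).

Lemma velocity_norm_ge0 t : 0 <= velocity_norm t.
Proof. exact: fine_ge0. Qed.

Lemma velocity_norm_integrable tau : 0 < tau ->
  muT.-integrable (`]0, tau[%classic : set T) (EFin \o velocity_norm).
Proof.
move=> t0; have mI : measurable (`]0, tau[%classic : set T) by exact: measurable_interval.
apply: (@le_integrable _ _ _ _ _ mI _ (fun t => V t)) => //.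
- by apply/measurable_EFinP; apply: measurableT_comp => //; exact: mV.
- move=> t It; rewrite /velocity_norm /=; move: (V0 t); case: (V t) => [r| |] //= _.
  by rewrite normr0 leey.
- exact: iV.
Qed.

Lemma velocity_power_integral : {ae muT, forall t : T, 0 < t ->
  muX.-integrable setT (EFin \o (fun x => u (x, t) `^ p)) /\
  \int[muX]_x (u (x, t) `^ p) = velocity_norm t `^ p}.
Proof.
have : {ae muT, forall t : T, forall n : nat, `]0, n.+1%:R[%classic t -> V t \is a fin_num}.
  by apply: ae_foralln => n; apply: integrable_ae; [exact: measurable_interval|exact: iV].
apply: ae_imp => t Ht t0.
have : V t \is a fin_num.
  by apply: (Ht (Num.truncn t)); rewrite /= in_itv/= t0 truncnS_gt.
have mt : measurable_fun [set: 'rV[T]_N] (EFin \o (fun x => u (x, t) `^ p)).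
  by apply/measurable_EFinP; exact: measurable_section mup t0.
rewrite /velocity_norm VE.
have I0 : (0 <= \int[muX]_x `|(u (x, t) `^ p)%:E|)%E by exact: integral_ge0.
have p'0 : 0 < p^-1 by rewrite invr_gt0.
move: I0; case E : (\int[muX]_x `|(u (x, t) `^ p)%:E|)%E => [r| |] //= r0 fin; last first.
  by move: fin; rewrite /= gt_eqF.
have iu : muX.-integrable setT (EFin \o (fun x => u (x, t) `^ p)).
  by apply/integrableP; split=> //; rewrite E ltry.
split=> //.
have pp : p^-1 * p = 1 by rewrite mulVf// gt_eqF.
rewrite -powRrM pp powRr1; last by rewrite -lee_fin.
rewrite /Rintegral -[RHS]/(fine r%:E) -E; congr fine.
by apply: eq_integral => x _; rewrite /= ger0_norm ?powR_ge0.
Qed.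

(** Splitting the speed at the level [eps / r ^ (N - 1)] balances the volume [r ^ N]
    of the ball against the factor [1 / r]. *)
Lemma annulus_bound (psi : 'rV[R]_N -> R) (K L r eps t : R) i : 0 <= K -> 0 < L -> 0 < r -> 0 < eps ->
  0 < t ->
  muX.-integrable setT (EFin \o (fun x => u (x, t) `^ p)) ->
  measurable_fun [set: 'rV[T]_N] psi ->
  (forall x : 'rV[R]_N, `|psi x| <= K / r) -> (forall x : 'rV[R]_N, ~ box (L * r) x -> psi x = 0) ->
  (forall x : 'rV[R]_N, (forall j, `|x ord0 j| < r) -> psi x = 0) ->
  (\int[muX]_x `|(v (x, t) ord0 i * psi x)%:E| <=
   (K * (eps * (2 * L) ^+ N +
      eps `^ (1 - p) * \int[muX]_x (u (x, t) `^ p * \1_(~` [set y : 'rV[R]_N | forall j, `|y ord0 j| < r]) x)))%:E)%E.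
Proof.
move=> K0 L0 r0 e0 t0 iu mpsi psiK psi0 psi1.
have N1 : 0 < N%:R - 1 :> R by rewrite subr_gt0 ltr1n (leq_trans _ N3).
(* The exponent satisfies (N - 1) (p - 1) = 1. *)
pose lam := eps * r `^ (- (N%:R - 1)).
have l0 : 0 < lam by rewrite mulr_gt0// powR_gt0.
have lamp : lam `^ (1 - p) = eps `^ (1 - p) * r.
  rewrite /lam powRM ?(ltW e0) ?powR_ge0// -powRrM; congr (_ * _).
  rewrite (_ : - (N%:R - 1) * (1 - p) = 1) ?powRr1 ?(ltW r0)//.
  by field; rewrite gt_eqF.
pose U : set 'rV[T]_N := [set y : 'rV[R]_N | forall j, `|y ord0 j| < r].
have mU : measurable U by exact: measurable_open_box.
pose G (x : 'rV[R]_N) : R := K / r * (lam * \1_(box (L * r)) x + lam `^ (1 - p) * (u (x, t) `^ p * \1_(~` U) x)).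
have Lr0 : 0 <= L * r by rewrite mulr_ge0// ltW.
have mB := @measurable_box R N (L * r).
have i1 : muX.-integrable setT (EFin \o (fun x : 'rV[R]_N => lam * \1_(box (L * r)) x)).
  have iB : muX.-integrable setT (EFin \o (\1_(box (L * r)) : 'rV[R]_N -> R)).
    exact: box_indic_integrable.
  by have := integrableZl measurableT lam iB; apply: eq_integrable.
have iuU : muX.-integrable setT (EFin \o (fun x : 'rV[R]_N => u (x, t) `^ p * \1_(~` U) x)).
  apply: (integrableM_bounded (C := 1) measurableT iu).
    by apply: measurable_indic; exact: measurableC.
  by move=> x _; rewrite indicE; case: (_ \in _); rewrite ?normr1 ?normr0.
have i2 : muX.-integrable setT (EFin \o (fun x : 'rV[R]_N => lam `^ (1 - p) * (u (x, t) `^ p * \1_(~` U) x))).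
  by have := integrableZl measurableT (lam `^ (1 - p)) iuU; apply: eq_integrable.
have i12 := integrableD measurableT i1 i2.
have iG : muX.-integrable setT (EFin \o G).
  by have := integrableZl measurableT (K / r) i12; apply: eq_integrable.
have mvt : measurable_fun [set: 'rV[T]_N] (fun x => v (x, t) ord0 i) by exact: measurable_section (mv i) t0.
apply: (@le_trans _ _ (\int[muX]_x (G x)%:E)%E).
  apply: ge0_le_integral => //.
  - by apply: measurableT_comp => //; apply/measurable_EFinP; exact: measurable_funM.
  - by have := measurable_int muX iG.
  - move=> x _; rewrite /= lee_fin /G normrM.
    have vu : `|v (x, t) ord0 i| <= u (x, t).
      by rewrite -ler_sqr ?nnegrE ?enorm_ge0//; exact: coord_le_enorm.
    have g0 : 0 <= K / r * (lam * \1_(box (L * r)) x + lam `^ (1 - p) * (u (x, t) `^ p * \1_(~` U) x)).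
      apply: mulr_ge0; first by rewrite divr_ge0// ltW.
      by apply: addr_ge0; rewrite mulr_ge0 ?mulr_ge0 ?powR_ge0 ?indic_ge0// ltW.
    have [xU|xU] := pselect (U x); first by rewrite (psi1 x xU) normr0 mulr0.
    have [xB|xB] := pselect (box (L * r) x); last by rewrite (psi0 x xB) normr0 mulr0.
    clear g0.
    rewrite !indicE !mem_set// !mulr1 mulrC; apply: ler_pM => //.
    apply: (le_trans vu); apply: powR_split => //; [exact: exponent_gt1|exact: enorm_ge0].
have -> : (\int[muX]_x (G x)%:E = (\int[muX]_x G x)%:E)%E.
  by rewrite /Rintegral fineK//; exact: integrable_fin_num iG.
rewrite lee_fin /G RintegralZl// RintegralD// !RintegralZl//; last first.
  exact: box_indic_integrable.
have -> : \int[muX]_x (\1_(box (L * r)) x) = (2 * (L * r)) ^+ N.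
  by rewrite /Rintegral integral_indic// setIT [X in fine X](box_volume Lr0).
rewrite -/U lamp le_eqVlt; apply/orP; left; apply/eqP.
have -> : lam = eps / r ^+ N * r.
  rewrite /lam opprB powRD; last by apply/implyP => _; rewrite gt_eqF.
  by rewrite powRr1 ?(ltW r0)// powRN powR_mulrn ?(ltW r0)// [r * _]mulrC mulrA.
rewrite mulrA exprMn; field; by rewrite !gt_eqF// exprn_gt0.
Qed.

End viscous.

Lemma integral_outside_box_cvg (R : realType) (N : nat) (W : 'rV[R]_N -> R) :
  (@lebesgue_rV R N).-integrable setT (EFin \o W) ->
  \int[@lebesgue_rV R N]_x
     (W x * \1_(~` [set y : 'rV[R]_N | forall j, `|y ord0 j| < n.+1%:R]) x)
     @[n --> \oo] --> (0 : R).
Proof.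
move=> iW.
have [] := @Rdominated_cvg _ _ _ (@lebesgue_rV R N) setT
  (fun n x => W x * \1_(~` [set y : 'rV[R]_N | forall j, `|y ord0 j| < n.+1%:R]) x)
  (fun=> 0) (fun x => `|W x|) measurableT.
- move=> n; apply: measurable_funM; first exact: measurable_of_integrable iW.
  by apply: measurable_indic; apply: measurableC; exact: measurable_open_box.
- by [].
- apply/aeW => x _; apply: cvg_near_cst; apply: filterS (near_box x) => n xn.
  by rewrite indicE memNset ?mulr0//; apply.
- exact: integrable_norm.
- apply/aeW => x _ n; rewrite normrM ler_piMr// indicE.
  by case: (_ \in _); rewrite ?normr1 ?normr0.
by move=> _ _; rewrite Rintegral_cst// mul0r.
Qed.

Section viscous_vanish.
Context {R : realType} {N : nat}.
Local Notation T := (measurableTypeR R).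
Local Notation muX := (@lebesgue_rV R N).
Local Notation muT := (@lebesgue_measure R).
Variable v : 'rV[R]_N * R -> 'rV[R]_N.
Local Notation p := (N%:R / (N%:R - 1) : R).
Hypothesis N3 : (3 <= N)%N.
Hypothesis hv : Lq_loc_Lp_mx 1%:E p%:E v.
Variables (S : 'rV[R]_N -> R).
Hypothesis test_S : test_function setT S.
Hypothesis S0 : forall x : 'rV[R]_N, (forall j, `|x ord0 j| < 1) -> S x = 0.
Local Notation u z := (enorm (v z)).

Let g i n (z : 'rV[R]_N * R) : R := v z ord0 i * (n.+1%:R^-1 * S (n.+1%:R^-1 *: z.1 + 0)).

Let mg i n : measurable_fun (@space_time R N) (g i n).
Proof.
apply: measurable_funM; first by case: hv => mv _; exact: mv.
apply: (@coord_measurable _ _ (fun x : 'rV[R]_N => n.+1%:R^-1 * S (n.+1%:R^-1 *: x + 0))).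
apply: measurable_funM => //; apply: smooth_measurable.
by apply: smooth_comp_affine; exact: test_smooth.
Qed.

(** The viscous terms carry a test field [S (x / r) / r] that vanishes near the origin:
    [annulus_bound] applies with any [eps]. *)
Lemma viscous_slices : exists K L : R, [/\ 0 < K, 0 < L & forall i,
  {ae muT, forall t : T, 0 < t -> forall n eps, 0 < eps ->
    (\int[muX]_x `|(g i n (x, t))%:E| <= (K * (eps * (2 * L) ^+ N +
      eps `^ (1 - p) * \int[muX]_x (u (x, t) `^ p *
        \1_(~` [set y : 'rV[R]_N | forall j, `|y ord0 j| < n.+1%:R]) x)))%:E)%E}].
Proof.
have [K K0 HK] := test_bounded test_S.
have /test_functionP[sS [L0 HL0]] := test_S.
have L1 : 0 < `|L0| + 1 by rewrite ltr_wpDl.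
exists K, (`|L0| + 1); split=> // i.
apply: ae_imp (velocity_power_integral N3 hv) => t Ht t0 n eps e0.
have [iu _] := Ht t0.
have n0 : 0 < n.+1%:R :> R by rewrite ltr0n.
have nV : 0 < n.+1%:R^-1 :> R by rewrite invr_gt0.
apply: (annulus_bound (psi := fun x : 'rV[R]_N => n.+1%:R^-1 * S (n.+1%:R^-1 *: x + 0)) N3 hv i (ltW K0) L1 n0 e0 t0 iu).
- apply: measurable_funM => //; apply: smooth_measurable.
  by apply: smooth_comp_affine.
- by move=> x; rewrite normrM (gtr0_norm nV) mulrC ler_pM2r.
- move=> x nx; rewrite HL0 ?mulr0// => bx; apply: nx => j.
  have := bx j; rewrite !mxE addr0 normrM (gtr0_norm nV) mulrC ler_pdivrMr// => /le_trans; apply.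
  by rewrite ler_pM2r// (le_trans (ler_norm _))// lerDl.
- move=> x nx; rewrite S0 ?mulr0// => j.
  by rewrite !mxE addr0 normrM (gtr0_norm nV) mulrC ltr_pdivrMr// mul1r.
Qed.

(** The choice [eps = velocity_norm v t + 1] makes both terms linear in the norm. *)
Lemma viscous_slices_dominated : exists2 C, 0 < C & forall i,
  {ae muT, forall t : T, 0 < t -> forall n,
    (\int[muX]_x `|(g i n (x, t))%:E| <= (C * (velocity_norm v t + 1))%:E)%E}.
Proof.
have [K [L [K0 L0 H]]] := viscous_slices.
have LN : 0 < (2 * L) ^+ N by rewrite exprn_gt0// mulr_gt0.
exists (K * ((2 * L) ^+ N + 1)); first by rewrite mulr_gt0// addr_gt0.
move=> i; apply: ae_imp2 (H i) (velocity_power_integral N3 hv) => t Ht Hu t0 n.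
have [iu uE] := Hu t0.
have V0 := velocity_norm_ge0 v t.
have V1 : 0 < velocity_norm v t + 1 by rewrite ltr_wpDl.
apply: (le_trans (Ht t0 n _ V1)); rewrite lee_fin.
have -> : K * ((2 * L) ^+ N + 1) * (velocity_norm v t + 1) =
  K * ((velocity_norm v t + 1) * (2 * L) ^+ N + (velocity_norm v t + 1)) by ring.
rewrite ler_pM2l// lerD2l.
apply: (@le_trans _ _ ((velocity_norm v t + 1) `^ (1 - p) * (velocity_norm v t + 1) `^ p)).
  rewrite ler_wpM2l ?powR_ge0//.
  apply: (@le_trans _ _ (velocity_norm v t `^ p)); last first.
    by rewrite ge0_ler_powR ?nnegrE ?(ltW V1)// ?lerDl//; apply: ltW; apply: lt_trans (exponent_gt1 N3).
  rewrite -uE; apply: ae_le_Rintegral => //.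
    apply: (integrableM_bounded (C := 1) measurableT iu).
      by apply: measurable_indic; apply: measurableC; exact: measurable_open_box.
    by move=> x _; rewrite indicE; case: (_ \in _); rewrite ?normr1 ?normr0.
  by apply/aeW => x _; rewrite ler_piMr ?powR_ge0// indicE lern1 leq_b1.
by rewrite -powRD ?subrK ?powRr1 ?(ltW V1)// gt_eqF ?implybT.
Qed.

(** For fixed [eps] the second term of [annulus_bound] is a tail of a convergent
    integral, and the first is small with [eps]. *)
Lemma viscous_slices_cvg i :
  {ae muT, forall t : T, 0 < t -> slice (g i n) t @[n --> \oo] --> 0}.
Proof.
have [K [L [K0 L0 H]]] := viscous_slices.
have LN : 0 < (2 * L) ^+ N by rewrite exprn_gt0// mulr_gt0.
apply: ae_imp2 (H i) (velocity_power_integral N3 hv) => t Ht Hu t0.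
have [iu uE] := Hu t0.
have c0 := integral_outside_box_cvg iu.
apply/cvgrPdist_le => e e0.
have [eps eps0 epsE] : exists2 eps, 0 < eps & K * (eps * (2 * L) ^+ N) = e / 2.
  exists (e / 2 / K / (2 * L) ^+ N); first by rewrite !divr_gt0.
  by field; rewrite !gt_eqF.
have w0 : 0 < eps `^ (1 - p) by rewrite powR_gt0.
have d0 : 0 < e / 2 / K / eps `^ (1 - p) by rewrite !divr_gt0.
have /cvgrPdist_le /(_ _ d0) := c0; apply: filterS => n.
rewrite !sub0r !normrN => Hn.
have B := Ht t0 n eps eps0.
have iG : muX.-integrable setT (EFin \o (fun x => g i n (x, t))).
  apply/integrableP; split; last by apply: le_lt_trans B _; rewrite ltry.
  by apply/measurable_EFinP; exact: measurable_section (mg i n) t0.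
apply: (le_trans (le_normr_Rintegral measurableT iG)).
have -> : e = K * (eps * (2 * L) ^+ N + eps `^ (1 - p) * (e / 2 / K / eps `^ (1 - p))).
  by rewrite mulrDr epsE; field; rewrite !gt_eqF.
have B' : \int[muX]_x `|g i n (x, t)| <= K * (eps * (2 * L) ^+ N +
      eps `^ (1 - p) * \int[muX]_x (u (x, t) `^ p *
        \1_(~` [set y : 'rV[R]_N | forall j, `|y ord0 j| < n.+1%:R]) x)).
  rewrite -lee_fin; apply: le_trans B; rewrite /Rintegral fineK//.
  by apply: integrable_fin_num => //; exact: integrable_norm iG.
by apply: (le_trans B'); rewrite ler_pM2l// lerD2l ler_pM2l// (le_trans (ler_norm _)).
Qed.

Lemma viscous_locally_finite i n : locally_finite (g i n).
Proof.
have [C C0 HC] := viscous_slices_dominated.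
have iV tau : muT.-integrable (`]0, tau[%classic : set T)
    (EFin \o (fun t => C * (velocity_norm v t + 1))).
  have t1 : 0 < `|tau| + 1 by rewrite ltr_wpDl.
  have mI (r : R) : measurable (`]0, r[%classic : set T) by exact: measurable_interval.
  have i1 : muT.-integrable (`]0, `|tau| + 1[%classic : set T) (EFin \o (fun=> 1)).
    by apply: (bounded_integrable_oo (C := 1)) => // t; rewrite normr1.
  have i2 := integrableZl (mI _) C (integrableD (mI _) (velocity_norm_integrable hv t1) i1).
  have i3 : muT.-integrable (`]0, `|tau| + 1[%classic : set T) (EFin \o (fun t => C * (velocity_norm v t + 1))).
    by move: i2; apply: eq_integrable.
  apply: integrableS i3; [exact: mI|exact: mI|].
  by apply: subset_itv; rewrite bnd_simp// (le_trans (ler_norm _))// lerDl.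
apply: (locally_finite_slices (b := fun t => (C * (velocity_norm v t + 1))%:E) (mg i n)).
- by move=> t; rewrite lee_fin mulr_ge0 ?(ltW C0)// addr_ge0// velocity_norm_ge0.
- by move=> tau; exact: measurable_int (iV tau).
- move=> tau _; have := integrable_lty (measurable_interval _) (iV tau).
  by [].
- by apply: ae_imp (HC i) => t Ht t0; exact: Ht.
Qed.

Let locally_finite_slice_all i : {ae muT, forall t : T, 0 < t -> forall n,
  muX.-integrable setT (EFin \o (fun x => g i n (x, t)))}.
Proof.
have : {ae muT, forall t : T, forall n, 0 < t -> muX.-integrable setT (EFin \o (fun x => g i n (x, t)))}.
  by apply: ae_foralln => n; exact: locally_finite_slice (viscous_locally_finite i n).
by apply: filterS => t H t0 n; exact: H.
Qed.

Lemma viscous_pairing_cvg i eta : Cc eta ->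
  \int[muT]_t (slice (g i n) t * eta t) @[n --> \oo] --> 0.
Proof.
move=> ce; have [C C0 HC] := viscous_slices_dominated.
have [C1 C10 HC1] := Cc_bounded ce.
have [ceta [a [b [a0 e0]]]] := ce.
pose I : set T := `]0, `|b| + 1[%classic.
have mI : measurable I by exact: measurable_interval.
have out t : ~ I t -> eta t = 0.
  rewrite /I /= in_itv/= => /negP H; apply: e0; apply: contra H => /andP[at_ tb].
  by rewrite (lt_le_trans a0 at_) (le_lt_trans tb)// (le_lt_trans (ler_norm b))// ltrDl.
have E n : \int[muT]_t (slice (g i n) t * eta t) = \int[muT]_(t in I) (slice (g i n) t * eta t).
  by apply: Rintegral_supp => // t _ /out ->; rewrite mulr0.
under eq_fun do rewrite E.
have b1 : 0 < `|b| + 1 by rewrite ltr_wpDl.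
have i1 : muT.-integrable I (EFin \o (fun=> 1)).
  by apply: (bounded_integrable_oo (C := 1)) => // t; rewrite normr1.
have i2 := integrableZl mI (C1 * C) (integrableD mI (velocity_norm_integrable hv b1) i1).
have [] := @Rdominated_cvg _ T R muT I (fun n t => slice (g i n) t * eta t) (fun=> 0)
  (fun t => C1 * C * (velocity_norm v t + 1)) mI.
- move=> n; apply: measurable_funM.
    have [is_ _] := slice_integrable (`|b| + 1) (viscous_locally_finite i n).
    exact: measurable_of_integrable is_.
  by apply: measurable_funTS; apply: continuous_measurable_fun.
- by [].
- apply: filterS (viscous_slices_cvg i) => t Ht; rewrite /I /= in_itv/= => /andP[t0 _].
  by rewrite -[X in _ --> X](mul0r (eta t)); apply: cvgM; [exact: Ht|exact: cvg_cst].
- by move: i2; apply: eq_integrable.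
- apply: filterS2 (HC i) (locally_finite_slice_all i) => t Ht Hi.
  rewrite /I /= in_itv/= => /andP[t0 _] n.
  rewrite normrM mulrC -mulrA; apply: ler_pM => //.
  apply: (le_trans (le_normr_Rintegral measurableT (Hi t0 n))).
  rewrite -lee_fin; apply: le_trans (Ht t0 n); rewrite /Rintegral fineK//.
  by apply: integrable_fin_num => //; exact: integrable_norm (Hi t0 n).
by move=> _ _; rewrite Rintegral_cst// mul0r.
Qed.

End viscous_vanish.

(** * Test functions of space and time, and the divergence-free force *)

Section product_test.
Context {R : realType} {N : nat}.
Implicit Types (g : 'rV[R]_N -> R) (z : 'rV[R]_N * R).

(** Both difference quotients are the same term, whence the empty proofs. *)
Lemma derive_fst g (w : 'rV[R]_N * R) z : 'D_w (fun z => g z.1) z = 'D_(w.1) g z.1.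
Proof. by []. Qed.

Lemma derive_snd (zeta : R -> R) (w : 'rV[R]_N * R) z :
  'D_w (fun z => zeta z.2) z = 'D_(w.2) zeta z.2.
Proof. by []. Qed.

Lemma smooth_fst g : smooth g -> smooth (fun z : 'rV[R]_N * R => g z.1).
Proof.
move=> sg; apply: (@smooth_coind _ _ (fun F => exists g, smooth g /\ F = fun z : 'rV[R]_N * R => g z.1)); last by exists g.
move=> _ {sg}[{}g [sg ->]]; split.
  move=> z; apply: continuous_comp; first exact: cvg_fst.
  exact: smooth_continuous.
move=> w; split=> [z|]; first exact: (@smooth_derivable _ _ g z.1 w.1 sg).
by exists ('D_(w.1) g); split; [exact: smooth_derive|].
Qed.

Lemma smooth_snd (zeta : R -> R) : smooth zeta -> smooth (fun z : 'rV[R]_N * R => zeta z.2).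
Proof.
move=> sg; apply: (@smooth_coind _ _ (fun F => exists g : R -> R, smooth g /\ F = fun z : 'rV[R]_N * R => g z.2)); last by exists zeta.
move=> _ {sg}[{}g [sg ->]]; split.
  move=> z; apply: continuous_comp; first exact: cvg_snd.
  exact: smooth_continuous.
move=> w; split=> [z|]; first exact: (@smooth_derivable _ _ g z.2 w.2 sg).
by exists ('D_(w.2) g); split; [exact: smooth_derive|].
Qed.

Lemma product_test g (zeta : R -> R) (a b : R) : test_function setT g -> smooth zeta ->
  0 < a -> (forall t, ~~ (a <= t <= b) -> zeta t = 0) ->
  test_function [set z : 'rV[R]_N * R | 0 < z.2] (fun z => g z.1 * zeta z.2).
Proof.
move=> tg sz a0 z0; have /test_functionP[sg [L HL]] := tg.
have cK : compact (box L `*` `[a, b]%classic : set ('rV[R]_N * R)).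
  by apply: compact_setX; [exact: box_compact|exact: segment_compact].
have cl : closed (box L `*` `[a, b]%classic : set ('rV[R]_N * R)).
  by apply: compact_closed => //; exact: norm_hausdorff.
have sub : support_closure (fun z : 'rV[R]_N * R => g z.1 * zeta z.2) `<=` box L `*` `[a, b]%classic.
  rewrite /support_closure [X in _ `<=` X]((closure_id _).1 cl); apply: closure_subset.
  move=> [x t] /= H; split=> /=.
    by apply: contrapT => nx; move: H; rewrite HL// mul0r eqxx.
  rewrite in_itv/=; apply: contraT => nt; move: H; rewrite z0//.
  by rewrite mulr0 eqxx.
split.
- by apply: smoothM; [exact: smooth_fst|exact: smooth_snd].
- by apply: subclosed_compact cK sub; exact: closed_closure.
- move=> z /sub[_ /=]; rewrite in_itv/= => /andP[az _]; exact: lt_le_trans az.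
Qed.

Lemma product_test_derive g (zeta : R -> R) z (w : 'rV[R]_N) : smooth g -> smooth zeta ->
  'D_(w, 0) (fun z => g z.1 * zeta z.2) z = 'D_w g z.1 * zeta z.2.
Proof.
move=> sg sz.
have d1 : derivable (fun z : 'rV[R]_N * R => g z.1) z (w, 0) by exact: smooth_derivable (smooth_fst sg).
have d2 : derivable (fun z : 'rV[R]_N * R => zeta z.2) z (w, 0) by exact: smooth_derivable (smooth_snd sz).
rewrite (deriveM d1 d2) derive_fst derive_snd /= derive0 scaler0 add0r.
by rewrite /GRing.scale /= mulrC.
Qed.

End product_test.

Section force.
Context {R : realType} {N : nat}.
Local Notation T := (measurableTypeR R).
Local Notation muX := (@lebesgue_rV R N).
Local Notation muT := (@lebesgue_measure R).
Local Notation mu2 := (muX \x muT)%E.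
Variable f : 'rV[R]_N * R -> 'rV[R]_N.
Hypothesis hf : forall i, L1loc_space_time (fun z => f z ord0 i).
Hypothesis hdivf : divergence_free f.

Let mf i : measurable_fun (@space_time R N) (fun z => f z ord0 i).
Proof.
apply: measurable_loc => K tau cK tau0; apply/measurable_EFinP.
exact: measurable_int (hf i cK tau0).
Qed.

Lemma force_locally_finite (psi : 'rV[R]_N -> R) i : test_function setT psi ->
  locally_finite (fun z => f z ord0 i * psi z.1).
Proof.
move=> tp; have [C C0 HC] := test_bounded tp; have /test_functionP[sp [L HL]] := tp.
have mp : measurable_fun (@space_time R N) (fun z => psi z.1).
  exact: coord_measurable (test_measurable tp).
have mg : measurable_fun (@space_time R N) (fun z => f z ord0 i * psi z.1) by exact: measurable_funM.
split=> // tau.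
suff H s : 0 < s -> mu2.-integrable (slab s) (EFin \o (fun z => f z ord0 i * psi z.1)).
  have t1 : 0 < `|tau| + 1 by rewrite ltr_wpDl.
  apply: integrableS (H _ t1); [exact: measurable_slab|exact: measurable_slab|].
  by apply: slabW; rewrite (le_trans (ler_norm _))// lerDl.
move=> s0; have iK := hf i (@box_compact R N L) s0.
have mK : measurable ((box L : set 'rV[T]_N) `*` (`]0, s[%classic : set T)).
  by apply: measurableX; [exact: measurable_box|exact: measurable_interval].
have sub : (box L : set 'rV[T]_N) `*` (`]0, s[%classic : set T) `<=` slab s by move=> z [].
apply: (@integrable_supp _ _ _ mu2 _ _ _ (measurable_slab s) mK sub).
  move=> z [_ zs] nz; rewrite HL ?mulr0// => bz; exact: nz.
apply: (@integrableM_bounded _ _ _ mu2 _ _ _ C mK iK) => //.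
apply: measurable_funS mp; first exact: measurable_space_time.
by apply: subset_trans sub _; exact: slab_space_time.
Qed.

Lemma force_gradient_locally_finite (psi : 'rV[R]_N -> R) : test_function setT psi ->
  locally_finite (fun z => dot (f z) (grad psi z.1)).
Proof.
move=> tp; apply: locally_finite_sum => i; under eq_fun do rewrite mxE.
by apply: force_locally_finite; exact: test_derive.
Qed.

Lemma bump_Cc (t h : R) : 0 < h -> 0 < t - h -> Cc (bump t h).
Proof.
move=> h0 th; split; first exact: bump_continuous.
exists (t - h), (t + h); split=> // s ns; apply: bump0 => //.
by apply: contra ns => /andP[s1 s2]; rewrite !ltW.
Qed.

(** A divergence-free force does no work on gradient fields. *)
Lemma force_gradient_slice (psi : 'rV[R]_N -> R) : test_function setT psi ->
  {ae muT, forall t : T, 0 < t -> slice (fun z => dot (f z) (grad psi z.1)) t = 0}.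
Proof.
move=> tp; have lg := force_gradient_locally_finite tp; have sp := test_smooth tp.
apply: (bump_orthogonal (Lloc_slice lg)) => t h h0 th.
have cb := bump_Cc h0 th.
have sb : smooth (bump t h) by exact: plateau_smooth.
have b0 s : ~~ (t - h <= s <= t + h) -> bump t h s = 0.
  move=> ns; apply: bump0 => //.
  by apply: contra ns => /andP[s1 s2]; rewrite !ltW.
have [_ ->] := pairing_slab lg cb th b0.
have := hdivf (product_test tp sb th b0) => E; rewrite -[RHS]E.
have mST := @measurable_space_time R N.
rewrite (@Rintegral_supp _ _ _ mu2 (@space_time R N) (slab (t + h + 1)) (fun z => \sum_(i < N)
   f z ord0 i * 'D_(delta_mx ord0 i, 0) (fun z => psi z.1 * bump t h z.2) z)).
- apply: eq_Rintegral => z _; rewrite /dot mulr_suml; apply: eq_bigr => i _.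
  rewrite (product_test_derive z (delta_mx ord0 i) sp sb) mxE.
  exact: esym (mulrA _ _ _).
- exact: slab_space_time.
- move=> z [_ /=]; rewrite in_itv/= => /andP[z0 _] nz; apply: big1 => i _.
  rewrite product_test_derive// b0 ?mulr0//; apply/negP => /andP[_ zt]; apply: nz; split=> //=.
  by rewrite in_itv/= z0 (le_lt_trans zt)// ltrDl.
Qed.

Lemma force_pairing (psi : 'rV[R]_N -> R) eta : test_function setT psi -> Cc eta ->
  time_space_integral (fun x t => dot (f (x, t)) (grad psi x) * eta t) = 0.
Proof.
move=> tp ce; rewrite (pairing (force_gradient_locally_finite tp) ce).
transitivity (\int[muT]_t (0 : R)); last by rewrite Rintegral_cst// mul0r.
have [_ [a [b [a0 e0]]]] := ce.
have [i1 _] := slice_integrable (b + 1) (force_gradient_locally_finite tp).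
have mI : measurable (`]0, b + 1[%classic : set T) by exact: measurable_interval.
rewrite (@Rintegral_supp _ T R muT setT (`]0, b + 1[%classic)) => //; last first.
  move=> t _; rewrite /= in_itv/= => nt; rewrite e0 ?mulr0//; apply/negP => /andP[t1 t2]; apply: nt.
  by rewrite (lt_le_trans a0 t1) (le_lt_trans t2)// ltrDl.
rewrite [RHS](@Rintegral_supp _ T R muT setT (`]0, b + 1[%classic)) => //.
apply: ae_eq_Rintegral => //.
  apply: measurable_funM; first exact: measurable_of_integrable i1.
  by apply: measurable_funTS; apply: continuous_measurable_fun; case: ce.
apply: filterS (force_gradient_slice tp) => t Ht; rewrite /= in_itv/= => /andP[t0 _].
by rewrite Ht// mul0r.
Qed.

End force.

(** * Approximation of the radial field by gradients of test functions *)

Section radial.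
Context {R : realType} {N : nat}.
Local Notation T := (measurableTypeR R).
Implicit Types (x : 'rV[R]_N) (psi : 'rV[R]_N -> R).

Definition open_box (r : R) : set 'rV[R]_N := [set x | forall j, `|x ord0 j| < r].

Lemma open_boxP (r : R) : open (open_box r).
Proof.
rewrite openE => x xr; suff H (i : 'I_N) : \forall y \near nbhs x, `|(y : 'rV[R]_N) ord0 i| < r.
  exact: filter_forall H.
have c : (fun y : 'rV[R]_N => `|y ord0 i|) y @[y --> x] --> `|x ord0 i|.
  exact: (cvg_norm (@coord_continuous R 1 N ord0 i x)).
by exact: (cvgr_lt _ c _ (xr i)).
Qed.

Definition half_square (x : 'rV[R]_N) : R := 2^-1 * \sum_(i < N) x ord0 i ^+ 2.

Lemma half_square_smooth : smooth half_square.
Proof.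
apply: smoothZ; apply: smooth_sum => i; under eq_fun do rewrite expr2.
by apply: smoothM; exact: smooth_coord.
Qed.

Lemma partial_half_square i : partial i half_square = fun x : 'rV[R]_N => x ord0 i.
Proof.
apply/funext => x; rewrite /partial.
have dj (j : 'I_N) : is_derive x (delta_mx ord0 i : 'rV[R]_N) (fun y : 'rV[R]_N => y ord0 j * y ord0 j)
    (x ord0 j * (j == i)%:R + x ord0 j * (j == i)%:R).
  have := coord_derive j x (delta_mx ord0 i); rewrite mxE eqxx /= => d.
  exact: (is_deriveM d d).
have ds := is_derive_sum dj.
have E : half_square = 2^-1 *: (\sum_(j < N) (fun y : 'rV[R]_N => y ord0 j * y ord0 j)).
  by apply/funext => y; rewrite /half_square; congr (_ * _); rewrite fct_sumE.
have [_ ->] : is_derive x (delta_mx ord0 i : 'rV[R]_N) half_square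
   (2^-1 *: (\sum_(j < N) (x ord0 j * (j == i)%:R + x ord0 j * (j == i)%:R))).
  by rewrite E; exact: is_deriveZ.
rewrite (bigD1 i)//= eqxx big1 => [|j /negPf ->]; last by rewrite mulr0 addr0.
by rewrite addr0 mulr1 /GRing.scale /=; field.
Qed.

Lemma partial_coord (i j : 'I_N) : partial j (fun x : 'rV[R]_N => x ord0 i) = cst (i == j)%:R.
Proof.
apply/funext => x; rewrite /partial; have [_ ->] := coord_derive i x (delta_mx ord0 j).
by rewrite mxE eqxx.
Qed.

(** A compactly supported version of |x|^2 / 2, whose gradient is the radial field near
    the origin. *)
Definition potential (x : 'rV[R]_N) : R := half_square x * cutoff 1 x.
Local Notation Phi := potential.

Lemma potential_test : test_function setT Phi.
Proof. by apply: test_mull; [exact: half_square_smooth|exact: cutoff_test]. Qed.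

Let U1 := open_box 1.

Lemma potential_open_box x : U1 x -> Phi x = half_square x.
Proof. by move=> Ux; rewrite /Phi cutoff1 ?mulr1// => i; exact: ltW. Qed.

Lemma partial_potential i x : U1 x -> partial i Phi x = x ord0 i.
Proof.
move=> Ux; rewrite /partial (@derive_eq_open _ _ _ _ _ _ (@open_boxP 1) potential_open_box)//.
exact: (congr1 (fun g => g x) (partial_half_square i)).
Qed.

Lemma partial2_potential i j x : U1 x -> partial j (partial i Phi) x = (i == j)%:R.
Proof.
move=> Ux; rewrite {1}/partial (@derive_eq_open _ _ _ _ _ _ (@open_boxP 1) (partial_potential i))//.
exact: (congr1 (fun g => g x) (partial_coord i j)).
Qed.

Lemma test_laplacian psi : test_function setT psi -> test_function setT (laplacian psi).
Proof.
move=> /test_functionP[sp [L HL]]; apply/test_functionP; split.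
  by apply: smooth_sum => i; do 2 apply: smooth_derive.
exists L => x nx; apply: big1 => i _; rewrite /partial.
by apply: (@derive_box0 _ _ _ L) => // y ny; apply: (@derive_box0 _ _ _ L).
Qed.

Lemma laplacian_partial_potential i x : U1 x -> laplacian (partial i Phi) x = 0.
Proof.
move=> Ux; apply: big1 => j _.
rewrite {1}/partial (@derive_eq_open _ _ _ _ _ _ (@open_boxP 1) (@partial2_potential i j))//.
exact: derive_cst.
Qed.

Lemma partial_laplacian_potential i x : U1 x -> partial i (laplacian Phi) x = 0.
Proof.
move=> Ux; rewrite /partial (@derive_eq_open _ _ _ _ (fun=> \sum_(j < N) 1) _ (@open_boxP 1))//.
  exact: derive_cst.
by move=> y Uy; apply: eq_bigr => j _; rewrite partial2_potential ?eqxx.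
Qed.

Lemma partial_affine psi i (k c : R) : smooth psi ->
  partial i (fun x => k * psi (c *: x + 0)) = fun x : 'rV[R]_N => k * c * partial i psi (c *: x + 0).
Proof.
move=> sp; apply/funext => x; rewrite /partial.
have d := derive_affine c 0 x (delta_mx ord0 i) sp.
have [_ ->] : is_derive x (delta_mx ord0 i : 'rV[R]_N) (k *: (fun x => psi (c *: x + 0)))
   (k *: (c * 'D_(delta_mx ord0 i) psi (c *: x + 0))) by exact: is_deriveZ.
by rewrite /GRing.scale /= mulrA.
Qed.

(** Dilations that are exact on larger and larger boxes.  The scaling keeps the second
    derivatives bounded, and the third ones decay. *)
Definition potential_scaled (n : nat) (x : 'rV[R]_N) : R :=
  n.+1%:R ^+ 2 * Phi (n.+1%:R^-1 *: x + 0).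
Local Notation Psi := potential_scaled.

Lemma potential_scaled_test n : test_function setT (Psi n).
Proof.
have /test_functionP[sp [L HL]] := potential_test; apply/test_functionP; split.
  by apply: smoothZ; exact: smooth_comp_affine.
exists (n.+1%:R * L) => x nx; rewrite /Psi HL ?mulr0// => bx; apply: nx => j.
have := bx j; rewrite !mxE addr0 normrM ger0_norm ?invr_ge0// mulrC ler_pdivrMr ?ltr0n//.
by rewrite mulrC.
Qed.

Lemma coord_radial n i : Defs.coord (grad (Psi n)) i =
  fun x => n.+1%:R * partial i Phi (n.+1%:R^-1 *: x + 0).
Proof.
have sP := test_smooth potential_test.
apply/funext => x; rewrite /Defs.coord /grad mxE (partial_affine _ _ _ sP).
by rewrite expr2 mulfK// pnatr_eq0.
Qed.

Lemma radial_test n : vector_test_function (grad (Psi n)).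
Proof.
move=> i; rewrite (_ : Defs.coord _ i = partial i (Psi n)).
  by apply: test_derive; exact: potential_scaled_test.
by apply/funext => x; rewrite /Defs.coord mxE.
Qed.

Let sPi i : smooth (partial i Phi).
Proof. by apply: smooth_derive; exact: test_smooth potential_test. Qed.

Lemma partial_radial n i j : partial j (Defs.coord (grad (Psi n)) i) =
  fun x => 1 * partial j (partial i Phi) (n.+1%:R^-1 *: x + 0).
Proof. by rewrite coord_radial partial_affine// mulfV// pnatr_eq0. Qed.

Lemma laplacian_radial n i x : laplacian (Defs.coord (grad (Psi n)) i) x =
  n.+1%:R^-1 * laplacian (partial i Phi) (n.+1%:R^-1 *: x + 0).
Proof.
rewrite /laplacian mulr_sumr; apply: eq_bigr => j _; rewrite partial_radial partial_affine.
  by rewrite mul1r.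
exact: smooth_derive.
Qed.

Lemma divergence_radial n : divergence (grad (Psi n)) =
  fun x => 1 * laplacian Phi (n.+1%:R^-1 *: x + 0).
Proof.
by apply/funext => x; rewrite /divergence /laplacian mul1r; apply: eq_bigr => j _; rewrite partial_radial mul1r.
Qed.

Lemma grad_divergence_radial n i x : grad (divergence (grad (Psi n))) x ord0 i =
  n.+1%:R^-1 * partial i (laplacian Phi) (n.+1%:R^-1 *: x + 0).
Proof.
rewrite mxE divergence_radial partial_affine ?mul1r//.
exact: test_smooth (test_laplacian potential_test).
Qed.

Let near_open_box x : \forall n \near \oo, U1 (n.+1%:R^-1 *: x + 0).
Proof.
apply: filterS (near_box x) => n xn j; rewrite !mxE addr0 normrM ger0_norm ?invr_ge0//.
by rewrite mulrC ltr_pdivrMr ?ltr0n// mul1r.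
Qed.

Lemma radial_cvg i x : grad (Psi n) x ord0 i @[n --> \oo] --> x ord0 i.
Proof.
apply: cvg_near_cst; apply: filterS (near_open_box x) => n xn.
have := congr1 (fun g => g x) (coord_radial n i); rewrite /Defs.coord => ->.
by rewrite partial_potential// !mxE addr0 mulVKf// pnatr_eq0.
Qed.

Lemma partial_radial_cvg i j x : partial j (Defs.coord (grad (Psi n)) i) x @[n --> \oo] --> ((i == j)%:R : R).
Proof.
apply: cvg_near_cst; apply: filterS (near_open_box x) => n xn.
by rewrite partial_radial mul1r partial2_potential.
Qed.

(** The first derivatives of [potential] are Lipschitz and vanish at the origin. *)
Lemma radial_bound : exists2 K, 0 <= K & forall n i x, `|grad (Psi n) x ord0 i| <= K * (1 + enorm x).
Proof.
have /choice[K HK] : forall i : 'I_N, exists K, 0 < K /\ forall x y, `|partial i Phi x - partial i Phi y| <= K * `|x - y|.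
  by move=> i; have [K K0 HK] := test_lipschitz (test_derive (delta_mx ord0 i) potential_test); exists K.
have K0 j : 0 <= K j by exact: ltW (HK j).1.
exists (\sum_(i < N) K i); first exact: sumr_ge0.
move=> n i x; have := congr1 (fun g => g x) (coord_radial n i); rewrite /Defs.coord => ->.
have n0 : 0 < n.+1%:R :> R by rewrite ltr0n.
have U0 : U1 0 by move=> j; rewrite mxE normr0.
have := (HK i).2 (n.+1%:R^-1 *: x + 0) 0; rewrite (partial_potential _ U0) mxE !subr0 addr0.
rewrite normrZ (gtr0_norm (_ : 0 < n.+1%:R^-1)) ?invr_gt0// => H.
rewrite normrM (gtr0_norm n0).
apply: (@le_trans _ _ (K i * `|x|)).
  apply: (le_trans (ler_wpM2l (ltW n0) H)).
  by rewrite mulrCA mulVKf// gt_eqF.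
apply: ler_pM => //; first by rewrite (bigD1 i)//= lerDl sumr_ge0.
rewrite (@le_trans _ _ (enorm x))// ?lerDr//.
by rewrite -ler_sqr ?nnegrE ?enorm_ge0//; exact: norm_le_enorm.
Qed.

Lemma partial_radial_bound : exists2 K, 0 <= K &
  forall n i j x, `|partial j (Defs.coord (grad (Psi n)) i) x| <= K.
Proof.
have /choice[K HK] : forall ij : 'I_N * 'I_N, exists K, 0 < K /\ forall x, `|partial ij.2 (partial ij.1 Phi) x| <= K.
  move=> ij.
  by have [K K0 HK] := test_bounded (test_derive (delta_mx ord0 ij.2) (test_derive (delta_mx ord0 ij.1) potential_test)); exists K.
have K0 ij : 0 <= K ij by exact: ltW (HK ij).1.
exists (\sum_ij K ij); first exact: sumr_ge0.
move=> n i j x; rewrite partial_radial mul1r; apply: le_trans ((HK (i, j)).2 _) _.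
by rewrite (bigD1 (i, j))//= lerDl sumr_ge0.
Qed.

Lemma partial_radial_measurable n i j :
  measurable_fun [set: 'rV[T]_N] (partial j (Defs.coord (grad (Psi n)) i)).
Proof. by apply: test_measurable; apply: test_derive; exact: radial_test. Qed.

End radial.

(** * The virial identity *)

Lemma cvg_balance (R : realType) (a b c d e : nat -> R) (A B C k l : R) :
  a n @[n --> \oo] --> A -> b n @[n --> \oo] --> B -> c n @[n --> \oo] --> C ->
  d n @[n --> \oo] --> 0 -> e n @[n --> \oo] --> 0 ->
  (forall n, a n + b n = - c n - k * d n - l * e n) -> A = - (B + C).
Proof.
move=> cA cB cC cd ce H.
have cR : (b n + c n + (k * d n + l * e n)) @[n --> \oo] --> B + C + (k * 0 + l * 0).
  apply: cvgD; first exact: cvgD.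
  by apply: cvgD; apply: cvgM => //; exact: cvg_cst.
have := cvg_opp_unique cA cR; rewrite !mulr0 !addr0; apply=> n.
by have := H n; lra.
Qed.

Section virial.
Context {R : realType} {N : nat}.
Local Notation T := (measurableTypeR R).
Local Notation muX := (@lebesgue_rV R N).
Local Notation muT := (@lebesgue_measure R).
Local Notation mu2 := (muX \x muT)%E.

Lemma pairing_sum (g : 'I_N -> 'rV[R]_N * R -> R) eta : (forall i, locally_finite (g i)) -> Cc eta ->
  time_space_integral (fun x t => (\sum_(i < N) g i (x, t)) * eta t) =
  \sum_(i < N) \int[muT]_t (slice (g i) t * eta t).
Proof.
move=> lg ce; have [_ [a [b [a0 e0]]]] := ce.
have [-> ->] := pairing_slab (locally_finite_sum lg) ce a0 e0.
under eq_Rintegral do rewrite mulr_suml.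
have mS := @measurable_slab R N (b + 1).
have ig i : mu2.-integrable (slab (b + 1)) (EFin \o (fun z => g i z * eta z.2)).
  exact: (locally_finite_time (lg i) ce).2.
have [_ ->] := @Rintegral_sum _ _ _ mu2 _ _ (index_enum 'I_N) _ mS ig.
by apply: eq_bigr => i _; have [_ ->] := pairing_slab (lg i) ce a0 e0.
Qed.

Variables (a gamma mu lambda : R) (f : 'rV[R]_N * R -> 'rV[R]_N).
Variables (rho0 : 'rV[R]_N -> R) (v0 : 'rV[R]_N -> 'rV[R]_N).
Variables (rho p : 'rV[R]_N * R -> R) (v : 'rV[R]_N * R -> 'rV[R]_N).
Variable Dv : 'rV[R]_N * R -> 'M[R]_N.
Hypothesis N3 : (3 <= N)%N.
Hypothesis a_gt0 : 0 < a.
Hypothesis gamma_gt1 : 1 < gamma.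
Hypothesis hf : forall i, L1loc_space_time (fun z => f z ord0 i).
Hypothesis hdivf : divergence_free f.
Hypothesis sol : finite_energy_solution_with a gamma mu lambda f rho0 v0 rho p v Dv.
Hypothesis second_moment : Lq_loc_Lp 1%:E 1%:E (fun z => rho z * enorm z.1 ^+ 2).
Hypothesis hv : Lq_loc_Lp_mx 1%:E (N%:R / (N%:R - 1))%:E v.

Local Notation phi n := (grad (@potential_scaled R N n)).

Let mrho := rho_measurable sol.

Let phi_measurable n j : measurable_fun [set: 'rV[T]_N] (fun x : 'rV[R]_N => phi n x ord0 j).
Proof. exact: test_measurable (radial_test n j). Qed.

Let tensor_measurable n :
  measurable_fun (@space_time R N) (fun z => tensor_grad (phi n) z.1 (v z)).
Proof.
apply: (@measurable_sum _ _ _ _ 'I_N (index_enum _) (fun i (z : 'rV[R]_N * R) => \sum_(j < N) v z ord0 i * v z ord0 j *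
  partial j (Defs.coord (phi n) i) z.1)) => i.
apply: (@measurable_sum _ _ _ _ 'I_N (index_enum _) (fun j (z : 'rV[R]_N * R) => v z ord0 i * v z ord0 j *
  partial j (Defs.coord (phi n) i) z.1)) => j.
apply: measurable_funM; last exact: coord_measurable (partial_radial_measurable n i j).
by apply: measurable_funM; exact: (v_measurable sol).
Qed.

Let divergence_measurable n :
  measurable_fun (@space_time R N) (fun z => divergence (phi n) z.1).
Proof.
apply: (@measurable_sum _ _ _ _ 'I_N (index_enum _) (fun i (z : 'rV[R]_N * R) =>
  partial i (Defs.coord (phi n) i) z.1)) => i.
exact: coord_measurable (partial_radial_measurable n i i).
Qed.

Lemma tensor_cvg z : tensor_grad (phi n) z.1 (v z) @[n --> \oo] --> enorm (v z) ^+ 2.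
Proof.
have -> : enorm (v z) ^+ 2 = \sum_(i < N) \sum_(j < N) v z ord0 i * v z ord0 j * (i == j)%:R.
  rewrite enorm_sq; apply: eq_bigr => i _; rewrite (bigD1 i)//= eqxx mulr1 -expr2 big1 ?addr0// => j ji.
  by rewrite eq_sym (negPf ji) mulr0.
apply: cvg_big => [|i _]; first exact: add_continuous.
apply: cvg_big => [|j _]; first exact: add_continuous.
by apply: cvgM; [exact: cvg_cst|exact: partial_radial_cvg].
Qed.

Lemma divergence_cvg (x : 'rV[R]_N) : divergence (phi n) x @[n --> \oo] --> (N%:R : R).
Proof.
have -> : N%:R = \sum_(i < N) (i == i)%:R :> R.
  by under eq_bigr do rewrite eqxx; rewrite sumr_const card_ord.
by apply: cvg_big => [|i _]; [exact: add_continuous|exact: partial_radial_cvg].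
Qed.

Lemma tensor_le K n z : 0 <= K ->
  (forall n i j x, `|partial j (Defs.coord (phi n) i) x| <= K) ->
  `|tensor_grad (phi n) z.1 (v z)| <= N%:R ^+ 2 * K * enorm (v z) ^+ 2.
Proof.
move=> K0 HK.
have vj j : `|v z ord0 j| <= enorm (v z).
  by rewrite -ler_sqr ?nnegrE ?enorm_ge0//; exact: coord_le_enorm.
have H i j : `|v z ord0 i * v z ord0 j * partial j (Defs.coord (phi n) i) z.1| <= K * enorm (v z) ^+ 2.
  by rewrite normrM mulrC ler_pM// normrM expr2 ler_pM.
apply: (le_trans (ler_norm_sum _ _ _)).
apply: (@le_trans _ _ (\sum_(i < N) \sum_(j < N) (K * enorm (v z) ^+ 2))).
  by apply: ler_sum => i _; apply: (le_trans (ler_norm_sum _ _ _)); apply: ler_sum => j _.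
have E (y : R) : y *+ N *+ N = N%:R ^+ 2 * y by rewrite -mulrnA -(mulr_natl y) natrM expr2.
by rewrite !sumr_const card_ord E mulrA.
Qed.

Lemma divergence_le K n (x : 'rV[R]_N) : 
  (forall n i j x, `|partial j (Defs.coord (phi n) i) x| <= K) ->
  `|divergence (phi n) x| <= N%:R * K.
Proof.
move=> HK; apply: (le_trans (ler_norm_sum _ _ _)).
by apply: (le_trans (ler_sum _ (fun j _ => HK _ _ _ _))); rewrite sumr_const card_ord mulr_natl.
Qed.

Let viscous_sum_cvg (S : 'I_N -> 'rV[R]_N -> R) eta : (forall i, test_function setT (S i)) ->
  (forall i (x : 'rV[R]_N), (forall j, `|x ord0 j| < 1) -> S i x = 0) -> Cc eta ->
  time_space_integral (fun x t => (\sum_(i < N) v (x, t) ord0 i *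
    (n.+1%:R^-1 * S i (n.+1%:R^-1 *: x + 0))) * eta t) @[n --> \oo] --> (0 : R).
Proof.
move=> tS S0 ce.
have l i n := @viscous_locally_finite R N v N3 hv (S i) (tS i) (S0 i) i n.
have E n := pairing_sum (fun i => l i n) ce.
under eq_fun do rewrite E.
suff c : \sum_(i < N) \int[muT]_t (slice (fun z => v z ord0 i *
    (n.+1%:R^-1 * S i (n.+1%:R^-1 *: z.1 + 0))) t * eta t) @[n --> \oo] --> \sum_(i < N) (0 : R).
  by move: c; rewrite [X in _ --> X]big1.
apply: cvg_big => [|i _]; first exact: add_continuous.
exact: (@viscous_pairing_cvg R N v N3 hv (S i) (tS i) (S0 i) i).
Qed.

(** The momentum equation tested with [x]: the viscous terms drop out as the
    second derivatives of the test fields decay like the inverse of the radius. *)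
Lemma momentum_weighted : weak_eq (slice (fun z => rho z * dot (v z) z.1))
  (fun t => slice (fun z => rho z * enorm (v z) ^+ 2) t + slice (fun z => p z * N%:R) t).
Proof.
have [K1 K10 HK1] := @radial_bound R N.
have [K2 K20 HK2] := @partial_radial_bound R N.
have lk := locally_finite_kinetic a_gt0 gamma_gt1 sol.
have lp := locally_finite_power a_gt0 gamma_gt1 sol.
have lpp := locally_finite_pressure a_gt0 gamma_gt1 sol.
have lpN : locally_finite (fun z => p z * N%:R).
  by have := locally_finiteZ N%:R lpp; under eq_fun do rewrite mulrC.
have lW := locally_finite_majorant a_gt0 gamma_gt1 sol second_moment.
have my : measurable_fun (@space_time R N) (fun z => rho z * dot (v z) z.1).
  apply: measurable_funM => //; apply: (dot_measurable sol (phi := id)) => j.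
  exact: measurable_coord_rV.
have ly : locally_finite (fun z => rho z * dot (v z) z.1).
  apply: (momentum_locally_finite a_gt0 gamma_gt1 sol second_moment (phi := id) ler01).
    by move=> j; exact: measurable_coord_rV.
  move=> x j; rewrite mul1r (@le_trans _ _ (enorm x))// ?lerDr//.
  by rewrite -ler_sqr ?nnegrE ?enorm_ge0//; exact: coord_le_enorm.
have LG : Lloc 0 (fun t => slice (fun z => rho z * enorm (v z) ^+ 2) t + slice (fun z => p z * N%:R) t).
  by apply: LlocD; exact: Lloc_slice.
split=> // [|xi cxi]; first exact: Lloc_slice.
have [c1 c2] := C1c_Cc cxi.
have x0 : xi 0 = 0.
  by have [_ _ [t1 [t2 [t10 H]]]] := cxi; apply: H; rewrite negb_and -ltNge t10.
have [] := @pairing_cvg R N (fun n z => rho z * dot (v z) (phi n z.1)) (fun z => rho z * dot (v z) z.1)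
  (fun z => N%:R * K1 * majorant rho v z) (derive1 xi).
- by move=> n; apply: measurable_funM => //; apply: (dot_measurable sol).
- by [].
- exact: locally_finiteZ.
- by [].
- apply: ae_imp (density_ge0 sol) => z r0 z0 n; apply: momentum_le_majorant => //; first exact: r0.
- move=> z; apply: cvgM; first exact: cvg_cst.
  rewrite /dot; apply: cvg_big => [|i _]; first exact: add_continuous.
  by apply: cvgM; [exact: cvg_cst|exact: radial_cvg].
move=> lA _ cA.
have [] := @pairing_cvg R N (fun n z => rho z * tensor_grad (phi n) z.1 (v z)) (fun z => rho z * enorm (v z) ^+ 2)
  (fun z => N%:R ^+ 2 * K2 * (rho z * enorm (v z) ^+ 2)) xi.
- by move=> n; apply: measurable_funM.
- by case: lk.
- exact: locally_finiteZ.
- by [].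
- apply: ae_imp (density_ge0 sol) => z r0 z0 n; rewrite normrM (ger0_norm (r0 z0)) mulrCA.
  by rewrite ler_wpM2l ?r0//; exact: tensor_le.
- by move=> z; apply: cvgM; [exact: cvg_cst|exact: tensor_cvg].
move=> lB _ cB.
have [] := @pairing_cvg R N (fun n z => p z * divergence (phi n) z.1) (fun z => p z * N%:R)
  (fun z => N%:R * K2 * a * rho z `^ gamma) xi.
- by move=> n; apply: measurable_funM => //; exact: (pressure_measurable sol).
- by case: lpN.
- exact: locally_finiteZ.
- by [].
- apply: ae_imp (pressure_law sol) => z pz z0 n; rewrite pz// normrM mulrC.
  rewrite (ger0_norm (_ : 0 <= a * _)) ?mulr_ge0 ?powR_ge0 ?(ltW a_gt0)// -[leRHS]mulrA.
  by rewrite ler_wpM2r ?mulr_ge0 ?powR_ge0 ?(ltW a_gt0)//; exact: divergence_le.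
- by move=> z; apply: cvgM; [exact: cvg_cst|exact: divergence_cvg].
move=> lP _ cP.
have tPi i : test_function setT (partial i (@potential R N)) by exact: test_derive potential_test.
have cV := viscous_sum_cvg (S := fun i => laplacian (partial i (@potential R N)))
  (fun i => test_laplacian (tPi i)) (@laplacian_partial_potential R N) c1.
have cW := viscous_sum_cvg (S := fun i => partial i (laplacian (@potential R N)))
  (fun i => test_derive _ (test_laplacian potential_test)) (@partial_laplacian_potential R N) c1.
have [iB iP] : muT.-integrable setT (EFin \o (fun t => slice (fun z => rho z * enorm (v z) ^+ 2) t * xi t)) /\
    muT.-integrable setT (EFin \o (fun t => slice (fun z => p z * N%:R) t * xi t)).
  by split; [have [] := C1c_integrable (Lloc_slice lk) cxi|have [] := C1c_integrable (Lloc_slice lpN) cxi].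
under [X in - X]eq_Rintegral do rewrite mulrDl.
rewrite RintegralD//.
refine (cvg_balance (k := mu) (l := mu + lambda) cA cB cP cV cW _) => n.
have := momentum_eq sol (radial_test n) (C1c_time_test cxi).
rewrite x0 mul0r add0r (force_pairing hf hdivf (potential_scaled_test n) c1) subr0.
rewrite (pairing (lA n) c2) (pairing (lB n) c1) (pairing (lP n) c1).
have -> : (fun (x : 'rV[R]_N) (t : R) => dot (v (x, t)) (vector_laplacian (phi n) x) * xi t) =
  (fun (x : 'rV[R]_N) (t : R) => (\sum_(i < N) v (x, t) ord0 i *
    (n.+1%:R^-1 * laplacian (partial i (@potential R N)) (n.+1%:R^-1 *: x + 0))) * xi t).
  apply/funext => x; apply/funext => t; congr (_ * _); apply: eq_bigr => i _.
  by rewrite mxE laplacian_radial.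
have -> : (fun (x : 'rV[R]_N) (t : R) => dot (v (x, t)) (grad (divergence (phi n)) x) * xi t) =
  (fun (x : 'rV[R]_N) (t : R) => (\sum_(i < N) v (x, t) ord0 i *
    (n.+1%:R^-1 * partial i (laplacian (@potential R N)) (n.+1%:R^-1 *: x + 0))) * xi t).
  apply/funext => x; apply/funext => t; congr (_ * _); apply: eq_bigr => i _.
  by rewrite grad_divergence_radial.
by [].
Qed.

End virial.

(** * Two differential inequalities *)

Section differential_inequalities.
Context {R : realType}.
Local Notation T := (measurableTypeR R).
Local Notation leb := (@lebesgue_measure R).

Lemma powR_weight t0 (r : R) : 0 <= t0 -> weight t0 (fun t => t `^ r) (fun t => r * t `^ (r - 1)).
Proof.
move=> t00 t tt; have t_gt0 : 0 < t by exact: le_lt_trans tt.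
split; first exact: is_derive1_powR.
have c : {for t, continuous (fun t : R => t `^ (r - 1))}.
  apply: differentiable_continuous; apply/derivable1_diffP.
  by case: (@is_derive1_powR R (r - 1) t t_gt0).
by apply: cvgM; [exact: cvg_cst|exact: c].
Qed.

Lemma id_weight t0 : weight t0 (fun t : R => t) (fun=> 1).
Proof. by move=> t _; split; [exact: is_derive_id|exact: cvg_cst]. Qed.

Lemma sqr_weight t0 : weight t0 (fun t : R => t ^+ 2) (fun t => 2 * t).
Proof.
move=> t _; split; last by apply: cvgM; [exact: cvg_cst|exact: cvg_id].
have [d1 d2] := is_deriveM (is_derive_id t (1 : R)) (is_derive_id t (1 : R)).
have E : (fun t : R => t ^+ 2) = (id * id)%R by apply/funext => u; rewrite expr2.
by rewrite E; apply: DeriveDef => //; rewrite d2 /GRing.scale /=; ring.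
Qed.

Lemma Lloc_const t0 (c : R) : Lloc t0 (fun=> c).
Proof. by move=> a b _; exact: continuous_integrable_itv _ _ (fun=> cvg_cst _). Qed.

Lemma weak_le_const t0 (c : R) : weak_le t0 (fun=> c) (fun=> 0).
Proof.
split; [exact: Lloc_const|exact: Lloc_const|move=> xi cxi _].
have [_ i] := C1c_integrable (Lloc_const (t0 := t0) 1) cxi.
have ix : leb.-integrable setT (EFin \o derive1 xi).
  by move: i; apply: eq_integrable => // t _; rewrite /= mul1r.
rewrite [leRHS]RintegralZl// (C1c_integral_derive cxi) mulr0.
by under eq_Rintegral do rewrite mul0r; rewrite Rintegral_cst// mul0r oppr0.
Qed.

(** With H = I - t y + t^2 E, the equations give H' <= y - y - t y' + 2 t E
    = (2 - k) t P, and this is at most m H / t, as t^2 P <= H; hence t^-m H is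
    nonincreasing. *)
Lemma virial_growth (I y y' E P : R -> R) (k : R) :
  weak_eq I y -> weak_eq y y' -> weak_le 0 E (fun=> 0) ->
  {ae leb, forall t : T, 0 < t -> y' t = 2 * E t + (k - 2) * P t} ->
  {ae leb, forall t : T, 0 < t -> 0 <= P t /\ t ^+ 2 * P t <= I t - t * y t + t ^+ 2 * E t} ->
  exists2 C, 0 <= C & {ae leb, forall t : T, 1 < t ->
    I t - t * y t + t ^+ 2 * E t <= C * t `^ (Num.max 0 (2 - k))}.
Proof.
move=> Iy yy' wE y'E PH; set m := Num.max 0 (2 - k).
have m0 : 0 <= m by rewrite le_max lexx.
have mk : 2 - k <= m by rewrite le_max lexx orbT.
have h1 := weak_eq_le 1 Iy.
have h2 := weak_leM (id_weight (t0 := 0)) (fun t => @ltW _ _ 0 t) (weak_eq_le (-1) yy').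
have h3 := weak_leM (sqr_weight (t0 := 0)) (fun t _ => sqr_ge0 t) wE.
have h := weak_leD h1 (weak_leD h2 h3).
have HE t : 1 * I t + (t * (-1 * y t) + t ^+ 2 * E t) = I t - t * y t + t ^+ 2 * E t by ring.
have {}h : weak_le 0 (fun t => I t - t * y t + t ^+ 2 * E t)
    (fun t => m / t * (I t - t * y t + t ^+ 2 * E t)).
  have LH : Lloc 0 (fun t => I t - t * y t + t ^+ 2 * E t).
    by case: h; under eq_fun do rewrite HE.
  have := weak_le_ge h; under eq_fun do rewrite HE; apply.
    apply: (Lloc_cont _ LH) => t t0; apply: cvgM; first exact: cvg_cst.
    by apply: cvgV; [rewrite gt_eqF|exact: cvg_id].
  apply: ae_imp2 y'E PH => t yE PHt t0; have [P0 PHt'] := PHt t0.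
  have -> : 1 * y t + (t * (-1 * y' t) + 1 * (-1 * y t) + (t ^+ 2 * 0 + 2 * t * E t)) =
      (2 - k) * (t * P t) by rewrite yE//; ring.
  apply: (@le_trans _ _ (m * (t * P t))).
    by rewrite ler_wpM2r// mulr_ge0// ltW.
  apply: (@le_trans _ _ (m / t * (t ^+ 2 * P t))).
    by rewrite le_eqVlt; apply/orP; left; apply/eqP; field; rewrite gt_eqF.
  by rewrite ler_wpM2l// divr_ge0// ltW.
have {}h : weak_le 0 (fun t => t `^ (- m) * (I t - t * y t + t ^+ 2 * E t)) (fun=> 0).
  apply: (weak_le_ge (weak_leM (powR_weight (- m) (lexx 0)) (fun t _ => powR_ge0 t _) h)).
    exact: Lloc_const.
  apply/aeW => t t0; rewrite le_eqVlt; apply/orP; left; apply/eqP.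
  have -> : t `^ (- m - 1) = t `^ (- m) / t.
    by rewrite powRD ?powR_inv1 ?(ltW t0)//; apply/implyP => _; rewrite gt_eqF.
  ring.
have [Q aeQ HQ] := weak_le_nonincreasing h.
have [s [/andP[s0 s1] [Qs Hs]]] : exists s, 0 < s < 1 /\ (Q s /\ 0 <= I s - s * y s + s ^+ 2 * E s).
  have aeR : {ae leb, forall s : T, 0 < s -> Q s /\ 0 <= I s - s * y s + s ^+ 2 * E s}.
    apply: ae_imp2 aeQ PH => s hq hp s0; split; first exact: hq.
    have [P0 H] := hp s0; by apply: le_trans H; rewrite mulr_ge0// sqr_ge0.
  have [s [/andP[s0 s1] Hs]] := ae_exists_itv (@ltr01 R) aeR.
  by exists s; rewrite s0 s1; split=> //; exact: Hs.
exists (s `^ (- m) * (I s - s * y s + s ^+ 2 * E s)); first by rewrite mulr_ge0// powR_ge0.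
apply: ae_imp aeQ => t hq t1; have t0 : 0 < t by exact: lt_trans t1.
have := HQ s t s0 (lt_trans s1 t1) Qs (hq t0).
rewrite powRN mulrC ler_pdivrMr// powR_gt0//.
Qed.

(** Since (A / t)' = (B - A / t) / t, the function A / t is nondecreasing up to an
    error of order t^(m/2 - 1).  As it is small at arbitrarily late times, it is at most
    this error. *)
Lemma sublinear_growth (A B : R -> R) (C m : R) : 0 <= C -> m < 2 ->
  weak_eq A B ->
  {ae leb, forall t : T, 1 < t -> A t / t - B t <= C * t `^ (m / 2 - 1)} ->
  (forall e s (Q : R -> Prop), 0 < e -> {ae leb, forall t : T, 1 < t -> Q t} ->
     exists t, [/\ s < t, 1 < t, Q t & A t <= e * t]) ->
  exists2 k, 0 <= k & {ae leb, forall t : T, 1 < t -> A t <= k * t `^ (m / 2)}.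
Proof.
move=> C0 m2 AB BA liminf.
have r0 : 0 < 1 - m / 2 by rewrite subr_gt0 ltr_pdivrMr// mul1r.
pose k := C / (1 - m / 2).
have k0 : 0 <= k by rewrite divr_ge0// ltW.
have h1 := weak_leM (powR_weight (-1) ler01) (fun t _ => powR_ge0 t _) (weak_leW ler01 (weak_eq_le (-1) AB)).
have h2 := weak_leM (powR_weight (m / 2 - 1) ler01) (fun t _ => powR_ge0 t _) (weak_le_const 1 k).
have h : weak_le 1 (fun t => t `^ (-1) * (-1 * A t) + t `^ (m / 2 - 1) * k) (fun=> 0).
  apply: (weak_le_ge (weak_leD h1 h2)); first exact: Lloc_const.
  apply: ae_imp BA => t H t1; have {}H := H t1; have t0 : 0 < t by exact: lt_trans t1.
  have -> : t `^ (-1) = t^-1 by rewrite powR_inv1// ltW.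
  have -> : t `^ (-1 - 1) = t^-1 * t^-1.
    by rewrite powRD ?powR_inv1 ?(ltW t0)//; apply/implyP => _; rewrite gt_eqF.
  have -> : t `^ (m / 2 - 1 - 1) = t `^ (m / 2 - 1) * t^-1.
    by rewrite powRD ?powR_inv1 ?(ltW t0)//; apply/implyP => _; rewrite gt_eqF.
  rewrite (_ : _ + _ = t^-1 * (A t / t - B t - (1 - m / 2) * k * t `^ (m / 2 - 1))); last by ring.
  have -> : (1 - m / 2) * k = C by rewrite /k mulrC divfK// gt_eqF.
  by rewrite pmulr_rle0 ?invr_gt0// subr_le0.
have [Q aeQ HQ] := weak_le_nonincreasing h.
exists k => //; apply: ae_imp (aeQ) => s Qs s1; have {}Qs := Qs s1.
have s0 : 0 < s by exact: lt_trans s1.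
rewrite -subr_le0.
suff H : A s / s <= k * s `^ (m / 2 - 1).
  rewrite subr_le0; move: H; rewrite ler_pdivrMr// => /le_trans; apply.
  rewrite -mulrA -[X in _ * (_ * X) <= _](powRr1 (ltW s0)) -powRD ?subrK//.
  by apply/implyP => _; rewrite gt_eqF.
apply/ler_addgt0Pr => e e0.
have [t [st t1 Qt At]] := liminf e s Q e0 aeQ.
have t0 : 0 < t by exact: lt_trans t1.
have := HQ s t s1 st Qs Qt; rewrite !powR_inv1 ?(ltW t0) ?(ltW s0)// => H.
have H1 : t^-1 * A t <= e by rewrite mulrC ler_pdivrMr.
have H2 : 0 <= t `^ (m / 2 - 1) * k by rewrite mulr_ge0// powR_ge0.
move: H H1 H2; rewrite !mulN1r !mulrN [A s / s]mulrC [k * _]mulrC; clear; lra.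
Qed.

End differential_inequalities.

(** * A smooth weight of linear growth *)

Section linear_weight.
Context {R : realType}.

Lemma continuous_segment_bounded (f : R -> R) (a b : R) : continuous f ->
  exists2 C, 0 < C & forall t, a <= t <= b -> `|f t| <= C.
Proof.
move=> cf.
have := continuous_compact (continuous_subspaceT cf) (@segment_compact R a b).
move=> /compact_bounded[M [_ HM]]; exists (`|M| + 1); first by rewrite ltr_wpDl.
move=> t tab; apply: (HM (`|M| + 1)); first by rewrite ltr_pwDr// ler_norm.
by exists t => //=; rewrite in_itv.
Qed.

(** A smooth modification of the absolute value near the origin. *)
Definition soft_abs (s : R) : R := s * (step s - step (- s)).

Lemma soft_abs_smooth : smooth soft_abs.
Proof.
apply: smoothM; first exact: smooth_id.
apply: smoothB; first exact: step_smooth.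
have := smooth_comp_affine (-1) 0 (@step_smooth R).
by under eq_fun do rewrite addr0 scaleN1r.
Qed.

Lemma soft_abs_pos s : 0 <= s -> soft_abs s = s * step s.
Proof. by move=> s0; rewrite /soft_abs (step_le0 (_ : - s <= 0)) ?oppr_le0// subr0. Qed.

Lemma soft_abs_neg s : s <= 0 -> soft_abs s = (- s) * step (- s).
Proof. by move=> s0; rewrite /soft_abs (step_le0 s0) sub0r mulrN mulNr. Qed.

Lemma soft_abs_ge0 s : 0 <= soft_abs s.
Proof.
have [s0|s0] := leP 0 s; first by rewrite soft_abs_pos// mulr_ge0// step_ge0.
by rewrite soft_abs_neg ?(ltW s0)// mulr_ge0 ?step_ge0// oppr_ge0 ltW.
Qed.

Lemma soft_abs_ge1 s : 1 <= s -> soft_abs s = s.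
Proof. by move=> s1; rewrite soft_abs_pos ?step_ge1 ?mulr1// (le_trans _ s1). Qed.

Lemma soft_abs_leN1 s : s <= -1 -> soft_abs s = - s.
Proof.
move=> s1; rewrite soft_abs_neg; last by rewrite (le_trans s1)// lerN10.
by rewrite step_ge1 ?mulr1// lerNr.
Qed.

Lemma soft_abs_ge s : `|s| - 1 <= soft_abs s.
Proof.
have [s1|s1] := leP 1 s.
  have s0 : 0 <= s by exact: le_trans s1.
  by rewrite soft_abs_ge1// (ger0_norm s0) gerBl.
have [sN|sN] := leP s (-1).
  have s0 : s <= 0 by rewrite (le_trans sN)// lerN10.
  by rewrite soft_abs_leN1// (ler0_norm s0) gerBl.
apply: le_trans (soft_abs_ge0 s); rewrite subr_le0 ler_norml (ltW s1) andbT ltW//.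
Qed.

Lemma soft_abs_le s : soft_abs s <= `|s|.
Proof.
have [s0|s0] := leP 0 s.
  by rewrite soft_abs_pos// ger0_norm// ler_piMr// step_le1.
by rewrite soft_abs_neg ?(ltW s0)// ltr0_norm// ler_piMr ?step_le1// oppr_ge0 ltW.
Qed.

Local Notation dsoft_abs := ('D_1 soft_abs).

Let derive_gt1 s : 1 < s -> dsoft_abs s = 1.
Proof.
move=> s1; have -> : dsoft_abs s = 'D_1 (@id R) s.
  apply: (@derive_eq_open _ _ [set s : R | 1 < s]) => //.
  by move=> t /= t1; rewrite soft_abs_ge1// ltW.
by rewrite derive_id.
Qed.

Let derive_ltN1 s : s < -1 -> dsoft_abs s = -1.
Proof.
move=> s1; have -> : dsoft_abs s = 'D_1 (- (@id R)) s.
  apply: (@derive_eq_open _ _ [set s : R | s < -1]) => //.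
  by move=> t /= t1; rewrite soft_abs_leN1// ltW.
by rewrite deriveN// derive_id.
Qed.

Lemma soft_abs_derive_bound : exists2 C, 0 <= C &
  forall s, `|dsoft_abs s| <= C /\ `|s * dsoft_abs s - soft_abs s| <= C.
Proof.
have cd : continuous dsoft_abs by exact: smooth_continuous (smooth_derive _ soft_abs_smooth).
have c2 : continuous (fun s : R => s * dsoft_abs s - soft_abs s : R).
  move=> s; apply: cvgB; last exact: smooth_continuous soft_abs_smooth _.
  by apply: cvgM; [exact: cvg_id|exact: cd].
have [C1 C10 HC1] := @continuous_segment_bounded _ (-1) 1 cd.
have [C2 C20 HC2] := @continuous_segment_bounded _ (-1) 1 c2.
have C0 : 0 <= C1 + C2 + 1 by rewrite !addr_ge0 ?(ltW C10) ?(ltW C20).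
have le1 : 1 <= C1 + C2 + 1 by rewrite lerDr addr_ge0 ?(ltW C10) ?(ltW C20).
exists (C1 + C2 + 1) => // s.
have [s1|s1] := ltP 1 s.
  by rewrite derive_gt1// normr1 mulr1 soft_abs_ge1 ?(ltW s1)// subrr normr0.
have [sN|sN] := ltP s (-1).
  by rewrite derive_ltN1// normrN1 mulrN1 soft_abs_leN1 ?(ltW sN)// subrr normr0.
split; first by apply: (le_trans (HC1 s _)); rewrite ?sN// -addrA lerDl addr_ge0// ltW.
by apply: (le_trans (HC2 s _)); rewrite ?sN// addrAC lerDr addr_ge0// ltW.
Qed.

End linear_weight.

Section weight_function.
Context {R : realType} {N : nat}.
Implicit Types (x : 'rV[R]_N).

Definition linear_weight (x : 'rV[R]_N) : R := \sum_(i < N) soft_abs (x ord0 i).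
Local Notation h := linear_weight.

Lemma linear_weight_smooth : smooth h.
Proof.
apply: smooth_sum => i.
exact: (smooth_comp (@soft_abs_smooth R) (smooth_coord i)).
Qed.

Lemma linear_weight_ge0 x : 0 <= h x.
Proof. by apply: sumr_ge0 => i _; exact: soft_abs_ge0. Qed.

Lemma linear_weight_ge x i : `|x ord0 i| - 1 <= h x.
Proof.
rewrite /h (bigD1 i)//=; apply: (le_trans (soft_abs_ge _)); rewrite lerDl.
by apply: sumr_ge0 => j _; exact: soft_abs_ge0.
Qed.

Lemma linear_weight_le x : `|h x| <= N%:R * (1 + enorm x ^+ 2).
Proof.
rewrite ger0_norm ?linear_weight_ge0//.
apply: (@le_trans _ _ (\sum_(i < N) (1 + enorm x ^+ 2))); last by rewrite sumr_const card_ord mulr_natl.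
apply: ler_sum => i _; apply: (le_trans (soft_abs_le _)).
have := coord_le_enorm x i; have := sqr_ge0 (`|x ord0 i| - 1); have := normr_ge0 (x ord0 i); nra.
Qed.

Lemma partial_linear_weight i x : partial i h x = 'D_1 (@soft_abs R) (x ord0 i).
Proof.
have dj (j : 'I_N) : is_derive x (delta_mx ord0 i : 'rV[R]_N) (fun y : 'rV[R]_N => soft_abs (y ord0 j))
    ('D_((j == i)%:R) (@soft_abs R) (x ord0 j)).
  apply: DeriveDef; first exact: smooth_derivable (smooth_comp (@soft_abs_smooth R) (smooth_coord j)).
  suff E : (fun k : R => k^-1 *: (((fun y : 'rV[R]_N => soft_abs (y ord0 j)) \o shift x)
      (k *: delta_mx ord0 i) - soft_abs (x ord0 j))) =
      (fun k => k^-1 *: ((@soft_abs R \o shift (x ord0 j)) (k *: (j == i)%:R) - soft_abs (x ord0 j))).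
    by rewrite /derive E.
  by apply/funext => k; rewrite /shift /= !mxE eqxx.
have ds := is_derive_sum dj.
have E : h = \sum_(j < N) (fun y : 'rV[R]_N => soft_abs (y ord0 j)).
  by apply/funext => y; rewrite /h fct_sumE.
rewrite /partial E; have [_ ->] := ds.
rewrite (bigD1 i)//= eqxx big1 ?addr0// => j /negPf ->.
by rewrite derive0.
Qed.

(** [linear_weight] is Lipschitz and, up to a bounded error, homogeneous of degree one. *)
Lemma grad_linear_weight_bound : exists2 C, 0 <= C & forall x,
  (forall i, `|grad h x ord0 i| <= C) /\ `|dot x (grad h x) - h x| <= C.
Proof.
have [C C0 HC] := @soft_abs_derive_bound R.
exists (C + N%:R * C) => [|x]; first by rewrite addr_ge0// mulr_ge0.
split=> [i|].
  by rewrite mxE partial_linear_weight (le_trans (HC _).1)// lerDl mulr_ge0.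
rewrite /dot /h -sumrB; apply: (le_trans (ler_norm_sum _ _ _)).
apply: (@le_trans _ _ (\sum_(i < N) C)); last by rewrite sumr_const card_ord -(mulr_natl C) lerDr.
by apply: ler_sum => i _; rewrite mxE partial_linear_weight; exact: (HC _).2.
Qed.

End weight_function.

(** * The total mass is constant and positive *)

Lemma initial_cutoff (R : realType) : let xi : R -> R := plateau (-1) 1 1 in
  [/\ C1c (-3) xi, xi 0 = 1 & forall t, 2 <= t -> xi t = 0].
Proof.
move=> xi; have sxi : smooth xi by exact: plateau_smooth.
have out t : ~~ (-2 <= t <= 2) -> xi t = 0.
  move=> nt; rewrite /xi plateau0//; apply: contra nt => /andP[t1 t2].
  by apply/andP; split; [move: t1|move: t2]; clear; lra.
split.
- split; first by move=> t; exact: smooth_derivable.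
    have -> : derive1 xi = 'D_1 xi by apply/funext => t; rewrite derive1E.
    exact: smooth_continuous (smooth_derive _ sxi).
  by exists (-2), 2; split=> //; rewrite ltrN2 ltr_nat.
- by rewrite /xi plateau1// lerN10 ler01.
- move=> t t2; rewrite /xi plateau0//; apply/negP => /andP[_ t3].
  by move: t2 t3; clear; lra.
Qed.

Section mass.
Context {R : realType} {N : nat}.
Local Notation T := (measurableTypeR R).
Local Notation muX := (@lebesgue_rV R N).
Local Notation muT := (@lebesgue_measure R).
Local Notation mu2 := (muX \x muT)%E.

Lemma measurable_loc_space (g : 'rV[R]_N -> R) : L1loc_space g ->
  measurable_fun [set: 'rV[T]_N] g.
Proof.
move=> lg.
have -> : [set: 'rV[T]_N] = \bigcup_n (box n.+1%:R : set 'rV[T]_N).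
  apply/seteqP; split=> // x _.
  by have [n _ Hn] := near_box x; exists n => // i; apply: ltW; exact: (Hn n (leqnn n)).
apply/measurable_fun_bigcup; first by move=> n; exact: measurable_box.
by move=> n; exact: measurable_of_integrable (lg _ (@box_compact R N _)).
Qed.

Lemma slice_vanish (g : 'rV[R]_N * R -> R) t : measurable_fun (@space_time R N) g -> 0 < t ->
  {ae muX, forall x : 'rV[T]_N, g (x, t) = 0} -> slice g t = 0.
Proof.
move=> mg t0 g0; transitivity (\int[muX]_x (0 : R)); last by rewrite Rintegral_cst// mul0r.
apply: ae_eq_Rintegral => //; first exact: measurable_section mg t0.
by apply: ae_imp g0 => x ->.
Qed.

Lemma time_space_integral_vanish (g : 'rV[R]_N * R -> R) (eta : R -> R) (b : R) :
  locally_finite (fun z => g z * eta z.2) -> (forall t, b <= t -> eta t = 0) ->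
  {ae muT, forall t : T, 0 < t -> {ae muX, forall x : 'rV[T]_N, g (x, t) = 0}} ->
  time_space_integral (fun x t => g (x, t) * eta t) = 0.
Proof.
move=> lg e0 g0; pose g1 (z : 'rV[R]_N * R) := g z * eta z.2.
have mI : measurable (`]0, b[%classic : set T) by exact: measurable_interval.
have -> : time_space_integral (fun x t => g (x, t) * eta t) = \int[muT]_(t in `]0, b[) slice g1 t.
  apply: Rintegral_supp; first by apply: subset_itv.
  move=> t; rewrite /= in_itv/= andbT in_itv/= => t0 /negP; rewrite t0/= -leNgt => bt.
  under eq_Rintegral do rewrite (e0 _ bt) mulr0.
  by rewrite Rintegral_cst// mul0r.
transitivity (\int[muT]_(t in `]0, b[) (0 : R)); last by rewrite Rintegral_cst// mul0r.
apply: ae_eq_Rintegral => //.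
  exact: (measurable_of_integrable (slice_integrable b lg).1).
apply: ae_imp g0 => t Ht; rewrite /= in_itv/= => /andP[t0 _].
apply: slice_vanish => //; first by case: lg.
by apply: ae_imp (Ht t0) => x gx; rewrite /g1 /= gx mul0r.
Qed.

Variables (a gamma mu lambda : R) (f : 'rV[R]_N * R -> 'rV[R]_N).
Variables (rho0 : 'rV[R]_N -> R) (v0 : 'rV[R]_N -> 'rV[R]_N).
Variables (rho p : 'rV[R]_N * R -> R) (v : 'rV[R]_N * R -> 'rV[R]_N).
Variable Dv : 'rV[R]_N * R -> 'M[R]_N.
Hypothesis a_gt0 : 0 < a.
Hypothesis gamma_gt1 : 1 < gamma.
Hypothesis sol : finite_energy_solution_with a gamma mu lambda f rho0 v0 rho p v Dv.
Hypothesis second_moment : Lq_loc_Lp 1%:E 1%:E (fun z => rho z * enorm z.1 ^+ 2).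
Hypothesis hdata : finite_energy_data gamma rho0 v0.

Lemma mass_constant : exists M, {ae muT, forall t : T, 0 < t -> slice rho t = M}.
Proof.
apply: weak_eq_constant.
have g1 x : grad (fun=> 1 : R) x = 0 :> 'rV[R]_N.
  by apply/rowP => i; rewrite !mxE /partial derive_cst.
have := @continuity_weighted R N a gamma mu lambda f rho0 v0 rho p v Dv a_gt0 gamma_gt1 sol
  second_moment (fun=> 1) 1 (smooth_cst 1) ler01 _ _.
have -> : (fun z : 'rV[R]_N * R => rho z * 1) = rho by apply/funext => z; rewrite mulr1.
have -> : slice (fun z : 'rV[R]_N * R => rho z * dot (v z) (grad (fun=> 1 : R) z.1)) = fun=> 0.
  apply/funext => t; rewrite /slice; under eq_Rintegral do rewrite g1.
  have d0 x : dot (v (x, t)) 0 = 0 by apply: big1 => i _; rewrite mxE mulr0.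
  under eq_Rintegral do rewrite d0 mulr0.
  by rewrite Rintegral_cst// mul0r.
apply.
- by move=> x; rewrite normr1 mul1r lerDl sqr_ge0.
- by move=> i x; rewrite /partial derive_cst normr0 mul1r addr_ge0// enorm_ge0.
Qed.

(** In the continuity equation with [xi 0 = 1] only the initial term survives. *)
Lemma vacuum_initially : {ae muT, forall t : T, 0 < t -> slice rho t = 0} ->
  {ae muX, forall x : 'rV[T]_N, rho0 x = 0}.
Proof.
move=> M0; have lr := locally_finite_rho sol second_moment.
have mr := rho_measurable sol.
have [r00 lr0 _ _] := hdata.
have rho_0 : {ae muT, forall t : T, 0 < t -> {ae muX, forall x : 'rV[T]_N, rho (x, t) = 0}}.
  apply: ae_imp2 (ae_and M0 (rho_ge0_slices sol)) (locally_finite_slice lr).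
  move=> t [H0 r0] ir t0.
  have : {ae muX, forall x : 'rV[T]_N, [set: 'rV[T]_N] x -> rho (x, t) = 0}.
    apply: Rintegral_abs_eq0 => //; [exact: ir|by apply: ae_imp (r0 t0)|exact: H0].
  by apply: ae_imp => x; apply.
have [cxi xi0 xi2] := @initial_cutoff R; set xi := plateau _ _ _ in cxi xi0 xi2.
have dxi_c : continuous (derive1 xi) by case: cxi.
have [K K0 HK] : exists2 K, 0 < K & forall t, `|derive1 xi t| <= K.
  have [b [c [_ _ d0]]] := C1c_deriv0 cxi; have [K K0 HK] := continuous_segment_bounded b c dxi_c.
  exists K => // t; have [bc|bc] := boolP (b <= t <= c); first exact: HK.
  by rewrite d0// normr0 ltW.
have xi1 t : `|xi t| <= 1 by rewrite ger0_norm ?plateau_ge0// plateau_le1.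
have dxi2 t : 2 + 1 <= t -> derive1 xi t = 0.
  move=> t2; rewrite derive1E; have -> : 'D_1 xi t = 'D_1 (cst 0 : R -> R) t.
    apply: (@derive_eq_open _ _ [set s : R | 2 < s]) => //.
      by move=> s /= s2; rewrite xi2// ltW.
    by apply: lt_le_trans t2; rewrite ltrDl.
  by rewrite derive_cst.
have I0 n : \int[muX]_x (rho0 x * cutoff n.+1%:R x) = 0.
  have n0 : 0 < n.+1%:R :> R by rewrite ltr0n.
  have tc := @cutoff_test R N n.+1%:R n0.
  have sc := test_smooth tc.
  have cW (y : R) : 0 <= y -> 1 <= 1 * (1 + y) by rewrite mul1r lerDl.
  have l1 : locally_finite (fun z => rho z * cutoff n.+1%:R z.1).
    apply: (density_locally_finite a_gt0 gamma_gt1 sol second_moment (test_measurable tc) ler01) => x.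
    by rewrite ger0_norm ?cutoff_ge0// (le_trans (cutoff_le1 _ _))// cW// sqr_ge0.
  have /choice[G HG] : forall i : 'I_N, exists G : R, 0 < G /\ forall x : 'rV[R]_N, `|partial i (cutoff n.+1%:R) x| <= G.
    by move=> i; have [G G0 HG] := test_bounded (test_derive (delta_mx ord0 i) tc); exists G.
  have G0 i : 0 <= G i by exact: ltW (HG i).1.
  have l2 : locally_finite (fun z => rho z * dot (v z) (grad (cutoff n.+1%:R) z.1)).
    apply: (@momentum_locally_finite _ _ _ _ _ _ _ _ _ _ _ _ _ a_gt0 gamma_gt1 sol second_moment _ (\sum_(i < N) G i)).
    - exact: sumr_ge0.
    - by move=> j; exact: grad_coord_measurable.
    - move=> x j; rewrite mxE; apply: (le_trans ((HG j).2 x)).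
      rewrite (bigD1 j)//= -[leLHS]mulr1 ler_pM ?lerDl ?enorm_ge0//.
      exact: sumr_ge0.
  have := continuity_eq sol tc (C1c_time_test cxi).
  rewrite xi0 mul1r.
  rewrite (@time_space_integral_vanish (fun z => rho z * cutoff n.+1%:R z.1) _ (2 + 1)) ?addr0//; first last.
  - by apply: ae_imp rho_0 => t Ht t0; apply: ae_imp (Ht t0) => x /= ->; rewrite mul0r.
  - exact: locally_finite_bounded_time HK.
  rewrite (@time_space_integral_vanish (fun z => rho z * dot (v z) (grad (cutoff n.+1%:R) z.1)) _ 2) ?addr0//.
  - exact: locally_finite_bounded_time (C1c_continuous cxi) xi1.
  - by apply: ae_imp rho_0 => t Ht t0; apply: ae_imp (Ht t0) => x /= ->; rewrite mul0r.
have H n : {ae muX, forall x : 'rV[T]_N, rho0 x * cutoff n.+1%:R x = 0}.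
  have tc : test_function setT (@cutoff R N n.+1%:R) by apply: cutoff_test; rewrite ltr0n.
  have : {ae muX, forall x : 'rV[T]_N, [set: 'rV[T]_N] x -> rho0 x * cutoff n.+1%:R x = 0}.
    apply: Rintegral_abs_eq0 => //.
    - by apply: test_mul_integrable tc => L; apply: lr0; exact: box_compact.
    - by apply: ae_imp r00 => x rx _; rewrite mulr_ge0// cutoff_ge0.
  by apply: ae_imp => x; apply.
have : {ae muX, forall x : 'rV[T]_N, forall n, rho0 x * cutoff n.+1%:R x = 0}.
  exact: ae_foralln.
apply: ae_imp => x Hx; have [n _ Hn] := near_box x.
have := Hx n; rewrite cutoff1 ?mulr1 ?ltr0n// => i.
by apply: ltW; exact: (Hn n (leqnn n)).
Qed.

(** Without mass the virial of the data would vanish. *)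
Lemma mass_positive : 0 < \int[muX]_x (rho0 x * dot (v0 x) x) ->
  exists2 M, 0 < M & {ae muT, forall t : T, 0 < t -> slice rho t = M}.
Proof.
move=> hvirial; have [M HM] := mass_constant; exists M => //.
have M0 : 0 <= M.
  have [t [t0 [Ht rt]]] := ae_exists_gt 0 (ae_and HM (rho_ge0_slices sol)).
  rewrite -Ht//; apply: fine_ge0.
  have m1 : measurable_fun [set: 'rV[T]_N] (fun x => (rho (x, t))%:E).
    by apply/measurable_EFinP; exact: measurable_section (rho_measurable sol) t0.
  have p1 : {ae muX, forall x : 'rV[T]_N, (0 <= (rho (x, t))%:E)%E}.
    by apply: ae_imp (rt t0) => x; rewrite lee_fin.
  by have E := @ae_eq_abse _ _ _ muX _ m1 p1; rewrite -[leRHS]E; exact: integral_ge0.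
rewrite lt_neqAle M0 andbT; apply/eqP => M_eq0; move: hvirial; rewrite ltNge => /negP; apply.
have r0 : {ae muX, forall x : 'rV[T]_N, rho0 x = 0}.
  by apply: vacuum_initially; apply: ae_imp HM => t Ht t0; rewrite Ht.
have [_ _ lm _] := hdata.
rewrite le_eqVlt; apply/orP; left; apply/eqP.
transitivity (\int[muX]_x (0 : R)); last by rewrite Rintegral_cst// mul0r.
apply: ae_eq_Rintegral => //; last by apply: ae_imp r0 => x ->; rewrite mul0r.
under eq_fun do rewrite /dot mulr_sumr.
apply: (@measurable_sum _ _ _ _ 'I_N (index_enum _) (fun i (x : 'rV[T]_N) => rho0 x * (v0 x ord0 i * x ord0 i))) => i.
under eq_fun do rewrite mulrA.
by apply: measurable_funM; [exact: measurable_loc_space|exact: measurable_coord_rV].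
Qed.

End mass.

(** * Decay of the internal energy *)

Section decay.
Context {R : realType} {N : nat}.
Local Notation T := (measurableTypeR R).
Local Notation muX := (@lebesgue_rV R N).
Local Notation muT := (@lebesgue_measure R).
Local Notation mu2 := (muX \x muT)%E.
Variables (a gamma mu lambda : R) (f : 'rV[R]_N * R -> 'rV[R]_N).
Variables (rho0 : 'rV[R]_N -> R) (v0 : 'rV[R]_N -> 'rV[R]_N).
Variables (rho p : 'rV[R]_N * R -> R) (v : 'rV[R]_N * R -> 'rV[R]_N).
Variable Dv : 'rV[R]_N * R -> 'M[R]_N.
Hypothesis N3 : (3 <= N)%N.
Hypothesis a_gt0 : 0 < a.
Hypothesis gamma_gt1 : 1 < gamma.
Hypothesis hf : forall i, L1loc_space_time (fun z => f z ord0 i).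
Hypothesis hdivf : divergence_free f.
Hypothesis sol : finite_energy_solution_with a gamma mu lambda f rho0 v0 rho p v Dv.
Hypothesis second_moment : Lq_loc_Lp 1%:E 1%:E (fun z => rho z * enorm z.1 ^+ 2).
Hypothesis hv : Lq_loc_Lp_mx 1%:E (N%:R / (N%:R - 1))%:E v.

Local Notation kin := (slice (fun z => rho z * enorm (v z) ^+ 2)).
Local Notation pow := (slice (fun z => rho z `^ gamma)).
Local Notation vir := (slice (fun z => rho z * dot (v z) z.1)).
Local Notation inertia := (slice (fun z => rho z * half_square z.1)).
Local Notation deviation t := (\int[muX]_x (rho (x, t) * enorm (t^-1 *: x - v (x, t)) ^+ 2)).

Let m : R := Num.max 0 (2 - N%:R * (gamma - 1)).

Lemma enorm_sqB (t : R) (x w : 'rV[R]_N) :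
  enorm (t^-1 *: x - w) ^+ 2 = t^-1 ^+ 2 * (2 * half_square x) - 2 * t^-1 * dot w x + enorm w ^+ 2.
Proof.
have -> : 2 * half_square x = \sum_(i < N) x ord0 i ^+ 2 by rewrite mulrA mulfV ?mul1r ?pnatr_eq0.
rewrite !enorm_sq /dot.
rewrite !mulr_sumr -sumrB -big_split; apply: eq_bigr => i _ /=.
by rewrite !mxE; ring.
Qed.

Let half_squareE (x : 'rV[R]_N) : half_square x = 2^-1 * enorm x ^+ 2.
Proof. by rewrite enorm_sq. Qed.

Let inertia_finite : locally_finite (fun z => rho z * half_square z.1).
Proof.
have := locally_finiteZ 2^-1 (locally_finite_moment second_moment).
by under eq_fun do rewrite mulrCA -half_squareE.
Qed.

Let vir_finite : locally_finite (fun z => rho z * dot (v z) z.1).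
Proof.
apply: (momentum_locally_finite a_gt0 gamma_gt1 sol second_moment (phi := id) ler01).
  by move=> j; exact: measurable_coord_rV.
move=> x j; rewrite mul1r (@le_trans _ _ (enorm x))// ?lerDr//.
by rewrite -ler_sqr ?nnegrE ?enorm_ge0//; exact: coord_le_enorm.
Qed.

Lemma deviation_slice : {ae muT, forall t : T, 0 < t ->
  [/\ muX.-integrable setT (EFin \o (fun x => rho (x, t) * enorm (t^-1 *: x - v (x, t)) ^+ 2)),
   0 <= deviation t &
   deviation t = t^-1 ^+ 2 * (2 * inertia t) - 2 * t^-1 * vir t + kin t]}.
Proof.
apply: ae_imp2 (ae_and (locally_finite_slice inertia_finite) (locally_finite_slice vir_finite))
  (ae_and (locally_finite_slice (locally_finite_kinetic a_gt0 gamma_gt1 sol)) (rho_ge0_slices sol)).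
move=> t [h1 h2] [h3 h4] t0; have {}h1 := h1 t0; have {}h2 := h2 t0; have {}h3 := h3 t0; have {}h4 := h4 t0.
have E x : rho (x, t) * enorm (t^-1 *: x - v (x, t)) ^+ 2 =
    t^-1 ^+ 2 * 2 * (rho (x, t) * half_square x) + (- (2 * t^-1)) * (rho (x, t) * dot (v (x, t)) x) +
    rho (x, t) * enorm (v (x, t)) ^+ 2 by rewrite enorm_sqB; ring.
have i1 := integrableZl measurableT (t^-1 ^+ 2 * 2) h1.
have i2 := integrableZl measurableT (- (2 * t^-1)) h2.
have i12 := integrableD measurableT i1 i2.
have i123 := integrableD measurableT i12 h3.
have iW : muX.-integrable setT (EFin \o (fun x => rho (x, t) * enorm (t^-1 *: x - v (x, t)) ^+ 2)).
  by move: i123; apply: eq_integrable => // x _; rewrite /= E !EFinD !EFinM.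
have WE : deviation t = t^-1 ^+ 2 * (2 * inertia t) - 2 * t^-1 * vir t + kin t.
  under eq_Rintegral do rewrite E.
  by rewrite RintegralD// RintegralD// !RintegralZl// mulNr mulrA.
split=> //.
apply: ae_Rintegral_ge0 => //.
by apply: ae_imp h4 => x rx; rewrite mulr_ge0// sqr_ge0.
Qed.

(** The functional of [virial_growth] is t^2 times half the deviation of [v] from x / t
    plus the internal energy. *)
Lemma energy_decay : exists2 C, 0 <= C & {ae muT, forall t : T, 1 < t ->
  pow t <= C * t `^ (m - 2) /\ deviation t <= C * t `^ (m - 2)}.
Proof.
have [E [E_ni E_ge0 EE _]] := energy_facts a_gt0 gamma_gt1 sol.
have ES := energy_slice a_gt0 gamma_gt1 sol EE.
have g0 : 0 < gamma - 1 by rewrite subr_gt0.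
have Iy : weak_eq inertia vir.
  have C0 : 0 <= 2^-1 :> R by rewrite invr_ge0.
  have := @continuity_weighted R N a gamma mu lambda f rho0 v0 rho p v Dv a_gt0 gamma_gt1 sol
    second_moment half_square 1 half_square_smooth ler01 _ _.
  have -> : (fun z : 'rV[R]_N * R => rho z * dot (v z) (grad half_square z.1)) =
      (fun z => rho z * dot (v z) z.1).
    apply/funext => z; congr (_ * dot _ _); apply/rowP => i; rewrite mxE.
    exact: (congr1 (fun g => g z.1) (partial_half_square i)).
  apply=> [x|i x].
    rewrite half_squareE mul1r normrM !ger0_norm ?sqr_ge0//.
    by have := sqr_ge0 (enorm x); lra.
  rewrite partial_half_square mul1r (@le_trans _ _ (enorm x))// ?lerDr//.
  by rewrite -ler_sqr ?nnegrE ?enorm_ge0//; exact: coord_le_enorm.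
have yy := momentum_weighted N3 a_gt0 gamma_gt1 hf hdivf sol second_moment hv.
pose E0 (t : R) : R := E (Num.max 0 t).
have wE : weak_le 0 E0 (fun=> 0).
  apply: (@nonincreasing_weak_le R E0 (E 0)) => [s t st|t|t].
  - apply: E_ni; first by rewrite le_max lexx.
    by rewrite ge_max !le_max lexx /= st orbT.
  - by apply: E_ge0; rewrite le_max lexx.
  - by apply: E_ni; rewrite ?lexx// le_max lexx.
pose P t : R := a / (gamma - 1) * pow t.
have aeE : {ae muT, forall t : T, 0 < t -> E0 t = 2^-1 * kin t + P t}.
  by apply: ae_imp ES => t Et t0; rewrite /E0 max_r ?(ltW t0)// Et.
have y'E : {ae muT, forall t : T, 0 < t -> kin t + slice (fun z => p z * N%:R) t =
    2 * E0 t + (N%:R * (gamma - 1) - 2) * P t}.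
  apply: ae_imp2 (ae_and aeE (pressure_slice a_gt0 gamma_gt1 sol))
    (locally_finite_slice (locally_finite_pressure a_gt0 gamma_gt1 sol)) => t [Et pt] ip t0.
  have -> : slice (fun z => p z * N%:R) t = slice p t * N%:R by rewrite /slice RintegralZr//; exact: ip.
  by rewrite Et// pt// /P; field; rewrite gt_eqF.
have HE t : 0 < t -> E0 t = 2^-1 * kin t + P t ->
    deviation t = t^-1 ^+ 2 * (2 * inertia t) - 2 * t^-1 * vir t + kin t ->
    inertia t - t * vir t + t ^+ 2 * E0 t = t ^+ 2 * (2^-1 * deviation t + P t).
  by move=> t0 -> ->; field; rewrite gt_eqF.
have P0 t : 0 <= P t.
  rewrite mulr_ge0 ?divr_ge0 ?(ltW a_gt0) ?(ltW g0)//.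
  by apply: fine_ge0; apply: integral_ge0 => x _; rewrite lee_fin powR_ge0.
have PH : {ae muT, forall t : T, 0 < t -> 0 <= P t /\
    t ^+ 2 * P t <= inertia t - t * vir t + t ^+ 2 * E0 t}.
  apply: ae_imp2 aeE deviation_slice => t Et Dt t0; split=> //.
  have [_ D0 DE] := Dt t0; rewrite HE ?Et// ler_wpM2l ?sqr_ge0// lerDr mulr_ge0// invr_ge0.
have [C C0 HC] := virial_growth Iy yy wE y'E PH.
pose c := a / (gamma - 1); have c0 : 0 < c by rewrite divr_gt0.
have cV : 0 <= c^-1 by rewrite invr_ge0 ltW.
exists (C * (c^-1 + 2)); first by rewrite mulr_ge0// addr_ge0.
apply: ae_imp2 (ae_and aeE deviation_slice) HC => t [Et Dt] Ht t1.
have t0 : 0 < t by exact: lt_trans t1.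
have [_ D0 DE] := Dt t0; have := Ht t1; rewrite HE ?Et// -/m.
have -> : t `^ m = t ^+ 2 * t `^ (m - 2).
  rewrite -[t ^+ 2](powR_mulrn 2 (ltW t0)) -powRD ?subrKC//.
  by apply/implyP => _; rewrite gt_eqF.
rewrite mulrCA ler_pM2l ?exprn_gt0// => H.
have H1 : P t <= C * t `^ (m - 2) by apply: le_trans H; rewrite lerDr mulr_ge0// invr_ge0.
have H2 : 2^-1 * deviation t <= C * t `^ (m - 2) by apply: le_trans H; rewrite lerDl P0.
have C1 : 0 <= C * t `^ (m - 2) by rewrite mulr_ge0// powR_ge0.
rewrite mulrAC; set z := C * t `^ (m - 2) in H1 H2 C1 *.
split.
  have -> : pow t = c^-1 * P t by rewrite /P -/c mulKf// gt_eqF.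
  apply: (@le_trans _ _ (c^-1 * z)); first by rewrite ler_wpM2l.
  by rewrite mulrC ler_wpM2l// lerDl.
have -> : deviation t = 2 * (2^-1 * deviation t) by rewrite mulrA mulfV ?mul1r.
apply: (@le_trans _ _ (2 * z)); first by rewrite ler_pM2l.
by rewrite mulrC ler_wpM2l// lerDr.
Qed.

End decay.

(** * The first moment grows slowly *)

(** Averaged Young inequality; splitting the density at the level [lam] bounds
    the mass carried by a set [A] of small measure. *)
Lemma young_split (R : realType) (r u w e theta lam gamma : R) (A : bool) :
  0 <= r -> 0 <= u -> u <= w -> 0 < e -> 0 < theta -> 0 < lam -> 1 < gamma -> (~~ A -> u <= e) ->
  r * u <= e * r + theta / 2 * (r * w ^+ 2)
    + (2 * theta)^-1 * (lam * A%:R + lam `^ (1 - gamma) * r `^ gamma).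
Proof.
move=> r0 u0 uw e0 th0 l0 g1 Ae.
have i0 : 0 <= (2 * theta)^-1 by rewrite invr_ge0 mulr_ge0// ltW.
have p0 : 0 <= theta / 2 * (r * w ^+ 2).
  by rewrite mulr_ge0 ?divr_ge0 ?(ltW th0)// mulr_ge0 ?sqr_ge0.
have q0 : 0 <= lam `^ (1 - gamma) * r `^ gamma by rewrite mulr_ge0 ?powR_ge0.
case: A Ae => [_|/(_ isT) ue]; last first.
  rewrite mulr0 add0r (@le_trans _ _ (e * r))//; first by rewrite mulrC ler_wpM2r.
  by rewrite -addrA lerDl addr_ge0// mulr_ge0.
have er0 : 0 <= e * r by rewrite mulr_ge0// ltW.
rewrite mulr1 -addrA (@le_trans _ _ (theta / 2 * (r * w ^+ 2) + (2 * theta)^-1 * r))//; last first.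
  rewrite (@le_trans _ _ (theta / 2 * (r * w ^+ 2) + (2 * theta)^-1 * (lam + lam `^ (1 - gamma) * r `^ gamma)))//.
    by rewrite lerD2l ler_wpM2l//; exact: powR_split.
  by rewrite lerDr.
have -> : theta / 2 * (r * w ^+ 2) + (2 * theta)^-1 * r = r * ((theta * w) ^+ 2 + 1) / (2 * theta).
  by field; rewrite gt_eqF.
rewrite -mulrA ler_wpM2l// (le_trans uw)// ler_pdivlMr ?mulr_gt0//.
by have := sqr_ge0 (theta * w - 1); nra.
Qed.

Section moment.
Context {R : realType} {N : nat}.
Local Notation T := (measurableTypeR R).
Local Notation muX := (@lebesgue_rV R N).
Local Notation muT := (@lebesgue_measure R).
Local Notation mu2 := (muX \x muT)%E.
Variables (a gamma mu lambda : R) (f : 'rV[R]_N * R -> 'rV[R]_N).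
Variables (rho0 : 'rV[R]_N -> R) (v0 : 'rV[R]_N -> 'rV[R]_N).
Variables (rho p : 'rV[R]_N * R -> R) (v : 'rV[R]_N * R -> 'rV[R]_N).
Variable Dv : 'rV[R]_N * R -> 'M[R]_N.
Hypothesis N3 : (3 <= N)%N.
Hypothesis a_gt0 : 0 < a.
Hypothesis gamma_gt1 : 1 < gamma.
Hypothesis mu_gt0 : 0 < mu.
Hypothesis mulambda_gt0 : 0 < mu + lambda.
Hypothesis sol : finite_energy_solution_with a gamma mu lambda f rho0 v0 rho p v Dv.
Hypothesis second_moment : Lq_loc_Lp 1%:E 1%:E (fun z => rho z * enorm z.1 ^+ 2).
Hypothesis hv : Lq_loc_Lp_mx 1%:E (N%:R / (N%:R - 1))%:E v.

Local Notation h := (@linear_weight R N).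
Local Notation moment := (slice (fun z => rho z * h z.1)).
Local Notation flux := (slice (fun z => rho z * dot (v z) (grad h z.1))).
Local Notation deviation t := (\int[muX]_x (rho (x, t) * enorm (t^-1 *: x - v (x, t)) ^+ 2)).

Let grad_le C : (forall x i, `|grad h x ord0 i| <= C) ->
  forall i x, `|partial i h x| <= C * (1 + enorm x).
Proof.
move=> HC i x; have := HC x i; rewrite mxE => H; apply: (le_trans H).
have C0 : 0 <= C by exact: le_trans H.
by rewrite mulrDr mulr1 lerDl mulr_ge0// enorm_ge0.
Qed.

Lemma moment_identity : weak_eq moment flux.
Proof.
have [C C0 HC] := @grad_linear_weight_bound R N.
have CN : 0 <= C + N%:R by rewrite addr_ge0.
apply: (continuity_weighted a_gt0 gamma_gt1 sol second_moment linear_weight_smooth CN).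
  move=> x; apply: (le_trans (linear_weight_le x)); rewrite ler_wpM2r ?lerDr//.
  by rewrite addr_ge0// sqr_ge0.
by apply: grad_le => x i; rewrite (le_trans ((HC x).1 i))// lerDl.
Qed.

Let moment_finite : locally_finite (fun z => rho z * h z.1).
Proof.
apply: (density_locally_finite a_gt0 gamma_gt1 sol second_moment _ (ler0n R N)).
  exact: smooth_measurable linear_weight_smooth.
exact: linear_weight_le.
Qed.

Let flux_finite : locally_finite (fun z => rho z * dot (v z) (grad h z.1)).
Proof.
have [C C0 HC] := @grad_linear_weight_bound R N.
apply: (momentum_locally_finite a_gt0 gamma_gt1 sol second_moment C0).
  by move=> j; exact: grad_coord_measurable linear_weight_smooth.
move=> x j; rewrite (le_trans ((HC x).1 j))// mulrDr mulr1 lerDl mulr_ge0//.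
exact: enorm_ge0.
Qed.

Let dot_bound (w g : 'rV[R]_N) C : 0 <= C -> (forall i, `|g ord0 i| <= C) -> `|dot w g| <= N%:R * C * enorm w.
Proof.
move=> C0 HC; apply: (le_trans (ler_norm_sum _ _ _)).
apply: (@le_trans _ _ (\sum_(i < N) C * enorm w)); last by rewrite sumr_const card_ord -mulrA mulr_natl.
apply: ler_sum => i _; rewrite normrM mulrC ler_pM//.
by rewrite -ler_sqr ?nnegrE ?enorm_ge0//; exact: coord_le_enorm.
Qed.

(** Replacing [v] by x / t in the flux gives the moment divided by [t], up to a bounded
    multiple of M / t, since the weight is nearly homogeneous.  Young's inequality with
    parameter t^(m/2 - 1) turns the quadratic bound on the deviation into a linear
    one. *)
Lemma flux_deviation M m C1 : 0 <= M -> 0 <= m -> 0 <= C1 ->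
  {ae muT, forall t : T, 0 < t -> slice rho t = M} ->
  {ae muT, forall t : T, 1 < t -> deviation t <= C1 * t `^ (m - 2)} ->
  exists2 C, 0 <= C & {ae muT, forall t : T, 1 < t -> moment t / t - flux t <= C * t `^ (m / 2 - 1)}.
Proof.
move=> M0 m0 C10 HM HD.
have [C C0 HC] := @grad_linear_weight_bound R N.
exists (N%:R * C / 2 * M + C * M + N%:R * C / 2 * C1).
  by rewrite !addr_ge0// !mulr_ge0// invr_ge0.
apply: ae_imp2 (ae_and (ae_and HM HD)
   (ae_and (rho_ge0_slices sol) (deviation_slice a_gt0 gamma_gt1 sol second_moment)))
  (ae_and (locally_finite_slice (locally_finite_rho sol second_moment))
     (ae_and (locally_finite_slice moment_finite) (locally_finite_slice flux_finite))).
move=> t [[Mt Dt] [rt Wt]] [ir [ih ifl]] t1.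
have t0 : 0 < t by exact: lt_trans t1.
have {}Mt := Mt t0; have {}Dt := Dt t1; have {}rt := rt t0; have {}ir := ir t0.
have {}ih := ih t0; have {}ifl := ifl t0; have [iW _ _] := Wt t0.
set s := t `^ (m / 2 - 1).
have s0 : 0 < s by rewrite powR_gt0.
have ss : t `^ (m - 2) = s * s.
  rewrite -powRD; first by congr (_ `^ _); field.
  by apply/implyP => _; rewrite gt_eqF.
have ts : t^-1 <= s.
  rewrite -powR_inv1 ?(ltW t0)// /s ler_powR// ?(ltW t1)//.
  by rewrite lerDr divr_ge0.
have tV : 0 < t^-1 by rewrite invr_gt0.
have i1 := integrableZl measurableT t^-1 ih.
have iL : muX.-integrable setT (EFin \o (fun x => t^-1 * (rho (x, t) * h x) - rho (x, t) * dot (v (x, t)) (grad h x))).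
  by have := integrableB measurableT i1 ifl; apply: eq_integrable.
have i2 := integrableZl measurableT (N%:R * C / 2 * s + C * t^-1) ir.
have i3 := integrableZl measurableT (N%:R * C / 2 * s^-1) iW.
have i23 := integrableD measurableT i2 i3.
have -> : moment t / t - flux t = \int[muX]_x (t^-1 * (rho (x, t) * h x) - rho (x, t) * dot (v (x, t)) (grad h x)).
  by rewrite RintegralB// RintegralZl// [_ / t]mulrC.
apply: (@le_trans _ _ (\int[muX]_x ((N%:R * C / 2 * s + C * t^-1) * rho (x, t) +
    N%:R * C / 2 * s^-1 * (rho (x, t) * enorm (t^-1 *: x - v (x, t)) ^+ 2)))).
  apply: ae_le_Rintegral => //.
  apply: ae_imp rt => x r0 _; set w := t^-1 *: x - v (x, t).
  have -> : t^-1 * (rho (x, t) * h x) - rho (x, t) * dot (v (x, t)) (grad h x) =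
      rho (x, t) * (t^-1 * (h x - dot x (grad h x)) + dot w (grad h x)).
    have -> : dot w (grad h x) = t^-1 * dot x (grad h x) - dot (v (x, t)) (grad h x).
      rewrite /dot mulr_sumr -sumrB; apply: eq_bigr => i _.
      by rewrite /w !mxE; ring.
    ring.
  have -> : (N%:R * C / 2 * s + C * t^-1) * rho (x, t) + N%:R * C / 2 * s^-1 * (rho (x, t) * enorm w ^+ 2) =
     rho (x, t) * (t^-1 * C + N%:R * C * ((s + s^-1 * enorm w ^+ 2) / 2)) by field; rewrite !gt_eqF.
  rewrite ler_wpM2l// lerD//.
    by rewrite ler_wpM2l ?(ltW tV)// (le_trans (ler_norm _))// distrC (HC x).2.
  apply: (le_trans (ler_norm _)); apply: (le_trans (dot_bound w C0 (HC x).1)).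
  rewrite ler_wpM2l ?mulr_ge0// ler_pdivlMr//.
  have -> : s + s^-1 * enorm w ^+ 2 = (s ^+ 2 + enorm w ^+ 2) / s by field; rewrite gt_eqF.
  by rewrite ler_pdivlMr//; have := sqr_ge0 (s - enorm w); nra.
rewrite RintegralD// !RintegralZl// -/(slice rho t) Mt.
have tC : C * t^-1 * M <= C * s * M by rewrite ler_wpM2r// ler_wpM2l.
have nC : 0 <= N%:R * C / 2 * s^-1 by rewrite !mulr_ge0// ?invr_ge0// ltW.
have := ler_wpM2l nC Dt; rewrite ss.
have -> : N%:R * C / 2 * s^-1 * (C1 * (s * s)) = N%:R * C / 2 * C1 * s by field; rewrite gt_eqF.
move=> H; apply: (@le_trans _ _ (N%:R * C / 2 * s * M + C * s * M + N%:R * C / 2 * C1 * s)).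
  by rewrite lerD// mulrDl lerD2l.
by rewrite le_eqVlt; apply/orP; left; apply/eqP; ring.
Qed.

Local Notation kin := (slice (fun z => rho z * enorm (v z) ^+ 2)).
Local Notation pow := (slice (fun z => rho z `^ gamma)).

(** When the dissipation is small the velocity is small off a set of small
    measure, which carries little momentum. *)
Lemma small_speed K eta : 0 <= K -> 0 < eta -> exists2 delta, 0 < delta &
  {ae muT, forall t : T, 0 < t -> slice rho t <= K -> kin t <= K -> pow t <= K ->
    (\int[muX]_x (enorm (Dv (x, t)) ^+ 2)%:E <= (delta ^+ 2)%:E)%E ->
    forall i, muX.-integrable setT (EFin \o (fun x => rho (x, t) * `|v (x, t) ord0 i|)) /\
      \int[muX]_x (rho (x, t) * `|v (x, t) ord0 i|) <= eta}.
Proof.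
move=> K0 eta0.
have K1 : 0 < K + 1 by rewrite ltr_wpDl.
have N0 : 0 < N%:R :> R by rewrite ltr0n (leq_trans _ N3).
(* Four parameters, so that each term of [young_split] integrates to at most
   [eta / 4]; [r] bounds the measure of the set of large speeds. *)
have [e [e0 eK]] : exists e, 0 < e /\ e * K <= eta / 4.
  exists (eta / (4 * (K + 1))); split; first by rewrite divr_gt0// mulr_gt0.
  rewrite mulrAC ler_pdivrMr ?mulr_gt0// [leRHS](_ : _ = eta * (K + 1)); last by field.
  by rewrite ler_pM2l// lerDl.
have [th [th0 thK]] : exists th, 0 < th /\ th / 2 * K <= eta / 4.
  exists (2 * e); split; first by rewrite mulr_gt0.
  by rewrite (_ : 2 * e / 2 = e)//; field.
have i0 : 0 < (2 * th)^-1 by rewrite invr_gt0 mulr_gt0.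
have [lam [l0 lK]] : exists lam, 0 < lam /\ (2 * th)^-1 * (lam `^ (1 - gamma) * K) <= eta / 4.
  pose x := 2 * th * e; have x0 : 0 < x by rewrite !mulr_gt0.
  exists (x `^ ((1 - gamma)^-1)); split; first by rewrite powR_gt0.
  rewrite -powRrM mulVf ?powRr1 ?(ltW x0)//; last by rewrite subr_eq0 lt_eqF.
  have -> : (2 * th)^-1 * (x * K) = e * K by rewrite /x; field; rewrite gt_eqF.
  exact: eK.
have [r [r0 r64 rl]] : exists r, [/\ 0 < r, 64 * r <= 1 & (2 * th)^-1 * (lam * r) <= eta / 4].
  pose y := eta * th / (2 * lam); have y0 : 0 < y by rewrite divr_gt0 ?mulr_gt0.
  exists (Num.min 64^-1 y); split.
  - by rewrite lt_min y0 invr_gt0 ltr0n.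
  - by rewrite -ler_pdivlMl// mulr1 ge_min lexx.
  - have -> : eta / 4 = (2 * th)^-1 * (lam * y) by rewrite /y; field; rewrite !gt_eqF.
    by rewrite ler_pM2l// ler_pM2l// ge_min lexx orbT.
exists (r * e / N%:R); first by rewrite divr_gt0// mulr_gt0.
have [_ H1 _] := velocity_H1 sol.
have lr := locally_finite_rho sol second_moment.
have lk := locally_finite_kinetic a_gt0 gamma_gt1 sol.
have lp := locally_finite_power a_gt0 gamma_gt1 sol.
apply: ae_imp2 (ae_and (ae_and H1 (velocity_power_integral N3 hv))
   (ae_and (rho_ge0_slices sol) (locally_finite_slice lr)))
  (ae_and (locally_finite_slice lk) (locally_finite_slice lp)).
move=> t [[Ht ut] [rt ir]] [ik ip] t0 MK kK pK DvD i.
have {}Ht := Ht t0; have [iu _] := ut t0; have {}rt := rt t0.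
have {}ir := ir t0; have {}ik := ik t0; have {}ip := ip t0.
have mvi : measurable_fun [set: 'rV[T]_N] (fun x => v (x, t) ord0 i).
  exact: measurable_section (v_measurable sol i) t0.
have vu x : `|v (x, t) ord0 i| <= enorm (v (x, t)).
  by rewrite -ler_sqr ?nnegrE ?enorm_ge0//; exact: coord_le_enorm.
have wd : weakly_differentiable (fun x => v (x, t) ord0 i) (fun j x => Dv (x, t) i j) (r * e / N%:R).
  case: Ht => L1 mD _ wg; split.
  - by move=> L; apply: L1; exact: box_compact.
  - by move=> j; exact: mD.
  - move=> j; apply: le_trans DvD; apply: ge0_le_integral => //.
    + by move=> x _; rewrite lee_fin sqr_ge0.
    + by apply/measurable_EFinP; apply: measurable_funX; exact: mD.
    + apply/measurable_EFinP; rewrite (_ : (fun _ => _) = (fun x => \sum_(k < N) \sum_(l < N) Dv (x, t) k l ^+ 2)).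
        apply: measurable_sum => k; apply: measurable_sum => l; apply: measurable_funX; exact: mD.
      apply/funext => x; rewrite /enorm sqr_sqrtr//.
      by apply: sumr_ge0 => k _; apply: sumr_ge0 => l _; exact: sqr_ge0.
    + move=> x _; rewrite lee_fin /enorm sqr_sqrtr; last first.
        by apply: sumr_ge0 => k _; apply: sumr_ge0 => l _; exact: sqr_ge0.
      rewrite (bigD1 i)//= (bigD1 j)//= -addrA lerDl addr_ge0//.
        by apply: sumr_ge0 => l _; exact: sqr_ge0.
      by apply: sumr_ge0 => k _; apply: sumr_ge0 => l _; exact: sqr_ge0.
  - by move=> psi tpsi j; exact: wg.
have ivp : muX.-integrable setT (EFin \o (fun x => `|v (x, t) ord0 i| `^ (N%:R / (N%:R - 1)))).
  apply: (ae_integrable_dom measurableT _ iu).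
    by apply: (measurableT_comp (measurable_powR _)); exact: measurableT_comp.
  apply/aeW => x _; rewrite ger0_norm ?powR_ge0// ge0_ler_powR ?nnegrE ?enorm_ge0//.
  by apply: ltW; apply: lt_trans (exponent_gt1 N3).
have d0 : 0 < r * e / N%:R by rewrite divr_gt0// mulr_gt0.
have Nd : N%:R * (r * e / N%:R) = r * e by field; rewrite gt_eqF.
have := weak_sobolev N3 d0 (exponent_gt1 N3) wd mvi ivp e0; rewrite Nd mulrA.
rewrite (_ : 64 * r * e <= e); last by rewrite ler_piMl// ltW.
rewrite mulfK ?gt_eqF// => /(_ isT).
set A := [set x | _] => muA.
have mA : measurable (A : set 'rV[T]_N).
  have mn : measurable_fun [set: 'rV[T]_N] (fun x => `|v (x, t) ord0 i|) by exact: measurableT_comp.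
  have := mn measurableT `[e, +oo[%classic (measurable_itv _).
  by rewrite setTI; congr measurable; apply/seteqP; split=> x /=; rewrite in_itv/= andbT.
have muAr : (muX A <= r%:E)%E.
  apply: (le_trans muA); rewrite lee_fin expr2 mulrA ler_piMl ?(ltW r0)//.
  by apply: le_trans r64; rewrite ler_pM2r// ler_nat.
have iA : muX.-integrable setT (EFin \o (\1_A : 'rV[R]_N -> R)).
  apply/integrableP; split; first by apply/measurable_EFinP; exact: measurable_indic.
  under eq_integral do rewrite /= ger0_norm ?indic_ge0//.
  by rewrite integral_indic// setIT (le_lt_trans muAr)// ltry.
have IA : \int[muX]_x (\1_A x : R) <= r.
  rewrite /Rintegral integral_indic// setIT -lee_fin fineK//.
  by rewrite ge0_fin_numE// (le_lt_trans muAr)// ltry.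
pose G x : R := e * rho (x, t) + th / 2 * (rho (x, t) * enorm (v (x, t)) ^+ 2)
    + (2 * th)^-1 * (lam * \1_A x + lam `^ (1 - gamma) * rho (x, t) `^ gamma).
have i1 := integrableZl measurableT e ir.
have i2 := integrableZl measurableT (th / 2) ik.
have i12 := integrableD measurableT i1 i2.
have i3 := integrableZl measurableT lam iA.
have i4 := integrableZl measurableT (lam `^ (1 - gamma)) ip.
have i34 := integrableD measurableT i3 i4.
have i5 := integrableZl measurableT (2 * th)^-1 i34.
have iG : muX.-integrable setT (EFin \o G).
  by have := integrableD measurableT i12 i5; apply: eq_integrable.
have mrv : measurable_fun [set: 'rV[T]_N] (fun x => rho (x, t) * `|v (x, t) ord0 i|).
  by apply: measurable_funM; [exact: measurable_of_integrable ir|exact: measurableT_comp].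
have rG : {ae muX, forall x : 'rV[T]_N, [set: 'rV[T]_N] x -> `|rho (x, t) * `|v (x, t) ord0 i| | <= G x}.
  apply: ae_imp rt => x rx _; rewrite ger0_norm ?mulr_ge0// /G indicE.
  apply: young_split => //; rewrite notin_setE => nA.
  by apply: ltW; rewrite ltNge; apply/negP.
have irv := ae_integrable_dom measurableT mrv iG rG.
split=> //; apply: (@le_trans _ _ (\int[muX]_x G x)).
  by apply: ae_le_Rintegral => //; apply: ae_imp rG => x Hx Ix; apply: le_trans (Hx Ix); exact: ler_norm.
have -> : \int[muX]_x G x = e * slice rho t + th / 2 * kin t + (2 * th)^-1 * (lam * (\int[muX]_x \1_A x) +
    lam `^ (1 - gamma) * pow t).
  by rewrite /G RintegralD// RintegralD// !RintegralZl// RintegralD// !RintegralZl.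
have h1 : e * slice rho t <= eta / 4 by apply: le_trans eK; rewrite ler_pM2l.
have h2 : th / 2 * kin t <= eta / 4 by apply: le_trans thK; rewrite ler_pM2l// divr_gt0.
have h3 : (2 * th)^-1 * (lam * (\int[muX]_x \1_A x)) <= eta / 4.
  by apply: le_trans rl; rewrite ler_pM2l// ler_pM2l.
have h4 : (2 * th)^-1 * (lam `^ (1 - gamma) * pow t) <= eta / 4.
  by apply: le_trans lK; rewrite ler_pM2l// ler_pM2l// powR_gt0.
rewrite mulrDr (_ : eta = eta / 4 + eta / 4 + (eta / 4 + eta / 4)); last by field.
exact: lerD (lerD h1 h2) (lerD h3 h4).
Qed.

End moment.

(** * Contradiction *)

Lemma powR_tail (R : realType) (al C e : R) : 0 < al -> 0 <= C -> 0 < e ->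
  exists s, 1 <= s /\ forall t, s <= t -> C * t `^ (- al) <= e.
Proof.
move=> al0 C0 e0; pose c := C / e + 1.
have c0 : 0 < c by rewrite ltr_wpDl// divr_ge0// ltW.
exists (Num.max 1 (c `^ (al^-1))); split; first by rewrite le_max lexx.
move=> t; rewrite ge_max => /andP[t1 ct]; have t0 : 0 < t by exact: lt_le_trans t1.
have H : c <= t `^ al.
  have -> : c = (c `^ al^-1) `^ al by rewrite -powRrM mulVf ?powRr1 ?(ltW c0)// gt_eqF.
  by rewrite ge0_ler_powR ?nnegrE ?powR_ge0 ?(ltW al0) ?(ltW t0).
rewrite powRN ler_pdivrMr ?powR_gt0//.
apply: (@le_trans _ _ (e * c)); last by rewrite ler_pM2l.
have -> : e * c = C + e by rewrite /c; field; rewrite gt_eqF.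
by rewrite lerDl ltW.
Qed.

Section contradiction.
Context {R : realType} {N : nat}.
Local Notation T := (measurableTypeR R).
Local Notation muX := (@lebesgue_rV R N).
Local Notation muT := (@lebesgue_measure R).
Local Notation mu2 := (muX \x muT)%E.
Variables (a gamma mu lambda : R) (f : 'rV[R]_N * R -> 'rV[R]_N).
Variables (rho0 : 'rV[R]_N -> R) (v0 : 'rV[R]_N -> 'rV[R]_N).
Variables (rho p : 'rV[R]_N * R -> R) (v : 'rV[R]_N * R -> 'rV[R]_N).
Variable Dv : 'rV[R]_N * R -> 'M[R]_N.
Hypothesis N3 : (3 <= N)%N.
Hypothesis a_gt0 : 0 < a.
Hypothesis gamma_gt1 : 1 < gamma.
Hypothesis mu_gt0 : 0 < mu.
Hypothesis mulambda_gt0 : 0 < mu + lambda.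
Hypothesis sol : finite_energy_solution_with a gamma mu lambda f rho0 v0 rho p v Dv.
Hypothesis second_moment : Lq_loc_Lp 1%:E 1%:E (fun z => rho z * enorm z.1 ^+ 2).
Hypothesis hv : Lq_loc_Lp_mx 1%:E (N%:R / (N%:R - 1))%:E v.

Local Notation h := (@linear_weight R N).
Local Notation moment := (slice (fun z => rho z * h z.1)).
Local Notation flux := (slice (fun z => rho z * dot (v z) (grad h z.1))).
Local Notation kin := (slice (fun z => rho z * enorm (v z) ^+ 2)).
Local Notation pow := (slice (fun z => rho z `^ gamma)).

Lemma energy_bounds : exists2 K, 0 <= K &
  {ae muT, forall t : T, 0 < t -> kin t <= K /\ pow t <= K}.
Proof.
have [E [E_ni E_ge0 EE _]] := energy_facts a_gt0 gamma_gt1 sol.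
have g0 : 0 < gamma - 1 by rewrite subr_gt0.
have c0 : 0 < a / (gamma - 1) by rewrite divr_gt0.
have E00 := E_ge0 0 (lexx 0).
exists (2 * E 0 + (a / (gamma - 1))^-1 * E 0).
  by rewrite addr_ge0// mulr_ge0// invr_ge0 ltW.
apply: ae_imp2 (ae_and (energy_slice a_gt0 gamma_gt1 sol EE) (rho_ge0_slices sol))
  (locally_finite_slice (locally_finite_kinetic a_gt0 gamma_gt1 sol)) => t [Et rt] ik t0.
have H := E_ni 0 t (lexx 0) (ltW t0); rewrite Et// in H.
have k0 : 0 <= kin t.
  apply: ae_Rintegral_ge0; first exact: ik t0.
  by apply: ae_imp (rt t0) => x rx; rewrite mulr_ge0// sqr_ge0.
have p0 : 0 <= pow t by apply: fine_ge0; apply: integral_ge0 => x _; rewrite lee_fin powR_ge0.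
split.
  have : 2^-1 * kin t <= E 0 by apply: le_trans H; rewrite lerDl mulr_ge0// ltW.
  by rewrite ler_pdivrMl// => /le_trans; apply; rewrite lerDl mulr_ge0// invr_ge0 ltW.
have H1 : a / (gamma - 1) * pow t <= E 0 by apply: le_trans H; rewrite lerDr mulr_ge0// invr_ge0.
apply: (@le_trans _ _ ((a / (gamma - 1))^-1 * E 0)); first by rewrite ler_pdivlMl.
by rewrite lerDr mulr_ge0.
Qed.

(** Otherwise the energy would decrease at a definite rate for all late times. *)
Lemma small_dissipation (delta s : R) (Q : R -> Prop) : 0 < delta -> 0 <= s ->
  {ae muT, forall t : T, s < t -> Q t} ->
  exists t, [/\ s < t, Q t & (\int[muX]_x (enorm (Dv (x, t)) ^+ 2)%:E <= (delta ^+ 2)%:E)%E].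
Proof.
move=> d0 s0 aeQ; apply: contrapT => nex.
have [E [E_ni E_ge0 _ EE]] := energy_facts a_gt0 gamma_gt1 sol.
pose E0 (t : R) : R := E (Num.max 0 t).
have [_ H1 _] := velocity_H1 sol.
apply: (@derive_not_bounded_away R E0 (E 0) _ _ _ (mu * delta ^+ 2) s).
- move=> t1 t2 t12; apply: E_ni; first by rewrite le_max lexx.
  by rewrite ge_max !le_max lexx /= t12 orbT.
- by move=> t; apply: E_ge0; rewrite le_max lexx.
- by move=> t; apply: E_ni; rewrite ?lexx// le_max lexx.
- by rewrite mulr_gt0// exprn_gt0.
apply: ae_imp2 (ae_and aeQ H1) EE => t [Qt Ht] Et st.
have t0 : 0 < t by exact: le_lt_trans st.
have [dE dis] := Et t0; have [_ mD iD _] := Ht t0.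
have nE : \forall u \near t, E u = E0 u.
  near=> u; rewrite /E0 max_r//; apply: ltW.
  by near: u; exact: lt_nbhsr.
have dE0 : derive1 E0 t = derive1 E t.
  by rewrite !derive1E; apply/esym; exact: near_eq_derive.
split; first exact: near_eq_derivable nE dE.
rewrite dE0.
have big : ((delta ^+ 2)%:E < \int[muX]_x (enorm (Dv (x, t)) ^+ 2)%:E)%E.
  by rewrite ltNge; apply/negP => Hd; apply: nex; exists t; split=> //; exact: Qt.
have mtr : measurable_fun [set: 'rV[T]_N] (fun x => \tr (Dv (x, t))).
  by apply: (@measurable_sum _ _ _ _ 'I_N (index_enum _) (fun k (x : 'rV[T]_N) => Dv (x, t) k k)).
have mD2 : measurable_fun [set: 'rV[T]_N] (fun x => enorm (Dv (x, t)) ^+ 2).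
  exact: measurable_of_integrable iD.
have disb : ((mu * delta ^+ 2)%:E <= dissipation mu lambda (fun x => Dv (x, t)))%E.
  apply: (@le_trans _ _ (mu%:E * \int[muX]_x (enorm (Dv (x, t)) ^+ 2)%:E)%E).
    by rewrite EFinM lee_pmul2l// ?lte_fin// ltW.
  rewrite -ge0_integralZl//; last first.
  - by rewrite lee_fin ltW.
  - by move=> x _; rewrite lee_fin sqr_ge0.
  - exact/measurable_EFinP.
  apply: ge0_le_integral => //.
  - by move=> x _; rewrite -EFinM lee_fin mulr_ge0 ?sqr_ge0// ltW.
  - by apply/measurable_EFinP; exact: measurable_funM.
  - apply/measurable_EFinP; apply: measurable_funD; first exact: measurable_funM.
    by apply: measurable_funM => //; exact: measurable_funX.
  - by move=> x _; rewrite lee_fin lerDl mulr_ge0 ?sqr_ge0// ltW.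
rewrite -lee_fin EFinN.
have : ((derive1 E t)%:E + (mu * delta ^+ 2)%:E <= 0)%E by apply: le_trans dis; rewrite leeD2l.
by rewrite -EFinD !lee_fin; lra.
Unshelve. all: by end_near. Qed.

(** At the times of small dissipation the momentum, hence the flux, is small. *)
Lemma small_moment M C m : 0 <= M -> m < 2 -> 0 <= C ->
  {ae muT, forall t : T, 0 < t -> slice rho t = M} ->
  {ae muT, forall t : T, 1 < t -> moment t / t - flux t <= C * t `^ (m / 2 - 1)} ->
  forall e s (Q : R -> Prop), 0 < e -> {ae muT, forall t : T, 1 < t -> Q t} ->
     exists t, [/\ s < t, 1 < t, Q t & moment t <= e * t].
Proof.
move=> M0 m2 C0 HM HB e s Q e0 aeQ.
have [K K0 HK] := energy_bounds.
have [D D0 HD] := @grad_linear_weight_bound R N.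
have ND : 0 <= N%:R * D by rewrite mulr_ge0.
pose eta := e / 2 / (N%:R * D + 1).
have ND1 : 0 < N%:R * D + 1 by rewrite ltr_wpDl.
have eta0 : 0 < eta by rewrite !divr_gt0.
have KM : 0 <= K + M by rewrite addr_ge0.
have [delta d0 Hd] := small_speed N3 a_gt0 gamma_gt1 sol second_moment hv KM eta0.
have [s1 [s11 ss1 Hs1]] : exists s1, [/\ 1 <= s1, s <= s1 & forall t, s1 < t -> C * t `^ (m / 2 - 1) <= e / 2].
  have al0 : 0 < 1 - m / 2 by rewrite subr_gt0 ltr_pdivrMr// mul1r.
  have [s2 [s21 Hs2]] := powR_tail al0 C0 (divr_gt0 e0 (ltr0n R 2)).
  exists (Num.max s2 s); split; rewrite ?le_max ?s21 ?lexx ?orbT//.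
  move=> t; rewrite gt_max => /andP[st _]; have := Hs2 t (ltW st).
  by rewrite opprB.
have G : {ae muT, forall t : T, s1 < t -> [/\ Q t, moment t / t - flux t <= e / 2 & 
    ((\int[muX]_x (enorm (Dv (x, t)) ^+ 2)%:E <= (delta ^+ 2)%:E)%E -> flux t <= e / 2)]}.
  apply: ae_imp2 (ae_and (ae_and aeQ HB)
    (ae_and HM HK)) (ae_and Hd (rho_ge0_slices sol)).
  move=> t [[Qt Bt] [Mt Kt]] [dt rt] s1t.
  have t1 : 1 < t by exact: le_lt_trans s1t.
  have t0 : 0 < t by exact: lt_trans t1.
  split; [exact: Qt|exact: le_trans (Bt t1) (Hs1 t s1t)|move=> Dd].
  have [k1 k2] := Kt t0.
  have rK : slice rho t <= K + M by rewrite Mt// lerDr.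
  have leK : K <= K + M by rewrite lerDl.
  have H := dt t0 rK (le_trans k1 leK) (le_trans k2 leK) Dd.
  have iH i := integrableZl measurableT D (H i).1.
  have [iS ES] := @Rintegral_sum _ _ _ muX setT _ (index_enum 'I_N)
    (fun i x => D * (rho (x, t) * `|v (x, t) ord0 i|)) measurableT iH.
  apply: (@le_trans _ _ (\int[muX]_x \sum_(i < N) (D * (rho (x, t) * `|v (x, t) ord0 i|)))).
    apply: (le_trans (ler_norm _)); apply: ae_norm_Rintegral_le => //.
      apply: (measurable_section _ t0 (g := fun z => rho z * dot (v z) (grad h z.1))).
      apply: measurable_funM; first exact: (rho_measurable sol).
      by apply: (dot_measurable sol) => j; exact: grad_coord_measurable linear_weight_smooth.
    apply: ae_imp (rt t0) => x rx _; rewrite normrM (ger0_norm rx).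
    apply: (@le_trans _ _ (rho (x, t) * \sum_(i < N) (D * `|v (x, t) ord0 i|))).
      rewrite ler_wpM2l//; apply: (le_trans (ler_norm_sum _ _ _)); apply: ler_sum => i _.
      by rewrite normrM mulrC ler_wpM2r// (HD x).1.
    by rewrite mulr_sumr le_eqVlt; apply/orP; left; apply/eqP; apply: eq_bigr => i _; rewrite mulrCA.
  rewrite ES; apply: (@le_trans _ _ (\sum_(i < N) (D * eta))).
    apply: ler_sum => i _; rewrite RintegralZl//; last exact: (H i).1.
    by rewrite ler_wpM2l// (H i).2.
  rewrite sumr_const card_ord -(mulr_natl (D * eta)) mulrA.
  have -> : e / 2 = (N%:R * D + 1) * eta by rewrite /eta [RHS]mulrC divfK// gt_eqF.
  by rewrite ler_pM2r// lerDl.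
have s10 : 0 <= s1 by exact: le_trans s11.
have [t [s1t [Qt H1 H2] Dd]] := small_dissipation d0 s10 G.
have t1 : 1 < t by exact: le_lt_trans s1t.
exists t; split=> //; first exact: le_lt_trans s1t.
rewrite -ler_pdivrMr ?(lt_trans _ t1)//.
by have := H2 Dd; move: H1; lra.
Qed.

End contradiction.

Section lower_bound.
Context {R : realType} {N : nat}.
Local Notation T := (measurableTypeR R).
Local Notation muX := (@lebesgue_rV R N).
Local Notation h := (@linear_weight R N).

(** The mass outside a box is bounded by the first moment, the mass inside by the
    volume and the integral of the power. *)
Lemma mass_upper_bound (r : 'rV[R]_N -> R) (gamma rad lam : R) :
  1 < gamma -> 1 < rad -> 0 < lam -> {ae muX, forall x : 'rV[T]_N, 0 <= r x} ->
  muX.-integrable setT (EFin \o r) -> muX.-integrable setT (EFin \o (fun x => r x * h x)) ->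
  muX.-integrable setT (EFin \o (fun x => r x `^ gamma)) ->
  \int[muX]_x r x <= (rad - 1)^-1 * (\int[muX]_x (r x * h x)) + lam * (2 * rad) ^+ N
     + lam `^ (1 - gamma) * \int[muX]_x (r x `^ gamma).
Proof.
move=> g1 rad1 l0 r0 ir ih ip.
have rd0 : 0 < rad - 1 by rewrite subr_gt0.
have radg0 : 0 <= rad by rewrite (le_trans ler01)// ltW.
have iB := @box_indic_integrable R N rad.
have i1 := integrableZl measurableT (rad - 1)^-1 ih.
have i2 := integrableZl measurableT lam iB.
have i12 := integrableD measurableT i1 i2.
have i3 := integrableZl measurableT (lam `^ (1 - gamma)) ip.
have iG := integrableD measurableT i12 i3.
apply: (@le_trans _ _ (\int[muX]_x ((rad - 1)^-1 * (r x * h x) + lam * \1_(box rad) x + lam `^ (1 - gamma) * r x `^ gamma))).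
  apply: ae_le_Rintegral => //; apply: ae_imp r0 => x rx _.
  have h0 : 0 <= (rad - 1)^-1 * (r x * h x).
    by rewrite mulr_ge0 ?invr_ge0 ?(ltW rd0)// mulr_ge0// linear_weight_ge0.
  have p0 : 0 <= lam `^ (1 - gamma) * r x `^ gamma by rewrite mulr_ge0 ?powR_ge0.
  rewrite indicE; have [xB|xB] := boolP (x \in box rad).
    rewrite mulr1 -addrA (@le_trans _ _ (lam + lam `^ (1 - gamma) * r x `^ gamma))//; last by rewrite lerDr.
    exact: powR_split.
  rewrite mulr0 addr0 (@le_trans _ _ ((rad - 1)^-1 * (r x * h x)))//; last by rewrite lerDl.
  move: xB; rewrite notin_setE => /existsNP[i /negP]; rewrite -ltNge => xi.
  rewrite ler_pdivlMl// mulrC ler_wpM2l//.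
  apply: le_trans (linear_weight_ge x i); rewrite lerD2r; exact: ltW.
rewrite RintegralD// RintegralD// !RintegralZl//.
have -> : \int[muX]_x (\1_(box rad) x : R) = (2 * rad) ^+ N.
  rewrite /Rintegral integral_indic//; last exact: measurable_box.
  by rewrite setIT [X in fine X](box_volume radg0).
by [].
Qed.

Lemma exponent_pos (k : R) : 0 < k -> let m := Num.max 0 (2 - k) in
  [/\ 0 <= m, m < 2 & 0 < 2 - m - m * k / 2].
Proof.
move=> k0 m; rewrite /m; have [k2|k2] := leP 0 (2 - k).
  split=> //; first by rewrite gtrBl.
  have -> : 2 - (2 - k) - (2 - k) * k / 2 = k ^+ 2 / 2 by field.
  by rewrite divr_gt0// exprn_gt0.
by split=> //; rewrite !mul0r !subr0.
Qed.

(** The box contains most of the mass when its side is of order t^(m/2), and its volume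
    term is small for a level of order t^(- m N / 2): this gives the exponent. *)
Lemma mass_decay (M k C gamma : R) : 0 < M -> 0 <= k -> 0 <= C -> 1 < gamma ->
  let m := Num.max 0 (2 - N%:R * (gamma - 1)) in (0 < N)%N ->
  exists K : R, 0 <= K /\ forall (t A P : R), 1 < t -> 
    (forall rad lam, 1 < rad -> 0 < lam ->
      M <= (rad - 1)^-1 * A + lam * (2 * rad) ^+ N + lam `^ (1 - gamma) * P) ->
    A <= k * t `^ (m / 2) -> P <= C * t `^ (m - 2) ->
    M / 2 <= K * t `^ (- (2 - m - m * (N%:R * (gamma - 1)) / 2)).
Proof.
move=> M0 k0 C0 g1 m N0.
have kk : 0 < N%:R * (gamma - 1) by rewrite mulr_gt0 ?ltr0n// subr_gt0.
have [m0 m2 al0] := exponent_pos kk.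
(* [q] makes the outer mass at most [M / 4], and [c] the volume term. *)
pose q := 4 * k / M + 1.
have q0 : 0 < q by rewrite ltr_wpDl// divr_ge0 ?(ltW M0)// mulr_ge0.
pose c := M / 4 / (2 * (1 + q)) ^+ N.
have q2 : 0 < 2 * (1 + q) by rewrite mulr_gt0// addr_gt0.
have c0 : 0 < c by rewrite !divr_gt0// exprn_gt0.
exists (c `^ (1 - gamma) * C); split; first by rewrite mulr_ge0// powR_ge0.
move=> t A P t1 H AH PH.
have t0 : 0 < t by exact: lt_trans t1.
pose s := t `^ (m / 2).
have s1 : 1 <= s by rewrite -(powRr0 t) ler_powR ?(ltW t1)// divr_ge0.
have s0 : 0 < s by exact: lt_le_trans s1.
have sN : s ^+ N = t `^ (m / 2 * N%:R) by rewrite -powR_mulrn ?(ltW s0)// -powRrM.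
pose lam := c / s ^+ N.
have l0 : 0 < lam by rewrite divr_gt0// exprn_gt0.
have rad1 : 1 < 1 + q * s by rewrite ltrDl mulr_gt0.
have rad1E : 1 + q * s - 1 = q * s by rewrite addrAC subrr add0r.
have := H _ _ rad1 l0; rewrite rad1E.
have h1 : (q * s)^-1 * A <= M / 4.
  rewrite ler_pdivrMl ?mulr_gt0//; apply: (le_trans AH); rewrite -/s mulrAC ler_pM2r//.
  have -> : q * (M / 4) = k + M / 4 by rewrite /q; field; rewrite gt_eqF.
  by rewrite lerDl divr_ge0// ltW.
have h2 : lam * (2 * (1 + q * s)) ^+ N <= M / 4.
  have -> : M / 4 = lam * (2 * (1 + q) * s) ^+ N.
    have cancel (x X Y : R) : 0 < X -> 0 < Y -> x = x / X / Y * (X * Y).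
      by move=> X0 Y0; field; rewrite !gt_eqF.
    by rewrite (exprMn N (2 * (1 + q)) s); apply: cancel; exact: exprn_gt0.
  rewrite ler_pM2l//; apply: lerXn2r; rewrite ?nnegrE.
  - by rewrite mulr_ge0// addr_ge0// mulr_ge0 ?(ltW q0)// ltW.
  - by rewrite mulr_ge0 ?(ltW q2)// ltW.
  - rewrite -subr_ge0 (_ : _ - _ = 2 * (s - 1)); last by ring.
    by rewrite mulr_ge0// subr_ge0.
have h3 : lam `^ (1 - gamma) * P <= c `^ (1 - gamma) * C * t `^ (- (2 - m - m * (N%:R * (gamma - 1)) / 2)).
  apply: (le_trans (ler_wpM2l (powR_ge0 _ _) PH)).
  rewrite /lam sN -powRN (powRM _ (ltW c0) (powR_ge0 _ _)) -powRrM.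
  rewrite mulrACA -powRD; last by apply/implyP => _; rewrite gt_eqF.
  rewrite le_eqVlt; apply/orP; left; apply/eqP.
  by congr (_ * _ `^ _); field.
move=> HM; have := lerD (lerD h1 h2) h3 => H4; have := le_trans HM H4.
set X := c `^ _ * C * _; move: X => X; lra.
Qed.

End lower_bound.

Theorem theorem1p1 (R : realType) (N : nat) (a gamma mu lambda : R)
    (f : 'rV[R]_N * R -> 'rV[R]_N)
    (rho0 : 'rV[R]_N -> R) (v0 : 'rV[R]_N -> 'rV[R]_N)
    (hN : (3 <= N)%N) (ha : 0 < a)
    (hgamma1 : 1 < gamma) (hgamma : gamma <= N%:R / 4 + 1 / 2)
    (hmu : 0 < mu) (hmulambda : 0 < mu + lambda)
    (hf : forall i, L1loc_space_time (fun z => f z ord0 i))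
    (hdivf : divergence_free f)
    (hdata : finite_energy_data gamma rho0 v0)
    (hE0 : (energy a gamma rho0 v0 < +oo)%E)
    (hmoment : (\int[lebesgue_rV N]_x (rho0 x * enorm (v0 x) * enorm x)%:E
                  < +oo)%E)
    (hvirial : 0 < \int[lebesgue_rV N]_x (rho0 x * dot (v0 x) x)) :
  ~ exists (rho : 'rV[R]_N * R -> R) (v : 'rV[R]_N * R -> 'rV[R]_N),
      [/\ finite_energy_weak_solution a gamma mu lambda f rho0 v0 rho v,
          Lq_loc_Lp 1%:E 1%:E (fun z => rho z * enorm z.1 ^+ 2) &
          Lq_loc_Lp_mx 1%:E (N%:R / (N%:R - 1))%:E v].
Proof.
move=> [rho [v [[p [Dv sol]] second_moment hv]]].
have N0 : (0 < N)%N by exact: leq_trans hN.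
have k0 : 0 < N%:R * (gamma - 1) by rewrite mulr_gt0 ?ltr0n// subr_gt0.
have [M M0 HM] := mass_positive ha hgamma1 sol second_moment hdata hvirial.
have [C C0 HC] := energy_decay hN ha hgamma1 hf hdivf sol second_moment hv.
have [m0 m2 al0] := exponent_pos k0; set m := Num.max 0 _ in HC m0 m2 al0.
have HD : {ae (@lebesgue_measure R), forall t : (measurableTypeR R), 1 < t ->
    \int[lebesgue_rV N]_x (rho (x, t) * enorm (t^-1 *: x - v (x, t)) ^+ 2) <= C * t `^ (m - 2)}.
  by apply: ae_imp HC => t Ht t1; have [] := Ht t1.
have [C1 C10 HC1] := flux_deviation ha hgamma1 sol second_moment (ltW M0) m0 C0 HM HD.
have Hs := small_moment hN ha hgamma1 hmu hmulambda sol second_moment hv (ltW M0) m2 C10 HM HC1.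
have [k kge0 Hk] := sublinear_growth C10 m2 (moment_identity ha hgamma1 sol second_moment) HC1 Hs.
have [K [K0 HK]] := @mass_decay R N M k C gamma M0 kge0 C0 hgamma1 N0.
have [s [s1 Htail]] := powR_tail al0 K0 (divr_gt0 M0 (ltr0n R 4)).
have lh : locally_finite (fun z => rho z * linear_weight z.1).
  apply: (density_locally_finite ha hgamma1 sol second_moment _ (ler0n R N)).
    exact: smooth_measurable linear_weight_smooth.
  exact: linear_weight_le.
have G := ae_and (ae_and (ae_and HM HC)
    (ae_and Hk (rho_ge0_slices sol)))
  (ae_and (locally_finite_slice (locally_finite_rho sol second_moment))
   (ae_and (locally_finite_slice lh) (locally_finite_slice (locally_finite_power ha hgamma1 sol)))).
have [t [st [[[Mt Ct] [kt rt]] [ir [ih ip]]]]] := ae_exists_gt s G.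
have t1 : 1 < t by exact: le_lt_trans st.
have t0 : 0 < t by exact: lt_trans t1.
have [pt _] := Ct t1.
have := HK t _ _ t1 _ (kt t1) pt.
have Hb rad lam : 1 < rad -> 0 < lam -> M <= (rad - 1)^-1 * slice (fun z => rho z * linear_weight z.1) t +
    lam * (2 * rad) ^+ N + lam `^ (1 - gamma) * slice (fun z => rho z `^ gamma) t.
  move=> rad1 l0; rewrite -(Mt t0).
  exact: (mass_upper_bound hgamma1 rad1 l0 (rt t0) (ir t0) (ih t0) (ip t0)).
move=> /(_ Hb) H; have := le_trans H (Htail t (ltW st)).
by rewrite leNgt => /negP; apply; rewrite ltr_pM2l// ltf_pV2 ?posrE// ltr_nat.
Qed.
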